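(* Let $\Omega=\{0,1\}^{\mathbb Z}$, let $\sigma$ be the shift map, and for $p\in[0,1]$ let $\mathbb P_p$ be the Bernoulli measure with $\mathbb P_p([0])=p$, where $[0]=\{\omega\colon\omega_0=0\}$. Let $\mathcal L_0$, $\mathcal L_1$ be the Perron-Frobenius operators of $T_0(z)=z^2$ and $T_1(z)=\left[(z+\frac14)/(1+\frac z4)\right]^2$ acting on $H^2(A_R)$, where $0<R<1$ satisfies $r_{\mathcal T}(R)<R$, and let $\mathcal L_\omega=\mathcal L_{\omega_0}$. For $\epsilon>0$ let $\mathcal L^\epsilon_\omega=\mathcal N_\epsilon\circ\mathcal L_\omega$, where $$(\mathcal N_\epsilon f)(z)=\frac1{\sqrt{2\pi}}\int_{-\infty}^\infty f(ze^{-2\pi i\epsilon t})\,e^{-2\pi i\epsilon t-t^2/2}\,dt .$$ If $p\ge\frac14$, then for every $\epsilon>0$ the perturbed cocycle $(\mathcal L^\epsilon_\omega)_{\omega\in\Omega}$ over $\sigma$ has $\lambda_1=0$ and $\lambda_j=-\infty$ for all $j>1$. In particular, if $\frac14\le p<\frac12$, then the unperturbed cocycle $(\mathcal L_\omega)$ has a complete Lyapunov spectrum (countably infinitely many finite Lyapunov exponents), but for each $\epsilon>0$ the Lyapunov spectrum of $(\mathcal L^\epsilon_\omega)$ collapses ($\lambda_1=0$ with multiplicity $1$ and all other exponents $-\infty$).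
   Context: Notation: $C_1$ is the unit circle, $A_R=\{z\colon R<|z|<1/R\}$. For a Blaschke product $T$, $r_T(R)=\max_{|z|=R}|T(z)|$; for the cocycle $\mathcal T=(T_{\omega_0})_{\omega\in\Omega}$, $r_{\mathcal T}(R)=\operatorname{ess\,sup}_\omega r_{T_{\omega_0}}(R)$. $H^2(A_R)$ is the Hardy–Hilbert space of analytic functions on $A_R$ with $L^2$ boundary extension to $\partial A_R$, with inner product $\langle f,g\rangle=\frac1{2\pi}\int_{\partial A_R}f\bar g\,\frac{|dz|}{|z|}$; an orthonormal basis is $\{(R^{2n}+R^{-2n})^{-1/2}z^n\colon n\in\mathbb Z\}$. The Perron-Frobenius operator is $\mathcal L_Tf(z)=\sum_{y\in T^{-1}z}f(y)/T'(y)$ for $z\in C_1$; for $f\in H^2(A_R)$ and $r_T(R)<R$, $\mathcal L_Tf$ is the element of $H^2(A_R)$ given on $C_1$ by this formula, and $\mathcal L_T$ is then a compact operator on $H^2(A_R)$. For a cocycle $(\mathcal A_\omega)$ of operators, $\mathcal A^{(n)}_\omega=\mathcal A_{\sigma^{n-1}\omega}\circ\cdots\circ\mathcal A_\omega$. Lyapunov exponents: for a compact cocycle $(\mathcal A_\omega)$ over an invertible ergodic base with $\lim\frac1n\log\|\mathcal A_\omega^{(n)}\|=\lambda_1>-\infty$, the Multiplicative Ergodic Theorem gives finite exponents $\lambda_1>\lambda_2>\cdots$ (finitely or infinitely many), and for a.e. $\omega$ finite-dimensional equivariant Oseledets spaces $V_i(\omega)$ of a.e. constant dimension $m_i$ (the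 multiplicity) with $\frac1n\log\|\mathcal A^{(n)}_\omega f\|\to\lambda_i$ for $f\in V_i(\omega)\setminus\{0\}$, and for each $j$ a closed equivariant complement $F_j(\omega)$ of $V_1(\omega)\oplus\cdots\oplus V_j(\omega)$ with $\limsup\frac1n\log\|\mathcal A^{(n)}_\omega f\|\le\lambda_{j+1}$ for $f\in F_j(\omega)$ (with $\lambda_{j+1}:=-\infty$ if $\lambda_j$ is the last finite exponent). ''$\lambda_1=0$ and $\lambda_j=-\infty$ for all $j>1$'' means the only finite exponent is $0$, with multiplicity $1$. *)

(* Defs.v *)
From HB Require Import structures.
From mathcomp Require Import all_boot all_order all_algebra.
From mathcomp Require Import complex.
From mathcomp Require Import all_classical all_reals all_analysis.
From mathcomp Require Import ess_sup_inf.

Set Implicit Arguments.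
Unset Strict Implicit.
Unset Printing Implicit Defensive.

Import Order.TTheory GRing.Theory Num.Theory numFieldNormedType.Exports.

Local Open Scope classical_set_scope.
Local Open Scope ring_scope.

(* The regular algebra is the form of K[i] that carries the library's
   topology and normed-module structure; its elements are those of K[i]. *)
Notation cplx K := (K[i]^o).

Section Complex.
Variable K : realType.

(* [Normc.normc] is the modulus with values in K, whereas the norm `|z| of
   K[i] is valued in K[i]. *)
Definition modulus (z : cplx K) : K := Normc.normc z.

Definition cis (t : K) : cplx K := Complex (cos t) (sin t).

Definition of_real (x : K) : cplx K := Complex x 0.

Definition circle (r : K) : set (cplx K) := [set z | modulus z = r].

Definition annulus (R : K) : set (cplx K) :=
  [set z | R < modulus z < R^-1].

Definition analytic_at (f : cplx K -> cplx K) (z0 : cplx K) : Prop :=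
  exists a : nat -> cplx K, exists2 d : K, 0 < d &
    forall z, modulus (z - z0) < d ->
      series (fun n => a n * (z - z0) ^+ n) @ \oo --> f z.

Definition cintegral (D : set K) (g : K -> cplx K) : cplx K :=
  Complex (\int[@lebesgue_measure K]_(t in D) complex.Re (g t))
          (\int[@lebesgue_measure K]_(t in D) complex.Im (g t)).

End Complex.

Section HardyAnnulus.
Variable K : realType.
Implicit Types (f : cplx K -> cplx K) (b : K -> cplx K) (R s : K).

Definition angles : set K := `[0, 2 * pi].

(* Integral of |b|^2 for the angular measure; on a circle centred at 0,
   |dz| / |z| is d theta. *)
Definition energy b : \bar K :=
  \int[@lebesgue_measure K]_(t in angles) ((modulus (b t)) ^+ 2)%:E.

Definition square_integrable b : Prop :=
  [/\ measurable_fun angles (fun t => complex.Re (b t)),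
      measurable_fun angles (fun t => complex.Im (b t)) &
      (energy b < +oo)%E].

Definition circle_trace f s : K -> cplx K := fun t => f (of_real s * cis t).

(* [b] is the L^2 limit of the traces of [f] on the circle of radius [s],
   as [s] tends to a boundary radius along the filter [Phi]. *)
Definition boundary_value f (Phi : set_system K) b : Prop :=
  square_integrable b /\
  energy (circle_trace f s - b) @[s --> Phi] --> 0%E.

(* Functions on the annulus are extended by 0, so that equality of elements of
   the Hardy space is equality of functions. *)
Definition hardy R : set (cplx K -> cplx K) := [set f |
  [/\ forall z, ~ annulus R z -> f z = 0,
      forall z, annulus R z -> analytic_at f z,
      exists b, boundary_value f R^'+ b &
      exists b, boundary_value f (R^-1)^'- b]].

(* Boundary values are unique up to null sets, hence the choice made here is
   immaterial in [hardy_norm]. *)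
Definition boundary f (Phi : set_system K) : K -> cplx K :=
  xget (cst 0) [set b | boundary_value f Phi b].

Definition hardy_norm R f : K :=
  Num.sqrt ((2 * pi)^-1 * (fine (energy (boundary f R^'+)) +
                           fine (energy (boundary f (R^-1)^'-)))).

(* The element of the Hardy space that is given on [D] by the formula [g];
   it is unique if [D] is the unit circle or the whole annulus.  The default
   value 0 is taken when there is no such element. *)
Definition hardy_given_by R (D : set (cplx K)) (g : cplx K -> cplx K) :
    cplx K -> cplx K :=
  xget 0 [set h | hardy R h /\ forall z, D z -> h z = g z].

(* The sum ranges over the fibre of T, which is finite. *)
Definition perron_frobenius R (T : cplx K -> cplx K) f : cplx K -> cplx K :=
  hardy_given_by R (circle 1)
    (fun z => \sum_(y \in [set y | T y = z]) f y / derive1 T y).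

Definition noise R (eps : K) f : cplx K -> cplx K :=
  hardy_given_by R (annulus R)
    (fun z => of_real (Num.sqrt (2 * pi))^-1 *
      cintegral setT (fun t => f (z * cis (- (2 * pi * eps * t))) *
        (cis (- (2 * pi * eps * t)) * of_real (expR (- (t ^+ 2 / 2)))))).

Definition max_modulus (T : cplx K -> cplx K) R : K :=
  sup [set modulus (T z) | z in circle R].

End HardyAnnulus.

Section Lyapunov.
Variables (K : realType) (E : lmodType K[i]).
(* The normed space under consideration is the linear subspace [H] of [E],
   with norm [N]. *)
Variables (H : set E) (N : E -> K).

Definition linear_subspace (V : set E) : Prop :=
  [/\ V `<=` H, V 0 &
      forall (a : K[i]) u v, V u -> V v -> V (a *: u + v)].

Definition has_dimension (V : set E) (n : nat) : Prop :=
  exists e : 'I_n -> E,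
    V = [set v | exists c : 'I_n -> K[i], v = \sum_(i < n) c i *: e i] /\
    forall c : 'I_n -> K[i], \sum_(i < n) c i *: e i = 0 -> forall i, c i = 0.

Definition norm_closed (F : set E) : Prop :=
  forall (u : nat -> E) f, (forall n, F (u n)) -> H f ->
    N (u n - f) @[n --> \oo] --> (0 : K) -> F f.

(* Algebraic direct sum decomposition H = V_0 + ... + V_j + F. *)
Definition complement_of_sum (V : nat -> set E) (j : nat) (F : set E) : Prop :=
  (forall f, H f -> exists v : 'I_j.+1 -> E, exists g,
     [/\ forall i : 'I_j.+1, V i (v i), F g & f = \sum_(i < j.+1) v i + g]) /\
  (forall (v : 'I_j.+1 -> E) g, (forall i : 'I_j.+1, V i (v i)) -> F g ->
     \sum_(i < j.+1) v i + g = 0 -> (forall i, v i = 0) /\ g = 0).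

Definition operator_norm (B : E -> E) : \bar K :=
  ereal_sup [set (N (B f))%:E | f in [set f | H f /\ N f <= 1]].

(* (1/n) log x, with log 0 = -oo. *)
Definition log_rate (x : \bar K) (n : nat) : \bar K :=
  ((n%:R^-1)%:E * lne x)%E.

Fixpoint iterate (Om : Type) (sigma : Om -> Om) (A : Om -> E -> E)
    (n : nat) (w : Om) (f : E) : E :=
  if n is k.+1 then A (iter k sigma w) (iterate sigma A k w f) else f.

(* The distinct exponents are lam 0 > lam 1 > ..., padded with -oo after the
   last finite one if there is a last one; m j is the multiplicity of lam j and
   is only meaningful if lam j is finite. *)
Definition exponent_list (lam : nat -> \bar K) (m : nat -> nat) : Prop :=
  (-oo < lam 0%N)%E /\
  forall j, [/\ (lam j < +oo)%E,
                (-oo < lam j)%E -> (lam j.+1 < lam j)%E /\ (0 < m j)%N &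
                lam j = -oo%E -> lam j.+1 = -oo%E].

(* V w j is the Oseledets space of lam j and F w j the complement of
   V w 0 + ... + V w j. *)
Definition oseledets_at (Om : Type) (sigma : Om -> Om) (A : Om -> E -> E)
    (lam : nat -> \bar K) (m : nat -> nat) (V F : Om -> nat -> set E)
    (w : Om) : Prop :=
  log_rate (operator_norm (iterate sigma A n w)) n @[n --> \oo] --> lam 0%N /\
  forall j, (-oo < lam j)%E ->
    [/\ [/\ linear_subspace (V w j), has_dimension (V w j) (m j),
            A w @` V w j = V (sigma w) j &
            forall f, V w j f -> f <> 0 ->
              log_rate (N (iterate sigma A n w f))%:E n @[n --> \oo] --> lam j]
      & [/\ linear_subspace (F w j) /\ norm_closed (F w j),
            complement_of_sum (V w) j (F w j),
            A w @` F w j `<=` F (sigma w) j &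
            forall f, F w j f ->
              (limn_esup (fun n => log_rate (N (iterate sigma A n w f))%:E n)
                <= lam j.+1)%E]].

Definition lyapunov_spectrum d (Om : measurableType d) (P : probability Om K)
    (sigma : Om -> Om) (A : Om -> E -> E)
    (lam : nat -> \bar K) (m : nat -> nat) : Prop :=
  exponent_list lam m /\
  exists V F : Om -> nat -> set E,
    {ae P, forall w, oseledets_at sigma A lam m V F w}.

Definition collapsed_spectrum d (Om : measurableType d) (P : probability Om K)
    (sigma : Om -> Om) (A : Om -> E -> E) : Prop :=
  exists lam m, [/\ lyapunov_spectrum P sigma A lam m,
    lam 0%N = 0%E, m 0%N = 1%N & forall j, (0 < j)%N -> lam j = -oo%E].

Definition complete_spectrum d (Om : measurableType d) (P : probability Om K)
    (sigma : Om -> Om) (A : Om -> E -> E) : Prop :=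
  exists lam m, lyapunov_spectrum P sigma A lam m /\
    forall j, (-oo < lam j)%E.

End Lyapunov.

(* The symbols 0 and 1 are [false] and [true]. *)
Definition coordinate_sets : set (set (int -> bool)) :=
  [set A | exists i b, A = [set w | w i = b]].

Definition Omega := g_sigma_algebraType coordinate_sets.

Definition bernoulli_shift (w : Omega) : Omega := fun i : int => w (i + 1).

Definition bernoulli_measure (K : realType) (p : K) (P : probability Omega K) :
    Prop :=
  forall (s : seq int) (a : int -> bool), uniq s ->
    P [set w : Omega | forall i, i \in s -> w i = a i] =
    (\prod_(i <- s) (if a i then 1 - p else p))%:E.

Section Example.
Variable K : realType.

Definition blaschke (b : bool) : cplx K -> cplx K :=
  if b then fun z => ((z + 4^-1) / (1 + z / 4)) ^+ 2 else fun z => z ^+ 2.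

Definition pf_cocycle (R : K) (w : Omega) : (cplx K -> cplx K) -> cplx K -> cplx K :=
  perron_frobenius R (blaschke (w 0)).

Definition noisy_pf_cocycle (R eps : K) (w : Omega) :
    (cplx K -> cplx K) -> cplx K -> cplx K :=
  noise R eps \o pf_cocycle R w.

Definition ess_max_modulus (P : probability Omega K) (R : K) : \bar K :=
  ess_sup P (fun w : Omega => (max_modulus (blaschke (w 0)) R)%:E).

End Example.

(* Main.v *)
(** Functions of the Hardy space are determined by their pairings, along circles
close to the two boundary circles, with the powers of z; the transfer operator
of a Blaschke product T is dual to the composition g |-> g o T.

With noise, the coefficient of order k is multiplied at each step by
exp (- c k^2).  The symbol 0 halves orders, so that a run of j zeros weighs the
next damping by 4^j; as such runs have probability p^j >= 4^-j, Birkhoff's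
theorem makes the total damping superlinear on the functions of mean zero.  The
invariant direction is the limit of the images of the constant mode from the
past.

Without noise, let x be the random fixed point of the compositions, and use the
coordinate h = (z - x) / (1 - x z), in which T becomes h (h + m) / (1 + m h).  If
p < 1/2 then log m is integrable, with mean Lam < 0: after k zeros log x is at
least of order - 2^k, and the sum of the (2 p)^k is finite.  The limits beta_i of
the pairings with h_n^i / (m_0 ... m_(n-1))^i exist, and the functions on which
beta_i vanishes for all i < j decay at the rate j Lam.  Elements with prescribed
Taylor coefficients at x separate the beta_i. *)

From HB Require Import structures.
Require Import Defs.
From mathcomp Require Import all_boot all_order all_algebra.
From mathcomp Require Import complex.
From mathcomp Require Import all_classical all_reals all_analysis.
From mathcomp Require Import ess_sup_inf measurable_realfun.
From mathcomp Require Import ring lra zify.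

Set Implicit Arguments.
Unset Strict Implicit.
Unset Printing Implicit Defensive.

Import Order.TTheory GRing.Theory Num.Theory numFieldNormedType.Exports.

Local Open Scope classical_set_scope.
Local Open Scope ring_scope.

(** * Complex numbers and series *)

(** The condition on R is open: there are r < R < s such that T maps the disc of radius s into that
    of radius r. Pairings of images are then O(r^k), while the norm only sees O(R^k). This gap
    produces the images as elements of the space, turns bounds on pairings into bounds on norms, and
    does the work of compactness. Since T has real coefficients, T (1/z) = 1 / T z, and z |-> 1/z
    exchanges the boundary circles. One dual map therefore serves both circles, told apart by a flag
    [e]; the order 0 is common to both and every other order occurs twice, so that the
    multiplicities without noise are 1, 2, 2, ... The multiplicative ergodic theorem is not invoked:
    the Oseledets spaces are written down and their rates proved. With noise, the symbol 1 mixes all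
    orders; the accumulated damping then survives only as a smaller norm, and each such exchange
    costs a constant factor, harmless against superlinear damping. Without noise, bounds on pairings
    must stay below R^k at all times; this is why expansions at x are measured by a
    submultiplicative norm. *)

Lemma eq_leW (d : Order.disp_t) (T : porderType d) (x y : T) : x = y -> (x <= y)%O.
Proof. by move=> ->. Qed.

Section ComplexToolbox.
Variable K : realType.
Implicit Types (x y z w : cplx K) (a b t s : K) (n : nat).

Lemma modulus_ge0 z : 0 <= modulus z.
Proof. by case: z => a b; rewrite /modulus /= sqrtr_ge0. Qed.

Lemma modulusM x y : modulus (x * y) = modulus x * modulus y.
Proof. exact: Normc.normcM. Qed.

Lemma modulusD x y : modulus (x + y) <= modulus x + modulus y.
Proof. exact: le_normcD. Qed.

Lemma modulusN x : modulus (- x) = modulus x.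
Proof. exact: normcN. Qed.

Lemma modulus0 : modulus (0 : cplx K) = 0.
Proof. exact: Normc.normc0. Qed.

Lemma modulus1 : modulus (1 : cplx K) = 1.
Proof. exact: Normc.normc1. Qed.

Lemma modulusV x : modulus x^-1 = (modulus x)^-1.
Proof. exact: Normc.normcV. Qed.

Lemma modulus_eq0 x : (modulus x == 0) = (x == 0).
Proof.
apply/eqP/eqP => [|->]; last exact: modulus0.
exact: Normc.eq0_normc.
Qed.

Lemma modulus_gt0 x : (0 < modulus x) = (x != 0).
Proof. by rewrite lt_neqAle modulus_ge0 andbT eq_sym modulus_eq0. Qed.

Lemma modulusX x n : modulus (x ^+ n) = modulus x ^+ n.
Proof.
by elim: n => [|n IH]; rewrite ?expr0 ?modulus1 // !exprS modulusM IH.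
Qed.

Lemma modulusB x y : modulus (x - y) = modulus (y - x).
Proof. by rewrite -modulusN opprB. Qed.

Lemma modulusB_le x y : modulus (x - y) <= modulus x + modulus y.
Proof. by rewrite -(modulusN y) modulusD. Qed.

Lemma modulus_triangle y x z : modulus (x - z) <= modulus (x - y) + modulus (y - z).
Proof. by rewrite -[x - z](subrKA y) modulusD. Qed.

Lemma modulus_subl x y : modulus x - modulus y <= modulus (x - y).
Proof. by rewrite lerBlDr -[x in leLHS](subrK y) modulusD. Qed.

Lemma modulus_sum (I : Type) (r : seq I) (P : pred I) (F : I -> cplx K) :
  modulus (\sum_(i <- r | P i) F i) <= \sum_(i <- r | P i) modulus (F i).
Proof.
elim/big_ind2: _ => [|u a v b ua vb|//]; first by rewrite modulus0.
exact: le_trans (modulusD _ _) (lerD _ _).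
Qed.

Lemma of_real_rcomplex a : of_real a = real_complex K a. Proof. by []. Qed.

Lemma of_realD a b : of_real (a + b) = of_real a + of_real b.
Proof. by rewrite !of_real_rcomplex rmorphD. Qed.

Lemma of_realB a b : of_real (a - b) = of_real a - of_real b.
Proof. by rewrite !of_real_rcomplex rmorphB. Qed.

Lemma of_realM a b : of_real (a * b) = of_real a * of_real b.
Proof. by rewrite !of_real_rcomplex rmorphM. Qed.

Lemma of_realV a : of_real a^-1 = (of_real a)^-1.
Proof. by rewrite !of_real_rcomplex; exact: fmorphV. Qed.

Lemma of_realX a n : of_real (a ^+ n) = of_real a ^+ n.
Proof. by rewrite !of_real_rcomplex rmorphXn. Qed.

Lemma of_real0 : of_real 0 = 0 :> cplx K. Proof. by []. Qed.
Lemma of_real1 : of_real 1 = 1 :> cplx K. Proof. by []. Qed.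

Lemma of_real_nat n : of_real n%:R = n%:R :> cplx K.
Proof. by rewrite of_real_rcomplex rmorph_nat. Qed.

Lemma modulus_of_real a : modulus (of_real a) = `|a|.
Proof. by rewrite /modulus /= expr0n /= addr0 sqrtr_sqr. Qed.

Lemma modulus_nat n : modulus (n%:R : cplx K) = n%:R.
Proof. by rewrite -of_real_nat modulus_of_real ger0_norm. Qed.

Lemma modulus_cis t : modulus (cis t) = 1.
Proof. by rewrite /modulus /= cos2Dsin2 sqrtr1. Qed.

Lemma cis0 : cis 0 = 1 :> cplx K.
Proof. by rewrite /cis cos0 sin0. Qed.

Lemma cisD s t : cis (s + t) = cis s * cis t :> cplx K.
Proof.
by rewrite /cis cosD sinD; apply/eqP; rewrite eq_complex /= eqxx /= addrC eqxx.
Qed.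

Lemma cis_neq0 t : cis t != 0 :> cplx K.
Proof. by rewrite -modulus_gt0 modulus_cis. Qed.

Lemma cisN t : cis (- t) = (cis t)^-1 :> cplx K.
Proof.
apply: (mulfI (cis_neq0 t)); rewrite -cisD subrr cis0 mulfV //.
exact: cis_neq0.
Qed.

Lemma cisX t n : cis t ^+ n = cis (n%:R * t) :> cplx K.
Proof.
elim: n => [|n IH]; first by rewrite expr0 mul0r cis0.
by rewrite exprS IH -cisD -[in RHS]natr1 mulrDl mul1r addrC.
Qed.

Lemma cis2pi : cis (2 * pi) = 1 :> cplx K.
Proof. by rewrite /cis mulr_natl cos2pi sin2pi. Qed.

Lemma Re_le_modulus z : `|complex.Re z| <= modulus z.
Proof.
case: z => a b; rewrite /modulus /= -sqrtr_sqr ler_wsqrtr //.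
by rewrite lerDl sqr_ge0.
Qed.

Lemma Im_le_modulus z : `|complex.Im z| <= modulus z.
Proof.
case: z => a b; rewrite /modulus /= -sqrtr_sqr ler_wsqrtr //.
by rewrite lerDr sqr_ge0.
Qed.

Lemma Re_add x y : complex.Re (x + y) = complex.Re x + complex.Re y.
Proof. by case: x y => ? ? [? ?]. Qed.
Lemma Im_add x y : complex.Im (x + y) = complex.Im x + complex.Im y.
Proof. by case: x y => ? ? [? ?]. Qed.
Lemma Re_sub x y : complex.Re (x - y) = complex.Re x - complex.Re y.
Proof. by case: x y => ? ? [? ?]. Qed.
Lemma Im_sub x y : complex.Im (x - y) = complex.Im x - complex.Im y.
Proof. by case: x y => ? ? [? ?]. Qed.
Lemma Re_mul x y : complex.Re (x * y) =
  complex.Re x * complex.Re y - complex.Im x * complex.Im y.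
Proof. by case: x y => ? ? [? ?]. Qed.
Lemma Im_mul x y : complex.Im (x * y) =
  complex.Re x * complex.Im y + complex.Im x * complex.Re y.
Proof. by case: x y => ? ? [? ?]. Qed.

Lemma modulus_sqr z : modulus z ^+ 2 = complex.Re z ^+ 2 + complex.Im z ^+ 2.
Proof. by case: z => a b; rewrite /modulus /= sqr_sqrtr // addr_ge0 ?sqr_ge0. Qed.

Lemma modulus_le_ReIm z : modulus z <= `|complex.Re z| + `|complex.Im z|.
Proof.
rewrite -ler_sqr ?nnegrE ?modulus_ge0 ?addr_ge0 // modulus_sqr sqrrD.
rewrite !real_normK ?num_real // lerD2r lerDl mulrn_wge0 // mulr_ge0 //.
Qed.

Lemma eq_ReIm x y : complex.Re x = complex.Re y -> complex.Im x = complex.Im y ->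
  x = y.
Proof. by case: x y => ? ? [? ?] /= -> ->. Qed.

Lemma cplx_norm z : `|z| = real_complex K (modulus z).
Proof. by rewrite /modulus; case: z. Qed.

(** A positive element of [K[i]] is real, so the balls of the [K[i]]-valued norm are those of the
    real-valued modulus. *)
Lemma cvg_modulus (T : Type) (F : set_system T) {FF : Filter F}
    (f : T -> cplx K) (l : cplx K) :
  (f @ F --> l) <-> (forall e : K, 0 < e -> \forall x \near F, modulus (f x - l) < e).
Proof.
split=> [/cvgrPdist_lt h e e0|h].
  have /h : 0 < (real_complex K e : cplx K) by rewrite ltcR.
  by apply: filterS => x /=; rewrite cplx_norm ltcR modulusB.
apply/cvgrPdist_lt => -[e1 e2]; rewrite ltcE /= => /andP[/eqP -> e0].
have := h _ e0; apply: filterS => x /=.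
by rewrite cplx_norm modulusB => ?; rewrite ltcE /= eqxx.
Qed.

Lemma cvg_to_modulus (T : Type) (F : set_system T) {FF : Filter F}
    (f : T -> cplx K) (l : cplx K) :
  f @ F --> l -> modulus (f x - l) @[x --> F] --> (0 : K).
Proof.
move=> /cvg_modulus h; apply/cvgrPdist_lt => e /h; apply: filterS => x /=.
by rewrite sub0r normrN ger0_norm ?modulus_ge0.
Qed.

Lemma modulus_le_small z : (forall e, 0 < e -> modulus z <= e) -> z = 0.
Proof.
move=> h; apply/eqP; rewrite -modulus_eq0 eq_le modulus_ge0 andbT.
apply/ler_addgt0Pl => e e0; rewrite addr0; exact: h.
Qed.

Lemma geometric_small (A t e : K) : 0 <= t < 1 -> 0 < e ->
  exists N : nat, forall n, (N <= n)%N -> A * t ^+ n < e.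
Proof.
move=> /andP[t0 t1] e0.
have /cvgrPdist_lt : (fun n => A * t ^+ n) @ \oo --> (A * 0 : K).
  by apply: cvgMr; apply: cvg_expr; rewrite ger0_norm.
move=> /(_ e e0) [N _ hN]; exists N => n /hN /=.
by rewrite mulr0 sub0r normrN; apply: le_lt_trans; exact: ler_norm.
Qed.

(** Real and imaginary limits are taken separately, which makes the sum total; under geometric
    domination [cvg_csum] shows that it is the limit. *)
Definition csum (u : nat -> cplx K) : cplx K :=
  Complex (limn (series (fun n => complex.Re (u n))))
          (limn (series (fun n => complex.Im (u n)))).

Lemma geometric_partial (A t : K) (N M : nat) : 0 <= t < 1 -> 0 <= A ->
  \sum_(N <= i < M) A * t ^+ i <= A * t ^+ N / (1 - t).
Proof.
move=> /andP[t0 t1] A0; have t1' : 0 < 1 - t by rewrite subr_gt0.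
have [MN|NM] := leqP M N.
  by rewrite big_geq // divr_ge0 ?(ltW t1') ?mulr_ge0 ?exprn_ge0.
rewrite ler_pdivlMr //.
suff -> : (\sum_(N <= i < M) A * t ^+ i) * (1 - t) = A * t ^+ N - A * t ^+ M.
  by rewrite lerBlDr lerDl mulr_ge0 // exprn_ge0.
elim: M NM => // M IH; rewrite ltnS leq_eqVlt => /orP[/eqP <-|NM'].
  by rewrite big_nat1 exprS; ring.
by rewrite big_nat_recr ?(ltnW NM') //= mulrDl IH // exprS; ring.
Qed.

Lemma series_geometric_tail (u : nat -> cplx K) (A t : K) (N M : nat) :
  0 <= t < 1 -> 0 <= A -> (forall n, modulus (u n) <= A * t ^+ n) ->
  (N <= M)%N ->
  modulus (series u M - series u N) <= A * t ^+ N / (1 - t).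
Proof.
move=> t01 A0 h NM; rewrite sub_series_geq //.
apply: le_trans (modulus_sum _ _ _) _.
by apply: le_trans (geometric_partial N M t01 A0); exact: ler_sum.
Qed.

Lemma cvg_real_geometric (u : nat -> K) (A t : K) : 0 <= t < 1 ->
  (forall n, `|u n| <= A * t ^+ n) -> cvgn (series u).
Proof.
move=> /andP[t0 t1] h; apply: normed_cvg.
apply: (series_le_cvg _ _ h) => [n|n|]; first exact: normr_ge0.
  exact: le_trans (h n).
by apply: is_cvg_geometric_series; rewrite ger0_norm.
Qed.

Lemma Re_series (u : nat -> cplx K) n :
  complex.Re (series u n) = series (fun k => complex.Re (u k)) n.
Proof.
by rewrite /series /=; elim/big_ind2: _ => // x a y b <- <-; rewrite Re_add.
Qed.

Lemma Im_series (u : nat -> cplx K) n :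
  complex.Im (series u n) = series (fun k => complex.Im (u k)) n.
Proof.
by rewrite /series /=; elim/big_ind2: _ => // x a y b <- <-; rewrite Im_add.
Qed.

Lemma cvg_csum (u : nat -> cplx K) (A t : K) : 0 <= t < 1 ->
  (forall n, modulus (u n) <= A * t ^+ n) -> series u @ \oo --> csum u.
Proof.
move=> t01 h.
have hR : cvgn (series (fun n => complex.Re (u n))).
  by apply: cvg_real_geometric t01 _ => n; apply: le_trans (h n); exact: Re_le_modulus.
have hI : cvgn (series (fun n => complex.Im (u n))).
  by apply: cvg_real_geometric t01 _ => n; apply: le_trans (h n); exact: Im_le_modulus.
apply/cvg_modulus => e e0.
have e2 : 0 < e / 2 by rewrite divr_gt0.
move/cvgrPdist_lt : hR => /(_ _ e2) hR; move/cvgrPdist_lt : hI => /(_ _ e2) hI.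
near=> n; apply: le_lt_trans (modulus_le_ReIm _) _.
rewrite Re_sub Im_sub Re_series Im_series /= [e]splitr ltrD // distrC.
  by near: n; exact: hR.
by near: n; exact: hI.
Unshelve. all: by end_near. Qed.

Lemma csum_tail (u : nat -> cplx K) (A t : K) N : 0 <= t < 1 ->
  (forall n, modulus (u n) <= A * t ^+ n) ->
  modulus (csum u - series u N) <= A * t ^+ N / (1 - t).
Proof.
move=> t01 h; have A0 : 0 <= A.
  by have := le_trans (modulus_ge0 _) (h 0%N); rewrite expr0 mulr1.
apply/ler_addgt0Pl => e e0.
have /cvg_modulus/(_ _ e0) [M _ hM] := cvg_csum t01 h.
apply: le_trans (modulus_triangle (series u (maxn M N)) _ _) _.
apply: lerD; first by rewrite modulusB ltW // hM //= leq_maxl.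
by apply: series_geometric_tail t01 A0 h _; exact: leq_maxr.
Qed.

Lemma csum_bound (u : nat -> cplx K) (A t : K) : 0 <= t < 1 ->
  (forall n, modulus (u n) <= A * t ^+ n) -> modulus (csum u) <= A / (1 - t).
Proof.
move=> t01 h; have := csum_tail 0 t01 h.
by rewrite /series /= big_geq // subr0 expr0 mulr1.
Qed.

Lemma cvg_series_unique (u : nat -> cplx K) (x y : cplx K) :
  series u @ \oo --> x -> series u @ \oo --> y -> x = y.
Proof. exact: cvg_unique. Qed.

End ComplexToolbox.

(** * Means over circles *)

Section ComplexIntegral.
Variable K : realType.
Local Notation mu := (@lebesgue_measure K).
Implicit Types (D : set K) (g h : K -> cplx K).

Definition cintegrable D g : Prop :=
  mu.-integrable D (EFin \o (fun t => complex.Re (g t))) /\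
  mu.-integrable D (EFin \o (fun t => complex.Im (g t))).

Lemma Re_cintegral D g :
  complex.Re (cintegral D g) = \int[mu]_(t in D) complex.Re (g t).
Proof. by []. Qed.

Lemma Im_cintegral D g :
  complex.Im (cintegral D g) = \int[mu]_(t in D) complex.Im (g t).
Proof. by []. Qed.

Lemma eq_cintegral D g h : (forall t, D t -> g t = h t) ->
  cintegral D g = cintegral D h.
Proof.
by move=> gh; congr Complex; apply: eq_Rintegral => t; rewrite inE => /gh ->.
Qed.

Lemma cintegralD D g h : measurable D -> cintegrable D g -> cintegrable D h ->
  cintegral D (fun t => g t + h t) = cintegral D g + cintegral D h.
Proof.
move=> mD [gr gi] [hr hi]; apply: eq_ReIm; rewrite ?Re_add ?Im_add /=.
  by rewrite -RintegralD //; apply: eq_Rintegral => t _; rewrite Re_add.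
by rewrite -RintegralD //; apply: eq_Rintegral => t _; rewrite Im_add.
Qed.

Lemma integrable_scale D (f : K -> K) (c : K) : measurable D ->
  mu.-integrable D (EFin \o f) -> mu.-integrable D (EFin \o (fun t => c * f t)).
Proof.
move=> mD h; have := @integrableZl _ _ _ mu D mD c (EFin \o f) h.
by apply: eq_integrable.
Qed.

Lemma cintegrableZ D g (c : cplx K) : measurable D -> cintegrable D g ->
  cintegrable D (fun t => c * g t).
Proof.
move=> mD [gr gi]; split.
  have := @integrableB _ _ _ mu D mD _ _ (integrable_scale (complex.Re c) mD gr)
    (integrable_scale (complex.Im c) mD gi).
  by apply: eq_integrable => // t _ /=; rewrite Re_mul.
have := @integrableD _ _ _ mu D mD _ _ (integrable_scale (complex.Re c) mD gi)
  (integrable_scale (complex.Im c) mD gr).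
by apply: eq_integrable => // t _ /=; rewrite Im_mul.
Qed.

Lemma cintegralZ D g (c : cplx K) : measurable D -> cintegrable D g ->
  cintegral D (fun t => c * g t) = c * cintegral D g.
Proof.
move=> mD [gr gi]; apply: eq_ReIm; rewrite ?Re_mul ?Im_mul !(Re_cintegral, Im_cintegral).
  rewrite -!RintegralZl // -RintegralB //; do ?exact: integrable_scale.
  by apply: eq_Rintegral => t _; rewrite Re_mul.
rewrite -!RintegralZl // -RintegralD //; do ?exact: integrable_scale.
by apply: eq_Rintegral => t _; rewrite Im_mul.
Qed.

(* Rotating the integral onto the positive half-line reduces the estimate to
   the real part. *)
Lemma modulus_cintegral_le D g (G : K -> K) : measurable D ->
  cintegrable D g -> mu.-integrable D (EFin \o G) ->
  (forall t, D t -> modulus (g t) <= G t) ->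
  modulus (cintegral D g) <= \int[mu]_(t in D) G t.
Proof.
move=> mD ig iG h; set I := cintegral D g.
have [I0|I0] := eqVneq I 0.
  by rewrite I0 modulus0 Rintegral_ge0 // => t /h; exact/le_trans/modulus_ge0.
pose c := of_real (modulus I) / I.
have c1 : modulus c = 1.
  by rewrite modulusM modulusV modulus_of_real ger0_norm ?modulus_ge0 // divff // modulus_eq0.
have [ir ii] := cintegrableZ c mD ig.
have -> : modulus I = \int[mu]_(t in D) complex.Re (c * g t).
  rewrite -Re_cintegral (cintegralZ c mD ig) -/I /c divfK //.
apply: le_Rintegral => // t /h; apply: le_trans.
by apply: le_trans (ler_norm _) _; apply: le_trans (Re_le_modulus _) _; rewrite modulusM c1 mul1r.
Qed.

Lemma continuous_Re g : continuous g -> continuous (fun t => complex.Re (g t)).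
Proof.
move=> cg t; apply/cvgrPdist_lt => e e0.
have /cvg_modulus/(_ _ e0) := cg t; apply: filterS => u /=.
rewrite distrC -Re_sub; exact/le_lt_trans/Re_le_modulus.
Qed.

Lemma continuous_Im g : continuous g -> continuous (fun t => complex.Im (g t)).
Proof.
move=> cg t; apply/cvgrPdist_lt => e e0.
have /cvg_modulus/(_ _ e0) := cg t; apply: filterS => u /=.
rewrite distrC -Im_sub; exact/le_lt_trans/Im_le_modulus.
Qed.

Lemma continuous_modulus g : continuous g -> continuous (fun t => modulus (g t)).
Proof.
move=> cg t; apply/cvgrPdist_lt => e e0.
have /cvg_modulus/(_ _ e0) := cg t; apply: filterS => u /=.
apply: le_lt_trans; rewrite ler_norml modulusB modulus_subl andbT.
by rewrite lerNl opprB modulusB modulus_subl.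
Qed.

Lemma continuous_ReIm g : continuous (fun t => complex.Re (g t)) ->
  continuous (fun t => complex.Im (g t)) -> continuous g.
Proof.
move=> cr ci t; apply/cvg_modulus => e e0.
have e2 : 0 < e / 2 by rewrite divr_gt0.
have /cvgrPdist_lt/(_ _ e2) hr := cr t; have /cvgrPdist_lt/(_ _ e2) hi := ci t.
near=> u; apply: le_lt_trans (modulus_le_ReIm _) _.
rewrite Re_sub Im_sub [e]splitr ltrD // distrC.
  by near: u; exact: hr.
by near: u; exact: hi.
Unshelve. all: by end_near. Qed.

Lemma continuous_uniform g :
  (forall e : K, 0 < e -> exists2 h, continuous h & forall t, modulus (g t - h t) <= e) ->
  continuous g.
Proof.
move=> H t; apply/cvg_modulus => e e0.
have e4 : 0 < e / 4 by rewrite divr_gt0.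
have [h ch hh] := H _ e4; have /cvg_modulus/(_ _ e4) := ch t.
apply: filterS => u hu.
have := modulus_triangle (h u) (g u) (g t).
have := modulus_triangle (h t) (h u) (g t).
have := hh u; have := hh t; rewrite (modulusB (h t)); move: hu; lra.
Qed.

Lemma continuous_cis : continuous (@cis K).
Proof. apply: continuous_ReIm; [exact: continuous_cos|exact: continuous_sin]. Qed.

Lemma continuous_integrable (f : K -> K) (a b : K) : continuous f ->
  mu.-integrable `[a, b] (EFin \o f).
Proof.
move=> cf; apply: continuous_compact_integrable; first exact: segment_compact.
exact: continuous_subspaceT.
Qed.

Lemma continuous_cintegrable g (a b : K) : continuous g -> cintegrable `[a, b] g.
Proof.
move=> cg; split; apply: continuous_integrable;
  [exact: continuous_Re|exact: continuous_Im].
Qed.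

Lemma Rintegral_shift (G : K -> K) (a b d : K) : a <= b -> continuous G ->
  \int[mu]_(t in `[a, b]) G (t + d) = \int[mu]_(t in `[a + d, b + d]) G t.
Proof.
move=> ab cG; rewrite /Rintegral; congr fine.
have dF : forall t : K, is_derive t (1 : K) (fun t => t + d) 1.
  by move=> t; apply: is_derive_eq; rewrite addr0.
have dF' : (fun t : K => t + d : K)^`()%classic = cst 1.
  by apply/funext => t; rewrite derive1E; exact: (@derive_val _ _ _ _ _ _ _ (dF t)).
rewrite (@integration_by_substitution_increasing K (fun t => t + d) G a b) //.
- by rewrite dF'; apply: eq_integral => t _ /=; rewrite /GRing.mul /= mulr1.
- by move=> x y _ _; rewrite ltrD2r.
- by move=> t _; rewrite dF'; exact: cvg_cst.
- by rewrite dF'; exact: is_cvg_cst.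
- by rewrite dF'; exact: is_cvg_cst.
- split=> [t _||]; first exact: (@ex_derive _ _ _ _ _ _ _ (dF t)).
  + by apply: cvg_at_right_filter; apply: cvgD; [exact: cvg_id|exact: cvg_cst].
  + by apply: cvg_at_left_filter; apply: cvgD; [exact: cvg_id|exact: cvg_cst].
- exact: continuous_subspaceT.
Qed.

Lemma Rintegral_cat (G : K -> K) (a b c : K) : a <= b -> b <= c -> continuous G ->
  \int[mu]_(t in `[a, c]) G t =
  \int[mu]_(t in `[a, b]) G t + \int[mu]_(t in `[b, c]) G t.
Proof.
move=> ab bc cG; apply/eqP; rewrite addrC -subr_eq; apply/eqP.
rewrite Rintegral_itvB; [|exact: continuous_integrable|by rewrite bnd_simp|by rewrite bnd_simp].
rewrite Rintegral_itv_obnd_cbnd //.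
apply: integrableS (continuous_integrable b c cG) => //.
by apply: subset_itvr; rewrite bnd_simp.
Qed.

(** For [d >= 0], cutting the interval from 0 to 2 pi + d at 2 pi or at d leaves end pieces that
    agree by periodicity. A negative shift is undone by the opposite positive one. *)
Lemma Rintegral_periodic_shift (G : K -> K) (d : K) : continuous G ->
  (forall t, G (t + 2 * pi) = G t) ->
  \int[mu]_(t in `[0, 2 * pi]) G (t + d) = \int[mu]_(t in `[0, 2 * pi]) G t.
Proof.
move=> cG pG; have pi0 : 0 <= 2 * pi :> K by rewrite mulr_ge0 ?pi_ge0.
have pos G1 d1 : continuous G1 -> (forall t, G1 (t + 2 * pi) = G1 t) -> 0 <= d1 ->
    \int[mu]_(t in `[0, 2 * pi]) G1 (t + d1) = \int[mu]_(t in `[0, 2 * pi]) G1 t.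
  move=> cG1 pG1 d10; rewrite Rintegral_shift // add0r.
  have h1 := Rintegral_cat pi0 (_ : 2 * pi <= 2 * pi + d1) cG1.
  have h2 := Rintegral_cat d10 (_ : d1 <= 2 * pi + d1) cG1.
  have h3 : \int[mu]_(t in `[2 * pi, 2 * pi + d1]) G1 t = \int[mu]_(t in `[0, d1]) G1 t.
    rewrite -{1}[2 * pi]add0r (addrC (2 * pi) d1) -Rintegral_shift //.
    by apply: eq_Rintegral => t _; rewrite pG1.
  have := h1 _; rewrite lerDl h2 ?lerDr // h3 => /(_ d10).
  by rewrite addrC => /addIr.
have [d0|d0] := leP 0 d; first exact: pos.
rewrite -(pos (fun t => G (t + d)) (- d)); last by rewrite oppr_ge0 ltW.
- by apply: eq_Rintegral => t _; rewrite subrK.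
- move=> t; apply: (continuous_comp (f := fun t => t + d)); last exact: cG.
  by apply: cvgD; [exact: cvg_id|exact: cvg_cst].
- by move=> t; rewrite addrAC pG.
Qed.

Definition avg g : cplx K := of_real (2 * pi)^-1 * cintegral (@angles K) g.

Lemma twopi_gt0 : 0 < 2 * pi :> K.
Proof. by rewrite mulr_gt0 ?pi_gt0. Qed.

Lemma measurable_angles : measurable (@angles K).
Proof. exact: measurable_itv. Qed.

Lemma lebesgue_angles : mu (@angles K) = (2 * pi)%:E.
Proof. by rewrite /angles lebesgue_measure_itv /= lte_fin twopi_gt0 sube0. Qed.

Lemma eq_avg g h : (forall t, g t = h t) -> avg g = avg h.
Proof. by move=> gh; congr (_ * _); apply: eq_cintegral => t _; exact: gh. Qed.

Lemma avgD g h : continuous g -> continuous h ->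
  avg (fun t => g t + h t) = avg g + avg h.
Proof.
move=> cg ch; rewrite /avg cintegralD ?mulrDr //; last 2 first.
- exact: continuous_cintegrable.
- exact: continuous_cintegrable.
exact: measurable_angles.
Qed.

Lemma avgZ g (c : cplx K) : continuous g -> avg (fun t => c * g t) = c * avg g.
Proof.
move=> cg; rewrite /avg cintegralZ; [ring|exact: measurable_angles|].
exact: continuous_cintegrable.
Qed.

Lemma continuousZ_fun g (c : cplx K) : continuous g -> continuous (fun t => c * g t).
Proof. by move=> cg t; apply: cvgM; [exact: cvg_cst|exact: cg]. Qed.

Lemma continuousD_fun g h : continuous g -> continuous h ->
  continuous (fun t => g t + h t).
Proof. by move=> cg ch t; apply: cvgD; [exact: cg|exact: ch]. Qed.

Lemma continuousM_fun g h : continuous g -> continuous h ->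
  continuous (fun t => g t * h t).
Proof. by move=> cg ch t; apply: cvgM; [exact: cg|exact: ch]. Qed.

Lemma continuousB_fun g h : continuous g -> continuous h ->
  continuous (fun t => g t - h t).
Proof. by move=> cg ch t; apply: cvgB; [exact: cg|exact: ch]. Qed.

Lemma continuousV_fun g : continuous g -> (forall t, g t != 0) ->
  continuous (fun t => (g t)^-1).
Proof. by move=> cg g0 t; apply: cvgV; [exact: g0|exact: cg]. Qed.

Lemma continuousX_fun g n : continuous g -> continuous (fun t => g t ^+ n).
Proof.
move=> cg; elim: n => [|n IH]; first by move=> t; exact: cvg_cst.
by under eq_fun do rewrite exprS; exact: continuousM_fun.
Qed.

Lemma continuous_cst_fun (c : cplx K) : continuous (fun _ : K => c).
Proof. by move=> t; exact: cvg_cst. Qed.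

Lemma avgB g h : continuous g -> continuous h ->
  avg (fun t => g t - h t) = avg g - avg h.
Proof.
move=> cg ch; have e : forall t, g t - h t = g t + -1 * h t by move=> t; rewrite mulN1r.
by rewrite (eq_avg e) (avgD cg (continuousZ_fun ch)) (avgZ _ ch) mulN1r.
Qed.

Lemma continuous_sum_fun (F : nat -> K -> cplx K) n :
  (forall i, continuous (F i)) -> continuous (fun t => \sum_(0 <= i < n) F i t).
Proof.
move=> cF; elim: n => [|n IH].
  have -> : (fun t => \sum_(0 <= i < 0) F i t) = (fun=> 0).
    by apply/funext => t; rewrite big_nil.
  exact: continuous_cst_fun.
have -> : (fun t => \sum_(0 <= i < n.+1) F i t) =
    (fun t => \sum_(0 <= i < n) F i t + F n t).
  by apply/funext => t; rewrite big_nat_recr.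
exact: continuousD_fun IH (cF n).
Qed.

Lemma avg_sum (F : nat -> K -> cplx K) n : (forall i, continuous (F i)) ->
  avg (fun t => \sum_(0 <= i < n) F i t) = \sum_(0 <= i < n) avg (F i).
Proof.
move=> cF; elim: n => [|n IH].
  rewrite big_nil (@eq_avg _ (fun t => 0 * 1)); last by move=> t; rewrite big_nil mul0r.
  by rewrite (avgZ _ (@continuous_cst_fun 1)) mul0r.
rewrite (@eq_avg _ (fun t => \sum_(0 <= i < n) F i t + F n t)); last first.
  by move=> t; rewrite big_nat_recr.
by rewrite (avgD (continuous_sum_fun cF) (cF n)) IH big_nat_recr.
Qed.

Lemma avg_le g (M : K) : continuous g ->
  (forall t, 0 <= t <= 2 * pi -> modulus (g t) <= M) -> modulus (avg g) <= M.
Proof.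
move=> cg h; rewrite /avg modulusM modulus_of_real.
rewrite ger0_norm ?invr_ge0 ?(ltW twopi_gt0) // mulrC ler_pdivrMr ?twopi_gt0 //.
have := @modulus_cintegral_le (@angles K) g (cst M) measurable_angles
  (continuous_cintegrable _ _ cg).
rewrite /= Rintegral_cst; last exact: measurable_angles.
rewrite [X in fine X]lebesgue_angles /=; apply.
  by apply: continuous_integrable => t; exact: cvg_cst.
by move=> t; rewrite /angles /= in_itv /=; exact: h.
Qed.

Lemma avg_shift g d : continuous g -> (forall t, g (t + 2 * pi) = g t) ->
  avg (fun t => g (t + d)) = avg g.
Proof.
move=> cg pg; congr (_ * Complex _ _); rewrite /angles.
  apply: (Rintegral_periodic_shift (G := fun t => complex.Re (g t))).
    exact: continuous_Re.
  by move=> t; rewrite pg.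
apply: (Rintegral_periodic_shift (G := fun t => complex.Im (g t))).
  exact: continuous_Im.
by move=> t; rewrite pg.
Qed.

Lemma avg_cst (c : cplx K) : avg (fun=> c) = c.
Proof.
suff h1 : avg (fun=> 1) = 1.
  have -> : (fun=> c) = (fun=> c * 1) :> (K -> cplx K) by rewrite mulr1.
  by rewrite avgZ ?h1 ?mulr1 //; exact: continuous_cst_fun.
rewrite /avg /cintegral !Rintegral_cst; do ?exact: measurable_angles.
rewrite [X in fine X]lebesgue_angles /= mul0r mul1r -/(of_real (2 * pi)).
by rewrite -of_realM mulVf // gt_eqF // twopi_gt0.
Qed.

Lemma cis_period t : cis (t + 2 * pi) = cis t :> cplx K.
Proof. by rewrite cisD cis2pi mulr1. Qed.

Lemma cis_pi : cis pi = -1 :> cplx K.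
Proof. by rewrite /cis cospi sinpi; apply: eq_ReIm; rewrite //= oppr0. Qed.

(** The shift by [d] preserves the mean and changes its sign. With d = pi / n this yields the
    orthogonality of the powers of [cis] without any antiderivative. *)
Lemma avg_antiperiodic g d : continuous g -> (forall t, g (t + 2 * pi) = g t) ->
  (forall t, g (t + d) = - g t) -> avg g = 0.
Proof.
move=> cg pg ag; have h := avg_shift d cg pg.
have e : forall t, g (t + d) = -1 * g t by move=> t; rewrite ag mulN1r.
move: h; rewrite (eq_avg e) (avgZ _ cg) mulN1r => /eqP.
by rewrite eq_sym -subr_eq0 opprK -mulr2n mulrn_eq0 /= => /eqP.
Qed.

Lemma cisX_shift (n : nat) t : (0 < n)%N -> cis (t + pi / n%:R) ^+ n = - cis t ^+ n :> cplx K.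
Proof.
move=> n0; rewrite cisD exprMn [X in _ * X]cisX mulrCA divff ?pnatr_eq0 -?lt0n //.
by rewrite mulr1 cis_pi mulrN1.
Qed.

Lemma avg_cisX (n : nat) : (0 < n)%N -> avg (fun t => cis t ^+ n) = 0.
Proof.
move=> n0; apply: (avg_antiperiodic (d := pi / n%:R)).
- exact: continuousX_fun continuous_cis.
- by move=> t; rewrite cis_period.
- by move=> t; exact: cisX_shift.
Qed.

Lemma avg_cisVX (n : nat) : (0 < n)%N -> avg (fun t => (cis t)^-1 ^+ n) = 0.
Proof.
move=> n0; apply: (avg_antiperiodic (d := pi / n%:R)).
- by apply: continuousX_fun; apply: continuousV_fun continuous_cis _; exact: cis_neq0.
- by move=> t; rewrite cis_period.
- by move=> t; rewrite !exprVn cisX_shift // invrN.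
Qed.

End ComplexIntegral.

(** * Cauchy's theorem on circles *)

Section SecondOrder.
Variable K : realType.
Implicit Types (f g : cplx K -> cplx K) (z w : cplx K).
Local Notation "'i" := (Complex 0 1 : cplx K).

(* A locally uniform second order expansion: the only regularity of analytic
   functions that Cauchy's theorem on circles needs. *)
Definition c2at f (z0 : cplx K) : Prop := exists d M : K, 0 < d /\
  forall w, modulus (w - z0) < d -> modulus (f w) <= M /\
    exists2 c, modulus c <= M & forall z, modulus (z - z0) < d ->
      modulus (f z - f w - c * (z - w)) <= M * modulus (z - w) ^+ 2.

Lemma c2at_eq f g z0 (d : K) : 0 < d ->
  (forall z, modulus (z - z0) < d -> f z = g z) -> c2at f z0 -> c2at g z0.
Proof.
move=> d0 fg [d' [M [d'0 h]]]; exists (Num.min d d'), M; split.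
  by rewrite lt_min d0.
move=> w; rewrite lt_min => /andP[wd /h[fM [c cM hc]]]; rewrite -fg //.
by split=> //; exists c => // z; rewrite lt_min => /andP[zd /hc]; rewrite fg.
Qed.

Lemma c2at_cst (a z0 : cplx K) : c2at (fun=> a) z0.
Proof.
exists 1, (modulus a); split=> // w _; split=> //; exists 0.
  by rewrite modulus0 modulus_ge0.
by move=> z _; rewrite mul0r subr0 subrr modulus0 mulr_ge0 ?modulus_ge0 // sqr_ge0.
Qed.

Lemma c2at_id z0 : c2at id z0.
Proof.
exists 1, (modulus z0 + 1); split=> // w wz; split.
  have := modulusD (w - z0) z0; rewrite subrK => /le_trans; apply.
  by rewrite addrC lerD2l ltW.
exists 1; first by rewrite modulus1 lerDr modulus_ge0.
move=> z _; rewrite mul1r subrr modulus0 mulr_ge0 ?sqr_ge0 // addr_ge0 //.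
exact: modulus_ge0.
Qed.

(** The constant 5 is 1 + 1 + 3: each remainder contributes M L t^2 and the product of the
    increments 3 M L t^2. The radius is capped at 1 so that t <= 2, which bounds the increment of
    [f] by 3 M t. *)
Lemma c2at_mul f g z0 : c2at f z0 -> c2at g z0 -> c2at (fun z => f z * g z) z0.
Proof.
move=> [d1 [M [d10 hf]]] [d2 [L [d20 hg]]].
have M0 : 0 <= M.
  have [|/(le_trans (modulus_ge0 _)) //] := hf z0.
  by rewrite subrr modulus0.
have L0 : 0 <= L.
  have [|/(le_trans (modulus_ge0 _)) //] := hg z0.
  by rewrite subrr modulus0.
pose d := Num.min (Num.min d1 d2) 1.
have dd1 x : x < d -> x < d1 by rewrite !lt_min => /andP[/andP[]].
have dd2 x : x < d -> x < d2 by rewrite !lt_min => /andP[/andP[]].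
exists d, (M * L * 5); split; first by rewrite !lt_min d10 d20 ltr01.
move=> w wd; have [fM [a aM ha]] := hf w (dd1 _ wd).
have [gL [b bL hb]] := hg w (dd2 _ wd).
have fgM : modulus (f w * g w) <= M * L by rewrite modulusM ler_pM ?modulus_ge0.
split; first by apply: le_trans fgM _; rewrite ler_peMr ?mulr_ge0 // ler1n.
exists (a * g w + f w * b).
  apply: le_trans (modulusD _ _) _; rewrite !modulusM.
  have h1 : modulus a * modulus (g w) <= M * L by rewrite ler_pM ?modulus_ge0.
  have h2 : modulus (f w) * modulus b <= M * L by rewrite ler_pM ?modulus_ge0.
  have := mulr_ge0 M0 L0; lra.
move=> z zd; have [fzM _] := hf z (dd1 _ zd).
have fz := ha z (dd1 _ zd); have gz := hb z (dd2 _ zd).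
have t2 : modulus (z - w) <= 2.
  have := modulus_triangle z0 z w; have : modulus (z - z0) < 1.
    by move: zd; rewrite !lt_min => /andP[].
  have : modulus (w - z0) < 1 by move: wd; rewrite !lt_min => /andP[].
  rewrite (modulusB z0 w); lra.
have fzw : modulus (f z - f w) <= 3 * M * modulus (z - w).
  have := modulusD (f z - f w - a * (z - w)) (a * (z - w)).
  rewrite subrK modulusM => /le_trans; apply.
  have h1 : modulus a * modulus (z - w) <= M * modulus (z - w).
    by rewrite ler_wpM2r ?modulus_ge0.
  have h2 : M * modulus (z - w) ^+ 2 <= M * modulus (z - w) * 2.
    by rewrite expr2 mulrA ler_wpM2l ?mulr_ge0 ?modulus_ge0.
  lra.
have -> : f z * g z - f w * g w - (a * g w + f w * b) * (z - w) =
  (f z - f w - a * (z - w)) * g w + f z * (g z - g w - b * (z - w)) +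
  (f z - f w) * (b * (z - w)) by ring.
set t := modulus (z - w) in fz gz t2 fzw *.
have t0 : 0 <= t by exact: modulus_ge0.
have h1 : modulus ((f z - f w - a * (z - w)) * g w) <= M * t ^+ 2 * L.
  by rewrite modulusM ler_pM ?modulus_ge0.
have h2 : modulus (f z * (g z - g w - b * (z - w))) <= M * (L * t ^+ 2).
  by rewrite modulusM ler_pM ?modulus_ge0.
have h3 : modulus ((f z - f w) * (b * (z - w))) <= 3 * M * t * (L * t).
  by rewrite !modulusM ler_pM ?mulr_ge0 ?modulus_ge0 // ler_pM ?modulus_ge0.
apply: le_trans (modulusD _ _) _; apply: le_trans (lerD (modulusD _ _) h3) _.
apply: le_trans (lerD (lerD h1 h2) (lexx _)) _.
by apply: eq_leW; ring.
Qed.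

Lemma c2at_X f z0 n : c2at f z0 -> c2at (fun z => f z ^+ n) z0.
Proof.
move=> hf; elim: n => [|n IH]; first exact: c2at_cst.
by under eq_fun do rewrite exprS; exact: c2at_mul.
Qed.

(** The remainder is exactly (z - w)^2 / ((z - a) (w - a)^2), and half of the distance to [a] as
    radius keeps the denominators away from 0. *)
Lemma c2at_inv (a z0 : cplx K) : z0 != a -> c2at (fun z => (z - a)^-1) z0.
Proof.
move=> z0a; pose d := modulus (z0 - a) / 2.
have d0 : 0 < d by rewrite divr_gt0 // modulus_gt0 subr_eq0.
have far z : modulus (z - z0) < d -> d <= modulus (z - a).
  have := modulus_triangle z z0 a; rewrite (modulusB z0 z) /d; lra.
have M1 z : modulus (z - z0) < d -> modulus (z - a)^-1 <= d^-1.
  by move=> /far h; rewrite modulusV lef_pV2 ?posrE // (lt_le_trans d0).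
have nz z : modulus (z - z0) < d -> z - a != 0.
  by move=> /far h; rewrite -modulus_gt0 (lt_le_trans d0).
pose M := d^-1 + d^-1 ^+ 2 + d^-1 ^+ 3.
have di0 : 0 <= d^-1 by rewrite invr_ge0 ltW.
exists d, M; split=> // w wd; split.
  apply: le_trans (M1 _ wd) _; rewrite /M -addrA lerDl.
  by rewrite addr_ge0 // exprn_ge0.
exists (- ((w - a)^-1 ^+ 2)).
  rewrite modulusN modulusX; apply: (@le_trans _ _ (d^-1 ^+ 2)).
    by rewrite ler_pXn2r ?nnegrE ?modulus_ge0 ?M1.
  by rewrite /M; have := exprn_ge0 3 di0; lra.
move=> z zd.
have -> : (z - a)^-1 - (w - a)^-1 - - (w - a)^-1 ^+ 2 * (z - w) =
    (z - w) ^+ 2 * ((z - a)^-1 * (w - a)^-1 ^+ 2).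
  by field; rewrite !nz.
rewrite modulusM modulusX mulrC ler_wpM2r ?sqr_ge0 // modulusM modulusX.
apply: (@le_trans _ _ (d^-1 ^+ 3)).
  rewrite [leRHS]exprS; apply: ler_pM; rewrite ?sqr_ge0 ?modulus_ge0 ?M1 //.
  by rewrite ler_sqr ?nnegrE ?modulus_ge0 ?M1.
by rewrite /M; have := exprn_ge0 2 di0; lra.
Qed.

Lemma c2at_lip f (z0 : cplx K) : c2at f z0 -> exists d L : K, 0 < d /\ 0 <= L /\
  forall z, modulus (z - z0) < d -> modulus (f z - f z0) <= L * modulus (z - z0).
Proof.
move=> [d [M [d0 h]]]; have [|fM [c cM hc]] := h z0.
  by rewrite subrr modulus0.
have M0 : 0 <= M := le_trans (modulus_ge0 _) fM.
exists (Num.min d 1), (2 * M); split; first by rewrite lt_min d0 /=.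
split=> [|z]; first by rewrite mulr_ge0.
rewrite lt_min => /andP[zd z1]; have := hc z zd.
have := modulusD (f z - f z0 - c * (z - z0)) (c * (z - z0)).
rewrite subrK modulusM.
have h1 : modulus c * modulus (z - z0) <= M * modulus (z - z0).
  by rewrite ler_wpM2r ?modulus_ge0.
have h2 : M * modulus (z - z0) ^+ 2 <= M * modulus (z - z0).
  by rewrite ler_wpM2l // expr2 ler_piMr ?modulus_ge0 // ltW.
lra.
Qed.

Lemma c2at_continuous f (gam : K -> cplx K) : continuous gam ->
  (forall t, c2at f (gam t)) -> continuous (fun t => f (gam t)).
Proof.
move=> cg cf t; apply/cvg_modulus => e e0.
have [d [L [d0 [L0 h]]]] := c2at_lip (cf t).
have e1 : 0 < Num.min d (e / (L + 1)) by rewrite lt_min d0 divr_gt0 // ltr_wpDl.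
have /cvg_modulus/(_ _ e1) := cg t; apply: filterS => u.
rewrite lt_min => /andP[/h hu]; rewrite ltr_pdivlMr ?ltr_wpDl // => hu2.
apply: le_lt_trans hu _; apply: le_lt_trans hu2; rewrite mulrC ler_wpM2l ?modulus_ge0 //.
by rewrite lerDl.
Qed.

Definition circ (s t : K) : cplx K := of_real s * cis t.

Lemma modulus_circ s t : 0 <= s -> modulus (circ s t) = s.
Proof. by move=> s0; rewrite modulusM modulus_cis mulr1 modulus_of_real ger0_norm. Qed.

Lemma continuous_circ s : continuous (circ s).
Proof. by apply: continuousZ_fun; exact: continuous_cis. Qed.

Lemma circ_period s t : circ s (t + 2 * pi) = circ s t.
Proof. by rewrite /circ cis_period. Qed.

(** Compactness of the interval of angles. A single integer [N] serves as constant and, through 1 /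
    (N + 1), as radius, so that the near-covering form of compactness applies along [\oo]. *)
Lemma circle_uniform f (s : K) : (forall t, c2at f (circ s t)) ->
  exists N : nat, forall t, 0 <= t <= 2 * pi -> exists2 c, modulus c <= N%:R &
    forall z, modulus (z - circ s t) < N.+1%:R^-1 ->
      modulus (f z - f (circ s t) - c * (z - circ s t)) <=
        N%:R * modulus (z - circ s t) ^+ 2.
Proof.
move=> hf.
have /compact_near_coveringP/(_ nat \oo (fun N t => exists2 c, modulus c <= N%:R &
    forall z, modulus (z - circ s t) < N.+1%:R^-1 ->
      modulus (f z - f (circ s t) - c * (z - circ s t)) <=
        N%:R * modulus (z - circ s t) ^+ 2) _) H := @segment_compact K 0 (2 * pi).
have [|N _ hN] := H.
  move=> t _; have [d [M [d0 h]]] := hf t.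
  have d2 : 0 < d / 2 by rewrite divr_gt0.
  have Nd : \forall N \near \oo, (N.+1%:R^-1 : K) < d / 2.
    have /cvgrPdist_lt/(_ _ d2) := @cvg_harmonic K; apply: filterS => N /=.
    by rewrite sub0r normrN ger0_norm ?invr_ge0.
  have NM : \forall N \near \oo, M <= N%:R :> K.
    exact: nbhs_infty_ger.
  have /cvg_modulus/(_ _ d2) tt := @continuous_circ s t.
  near=> u N.
  have MN : M <= N%:R by near: N; exact: NM.
  have ud : modulus (circ s u - circ s t) < d / 2 by near: u; exact: tt.
  have Nd' : N.+1%:R^-1 < d / 2 by near: N; exact: Nd.
  have [|_ [c cM hc]] := h (circ s u); first by move: ud; lra.
  exists c; first exact: le_trans cM MN.
  move=> z zu; apply: le_trans (hc z _) _; last by rewrite ler_wpM2r ?sqr_ge0.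
  apply: le_lt_trans (modulus_triangle (circ s u) _ _) _.
  by rewrite [d]splitr ltrD // (lt_trans zu).
by exists N => t t01; apply: (hN N) => //=; rewrite in_itv.
Unshelve. all: by end_near. Qed.

(** The derivative of [cis] at 0 is i: a radial displacement x and i times the displacement of a
    rotation by x cancel to first order. *)
Lemma cis_small (e : K) : 0 < e -> exists2 d, 0 < d & forall x, `|x| < d ->
  modulus (of_real x + 'i * (cis x - 1)) <= e * `|x|.
Proof.
move=> e0; have e2 : 0 < e / 2 by rewrite divr_gt0.
have dS := is_derive_sin (0 : K); have dC := is_derive_cos (0 : K).
have /cvgrPdist_lt/(_ _ e2) hS : h^-1 *: (sin (h *: 1 + 0 : K) - sin 0) @[h --> (0:K)^'] --> cos (0 : K).
  by rewrite -(@derive_val _ _ _ _ _ _ _ dS); exact: (@ex_derive _ _ _ _ _ _ _ dS).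
have /cvgrPdist_lt/(_ _ e2) hC : h^-1 *: (cos (h *: 1 + 0 : K) - cos 0) @[h --> (0:K)^'] --> - sin (0 : K).
  by rewrite -(@derive_val _ _ _ _ _ _ _ dC); exact: (@ex_derive _ _ _ _ _ _ _ dC).
have [d d0 hd] : \forall h \near (0:K)^',
    `|cos (0 : K) - h^-1 *: (sin (h *: 1 + 0 : K) - sin 0)| < e / 2 /\
    `|- sin (0 : K) - h^-1 *: (cos (h *: 1 + 0 : K) - cos 0)| < e / 2.
  by near=> h; split; near: h.
exists d => // x xd; have [->|x0] := eqVneq x 0.
  by rewrite cis0 subrr mulr0 addr0 modulus0 normr0 mulr0.
have [|h1 h2] := hd x _ x0; first by rewrite /ball_ /= sub0r normrN.
have {}h1 : `|1 - x^-1 * sin x| < e / 2.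
  by move: h1; rewrite /GRing.scale /= mulr1 addr0 cos0 sin0 subr0.
have {}h2 : `|x^-1 * (cos x - 1)| < e / 2.
  by move: h2; rewrite /GRing.scale /= mulr1 addr0 cos0 sin0 oppr0 sub0r normrN.
have -> : of_real x + 'i * (cis x - 1) =
    of_real x * Complex (1 - x^-1 * sin x) (x^-1 * (cos x - 1)).
  apply: eq_ReIm; rewrite !(Re_add, Im_add, Re_mul, Im_mul, Re_sub, Im_sub) /=.
    by field; rewrite x0.
  by field; rewrite x0.
rewrite modulusM modulus_of_real mulrC ler_wpM2r // ltW //.
by apply: le_lt_trans (modulus_le_ReIm _) _; rewrite /= [e]splitr ltrD.
Unshelve. all: by end_near. Qed.

Lemma avg_circ_shift f s d : (forall t, c2at f (circ s t)) ->
  avg (fun t => f (circ s t * cis d)) = avg (fun t => f (circ s t)).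
Proof.
move=> hf; have cf := c2at_continuous (@continuous_circ s) hf.
rewrite -[RHS](avg_shift d cf); last by move=> t; rewrite circ_period.
by apply: eq_avg => t; rewrite /circ cisD mulrA.
Qed.

(** A rotation does not change the mean, so i times the mean of f (w cis x) - f w may be added for
    free. The first order terms then cancel by [cis_small], and only quadratic remainders are
    left. *)
Lemma avg_circ_derive f s : 0 < s -> (forall t, c2at f (circ s t)) ->
  (exists2 d, 0 < d & forall x t, `|x - s| < d -> c2at f (circ x t)) ->
  forall e, 0 < e -> exists2 d, 0 < d & forall x, `|x| < d ->
  modulus (avg (fun t => f (circ (s * (1 + x)) t)) - avg (fun t => f (circ s t)))
    <= e * `|x|.
Proof.
move=> s0 hf [d1 d10 hd1] e e0; have [N hN] := circle_uniform hf.
(* N s comes from the first order term; 5 N s^2 = (1 + 4) N s^2 comes from the remainders at the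
   radial displacement s |x| and at the rotation, which moves by at most 2 s |x|. The final 1
   ensures positivity. *)
pose B : K := N%:R * s + N%:R * s ^+ 2 * 5 + 1.
have N0 : 0 <= N%:R :> K by [].
have B0 : 0 < B by rewrite /B ltr_wpDl // addr_ge0 ?mulr_ge0 ?sqr_ge0 // ltW.
pose e' := Num.min (e / B) 1.
have e'0 : 0 < e' by rewrite lt_min divr_gt0 /=.
have [d2 d20 hd2] := cis_small e'0.
pose d := Num.min (Num.min (d1 / s) d2) (Num.min (N.+1%:R^-1 / (2 * s)) e').
exists d; first by rewrite /d 3!lt_min e'0 d20 !divr_gt0 ?mulr_gt0 ?invr_gt0.
move=> x; rewrite !lt_min -!andbA => /and4P[xd1 /hd2 xd2 xN xe].
have cis1 : modulus (cis x - 1) <= 2 * `|x|.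
  have := modulusB_le (of_real x + 'i * (cis x - 1)) (of_real x).
  rewrite addrAC subrr add0r modulusM modulus_of_real.
  have -> : modulus 'i = 1 by rewrite /modulus /= expr0n /= add0r expr1n sqrtr1.
  have : e' <= 1 by rewrite /e' ge_min lexx orbT.
  have := normr_ge0 x; move: xd2; nra.
have cw : continuous (fun t => f (circ s t)) := c2at_continuous (@continuous_circ s) hf.
have cx : continuous (fun t => f (circ (s * (1 + x)) t)).
  apply: (c2at_continuous (@continuous_circ _)) => t; apply: hd1.
  have -> : s * (1 + x) - s = x * s by ring.
  by rewrite normrM (gtr0_norm s0) -ltr_pdivlMr.
have cs : continuous (fun t => f (circ s t * cis x)).
  have -> : (fun t => f (circ s t * cis x)) = (fun t => f (circ s (t + x))).
    by apply/funext => t; rewrite /circ cisD mulrA.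
  apply: (c2at_continuous (gam := fun t => circ s (t + x))) => [t|t]; last exact: hf.
  apply: (continuous_comp (f := fun t => t + x)); last exact: continuous_circ.
  by apply: cvgD; [exact: cvg_id|exact: cvg_cst].
have -> : avg (fun t => f (circ (s * (1 + x)) t)) - avg (fun t => f (circ s t)) =
  avg (fun t => (f (circ (s * (1 + x)) t) - f (circ s t)) +
     'i * (f (circ s t * cis x) - f (circ s t))).
  have c1 := continuousB_fun cx cw; have c2 := continuousB_fun cs cw.
  rewrite (avgD c1 (continuousZ_fun c2)) (avgZ _ c2) (avgB cx cw) (avgB cs cw).
  by rewrite (avg_circ_shift x hf) (subrr (avg (fun t => f (circ s t)))) mulr0 addr0.
apply: avg_le; first by apply: continuousD_fun; [|apply: continuousZ_fun]; exact: continuousB_fun.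
move=> t /hN[c cN hc]; set w := circ s t in hc *.
have wE : modulus w = s by rewrite modulus_circ // ltW.
have -> : circ (s * (1 + x)) t = w + w * of_real x.
  by rewrite /w /circ of_realM of_realD of_real1; ring.
set a := w + w * of_real x; set b := w * cis x.
have aw : modulus (a - w) = s * `|x|.
  by rewrite /a [w + _]addrC addrK modulusM modulus_of_real wE.
have bw : modulus (b - w) <= 2 * s * `|x|.
  have -> : b - w = w * (cis x - 1) by rewrite /b; ring.
  by rewrite modulusM wE -mulrA mulrCA ler_wpM2l // ltW.
have xs : 2 * s * `|x| < N.+1%:R^-1 by rewrite mulrC -ltr_pdivlMr // mulr_gt0.
have x0 := normr_ge0 x.
have ha := hc a _; have hb := hc b (le_lt_trans bw xs).
have {}ha := ha _; rewrite aw in ha.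
have {}ha := ha (le_lt_trans (_ : _ <= 2 * s * `|x|) xs).
rewrite -mulrA ler_peMl ?mulr_ge0 ?(ltW s0) ?ler1n // in ha.
have -> : f a - f w + 'i * (f b - f w) = (f a - f w - c * (a - w)) +
    'i * (f b - f w - c * (b - w)) + c * w * (of_real x + 'i * (cis x - 1)).
  by rewrite /a /b; ring.
have i1 : modulus 'i = 1 by rewrite /modulus /= expr0n /= add0r expr1n sqrtr1.
have h2 : modulus ('i * (f b - f w - c * (b - w))) <= N%:R * (2 * s * `|x|) ^+ 2.
  rewrite modulusM i1 mul1r; apply: le_trans hb _; rewrite ler_wpM2l //.
  by rewrite ler_pXn2r ?nnegrE ?modulus_ge0 ?mulr_ge0 // ltW.
have h3 : modulus (c * w * (of_real x + 'i * (cis x - 1))) <= N%:R * s * (e' * `|x|).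
  rewrite (modulusM (c * w)) (modulusM c) wE.
  apply: ler_pM; rewrite ?modulus_ge0 ?mulr_ge0 ?modulus_ge0 ?(ltW s0) //.
  by rewrite ler_wpM2r // ltW.
apply: le_trans (modulusD _ _) _; apply: le_trans (lerD (modulusD _ _) h3) _.
apply: le_trans (lerD (lerD (ha isT) h2) (lexx _)) _.
have xx : `|x| ^+ 2 <= e' * `|x| by rewrite expr2 ler_wpM2r // /e' le_min; case/andP: xe => /ltW -> /ltW.
apply: (@le_trans _ _ (B * (e' * `|x|))).
  have := mulr_ge0 N0 (sqr_ge0 s); rewrite /B !exprMn => Ns.
  have : N%:R * s ^+ 2 * `|x| ^+ 2 <= N%:R * s ^+ 2 * (e' * `|x|) by rewrite ler_wpM2l.
  have := mulr_ge0 (ltW e'0) x0; rewrite !mulrA; lra.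
rewrite mulrA ler_wpM2r // mulrC -ler_pdivlMr // /e' ge_min lexx.
by [].
Qed.

(* Moving a circle radially and rotating it have opposite first order effects
   on the mean of an analytic function, and the rotation leaves it unchanged. *)
Lemma avg_circ_const f a b : 0 < a -> (forall s t, a < s < b -> c2at f (circ s t)) ->
  forall s1 s2, a < s1 < b -> a < s2 < b ->
  avg (fun t => f (circ s1 t)) = avg (fun t => f (circ s2 t)).
Proof.
move=> a0 hf; pose J s := avg (fun t => f (circ s t)).
(* The mean value theorem is real, so it is applied to the real and the imaginary part [p] of the
   mean. *)
have dJ (p : cplx K -> K) : (forall x y, p (x - y) = p x - p y) ->
    (forall x, `|p x| <= modulus x) ->
    forall s, a < s < b -> is_derive s (1 : K) (fun s => p (J s)) (0 : K).
  move=> pB pl s /andP[as_ sb].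
  have s0 : 0 < s := lt_trans a0 as_.
  have H : h^-1 *: (p (J (h *: 1 + s)) - p (J s)) @[h --> (0:K)^'] --> (0 : K).
    apply/cvgrPdist_le => e e0.
    have es : 0 < e * s by rewrite mulr_gt0.
    have [||d d0 hd] := @avg_circ_derive f s s0 _ _ _ es.
    - by move=> t; apply: hf; rewrite as_.
    - exists (Num.min (s - a) (b - s)); first by rewrite lt_min !subr_gt0 as_.
      move=> x t; rewrite lt_min !ltr_norml => /andP[/andP[h1 _] /andP[_ h2]].
      by apply: hf; apply/andP; split; move: h1 h2; lra.
    exists (d * s); first by rewrite /= mulr_gt0.
    move=> h /=; rewrite /ball_ /= !sub0r !normrN => hds h0.
    rewrite normrM normfV ler_pdivrMl ?normr_gt0 // -pB.
    apply: le_trans (pl _) _; rewrite /GRing.scale /= mulr1.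
    have := hd (h / s) _; rewrite normrM normfV (gtr0_norm s0) ltr_pdivrMr // => /(_ hds).
    have -> : s * (1 + h / s) = h + s by field; rewrite gt_eqF.
    move=> /le_trans; apply; apply: eq_leW.
    by field; rewrite gt_eqF.
  by split; [apply/cvg_ex; exists 0; exact: H|exact/cvg_lim].
have key (p : cplx K -> K) : (forall x y, p (x - y) = p x - p y) ->
    (forall x, `|p x| <= modulus x) ->
    forall s1 s2, a < s1 < b -> a < s2 < b -> s1 < s2 -> p (J s1) = p (J s2).
  move=> pB pl s1 s2 h1 h2 s12; have dp := dJ p pB pl.
  have hin x : s1 <= x <= s2 -> a < x < b.
    by move: h1 h2 => /andP[? ?] /andP[? ?] /andP[? ?]; apply/andP; split; lra.
  have [||c _] := @MVT _ (fun s => p (J s)) (fun=> 0) s1 s2 s12.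
  - by move=> x; rewrite in_itv /= => /andP[? ?]; apply/dp/hin; rewrite !ltW.
  - apply: derivable_within_continuous => x; rewrite in_itv /= => /hin hx.
    exact: (@ex_derive _ _ _ _ _ _ _ (dp x hx)).
  by rewrite mul0r => /eqP; rewrite subr_eq0 => /eqP.
move=> s1 s2 h1 h2; rewrite -/(J s1) -/(J s2).
have main u v : a < u < b -> a < v < b -> u < v -> J u = J v.
  move=> hu hv uv; apply: eq_ReIm.
    by apply: (key (@complex.Re K)) => // [x y|x]; [exact: Re_sub|exact: Re_le_modulus].
  by apply: (key (@complex.Im K)) => // [x y|x]; [exact: Im_sub|exact: Im_le_modulus].
by case: (ltgtP s1 s2) => [/main ->|/main ->|->].
Qed.

End SecondOrder.

Section CauchyLaurent.
Variable K : realType.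
Implicit Types (f g : cplx K -> cplx K) (z w u v : cplx K).

Lemma sqr_le_exp2 n : (n ^ 2 <= 2 * 2 ^ n)%N.
Proof.
elim: n => // n IH; do 3 (case: n IH => // n IH).
rewrite expnS mulnCA; apply: leq_trans (_ : 2 * (n.+3 ^ 2) <= _)%N; last by rewrite leq_mul2l.
by rewrite -!mulnn; nia.
Qed.

(** Induction on n: the remainder of order n + 1 is u times that of order n plus n v^(n-1) (u -
    v)^2. Multiplying by d^2 avoids a division, which small n and d = 0 would forbid. *)
Lemma taylor2_power u v (d : K) n : modulus u <= d -> modulus v <= d ->
  modulus (u ^+ n - v ^+ n - n%:R * v ^+ n.-1 * (u - v)) * d ^+ 2 <=
    (n ^ 2)%:R * d ^+ n * modulus (u - v) ^+ 2.
Proof.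
move=> ud vd; have d0 : 0 <= d := le_trans (modulus_ge0 u) ud.
elim: n => [|n IH].
  by rewrite !expr0 subrr mul0r mul0r subr0 modulus0 mul0r mul0r mul0r.
pose e := u ^+ n - v ^+ n - n%:R * v ^+ n.-1 * (u - v).
have -> : u ^+ n.+1 - v ^+ n.+1 - n.+1%:R * v ^+ n.+1.-1 * (u - v) =
    u * e + n%:R * v ^+ n.-1 * (u - v) ^+ 2.
  rewrite /e /= -natr1; case: n {IH e} => [|n]; first by rewrite !expr1 !expr0; ring.
  by rewrite /= !exprS; ring.
apply: (@le_trans _ _ ((d * modulus e + n%:R * d ^+ n.-1 * modulus (u - v) ^+ 2) * d ^+ 2)).
  rewrite ler_wpM2r ?sqr_ge0 //; apply: le_trans (modulusD _ _) _.
  rewrite !modulusM !modulusX modulus_nat lerD //.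
    by rewrite ler_wpM2r ?modulus_ge0.
  rewrite ler_wpM2r ?sqr_ge0 // ler_wpM2l //.
  by case: n {IH e} => [|n]; rewrite ?expr0 //= lerXn2r // ?nnegrE ?modulus_ge0.
rewrite mulrDl.
have h1 : d * modulus e * d ^+ 2 <= (n ^ 2)%:R * d ^+ n.+1 * modulus (u - v) ^+ 2.
  rewrite -mulrA; apply: le_trans (ler_wpM2l d0 IH) _.
  rewrite (exprS d n); move: (n ^ 2)%:R => c.
  by apply: eq_leW; ring.
have h2 : n%:R * d ^+ n.-1 * modulus (u - v) ^+ 2 * d ^+ 2 <=
    n%:R * d ^+ n.+1 * modulus (u - v) ^+ 2.
  case: n {IH e h1} => [|n]; first by rewrite !mul0r.
  by rewrite /= !exprS le_eqVlt; apply/orP; left; apply/eqP; ring.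
apply: le_trans (lerD h1 h2) _; rewrite -mulrDl -mulrDl -natrD.
rewrite !ler_wpM2r ?sqr_ge0 ?exprn_ge0 // ler_nat !expnS !expn0; lia.
Qed.

Lemma cvg_series_bounded (u_ : nat -> cplx K) (l : cplx K) :
  series u_ @ \oo --> l -> exists2 M, 0 < M & forall n, modulus (u_ n) <= M.
Proof.
move=> h; have b1 : bounded_fun (fun n => modulus (series u_ n - l)).
  by apply: cvg_seq_bounded; apply/cvg_ex; exists 0; exact: cvg_to_modulus.
have [M [_ hM]] := b1; have := hM (`|M| + 1) _; rewrite ltr_pwDr ?ler_norm // => /(_ isT) {}hM.
have M0 : 0 < `|M| + 1 by rewrite ltr_wpDl.
exists (2 * (`|M| + 1)) => [|n]; first by rewrite mulr_gt0.
have -> : u_ n = (series u_ n.+1 - l) - (series u_ n - l).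
  by rewrite /series /= big_nat_recr //=; ring.
apply: le_trans (modulusB_le _ _) _.
have := le_trans (ler_norm _) (hM n I); have := le_trans (ler_norm _) (hM n.+1 I); lra.
Qed.

Lemma half_lt1 : 0 <= (2^-1 : K) < 1.
Proof. by apply/andP; split; lra. Qed.

(** Convergence at distance d / 2 bounds the coefficients geometrically; derivative and remainder
    are then summed term by term with [taylor2_power]. *)
Lemma analytic_c2at f (z0 : cplx K) : analytic_at f z0 -> c2at f z0.
Proof.
move=> [a [d d0 h]].
have [M M0 hM] : exists2 M : K, 0 < M & forall n, modulus (a n) * (d / 2) ^+ n <= M.
  have [|M M0 hM] := @cvg_series_bounded (fun n => a n * of_real (d / 2) ^+ n)
      (f (z0 + of_real (d / 2))).
    have := h (z0 + of_real (d / 2)); rewrite addrAC subrr add0r; apply.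
    by rewrite modulus_of_real ger0_norm ?divr_ge0 ?(ltW d0) //; lra.
  exists M => // n; have := hM n; rewrite modulusM modulusX modulus_of_real.
  by rewrite ger0_norm // divr_ge0 // ltW.
(* An eighth of the radius is a quarter of d / 2: the terms acquire 4^-n, which absorbs the factors
   n and n^2 <= 2 2^n and still leaves 2^-n. *)
pose d2 := d / 8; have d20 : 0 < d2 by rewrite divr_gt0.
have hM' n : modulus (a n) * d2 ^+ n <= M * 4^-1 ^+ n.
  have -> : d2 = d / 2 * 4^-1 by rewrite /d2; field.
  by rewrite exprMn mulrA ler_wpM2r // exprn_ge0.
have p2 n : 4^-1 ^+ n * 2 ^+ n = 2^-1 ^+ n :> K by rewrite -exprMn; congr (_ ^+ n); field.
have M2 : 0 <= M * 4 / d2 ^+ 2 by rewrite divr_ge0 ?mulr_ge0 ?sqr_ge0 // ltW.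
have M1 : 0 <= M / d2 * 2.
  by apply: mulr_ge0 => //; exact: (divr_ge0 (ltW M0) (ltW d20)).
exists d2, (2 * M + M / d2 * 2 + M * 4 / d2 ^+ 2); split => // w wd; split.
  have hw : series (fun n => a n * (w - z0) ^+ n) @ \oo --> f w.
    by apply: h; move: wd; rewrite /d2; lra.
  have bw n : modulus (a n * (w - z0) ^+ n) <= M * 2^-1 ^+ n.
    rewrite modulusM modulusX; apply: le_trans (_ : _ <= modulus (a n) * d2 ^+ n) _.
      by rewrite ler_wpM2l ?modulus_ge0 // lerXn2r ?nnegrE ?modulus_ge0 ?(ltW d20) // ltW.
    apply: le_trans (hM' n) _; rewrite ler_wpM2l ?(ltW M0) // lerXn2r ?nnegrE //; lra.
  rewrite (cvg_series_unique hw (cvg_csum half_lt1 bw)).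
  apply: le_trans (csum_bound half_lt1 bw) _.
  have -> : M / (1 - 2^-1) = 2 * M by field.
  by lra.
pose b n := a n * (n%:R * (w - z0) ^+ n.-1).
have bb n : modulus (b n) <= M / d2 * 2^-1 ^+ n.
  rewrite /b !modulusM modulus_nat modulusX mulrAC ler_pdivlMr //.
  apply: le_trans (_ : _ <= modulus (a n) * d2 ^+ n * n%:R) _.
    rewrite -!mulrA ler_wpM2l ?modulus_ge0 //; case: n => [|n]; first by rewrite mul0r mulr0.
    rewrite [leRHS]mulrC ler_wpM2l // exprSr ler_wpM2r ?(ltW d20) //.
    by rewrite lerXn2r ?nnegrE ?modulus_ge0 ?(ltW d20) // ltW.
  rewrite -p2 mulrA; apply: ler_pM => //; rewrite ?mulr_ge0 ?modulus_ge0 ?exprn_ge0 ?(ltW d20) //.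
  by rewrite -natrX ler_nat ltnW // ltn_expl.
exists (csum b).
  apply: le_trans (csum_bound half_lt1 bb) _.
  have -> : M / d2 / (1 - 2^-1) = M / d2 * 2 by field; rewrite gt_eqF.
  by have := ltW M0; lra.
move=> z zd; pose e n := a n * ((z - z0) ^+ n - (w - z0) ^+ n - n%:R * (w - z0) ^+ n.-1 * (z - w)).
have zw : z - w = (z - z0) - (w - z0) by ring.
have be n : modulus (e n) <= 2 * M / d2 ^+ 2 * modulus (z - w) ^+ 2 * 2^-1 ^+ n.
  rewrite /e modulusM zw.
  have := @taylor2_power (z - z0) (w - z0) d2 n (ltW zd) (ltW wd); rewrite -zw.
  set E := modulus (_ - _) => hE.
  have -> : 2 * M / d2 ^+ 2 * modulus (z - w) ^+ 2 * 2^-1 ^+ n =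
      2 * M * modulus (z - w) ^+ 2 * 2^-1 ^+ n / d2 ^+ 2 by ring.
  rewrite ler_pdivlMr ?exprn_gt0 // -[leLHS]mulrA.
  apply: le_trans (ler_wpM2l (modulus_ge0 _) hE) _.
  have -> : modulus (a n) * ((n ^ 2)%:R * d2 ^+ n * modulus (z - w) ^+ 2) =
    (modulus (a n) * d2 ^+ n) * (n ^ 2)%:R * modulus (z - w) ^+ 2 by ring.
  have -> : 2 * M * modulus (z - w) ^+ 2 * 2^-1 ^+ n =
    M * 4^-1 ^+ n * (2 * 2 ^+ n) * modulus (z - w) ^+ 2 by rewrite -p2; ring.
  rewrite ler_wpM2r ?sqr_ge0 //; apply: ler_pM => //.
    by rewrite mulr_ge0 ?modulus_ge0 ?exprn_ge0 // ltW.
  by rewrite -natrX -natrM ler_nat sqr_le_exp2.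
have hz : series (fun n => a n * (z - z0) ^+ n) @ \oo --> f z.
  by apply: h; move: zd; rewrite /d2; lra.
have hw : series (fun n => a n * (w - z0) ^+ n) @ \oo --> f w.
  by apply: h; move: wd; rewrite /d2; lra.
have he : series e @ \oo --> f z - f w - csum b * (z - w).
  have -> : series e = (fun n => series (fun n => a n * (z - z0) ^+ n) n -
      series (fun n => a n * (w - z0) ^+ n) n - series b n * (z - w)).
    apply/funext => n; rewrite /series /= mulr_suml -!sumrB; apply: eq_bigr => i _.
    by rewrite /e /b; ring.
  apply: cvgB; first exact: cvgB hz hw.
  by apply: cvgM; [exact: cvg_csum half_lt1 bb|exact: cvg_cst].
rewrite (cvg_series_unique he (cvg_csum half_lt1 be)).
apply: le_trans (csum_bound half_lt1 be) _.
have -> : 2 * M / d2 ^+ 2 * modulus (z - w) ^+ 2 / (1 - 2^-1) =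
  M * 4 / d2 ^+ 2 * modulus (z - w) ^+ 2 by field; rewrite gt_eqF.
by rewrite ler_wpM2r ?sqr_ge0 //; have := ltW M0; lra.
Qed.

(** Dropping the constant term and shifting the coefficients; the value c at the centre is the
    coefficient of order 1. Cauchy's formula comes from the means of this quotient. *)
Lemma analytic_quotient f (z0 : cplx K) : analytic_at f z0 ->
  exists c : cplx K,
    analytic_at (fun w => if w == z0 then c else (f w - f z0) / (w - z0)) z0.
Proof.
move=> [a [d d0 h]]; exists (a 1%N); exists (fun n => a n.+1); exists d; first exact: d0.
move=> z zd.
have fz0 : f z0 = a 0%N.
  have h0 := h z0; rewrite subrr modulus0 in h0.
  apply: (cvg_unique _ (h0 d0)) => //.
  apply: cvg_near_cst; near=> n; rewrite /series /=.
  have n0 : (0 < n)%N by near: n; exact: nbhs_infty_gt.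
  rewrite big_ltn // big_nat_cond big1 ?addr0 ?expr0 ?mulr1 // => i /andP[/andP[i0 _] _].
  by rewrite expr0n gtn_eqF // mulr0.
have [->|zz0] := eqVneq z z0.
  apply: cvg_near_cst; near=> n; rewrite /series /= subrr.
  have n0 : (0 < n)%N by near: n; exact: nbhs_infty_gt.
  rewrite big_ltn // big_nat_cond big1 ?addr0 ?expr0 ?mulr1 // => i /andP[/andP[i0 _] _].
  by rewrite expr0n gtn_eqF // mulr0.
have nz : z - z0 != 0 by rewrite subr_eq0.
have h1 : (fun n => (series (fun n => a n * (z - z0) ^+ n) n.+1 - a 0%N) / (z - z0)) @ \oo
    --> (f z - f z0) / (z - z0).
  rewrite fz0; apply: cvgM; last exact: cvg_cst.
  by apply: cvgB; [rewrite (cvg_shiftS (series _)); exact: h|exact: cvg_cst].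
move: h1; apply: cvg_trans; apply: near_eq_cvg; near=> n.
rewrite /series /= big_nat_recl //= expr0 mulr1 addrAC subrr add0r mulr_suml.
by apply: eq_bigr => i _; rewrite exprS mulrCA mulrC mulKf.
Unshelve. all: by end_near. Qed.

Lemma avg_geometric (F q : K -> cplx K) (M t : K) : continuous F -> continuous q ->
  0 <= t < 1 -> (forall x, modulus (F x) <= M) -> (forall x, modulus (q x) <= t) ->
  forall N, modulus (avg (fun x => F x / (1 - q x)) -
    \sum_(0 <= k < N) avg (fun x => F x * q x ^+ k)) <= M / (1 - t) * t ^+ N.
Proof.
move=> cF cq /andP[t0 t1] FM qt N.
have M0 : 0 <= M := le_trans (modulus_ge0 _) (FM 0).
have q1 x : 1 - t <= modulus (1 - q x).
  have := modulus_subl 1 (q x); rewrite modulus1; have := qt x; lra.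
have q0 x : 1 - q x != 0 by rewrite -modulus_gt0; have := q1 x; lra.
have c1 : continuous (fun x => F x / (1 - q x)).
  apply: continuousM_fun cF _; apply: continuousV_fun q0.
  by apply: continuousB_fun cq; exact: continuous_cst_fun.
have ck k : continuous (fun x => F x * q x ^+ k).
  by apply: continuousM_fun cF _; exact: continuousX_fun.
rewrite -(avg_sum N ck) -(avgB c1 (continuous_sum_fun ck)).
apply: avg_le => [|x _]; first by apply: continuousB_fun c1 _; exact: continuous_sum_fun.
have -> : F x / (1 - q x) - \sum_(0 <= i < N) F x * q x ^+ i =
    F x / (1 - q x) * q x ^+ N.
  rewrite -mulr_sumr; have := q0 x => qx.
  have -> : \sum_(0 <= i < N) q x ^+ i = (1 - q x ^+ N) / (1 - q x).
    apply: (mulIf qx); rewrite divfK //; elim: N => [|N IH].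
      by rewrite big_nil mul0r expr0 subrr.
    by rewrite big_nat_recr //= mulrDl IH exprS; ring.
  by field.
rewrite !modulusM modulusV modulusX; apply: ler_pM => //.
- by rewrite divr_ge0 ?modulus_ge0.
- by rewrite exprn_ge0 ?modulus_ge0.
- by rewrite ler_pM ?modulus_ge0 ?invr_ge0 ?modulus_ge0 ?FM // lef_pV2 ?posrE ?(lt_le_trans _ (q1 x)) //; lra.
- by rewrite lerXn2r ?nnegrE ?modulus_ge0 ?qt.
Qed.

Lemma circ_neq0 s t : 0 < s -> circ s t != 0 :> cplx K.
Proof. by move=> s0; rewrite -modulus_gt0 modulus_circ // ltW. Qed.

Lemma circ_dist s t z : 0 <= s -> `|s - modulus z| <= modulus (circ s t - z).
Proof.
move=> s0; rewrite -{1}(modulus_circ t s0) ler_norml modulus_subl andbT.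
by rewrite lerNl opprB modulusB modulus_subl.
Qed.

(** Enlarging the circle does not change the mean, and the kernel tends to 1 uniformly on large
    circles. *)
Lemma avg_kernel_out s z : modulus z < s -> avg (fun t => circ s t / (circ s t - z)) = 1.
Proof.
move=> zs; have s0 : 0 < s := le_lt_trans (modulus_ge0 z) zs.
have cker : forall r, modulus z < r -> continuous (fun t => (circ r t - z)^-1).
  move=> r zr; apply: continuousV_fun.
    by apply: continuousB_fun; [exact: continuous_circ|exact: continuous_cst_fun].
  move=> t; rewrite -modulus_gt0 (lt_le_trans _ (circ_dist _ _ _)) ?normr_gt0 ?subr_eq0 ?gt_eqF //.
  by rewrite ltW // (le_lt_trans (modulus_ge0 z)).
apply/eqP; rewrite -subr_eq0; apply/eqP; apply: modulus_le_small => e e0.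
pose r := Num.max s (modulus z + (modulus z + 1) / e).
have zr : modulus z < r by rewrite lt_max zs.
have r0 : 0 < r := le_lt_trans (modulus_ge0 z) zr.
have -> : avg (fun t => circ s t / (circ s t - z)) = avg (fun t => circ r t / (circ r t - z)).
  apply: (@avg_circ_const _ (fun w => w / (w - z)) ((modulus z + s) / 2) (r + 1)).
  - by rewrite divr_gt0 // ltr_wpDl // modulus_ge0.
  - move=> x t /andP[x1 _]; apply: c2at_mul; first exact: c2at_id.
    apply: c2at_inv; apply/eqP => /(congr1 (@modulus K)); rewrite modulus_circ; first lra.
    by have := modulus_ge0 z; lra.
  - have : s <= r by rewrite le_max lexx.
    by move=> ?; apply/andP; split; lra.
  - have : s <= r by rewrite le_max lexx.
    by move=> ?; apply/andP; split; lra.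
have cr := @continuous_circ K r.
rewrite -(avg_cst 1) -(avgB (continuousM_fun cr (cker _ zr)) (@continuous_cst_fun _ 1)).
apply: avg_le.
  by apply: continuousB_fun; [exact: continuousM_fun (cker _ zr)|exact: continuous_cst_fun].
move=> t _; have d0 : 0 < r - modulus z by rewrite subr_gt0.
have := circ_dist t z (ltW r0); rewrite (gtr0_norm d0) => hd.
have nz : circ r t - z != 0 by rewrite -modulus_gt0 (lt_le_trans d0).
have -> : circ r t / (circ r t - z) - 1 = z / (circ r t - z) by field.
rewrite modulusM modulusV ler_pdivrMr ?modulus_gt0 //.
apply: le_trans (_ : _ <= e * (r - modulus z)) _; last by rewrite ler_wpM2l // ltW.
have : (modulus z + 1) / e <= r - modulus z by rewrite lerBrDl le_max lexx orbT.
by rewrite ler_pdivrMr // mulrC; lra.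
Qed.

(** Shrinking the circle does not change the mean, and the kernel tends to 0 uniformly on small
    circles. *)
Lemma avg_kernel_in s z : 0 < s < modulus z ->
  avg (fun t => circ s t / (circ s t - z)) = 0.
Proof.
move=> /andP[s0 sz]; apply: modulus_le_small => e e0.
have z0 : 0 < modulus z := lt_trans s0 sz.
pose r := Num.min s (modulus z * e / (1 + e)).
have r0 : 0 < r by rewrite lt_min s0 divr_gt0 ?mulr_gt0 // addr_gt0.
have rs : r <= s by rewrite ge_min lexx.
have -> : avg (fun t => circ s t / (circ s t - z)) = avg (fun t => circ r t / (circ r t - z)).
  apply: (@avg_circ_const _ (fun w => w / (w - z)) (r / 2) ((modulus z + s) / 2)).
  - by rewrite divr_gt0.
  - move=> x t /andP[x1 x2]; apply: c2at_mul; first exact: c2at_id.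
    by apply: c2at_inv; apply/eqP => /(congr1 (@modulus K)); rewrite modulus_circ; lra.
  - by apply/andP; split; lra.
  - by apply/andP; split; lra.
have far t : modulus z - r <= modulus (circ r t - z).
  have := circ_dist t z (ltW r0); rewrite ler_norml => /andP[h1 h2].
  by lra.
have nz t : circ r t - z != 0 by rewrite -modulus_gt0; have := far t; lra.
apply: avg_le.
  apply: continuousM_fun; first exact: continuous_circ.
  apply: continuousV_fun nz.
  by apply: continuousB_fun; [exact: continuous_circ|exact: continuous_cst_fun].
move=> t _; rewrite modulusM modulusV ler_pdivrMr ?modulus_gt0 // (modulus_circ _ (ltW r0)).
apply: le_trans (_ : _ <= e * (modulus z - r)) _; last by rewrite ler_wpM2l ?far // ltW.
have : r <= modulus z * e / (1 + e) by rewrite ge_min lexx orbT.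
by rewrite ler_pdivlMr ?addr_gt0 // => ?; lra.
Qed.

End CauchyLaurent.

(** * Laurent coefficients *)

Arguments modulus : simpl never.
Arguments circ : simpl never.
Arguments cis : simpl never.
Arguments of_real : simpl never.

Section LaurentCoefficients.
Variable K : realType.
Implicit Types (f g : cplx K -> cplx K) (z w : cplx K) (a b s : K).

(** The difference quotient of [f] at [z], filled at [z], times w has the same mean on both circles.
    Splitting off [f z] leaves the kernel means, which are 1 outside and 0 inside. *)
Lemma cauchy_annulus f a b (r s : K) z : 0 < a ->
  (forall w, a < modulus w < b -> analytic_at f w) ->
  a < r < modulus z -> modulus z < s < b ->
  f z = avg (fun t => f (circ s t) * (circ s t / (circ s t - z))) -
        avg (fun t => f (circ r t) * (circ r t / (circ r t - z))).
Proof.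
move=> a0 hf /andP[ar rz] /andP[zs sb].
have r0 : 0 < r := lt_trans a0 ar.
have s0 : 0 < s by apply: lt_trans zs; exact: lt_trans rz.
have zab : a < modulus z < b by rewrite (lt_trans ar) // (lt_trans zs).
have hc w : a < modulus w < b -> c2at f w by move/hf/analytic_c2at.
have [c /analytic_c2at hcz] := analytic_quotient (hf z zab).
pose h w := if w == z then c else (f w - f z) / (w - z).
have hh w : a < modulus w < b -> c2at h w.
  move=> wab; have [->//|wz] := eqVneq w z.
  have wz0 : 0 < modulus (w - z) by rewrite modulus_gt0 subr_eq0.
  apply: (@c2at_eq _ (fun w => (f w + (- f z)) * (w - z)^-1) _ _ _ wz0).
    move=> x xw; rewrite /h; case: eqP => // xz.
    by move: xw; rewrite xz modulusB ltxx.
  apply: c2at_mul; last exact: c2at_inv.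
  have [d [M [d0 H]]] := hc w wab.
  exists d, (M + modulus (f z)); split=> // x /H[fM [e eM he]]; split.
    by apply: le_trans (modulusD _ _) _; rewrite modulusN lerD2r.
  exists e; first by rewrite (le_trans eM) // lerDl modulus_ge0.
  move=> y /he; rewrite opprD opprK addrACA addNr addr0 => /le_trans; apply.
  by rewrite ler_wpM2r ?sqr_ge0 // lerDl modulus_ge0.
have key := @avg_circ_const _ (fun w => h w * w) a b a0 _ r s.
have {key} key : avg (fun t => h (circ r t) * circ r t) =
    avg (fun t => h (circ s t) * circ s t).
  apply: key; [|by rewrite ar (lt_trans rz) // (lt_trans zs)|].
    move=> x t xab; apply: c2at_mul; last exact: c2at_id.
    apply: hh; rewrite modulus_circ //; case/andP: xab => ax _.
    by rewrite ltW // (lt_trans a0).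
  by rewrite (lt_trans ar) // (lt_trans rz).
have split u : 0 < u -> a < u < b -> (forall t, circ u t - z != 0) ->
    avg (fun t => h (circ u t) * circ u t) =
    avg (fun t => f (circ u t) * (circ u t / (circ u t - z))) -
    f z * avg (fun t => circ u t / (circ u t - z)).
  move=> u0 uab nz.
  have ck : continuous (fun t => circ u t / (circ u t - z)).
    apply: continuousM_fun; first exact: continuous_circ.
    apply: continuousV_fun nz; apply: continuousB_fun; first exact: continuous_circ.
    exact: continuous_cst_fun.
  have cf : continuous (fun t => f (circ u t)).
    apply: c2at_continuous; first exact: continuous_circ.
    by move=> t; apply: hc; rewrite modulus_circ // ltW.
  rewrite -(avgZ _ ck) -(avgB (continuousM_fun cf ck) (continuousZ_fun ck)).
  apply: eq_avg => t; rewrite /h ifF; last by have := nz t; rewrite subr_eq0 => /negbTE.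
  by rewrite -mulrBl mulrAC -mulrA mulrC; ring.
have nzs t : circ s t - z != 0.
  rewrite -modulus_gt0 (lt_le_trans _ (circ_dist _ _ (ltW s0))) // normr_gt0 subr_eq0.
  by rewrite gt_eqF.
have nzr t : circ r t - z != 0.
  rewrite -modulus_gt0 (lt_le_trans _ (circ_dist _ _ (ltW r0))) // normr_gt0 subr_eq0.
  by rewrite lt_eqF.
move: key; rewrite !split //; last 2 first.
- by rewrite (lt_trans ar) ?(lt_trans rz).
- by rewrite ar (lt_trans rz) // (lt_trans zs).
rewrite avg_kernel_in ?r0 // avg_kernel_out // mulr1 mulr0 subr0 => ->.
by rewrite opprB addrC subrK.
Qed.

(** The flag selects a boundary circle: for [true] the circle has radius 1/s and the argument is
    inverted. In both cases [parg] runs over the circle of radius s, where test functions live. *)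
Definition pcirc s (e : bool) t : cplx K := circ (if e then s^-1 else s) t.
Definition parg (e : bool) w : cplx K := if e then w^-1 else w.

(* Writing f(z) dz = (sum of a_m z^m) dz / z, [pair s false f] and
   [pair s true f] send the k-th power to a_{-k} and a_k. *)
Definition pair s (e : bool) f g : cplx K :=
  avg (fun t => f (pcirc s e t) * pcirc s e t * g (parg e (pcirc s e t))).

Definition monom (k : nat) : cplx K -> cplx K := fun z => z ^+ k.

Arguments pcirc : simpl never.

Variable R : K.
Hypothesis hR : 0 < R < 1.

Let R0 : 0 < R. Proof. by case/andP: hR. Qed.

Definition analytic_annulus f := forall z, annulus R z -> analytic_at f z.

Lemma pcirc_modulus s e t : 0 < s -> modulus (pcirc s e t) = if e then s^-1 else s.
Proof. by move=> s0; rewrite modulus_circ //; case: e; rewrite ?invr_ge0 ltW. Qed.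

Lemma pcirc_neq0 s e t : 0 < s -> pcirc s e t != 0.
Proof. by move=> s0; rewrite circ_neq0 //; case: e; rewrite ?invr_gt0. Qed.

Lemma parg_modulus s e t : 0 < s -> modulus (parg e (pcirc s e t)) = s.
Proof.
move=> s0; have := pcirc_modulus e t s0; rewrite /parg; case: e => //.
by rewrite modulusV => ->; rewrite invrK.
Qed.

Lemma pcirc_annulus s e t : R < s < 1 -> annulus R (pcirc s e t).
Proof.
move=> /andP[Rs s1]; have s0 : 0 < s := lt_trans R0 Rs.
have si : 1 < s^-1 by rewrite invf_gt1.
rewrite /annulus /= pcirc_modulus //; case: e; last first.
  by rewrite Rs (lt_trans s1) // invf_gt1 //; case/andP: hR.
rewrite ltf_pV2 ?posrE // Rs andbT (lt_trans _ si) //; by case/andP: hR.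
Qed.

Lemma continuous_pcirc s e : continuous (pcirc s e).
Proof. exact: continuous_circ. Qed.

Lemma continuous_parg s e : 0 < s -> continuous (fun t => parg e (pcirc s e t)).
Proof.
move=> s0; rewrite /parg; case: e; last exact: continuous_pcirc.
by apply: continuousV_fun; [exact: continuous_pcirc|move=> t; exact: pcirc_neq0].
Qed.

Lemma analytic_continuous f s e : analytic_annulus f -> R < s < 1 ->
  continuous (fun t => f (pcirc s e t)).
Proof.
move=> hf hs; apply: c2at_continuous; first exact: continuous_pcirc.
by move=> t; apply/analytic_c2at/hf/pcirc_annulus.
Qed.

Lemma continuous_weight f s e : analytic_annulus f -> R < s < 1 ->
  continuous (fun t => f (pcirc s e t) * pcirc s e t).
Proof.
by move=> hf hs; apply: continuousM_fun; [exact: analytic_continuous|exact: continuous_pcirc].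
Qed.

Lemma pair_radius f k e s r : analytic_annulus f -> R < s < 1 -> R < r < R^-1 ->
  pair s e f (monom k) = avg (fun t => f (circ r t) * circ r t * monom k (parg e (circ r t))).
Proof.
move=> hf hs hr; have r12 : R < (if e then s^-1 else s) < R^-1.
  by have := pcirc_annulus e 0 hs; rewrite /annulus /= pcirc_modulus //; case/andP: hs => ? _; exact: lt_trans R0 _.
apply: (@avg_circ_const _ (fun w => f w * w * monom k (parg e w)) R R^-1) => //.
move=> u t /andP[Ru uR]; have u0 : 0 < u := lt_trans R0 Ru.
apply: c2at_mul; first apply: c2at_mul; last 2 first.
- exact: c2at_id.
- apply: c2at_X; rewrite /parg; case: e {r12}; last exact: c2at_id.
  have -> : (fun x : cplx K => x^-1) = (fun x => (x - 0)^-1).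
    by apply/funext => x; rewrite subr0.
  by apply: c2at_inv; exact: circ_neq0.
- by apply/analytic_c2at/hf; rewrite /annulus /= modulus_circ ?Ru // ltW.
Qed.

Lemma pair_indep f k e s1 s2 : analytic_annulus f -> R < s1 < 1 -> R < s2 < 1 ->
  pair s1 e f (monom k) = pair s2 e f (monom k).
Proof.
move=> hf h1 h2; have RR : R < 1 < R^-1 by case/andP: hR => ? ?; rewrite invf_gt1 ?andbT //; apply/andP.
by rewrite (pair_radius _ _ hf h1 RR) (pair_radius _ _ hf h2 RR).
Qed.

(** In order 0 both sides are the mean of f w * w, on two circles of the annulus. The two families
    of pairings share exactly this number, which is why the exponent 0 is simple. *)
Lemma pair_const f s : analytic_annulus f -> R < s < 1 ->
  pair s true f (monom 0) = pair s false f (monom 0).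
Proof.
move=> hf hs; have RR : R < R^-1.
  by case/andP: hR => ? ?; rewrite (lt_trans (_ : _ < 1)) // invf_gt1.
have s0 : 0 < s by case/andP: hs => ? _; exact: lt_trans R0 _.
have r12 e : R < (if e then s^-1 else s) < R^-1.
  by have := pcirc_annulus e 0 hs; rewrite /annulus /= pcirc_modulus.
apply: (@avg_circ_const _ (fun w => f w * w * 1) R R^-1) => //; try exact: (r12 true); try exact: (r12 false).
move=> u t /andP[Ru uR]; apply: c2at_mul; last exact: c2at_cst.
apply: c2at_mul; last exact: c2at_id.
apply/analytic_c2at/hf; rewrite /annulus /= modulus_circ ?Ru // ltW //.
exact: lt_trans R0 _.
Qed.

(** Pairings carry the weight w, so the coefficient of z^k in [f] is the pairing of order k + 1 on
    the outer circle, and that of z^(-k-1) the pairing of order k on the inner one. One term groups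
    both. *)
Definition laurent s f z (k : nat) : cplx K :=
  z ^+ k * pair s true f (monom k.+1) + z^-1 ^+ k.+1 * pair s false f (monom k).

Lemma sup_circ f s e : analytic_annulus f -> R < s < 1 ->
  exists2 M : K, 0 <= M & forall t, modulus (f (pcirc s e t)) <= M.
Proof.
move=> hf hs; have cf := analytic_continuous (e := e) hf hs.
have /compact_bounded[M [_ hM]] : compact ((fun t => modulus (f (pcirc s e t))) @` `[0, 2 * pi]).
  apply: continuous_compact; last exact: segment_compact.
  by apply: continuous_subspaceT; exact: continuous_modulus.
have hM' u : 0 <= u <= 2 * pi -> modulus (f (pcirc s e u)) <= `|M| + 1.
  move=> hu; have M1 : M < `|M| + 1 by rewrite (le_lt_trans (ler_norm M)) // ltrDl.
  have /= := hM _ M1 (modulus (f (pcirc s e u))).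
  by rewrite ger0_norm ?modulus_ge0 //; apply; exists u => //; rewrite /= in_itv.
exists (`|M| + 1) => [|t]; first by rewrite addr_ge0.
pose n := Num.floor (t / (2 * pi)).
have := floor_itv (t / (2 * pi)); rewrite -/n => /andP[n1 n2].
have tp := twopi_gt0 K.
have per (m : nat) u : pcirc s e (u + m%:R * (2 * pi)) = pcirc s e u.
  elim: m => [|m IH]; first by rewrite mul0r addr0.
  by rewrite -natr1 mulrDl mul1r addrA /pcirc circ_period; exact: IH.
have peri (m : int) u : pcirc s e (u + m%:~R * (2 * pi)) = pcirc s e u.
  case: m => m; first exact: per.
  rewrite NegzE mulrNz -[RHS]/(pcirc s e u) mulNr.
  by rewrite -[in RHS](subrK (m.+1%:R * (2 * pi)) u) per.
have -> : t = (t - n%:~R * (2 * pi)) + n%:~R * (2 * pi) by rewrite subrK.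
rewrite peri; apply: hM'; rewrite subr_ge0 -ler_pdivlMr // n1 lerBlDr.
rewrite -[X in X + _]mul1r -mulrDl -ler_pdivrMr // addrC ltW // (lt_le_trans n2) //.
by rewrite intrD.
Qed.

(** In Cauchy's formula the kernel is expanded in powers of z/w on the outer circle, with ratio |z|
    s, and of w/z on the inner one, with ratio s / |z|. *)
Lemma laurent_series f s z : analytic_annulus f -> R < s < 1 ->
  s < modulus z < s^-1 -> series (laurent s f z) @ \oo --> f z.
Proof.
move=> hf hs /andP[sz zs].
have [[Rs s1] s0] : (R < s /\ s < 1) /\ 0 < s.
  by case/andP: hs => ? ?; split=> //; exact: lt_trans R0 _.
have z0 : z != 0 by rewrite -modulus_gt0 (lt_trans s0).
have sR : s^-1 < R^-1 by rewrite ltf_pV2 ?posrE.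
rewrite (@cauchy_annulus f R R^-1 s s^-1 z) //; last 2 first.
- by rewrite Rs sz.
- by rewrite zs sR.
have [M1 M10 h1] := sup_circ true hf hs; have [M2 M20 h2] := sup_circ false hf hs.
have c1 := analytic_continuous (e := true) hf hs.
have c2 := continuous_weight (e := false) hf hs.
have g1 := @avg_geometric K (fun t => f (pcirc s true t)) (fun t => z / pcirc s true t)
  M1 (modulus z * s) c1 _ _ h1 _.
have g2 := @avg_geometric K (fun t => z^-1 * (f (pcirc s false t) * pcirc s false t))
  (fun t => pcirc s false t / z) (modulus z^-1 * (M2 * s)) (s / modulus z) _ _ _ _ _.
have t1 : 0 <= modulus z * s < 1.
  by rewrite mulr_ge0 ?modulus_ge0 ?(ltW s0) //= -ltr_pdivlMr // mul1r.
have t2 : 0 <= s / modulus z < 1.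
  by rewrite divr_ge0 ?modulus_ge0 ?(ltW s0) //= ltr_pdivrMr ?mul1r // modulus_gt0.
have {}g1 := g1 _ t1 _; have {}g2 := g2 _ _ t2 _ _.
have {}g1 : forall N, modulus (avg (fun t => f (circ s^-1 t) * (circ s^-1 t / (circ s^-1 t - z))) -
   \sum_(0 <= k < N) z ^+ k * pair s true f (monom k.+1)) <= M1 / (1 - modulus z * s) * (modulus z * s) ^+ N.
  move=> N; have := g1 _ _ N.
  have -> : \sum_(0 <= k < N) avg (fun x => f (pcirc s true x) * (z / pcirc s true x) ^+ k) =
      \sum_(0 <= k < N) z ^+ k * pair s true f (monom k.+1).
    apply: eq_bigr => k _; rewrite -avgZ; last first.
      apply: continuousM_fun; first exact: continuous_weight.
      by apply: continuousX_fun; exact: continuous_parg.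
    apply: eq_avg => t; rewrite /monom /parg; move: (pcirc_neq0 true t s0).
    move: (pcirc s true t) => w w0; rewrite exprMn exprS -!mulrA.
    by rewrite mulVKf // mulrCA.
  rewrite (@eq_avg _ _ (fun t => f (circ s^-1 t) * (circ s^-1 t / (circ s^-1 t - z)))); last first.
    move=> t; congr (_ * _); have := pcirc_neq0 true t s0; rewrite /pcirc => nz.
    have nz2 : circ s^-1 t - z != 0.
      rewrite -modulus_gt0 (lt_le_trans _ (circ_dist _ _ _)) ?invr_ge0 ?(ltW s0) //.
      by rewrite normr_gt0 subr_eq0 gt_eqF.
    by field; rewrite nz nz2.
  apply=> [|x].
    apply: continuousZ_fun; apply: continuousV_fun; first exact: continuous_pcirc.
    by move=> t; exact: pcirc_neq0.
  by rewrite modulusM modulusV pcirc_modulus // invrK.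
have {}g2 : forall N, modulus (- avg (fun t => f (circ s t) * (circ s t / (circ s t - z))) -
   \sum_(0 <= k < N) z^-1 ^+ k.+1 * pair s false f (monom k)) <=
   modulus z^-1 * (M2 * s) / (1 - s / modulus z) * (s / modulus z) ^+ N.
  move=> N; have := g2 _ _ _ _ N.
  have -> : \sum_(0 <= k < N) avg (fun x => z^-1 * (f (pcirc s false x) * pcirc s false x) * (pcirc s false x / z) ^+ k) =
      \sum_(0 <= k < N) z^-1 ^+ k.+1 * pair s false f (monom k).
    apply: eq_bigr => k _; rewrite -avgZ; last first.
      apply: continuousM_fun; first exact: continuous_weight.
      by apply: continuousX_fun; exact: continuous_parg.
    by apply: eq_avg => t; rewrite /monom /parg exprMn exprS; ring.
  rewrite (@eq_avg _ _ (fun t => -1 * (f (circ s t) * (circ s t / (circ s t - z))))); last first.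
    move=> t; rewrite /pcirc.
    have nz2 : circ s t - z != 0.
      rewrite -modulus_gt0 (lt_le_trans _ (circ_dist _ _ (ltW s0))) //.
      by rewrite normr_gt0 subr_eq0 lt_eqF.
    have nz3 : z - circ s t != 0 by rewrite -opprB oppr_eq0.
    by field; rewrite z0 nz2 nz3.
  rewrite avgZ ?mulN1r; last first.
    apply: continuousM_fun; first exact: (analytic_continuous (e := false) hf hs).
    apply: continuousM_fun; first exact: continuous_circ.
    apply: continuousV_fun.
      by apply: continuousB_fun; [exact: continuous_circ|exact: continuous_cst_fun].
    move=> t; rewrite -modulus_gt0 (lt_le_trans _ (circ_dist _ _ (ltW s0))) //.
    by rewrite normr_gt0 subr_eq0 lt_eqF.
  apply=> [||x|x].
  - exact: continuousZ_fun.
  - by apply: continuousM_fun; [exact: continuous_pcirc|exact: continuous_cst_fun].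
  - rewrite (modulusM z^-1) (modulusM (f _)) pcirc_modulus //.
    by rewrite ler_wpM2l ?modulus_ge0 // ler_wpM2r ?(ltW s0).
  - by rewrite modulusM modulusV pcirc_modulus.
apply/cvg_modulus => e e0; have e2 : 0 < e / 2 by rewrite divr_gt0.
have [N1 hN1] := geometric_small (M1 / (1 - modulus z * s)) t1 e2.
have [N2 hN2] := geometric_small (modulus z^-1 * (M2 * s) / (1 - s / modulus z)) t2 e2.
exists (maxn N1 N2) => // n /=; rewrite geq_max => /andP[/hN1 n1 /hN2 n2].
rewrite modulusB /series /= /laurent big_split /=.
set A := avg _; set B := avg _; set S1 := \sum_(_ <= _ < _) _; set S2 := \sum_(_ <= _ < _) _.
have -> : A - B - (S1 + S2) = (A - S1) + (- B - S2) by ring.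
apply: le_lt_trans (modulusD _ _) _; rewrite [e]splitr ltrD //.
  exact: le_lt_trans (g1 n) n1.
exact: le_lt_trans (g2 n) n2.
Qed.

End LaurentCoefficients.

(** * Boundary energies and the norm of the space *)

Section HardyNorm.
Variable K : realType.
Local Notation mu := (@lebesgue_measure K).
Implicit Types (f g : cplx K -> cplx K) (z w : cplx K) (a b s : K).
Local Open Scope ereal_scope.

Lemma cvg_pow (T : Type) (F : set_system T) {FF : Filter F} (f : T -> K) (l : K) n :
  (f @ F --> l -> (fun x => f x ^+ n)%R @ F --> (l ^+ n)%R)%classic.
Proof.
move=> h; elim: n => [|n IH]; first exact: cvg_cst.
under eq_fun do rewrite exprS.
by rewrite exprS; apply: cvgM.
Qed.

Definition trace_measurable (g : K -> cplx K) : Prop :=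
  measurable_fun (@angles K) (fun t => complex.Re (g t)) /\
  measurable_fun (@angles K) (fun t => complex.Im (g t)).

Lemma measurable_energy (g : K -> cplx K) : trace_measurable g ->
  measurable_fun (@angles K) (fun t => ((modulus (g t)) ^+ 2)%:E : \bar K).
Proof.
move=> [mr mi]; apply/measurable_EFinP.
under eq_fun do rewrite modulus_sqr.
by apply: measurable_funD; exact: measurable_funX.
Qed.

Lemma continuous_trace_measurable (g : K -> cplx K) : continuous g -> trace_measurable g.
Proof.
move=> cg; split; apply: measurable_funTS; apply: continuous_measurable_fun.
  exact: continuous_Re.
exact: continuous_Im.
Qed.

Lemma trace_measurableB (g h : K -> cplx K) : trace_measurable g -> trace_measurable h ->
  trace_measurable (g - h)%R.
Proof.
move=> [gr gi] [hr hi]; split.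
  under eq_fun do rewrite Re_sub; exact: measurable_funB.
under eq_fun do rewrite Im_sub; exact: measurable_funB.
Qed.

Lemma energy_ge0 (g : K -> cplx K) : 0 <= energy g.
Proof. by apply: integral_ge0 => t _; rewrite lee_fin sqr_ge0. Qed.

(** From (c + y)^2 <= 2 c^2 + 2 y^2. This weak triangle inequality replaces Minkowski's; its factor
    2 only affects constants. *)
Lemma energy_le2 (g h : K -> cplx K) : trace_measurable g -> trace_measurable h ->
  energy g <= 2%:E * energy h + 2%:E * energy (g - h)%R.
Proof.
move=> mg mh; have mgh := trace_measurableB mg mh.
have mA := @measurable_angles K.
rewrite /energy -!ge0_integralZl //; last 4 first.
- exact: measurable_energy.
- by move=> t _; rewrite lee_fin sqr_ge0.
- exact: measurable_energy.
- by move=> t _; rewrite lee_fin sqr_ge0.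
rewrite -ge0_integralD //; last 4 first.
- by move=> t _; rewrite -EFinM lee_fin mulr_ge0 // sqr_ge0.
- by apply: measurable_funeM; exact: measurable_energy.
- by move=> t _; rewrite -EFinM lee_fin mulr_ge0 // sqr_ge0.
- by apply: measurable_funeM; exact: measurable_energy.
apply: ge0_le_integral => //.
- by move=> t _; rewrite lee_fin sqr_ge0.
- exact: measurable_energy.
- by apply: emeasurable_funD; apply: measurable_funeM; exact: measurable_energy.
- move=> t _; rewrite -!EFinM -EFinD lee_fin.
  have -> : (g - h)%R t = (g t - h t)%R by [].
  have := modulusD (g t - h t)%R (h t); rewrite subrK.
  have := modulus_ge0 (g t - h t)%R; have := modulus_ge0 (h t); have := modulus_ge0 (g t).
  set x := modulus (g t); set y := modulus (h t); set c := modulus _ => x0 y0 c0 xyc.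
  apply: (@le_trans _ _ ((c + y) ^+ 2)%R).
    by rewrite lerXn2r // ?nnegrE // addr_ge0.
  rewrite -subr_ge0; have -> : (2 * y ^+ 2 + 2 * c ^+ 2 - (c + y) ^+ 2 = (c - y) ^+ 2)%R by ring.
  exact: sqr_ge0.
Qed.

Lemma energyN_sub (g h : K -> cplx K) : energy (g - h)%R = energy (h - g)%R.
Proof.
apply: eq_integral => t _; congr (_ ^+ 2)%:E.
by have -> : (g - h)%R t = (g t - h t)%R by []; rewrite modulusB.
Qed.

Lemma energy_le_sup (g : K -> cplx K) (M : K) : (0 <= M)%R -> trace_measurable g ->
  (forall t, angles t -> (modulus (g t) <= M)%R) -> energy g <= (2 * pi * M ^+ 2)%:E.
Proof.
move=> M0 mg h; have mA := @measurable_angles K.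
apply: (@le_trans _ _ (\int[mu]_(t in @angles K) (M ^+ 2)%:E)).
  apply: ge0_le_integral => //.
  - by move=> t _; rewrite lee_fin sqr_ge0.
  - exact: measurable_energy.
  - by move=> t /h hM; rewrite lee_fin lerXn2r // nnegrE // modulus_ge0.
by rewrite integral_cst // [X in (_ * X)%E]lebesgue_angles -EFinM mulrC.
Qed.

Lemma energy_scale (g h : K -> cplx K) (c : K) : trace_measurable h ->
  (forall t, modulus (g t) = c * modulus (h t))%R ->
  energy g = (c ^+ 2)%:E * energy h.
Proof.
have mA := @measurable_angles K.
move=> mh gh; rewrite /energy -ge0_integralZl //.
- by apply: eq_integral => t _; rewrite gh exprMn EFinM.
- exact: measurable_energy.
- by move=> t _; rewrite lee_fin sqr_ge0.
- by rewrite lee_fin sqr_ge0.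
Qed.

(* Integrating (|g| - m)^2 >= 0, with m the modulus of the mean, replaces the
   Cauchy-Schwarz inequality. *)
Lemma avg_energy (g : K -> cplx K) : continuous g ->
  (2 * pi * (modulus (avg g)) ^+ 2)%:E <= energy g.
Proof.
move=> cg; have mA := @measurable_angles K; set m := modulus (avg g).
have m0 : (0 <= m)%R := modulus_ge0 _.
have cm := continuous_modulus cg.
have cm2 : continuous (fun t => modulus (g t) ^+ 2)%R.
  by move=> t; apply: (@cvgM _ _ _ _ (fun t => modulus (g t)) (fun t => modulus (g t))); exact: cm.
have im : mu.-integrable (@angles K) (EFin \o (fun t => modulus (g t))).
  exact: continuous_integrable.
have im2 : mu.-integrable (@angles K) (EFin \o (fun t => modulus (g t) ^+ 2)%R).
  exact: continuous_integrable.
have -> : energy g = (\int[mu]_(t in @angles K) (modulus (g t) ^+ 2))%R%:E.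
  by rewrite /energy /Rintegral fineK //; exact: integrable_fin_num im2.
rewrite lee_fin.
have h1 : (2 * pi * m <= \int[mu]_(t in @angles K) modulus (g t))%R.
  have tp := twopi_gt0 K.
  rewrite /m /avg modulusM modulus_of_real ger0_norm ?invr_ge0 ?(ltW tp) //.
  rewrite mulrA mulfV ?gt_eqF // mul1r; apply: modulus_cintegral_le => //.
  exact: continuous_cintegrable.
have ic : mu.-integrable (@angles K) (EFin \o cst (m ^+ 2)%R).
  by apply: continuous_integrable => t; exact: cvg_cst.
have i2m : mu.-integrable (@angles K) (EFin \o (fun t => 2 * m * modulus (g t))%R).
  exact: integrable_scale.
have h2 : (\int[mu]_(t in @angles K) (2 * m * modulus (g t)) <=
   \int[mu]_(t in @angles K) (modulus (g t) ^+ 2 + m ^+ 2))%R.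
  apply: le_Rintegral => //.
    by apply: continuous_integrable => t; apply: cvgD; [exact: cm2|exact: cvg_cst].
  move=> t _; rewrite -subr_ge0.
  have -> : (modulus (g t) ^+ 2 + m ^+ 2 - 2 * m * modulus (g t) = (modulus (g t) - m) ^+ 2)%R by ring.
  exact: sqr_ge0.
move: h2; rewrite RintegralZl // (RintegralD _ im2 ic) // Rintegral_cst //.
rewrite [X in fine X]lebesgue_angles /= => h2.
have h3 : (2 * m * (2 * pi * m) <= 2 * m * \int[mu]_(t in @angles K) modulus (g t))%R.
  by rewrite ler_wpM2l // mulr_ge0.
have := le_trans h3 h2; rewrite -lerBlDr; apply: le_trans.
by apply: eq_leW; ring.
Qed.

Local Close Scope ereal_scope.

Variable R : K.
Hypothesis hR : 0 < R < 1.
Let R0 : 0 < R. Proof. by case/andP: hR. Qed.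
Let R1 : R < 1. Proof. by case/andP: hR. Qed.
Let Ri1 : 1 < R^-1. Proof. by rewrite invf_gt1. Qed.

Definition bfilter (e : bool) : set_system K := if e then R^-1^'- else R^'+.

#[local] Instance bfilter_proper e : ProperFilter (bfilter e).
Proof. by case: e; rewrite /bfilter; typeclasses eauto. Qed.

(** Describes the approach to either boundary circle by a radius in the interval from R to 1, as
    [pcirc] expects. *)
Definition bradius (e : bool) (s : K) : K := if e then s^-1 else s.

Lemma bradiusK e s : (if e then (bradius e s)^-1 else bradius e s) = s.
Proof. by case: e; rewrite /bradius ?invrK. Qed.

Lemma near_bfilter e : \forall s \near bfilter e, R < bradius e s < 1.
Proof.
case: e; rewrite /bfilter /bradius.
  near=> s; have s1 : 1 < s by near: s; exact: nbhs_left_gt.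
  have sR : s < R^-1 by near: s; exact: nbhs_left_lt.
  rewrite (invf_lt1 (lt_trans ltr01 s1)) s1 andbT.
  by rewrite -[R]invrK ltf_pV2 ?posrE ?invr_gt0 // (lt_trans _ s1).
near=> s; apply/andP; split; near: s; [exact: nbhs_right_gt|exact: nbhs_right_lt].
Unshelve. all: by end_near. Qed.

Lemma bradius_cvg e : bradius e s @[s --> bfilter e] --> R.
Proof.
case: e; rewrite /bfilter /bradius; last first.
  by apply: cvg_at_right_filter; exact: cvg_id.
rewrite -[X in _ --> X]invrK; apply: cvgV; first by rewrite invr_neq0 // gt_eqF.
by apply: cvg_at_left_filter; exact: cvg_id.
Qed.

Lemma circle_trace_pcirc f e s : circle_trace f s = (fun t => f (pcirc (bradius e s) e t)).
Proof. by apply/funext => t; rewrite /pcirc bradiusK. Qed.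

Lemma hardy_analytic f : hardy R f -> analytic_annulus R f.
Proof. by case. Qed.

Lemma hardy_boundary f e : hardy R f -> boundary_value f (bfilter e) (boundary f (bfilter e)).
Proof.
move=> [_ _ h1 h2]; have : exists b : K -> cplx K, boundary_value f (bfilter e) b by case: e.
by move=> [b hb]; exact: (@xgetPex _ (cst 0) [set b : K -> cplx K | boundary_value f (bfilter e) b] (ex_intro _ b hb)).
Qed.

Definition benergy f e : K := fine (energy (boundary f (bfilter e))).

Lemma benergy_ge0 f e : 0 <= benergy f e.
Proof. by rewrite fine_ge0 // energy_ge0. Qed.

Lemma hardy_normE f : hardy_norm R f =
  Num.sqrt ((2 * pi)^-1 * (benergy f false + benergy f true)).
Proof. by []. Qed.

Lemma hardy_norm_ge0 f : 0 <= hardy_norm R f.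
Proof. exact: sqrtr_ge0. Qed.

Lemma hardy_norm_sqr f : hardy_norm R f ^+ 2 = (2 * pi)^-1 * (benergy f false + benergy f true).
Proof.
rewrite hardy_normE sqr_sqrtr // mulr_ge0 ?addr_ge0 ?benergy_ge0 // invr_ge0.
exact/ltW/twopi_gt0.
Qed.

Lemma boundary_energyE f e : hardy R f -> energy (boundary f (bfilter e)) = (benergy f e)%:E.
Proof.
move=> hf; have [[_ _ h] _] := hardy_boundary e hf.
by rewrite /benergy fineK // ge0_fin_numE ?energy_ge0.
Qed.

Lemma boundary_measurable f e : hardy R f -> trace_measurable (boundary f (bfilter e)).
Proof. by move=> hf; have [[mr mi _] _] := hardy_boundary e hf. Qed.

Lemma near_trace_energy f e (x : K) : hardy R f -> 0 < x ->
  \forall s \near bfilter e,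
    (energy (circle_trace f s - boundary f (bfilter e))%R <= x%:E)%E.
Proof.
move=> hf x0; have [_ h] := hardy_boundary e hf.
move: h => /fine_cvgP[h1 /cvgrPdist_le/(_ _ x0) h2]; near=> s.
have : energy (circle_trace f s - boundary f (bfilter e)) \is a fin_num.
  by near: s; exact: h1.
move=> /fineK <-; rewrite lee_fin.
have : `|0 - (fine \o (fun s0 : K => energy (circle_trace f s0 - boundary f (bfilter e)))) s| <= x.
  by near: s; exact: h2.
by rewrite /= sub0r normrN; apply: le_trans; exact: ler_norm.
Unshelve. all: by end_near. Qed.

Lemma weight_le (e : bool) (r : K) k : R < r < 1 ->
  ((if e then r^-1 else r) * r ^+ k) ^+ 2 <= (R^-1 * r ^+ k) ^+ 2.
Proof.
move=> /andP[Rr r1]; have r0 : 0 < r := lt_trans R0 Rr.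
have h1 : 0 <= (if e then r^-1 else r) by case: e; rewrite ?invr_ge0 ltW.
have h2 : (if e then r^-1 else r) <= R^-1.
  case: e {h1}; first by rewrite lef_pV2 ?posrE // ltW.
  by rewrite (le_trans (ltW r1)) // ltW.
have h3 : 0 <= r ^+ k by rewrite exprn_ge0 // ltW.
by rewrite lerXn2r ?nnegrE ?mulr_ge0 ?(le_trans h1 h2) // ler_wpM2r.
Qed.

(** The pairing does not depend on the circle; letting the circle tend to the boundary replaces s^k
    by R^k. The weight on the circle is at most 1/R, and the 2 pays for [energy_le2]. *)
Lemma pair_le_norm f s e k : hardy R f -> R < s < 1 ->
  modulus (pair s e f (monom k)) <= 2 / R * R ^+ k * hardy_norm R f.
Proof.
have le24 (a b : K) : 0 <= a -> 0 <= b -> 2 * a <= 4 * (a + b) by lra.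
move=> hf hs; have fa := hardy_analytic hf; set E := benergy f e.
have E0 : 0 <= E := benergy_ge0 _ _.
set P := modulus _; have P0 : 0 <= P := modulus_ge0 _.
have tp := twopi_gt0 K.
suff H : 2 * pi * P ^+ 2 <= 2 * E * (R^-1 * R ^+ k) ^+ 2.
  have r0 : 0 <= 2 / R * R ^+ k * hardy_norm R f.
    apply: mulr_ge0; last exact: hardy_norm_ge0.
    by apply: mulr_ge0; [rewrite divr_ge0 // ltW|rewrite exprn_ge0 // ltW].
  rewrite -ler_sqr ?nnegrE // -(ler_pM2l tp); apply: le_trans H _.
  have -> : 2 * pi * (2 / R * R ^+ k * hardy_norm R f) ^+ 2 =
      4 * (benergy f false + benergy f true) * (R^-1 * R ^+ k) ^+ 2.
    have -> : (2 / R * R ^+ k * hardy_norm R f) ^+ 2 =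
      4 * (R^-1 * R ^+ k) ^+ 2 * hardy_norm R f ^+ 2 by ring.
    rewrite hardy_norm_sqr; move: (R^-1 * R ^+ k) (benergy f false + _) (2 * pi) tp => q X t t0.
    by rewrite mulrCA (mulrA t) mulfV ?gt_eqF // mul1r mulrAC.
  rewrite ler_wpM2r ?sqr_ge0 //.
  rewrite /E; case: (e); last by apply: le24; exact: benergy_ge0.
  by rewrite [_ + benergy f true]addrC; apply: le24; exact: benergy_ge0.
have near1 (x : K) : 0 < x -> \forall u \near bfilter e,
    2 * pi * P ^+ 2 <= (2 * E + 2 * x) * (R^-1 * bradius e u ^+ k) ^+ 2.
  move=> x0; near=> u.
  have ur : R < bradius e u < 1 by near: u; exact: near_bfilter.
  have u0 : 0 < bradius e u by case/andP: ur => ? _; exact: lt_trans R0 _.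
  have ue : (energy (circle_trace f u - boundary f (bfilter e))%R <= x%:E)%E.
    by near: u; exact: near_trace_energy.
  have ct : continuous (fun t => f (pcirc (bradius e u) e t)).
    exact: (analytic_continuous hR).
  have ctE := circle_trace_pcirc f e u.
  have mt := continuous_trace_measurable ct.
  have mt' : trace_measurable (circle_trace f u) by rewrite ctE.
  set F := fun t => f (pcirc (bradius e u) e t) * pcirc (bradius e u) e t *
    monom k (parg e (pcirc (bradius e u) e t)).
  have cF : continuous F.
    apply: continuousM_fun; first exact: (continuous_weight hR).
    by apply: continuousX_fun; exact: continuous_parg.
  have FP : P = modulus (avg F) by rewrite /P (@pair_indep _ _ hR _ _ _ _ (bradius e u)).
  have FE : energy F = (((((if e then (bradius e u)^-1 else bradius e u) *
      bradius e u ^+ k)) ^+ 2)%:E * energy (fun t => f (pcirc (bradius e u) e t)))%E.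
    apply: (energy_scale mt) => t; rewrite /F (modulusM (f _ * _)) (modulusM (f _)).
    by rewrite modulusX (pcirc_modulus _ _ u0) (parg_modulus _ _ u0) -mulrA mulrC.
  have := avg_energy cF; rewrite -FP FE.
  have h1 := energy_le2 mt' (boundary_measurable e hf).
  rewrite (boundary_energyE e hf) -/E in h1.
  have h2 : (energy (circle_trace f u) <= (2 * E + 2 * x)%:E)%E.
    apply: le_trans h1 _.
    have -> : (2 * E + 2 * x)%:E = (2%:E * E%:E + 2%:E * x%:E)%E by rewrite -!EFinM -EFinD.
    have two0 : (0 <= 2%:E :> \bar K)%E by rewrite lee_fin.
    exact: leeD2l (lee_wpmul2l two0 ue).
  rewrite -ctE => h3; rewrite -lee_fin; apply: le_trans h3 _.
  rewrite [X in (_ <= X%:E)%E]mulrC [X in (_ <= X)%E]EFinM.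
  apply: lee_pmul; last exact: h2.
  - by rewrite lee_fin sqr_ge0.
  - exact: energy_ge0.
  by rewrite lee_fin; exact: weight_le.
apply/ler_addgt0Pl => x x0; rewrite addrC.
pose y := x / (2 * ((R^-1 * R ^+ k) ^+ 2)).
have q0 : 0 < (R^-1 * R ^+ k) ^+ 2 by rewrite exprn_gt0 // mulr_gt0 ?invr_gt0 ?exprn_gt0.
have y0 : 0 < y by rewrite divr_gt0 // mulr_gt0.
have -> : 2 * E * (R^-1 * R ^+ k) ^+ 2 + x = (2 * E + 2 * y) * (R^-1 * R ^+ k) ^+ 2.
  by rewrite /y; field; rewrite !gt_eqF ?exprn_gt0.
apply: (@cvgr_to_ge _ (bfilter e) (bfilter_proper e) K
   (fun u => (2 * E + 2 * y) * (R^-1 * bradius e u ^+ k) ^+ 2)); last exact: near1.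
by apply: cvgMr; apply: cvg_pow; apply: cvgMr; apply: cvg_pow; exact: bradius_cvg.
Unshelve. all: by end_near. Qed.

(** Each boundary energy is at most twice the energy on a nearby circle, up to an arbitrarily small
    term. This factor and the presence of two circles give 4 under the square root. *)
Lemma norm_le_sup f (S : K) : hardy R f -> 0 <= S ->
  (forall z, annulus R z -> modulus (f z) <= S) -> hardy_norm R f <= 2 * S.
Proof.
move=> hf S0 hS; have fa := hardy_analytic hf; have tp := twopi_gt0 K.
have hE e : benergy f e <= 4 * pi * S ^+ 2.
  apply/ler_addgt0Pl => x x0; rewrite addrC.
  have x2 : 0 < x / 2 by rewrite divr_gt0.
  have [u [ur ue]] : exists u, R < bradius e u < 1 /\
     (energy (circle_trace f u - boundary f (bfilter e))%R <= (x / 2)%:E)%E.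
    by apply: (@filter_ex _ (bfilter e)); near=> u; split; near: u;
      [exact: near_bfilter|exact: near_trace_energy].
  have ct : continuous (fun t => f (pcirc (bradius e u) e t)).
    exact: (analytic_continuous hR).
  have ctE := circle_trace_pcirc f e u.
  have mt : trace_measurable (circle_trace f u).
    by rewrite ctE; exact: continuous_trace_measurable.
  have h1 := energy_le2 (boundary_measurable e hf) mt.
  rewrite (boundary_energyE e hf) energyN_sub in h1.
  have h2 : (energy (circle_trace f u) <= (2 * pi * S ^+ 2)%:E)%E.
    apply: (energy_le_sup S0 mt) => t _; rewrite ctE.
    by apply: hS; exact: (pcirc_annulus hR).
  rewrite -lee_fin; apply: le_trans h1 _.
  have -> : (4 * pi * S ^+ 2 + x)%:E = (2%:E * (2 * pi * S ^+ 2)%:E + 2%:E * (x / 2)%:E)%E.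
    by rewrite -!EFinM -EFinD; congr EFin; field.
  have two0 : (0 <= 2%:E :> \bar K)%E by rewrite lee_fin.
  exact: leeD (lee_wpmul2l two0 h2) (lee_wpmul2l two0 ue).
rewrite -ler_sqr ?nnegrE ?hardy_norm_ge0 ?mulr_ge0 // hardy_norm_sqr.
rewrite ler_pdivrMl //; apply: le_trans (lerD (hE false) (hE true)) _.
by apply: eq_leW; ring.
Unshelve. all: by end_near. Qed.

End HardyNorm.

(** * The disc algebra *)

Section DiscAlgebra.
Variable K : realType.
Variable s : K.
Hypothesis s0 : 0 < s.
Implicit Types (f g h : cplx K -> cplx K) (z w : cplx K).

(** The disc algebra of the closed disc of radius s, given as the uniform closure of the
    polynomials: a bounded functional is then known from its values on monomials. *)
Definition dalg g : Prop := forall e : K, 0 < e -> exists p : {poly cplx K},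
  forall z, modulus z <= s -> modulus (g z - p.[z]) <= e.

Lemma poly_bounded (p : {poly cplx K}) : exists2 M : K, 0 <= M &
  forall z, modulus z <= s -> modulus p.[z] <= M.
Proof.
exists (\sum_(i < size p) modulus p`_i * s ^+ i).
  by apply: sumr_ge0 => i _; rewrite mulr_ge0 ?modulus_ge0 // exprn_ge0 // ltW.
move=> z zs; rewrite horner_coef; apply: le_trans (modulus_sum _ _ _) _.
apply: ler_sum => i _; rewrite modulusM modulusX ler_wpM2l ?modulus_ge0 //.
by rewrite lerXn2r // ?nnegrE ?modulus_ge0 // ltW.
Qed.

Lemma dalg_bounded g : dalg g -> exists2 M : K, 0 <= M &
  forall z, modulus z <= s -> modulus (g z) <= M.
Proof.
move=> /(_ 1 ltr01)[p hp]; have [M M0 hM] := poly_bounded p.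
exists (M + 1) => [|z zs]; first by rewrite addr_ge0.
by rewrite -[g z](subrK p.[z]) (le_trans (modulusD _ _)) // addrC lerD ?hM ?hp.
Qed.

Lemma dalg_lim g : (forall e : K, 0 < e -> exists2 h, dalg h &
  forall z, modulus z <= s -> modulus (g z - h z) <= e) -> dalg g.
Proof.
move=> H e e0; have e2 : 0 < e / 2 by rewrite divr_gt0.
have [h hh gh] := H _ e2; have [p hp] := hh _ e2.
exists p => z zs; rewrite [e]splitr; apply: le_trans (modulus_triangle (h z) _ _) _.
by rewrite lerD ?gh ?hp.
Qed.

Lemma dalg_ext g h : (forall z, modulus z <= s -> g z = h z) -> dalg g -> dalg h.
Proof. by move=> gh hg e /hg[p hp]; exists p => z zs; rewrite -gh ?hp. Qed.

Lemma dalg_poly (p : {poly cplx K}) : dalg (fun z => p.[z]).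
Proof. by move=> e e0; exists p => z _; rewrite subrr modulus0 ltW. Qed.

Lemma dalg_cst (c : cplx K) : dalg (fun=> c).
Proof. by apply: (dalg_ext _ (dalg_poly c%:P)) => z _; rewrite hornerC. Qed.

Lemma dalg_id : dalg id.
Proof. by apply: (dalg_ext _ (dalg_poly 'X)) => z _; rewrite hornerX. Qed.

Lemma dalgD g h : dalg g -> dalg h -> dalg (fun z => g z + h z).
Proof.
move=> hg hh e e0; have e2 : 0 < e / 2 by rewrite divr_gt0.
have [p hp] := hg _ e2; have [q hq] := hh _ e2.
exists (p + q) => z zs; rewrite hornerD opprD addrACA [e]splitr.
by rewrite (le_trans (modulusD _ _)) // lerD ?hp ?hq.
Qed.

Lemma dalgM g h : dalg g -> dalg h -> dalg (fun z => g z * h z).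
Proof.
move=> hg hh e e0; have [M M0 hM] := dalg_bounded hg; have [L L0 hL] := dalg_bounded hh.
have M1 : 0 < M + 1 by rewrite ltr_wpDl.
have L1 : 0 < L + 1 by rewrite ltr_wpDl.
have e1 : 0 < e / 2 / (L + 1) by rewrite !divr_gt0.
have [p hp] := hg _ e1.
have [N N0 hN] := poly_bounded p; have N1 : 0 < N + 1 by rewrite ltr_wpDl.
have [q hq] := hh _ (divr_gt0 (divr_gt0 e0 (ltr0n _ 2)) N1).
exists (p * q) => z zs; rewrite hornerM.
have -> : g z * h z - p.[z] * q.[z] = (g z - p.[z]) * h z + p.[z] * (h z - q.[z]) by ring.
apply: le_trans (modulusD _ _) _; rewrite !modulusM [leRHS]splitr; apply: lerD.
  have := ler_pM (modulus_ge0 _) (modulus_ge0 _) (hp _ zs) (hL _ zs).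
  move=> /le_trans; apply; rewrite mulrAC ler_pdivrMr // ler_wpM2l ?divr_ge0 ?(ltW e0) //.
  by rewrite lerDl.
have := ler_pM (modulus_ge0 _) (modulus_ge0 _) (hN _ zs) (hq _ zs).
move=> /le_trans; apply; rewrite mulrA ler_pdivrMr // mulrC ler_wpM2l ?divr_ge0 ?(ltW e0) //.
by rewrite lerDl.
Qed.

Lemma dalgZ (c : cplx K) g : dalg g -> dalg (fun z => c * g z).
Proof. by move=> hg; apply: dalgM hg; exact: dalg_cst. Qed.

Lemma dalgB g h : dalg g -> dalg h -> dalg (fun z => g z - h z).
Proof.
move=> hg hh; apply: (dalg_ext _ (dalgD hg (dalgZ (-1) hh))) => z _.
by rewrite mulN1r.
Qed.

Lemma dalgX g n : dalg g -> dalg (fun z => g z ^+ n).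
Proof.
move=> hg; elim: n => [|n IH]; first exact: dalg_cst.
by apply: (dalg_ext _ (dalgM hg IH)) => z _; rewrite exprS.
Qed.

Lemma dalg_monom k : dalg (monom k).
Proof. exact: dalgX dalg_id. Qed.

Lemma dalg_sum n (F : nat -> cplx K -> cplx K) : (forall i, dalg (F i)) ->
  dalg (fun z => \sum_(0 <= i < n) F i z).
Proof.
move=> hF; elim: n => [|n IH].
  by apply: (dalg_ext _ (dalg_cst 0)) => z _; rewrite big_nil.
by apply: (dalg_ext _ (dalgD IH (hF n))) => z _; rewrite big_nat_recr.
Qed.

Lemma dalg_comp g (T : cplx K -> cplx K) : dalg g -> dalg T ->
  (forall z, modulus z <= s -> modulus (T z) <= s) -> dalg (fun z => g (T z)).
Proof.
move=> hg hT Ts; apply: dalg_lim => e /hg[p hp].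
exists (fun z => p.[T z]) => [|z /Ts /hp //].
have := dalg_sum (size p) (fun i => dalgZ p`_i (dalgX i hT)); apply: dalg_ext => z _.
by rewrite horner_coef big_mkord.
Qed.

Lemma dalg_inv (c : cplx K) : modulus c * s < 1 -> dalg (fun z => (1 + c * z)^-1).
Proof.
move=> cs; apply: dalg_lim => e e0.
have cs0 : 0 <= modulus c * s by rewrite mulr_ge0 ?modulus_ge0 // ltW.
have t01 : 0 <= modulus c * s < 1 by rewrite cs0.
have [N hN] := geometric_small (1 - modulus c * s)^-1 t01 e0.
exists (fun z => \sum_(0 <= i < N) (- (c * z)) ^+ i).
  apply: dalg_sum => i; apply: dalgX; apply: (dalg_ext _ (dalgZ (-1) (dalgZ c dalg_id))).
  by move=> z _; rewrite mulN1r.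
move=> z zs; have cz : modulus (c * z) <= modulus c * s by rewrite modulusM ler_wpM2l ?modulus_ge0.
have d1 : 1 - modulus c * s <= modulus (1 + c * z).
  have := modulus_subl 1 (- (c * z)); rewrite opprK modulus1 modulusN; move: cz; lra.
have d0 : 0 < 1 - modulus c * s by rewrite subr_gt0.
have nz : 1 + c * z != 0 by rewrite -modulus_gt0 (lt_le_trans d0).
have -> : (1 + c * z)^-1 - \sum_(0 <= i < N) (- (c * z)) ^+ i =
    (- (c * z)) ^+ N * (1 + c * z)^-1.
  have -> : \sum_(0 <= i < N) (- (c * z)) ^+ i = (1 - (- (c * z)) ^+ N) / (1 + c * z).
    apply: (mulIf nz); rewrite divfK //; elim: (N) => [|n IH].
      by rewrite big_nil mul0r expr0 subrr.
    by rewrite big_nat_recr //= mulrDl IH exprS; ring.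
  by field.
apply: ltW; apply: le_lt_trans (hN N (leqnn _)).
rewrite modulusM modulusX modulusN modulusV mulrC; apply: ler_pM.
- by rewrite invr_ge0 modulus_ge0.
- by rewrite exprn_ge0 ?modulus_ge0.
- by rewrite lef_pV2 ?posrE // (lt_le_trans d0).
- by rewrite lerXn2r ?nnegrE ?modulus_ge0.
Qed.

Lemma dalg_continuous g (gam : K -> cplx K) : dalg g -> continuous gam ->
  (forall t, modulus (gam t) <= s) -> continuous (fun t => g (gam t)).
Proof.
move=> hg cg gs; apply: continuous_uniform => e /hg[p hp].
exists (fun t => p.[gam t]) => [|t]; last exact: hp.
have := @continuous_sum_fun K (fun i t => p`_i * gam t ^+ i) (size p).
have -> : (fun t => \sum_(0 <= i < size p) p`_i * gam t ^+ i) = (fun t => p.[gam t]).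
  by apply/funext => t; rewrite horner_coef big_mkord.
by apply=> i; apply: continuousZ_fun; exact: continuousX_fun.
Qed.

(** Functions are defined on the whole plane, whereas only their restriction to the disc matters;
    boundedness by the supremum over the disc makes [bfunc_ext] a consequence. *)
Definition bfunc (phi : (cplx K -> cplx K) -> cplx K) : Prop :=
  (forall c g h, dalg g -> dalg h -> phi (fun z => c * g z + h z) = c * phi g + phi h) /\
  exists2 M : K, 0 <= M & forall g (e : K), dalg g ->
    (forall z, modulus z <= s -> modulus (g z) <= e) -> modulus (phi g) <= M * e.

Lemma bfunc_ext phi g h : bfunc phi -> dalg g ->
  (forall z, modulus z <= s -> g z = h z) -> phi g = phi h.
Proof.
move=> [lin [M M0 hM]] hg gh; have hh := dalg_ext gh hg.
apply/eqP; rewrite eq_sym -subr_eq0 -mulN1r addrC -lin // -modulus_eq0 eq_le modulus_ge0 andbT.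
rewrite -[leRHS](mulr0 M); apply: hM; first exact: dalgD (dalgZ _ hg) hh.
by move=> z zs; rewrite gh // mulN1r addNr modulus0.
Qed.

Lemma bfunc0 phi : bfunc phi -> phi (fun=> 0) = 0.
Proof.
move=> [lin [M M0 hM]]; apply/eqP; rewrite -modulus_eq0 eq_le modulus_ge0 andbT.
rewrite -[leRHS](mulr0 M); apply: hM; first exact: dalg_cst.
by move=> z _; rewrite modulus0.
Qed.

Lemma bfuncZ phi c g : bfunc phi -> dalg g -> phi (fun z => c * g z) = c * phi g.
Proof.
move=> hp hg; rewrite -[RHS]addr0 -(bfunc0 hp) -hp.1 //; last exact: dalg_cst.
by apply: bfunc_ext => //; [exact: dalgZ|move=> z _; rewrite addr0].
Qed.

Lemma bfuncD phi g h : bfunc phi -> dalg g -> dalg h ->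
  phi (fun z => g z + h z) = phi g + phi h.
Proof.
move=> hp hg hh; rewrite -[phi g]mul1r -hp.1 //.
by apply: bfunc_ext => //; [exact: dalgD|move=> z _; rewrite mul1r].
Qed.

Lemma bfuncB phi g h : bfunc phi -> dalg g -> dalg h ->
  phi (fun z => g z - h z) = phi g - phi h.
Proof.
move=> hp hg hh; rewrite -mulN1r -(bfuncZ _ hp hh) -(bfuncD hp hg (dalgZ _ hh)).
by apply: bfunc_ext => //; [exact: dalgB|move=> z _; rewrite mulN1r].
Qed.

Lemma bfunc_sum phi n (F : nat -> cplx K -> cplx K) : bfunc phi -> (forall i, dalg (F i)) ->
  phi (fun z => \sum_(0 <= i < n) F i z) = \sum_(0 <= i < n) phi (F i).
Proof.
move=> hp hF; elim: n => [|n IH].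
  rewrite big_nil; apply: etrans (bfunc0 hp).
  by apply: (bfunc_ext hp) => [|z _]; [exact: dalg_sum|rewrite big_nil].
rewrite big_nat_recr //= -IH -bfuncD //; last exact: dalg_sum.
by apply: bfunc_ext => // [|z _]; [exact: dalg_sum|rewrite big_nat_recr].
Qed.

(** Both functionals agree on polynomials, which are dense. The duality identities for transfer and
    noise are reduced to monomials in this way. *)
Lemma bfunc_eq phi psi : bfunc phi -> bfunc psi ->
  (forall k, phi (monom k) = psi (monom k)) -> forall g, dalg g -> phi g = psi g.
Proof.
move=> hp hq mon g hg; have [_ [M M0 hM]] := hp; have [_ [L L0 hL]] := hq.
apply/eqP; rewrite -subr_eq0; apply/eqP; apply: modulus_le_small => e e0.
have ML : 0 < M + L + 1 by rewrite ltr_wpDl // addr_ge0.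
have [p hpg] := hg _ (divr_gt0 e0 ML).
have pp (chi : (cplx K -> cplx K) -> cplx K) : bfunc chi ->
    chi (fun z => p.[z]) = \sum_(0 <= i < size p) p`_i * chi (monom i).
  move=> hc; rewrite (eq_bigr (fun i => chi (fun z => p`_i * monom i z))); last first.
    by move=> i _; rewrite bfuncZ //; exact: dalg_monom.
  rewrite -bfunc_sum //; last by move=> i; exact: dalgZ (dalg_monom i).
  apply: bfunc_ext => // [|z _]; first exact: dalg_poly.
  by rewrite horner_coef big_mkord.
have epq : phi (fun z => p.[z]) = psi (fun z => p.[z]).
  by rewrite !pp //; apply: eq_bigr => i _; rewrite mon.
have -> : phi g - psi g = phi (fun z => g z - p.[z]) - psi (fun z => g z - p.[z]).
  rewrite !bfuncB //; try exact: dalg_poly.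
  by rewrite epq; ring.
have dg : dalg (fun z => g z - p.[z]) by apply: dalgB hg _; exact: dalg_poly.
apply: le_trans (modulusB_le _ _) _; apply: le_trans (lerD (hM _ _ dg hpg) (hL _ _ dg hpg)) _.
rewrite -mulrDl mulrCA ler_piMr ?(ltW e0) // ler_pdivrMr // mul1r.
by rewrite lerDl.
Qed.

End DiscAlgebra.

(** * The Hardy space *)

#[local] Existing Instance bfilter_proper.

Section HardySpace.
Variable K : realType.
Implicit Types (f g : cplx K -> cplx K) (z w : cplx K) (a b s : K).
Variable R : K.
Hypothesis hR : 0 < R < 1.
Let R0 : 0 < R. Proof. by case/andP: hR. Qed.
Let R1 : R < 1. Proof. by case/andP: hR. Qed.
Let Ri1 : 1 < R^-1. Proof. by rewrite invf_gt1. Qed.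

Lemma analytic_at_lin (c : cplx K) f g (z0 : cplx K) :
  analytic_at f z0 -> analytic_at g z0 -> analytic_at (fun z => c * f z + g z) z0.
Proof.
move=> [a [d d0 ha]] [b [e e0 hb]].
exists (fun n => c * a n + b n); exists (Num.min d e); first by rewrite lt_min d0.
move=> z; rewrite lt_min => /andP[/ha hz /hb hz'].
have -> : series (fun n => (c * a n + b n) * (z - z0) ^+ n) =
    (fun n => c * series (fun n => a n * (z - z0) ^+ n) n +
              series (fun n => b n * (z - z0) ^+ n) n).
  apply/funext => n; rewrite /series /= mulr_sumr -big_split; apply: eq_bigr => i _.
  by rewrite /=; ring.
by apply: cvgD hz'; apply: cvgM hz; exact: cvg_cst.
Qed.

Lemma analytic_at0 (z0 : cplx K) : analytic_at (fun=> 0) z0.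
Proof.
exists (fun=> 0); exists 1 => // z _.
have -> : series (fun n => 0 * (z - z0) ^+ n) = (fun=> 0).
  by apply/funext => n; rewrite /series /= big1 // => i _; rewrite mul0r.
exact: cvg_cst.
Qed.

Lemma measurable_lin (c : cplx K) (g h : K -> cplx K) : trace_measurable g ->
  trace_measurable h -> trace_measurable (fun t => c * g t + h t).
Proof.
move=> [gr gi] [hr hi]; split.
  under eq_fun do rewrite Re_add Re_mul; apply: measurable_funD => //.
  by apply: measurable_funB; exact: measurable_funM.
under eq_fun do rewrite Im_add Im_mul; apply: measurable_funD => //.
by apply: measurable_funD; exact: measurable_funM.
Qed.

Lemma energy_lin (c : cplx K) (g h : K -> cplx K) : trace_measurable g ->
  trace_measurable h ->
  (energy (fun t => c * g t + h t)%R <=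
     (2 * modulus c ^+ 2)%:E * energy g + 2%:E * energy h)%E.
Proof.
move=> mg mh.
have m0 : trace_measurable (fun _ : K => 0 : cplx K).
  by split; exact: measurable_cst.
have mcg : trace_measurable (fun t => c * g t).
  have := measurable_lin c mg m0; rewrite /trace_measurable.
  by under eq_fun do rewrite addr0; under [X in _ /\ measurable_fun _ X -> _]eq_fun do rewrite addr0.
have := energy_le2 (measurable_lin c mg mh) mcg.
have -> : (fun t => c * g t + h t) - (fun t => c * g t) = h.
  by apply/funext => t; rewrite !fctE addrAC subrr add0r.
rewrite (energy_scale mg (g := fun t => c * g t) (c := modulus c)); last first.
  by move=> t; rewrite modulusM.
by rewrite muleA -EFinM.
Qed.

Lemma near_trace_measurable f e : analytic_annulus R f ->
  \forall u \near bfilter R e, trace_measurable (circle_trace f u).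
Proof.
move=> hf; have := near_bfilter hR e; apply: filterS => u hu.
rewrite (circle_trace_pcirc f e); apply: continuous_trace_measurable.
exact: (analytic_continuous hR).
Qed.

Lemma boundary_value_lin (c : cplx K) f g e (b1 b2 : K -> cplx K) :
  analytic_annulus R f -> analytic_annulus R g ->
  boundary_value f (bfilter R e) b1 -> boundary_value g (bfilter R e) b2 ->
  boundary_value (fun z => c * f z + g z) (bfilter R e) (fun t => c * b1 t + b2 t).
Proof.
move=> hf hg [[m1r m1i e1] h1] [[m2r m2i e2] h2].
have m1 : trace_measurable b1 by [].
have m2 : trace_measurable b2 by [].
have [mr mi] := measurable_lin c m1 m2; split; first split=> //.
  apply: le_lt_trans (energy_lin c m1 m2) _.
  by apply: lte_add_pinfty; apply: lte_mul_pinfty; rewrite ?lee_fin // mulr_ge0 // sqr_ge0.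
have fl : Filter (bfilter R e) by exact: (bfilter_proper R e).
have lim0 : ((2 * modulus c ^+ 2)%:E * energy (circle_trace f u - b1)%R +
    2%:E * energy (circle_trace g u - b2)%R)%E @[u --> bfilter R e] --> 0%E.
  rewrite -[X in _ --> X](_ : ((2 * modulus c ^+ 2)%:E * 0 + 2%:E * 0 = 0 :> \bar K)%E); last first.
    by rewrite !mule0 adde0.
  by apply: cvgeD; [rewrite !mule0|exact: cvgeZl|exact: cvgeZl].
apply: (squeeze_cvge _ (cvg_cst 0%E) lim0).
near=> u; apply/andP; split; first exact: energy_ge0.
have mf : trace_measurable (circle_trace f u) by near: u; exact: near_trace_measurable.
have mg : trace_measurable (circle_trace g u) by near: u; exact: near_trace_measurable.
have := energy_lin c (trace_measurableB mf m1) (trace_measurableB mg m2).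
apply: le_trans; apply: eq_leW.
apply: eq_integral => t _; congr (modulus _ ^+ 2)%:E.
by rewrite !fctE /circle_trace; ring.
Unshelve. all: by end_near. Qed.

Lemma boundary_value0 e : boundary_value (fun=> 0) (bfilter R e) (fun=> 0 : cplx K).
Proof.
have z0 : energy (fun _ : K => 0 : cplx K) = 0%E.
  by apply: integral0_eq => t _; rewrite modulus0 expr0n.
split; first by split; [exact: measurable_cst|exact: measurable_cst|rewrite z0].
apply: cvg_near_cst; near=> u.
have -> // : circle_trace (fun=> 0) u - (fun=> 0) = (fun _ : K => 0 : cplx K).
by apply/funext => t; rewrite !fctE /circle_trace subr0.
Unshelve. all: by end_near. Qed.

Lemma hardyP f : (forall z, ~ annulus R z -> f z = 0) -> analytic_annulus R f ->
  (forall e, exists b : K -> cplx K, boundary_value f (bfilter R e) b) -> hardy R f.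
Proof. by move=> h1 h2 h3; split=> //; [exact: (h3 false)|exact: (h3 true)]. Qed.

Lemma hardy_bv f e : hardy R f -> exists b : K -> cplx K, boundary_value f (bfilter R e) b.
Proof. by case=> _ _ h1 h2; case: e. Qed.

Lemma hardy_lin (c : K[i]) f g : hardy R f -> hardy R g -> hardy R (c *: f + g).
Proof.
move=> hf hg; have -> : c *: f + g = (fun z => (c : cplx K) * f z + g z) by [].
apply: hardyP => [z nz|z az|e].
- by case: hf => -> // _ _ _; case: hg => -> // _ _ _; rewrite mulr0 addr0.
- by apply: analytic_at_lin; [case: hf => _ /(_ z az)|case: hg => _ /(_ z az)].
have [b1 h1] := hardy_bv e hf; have [b2 h2] := hardy_bv e hg.
by exists (fun t => c * b1 t + b2 t); apply: boundary_value_lin; rewrite // ; apply: hardy_analytic.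
Qed.

Lemma hardy0 : hardy R (0 : cplx K -> cplx K).
Proof.
apply: hardyP => [//|z _|e]; first exact: analytic_at0.
by exists (fun=> 0); exact: boundary_value0.
Qed.

Lemma hardyZ (c : K[i]) f : hardy R f -> hardy R (c *: f).
Proof. by move=> hf; rewrite -[_ *: _]addr0; apply: hardy_lin hardy0. Qed.

Lemma hardyD f g : hardy R f -> hardy R g -> hardy R (f + g).
Proof. by move=> hf hg; rewrite -[f]scale1r; exact: hardy_lin. Qed.

Lemma hardyB f g : hardy R f -> hardy R g -> hardy R (f - g).
Proof. by move=> hf hg; rewrite addrC -scaleN1r; exact: hardy_lin. Qed.

Lemma hardy_sum n (F : 'I_n -> cplx K -> cplx K) : (forall i, hardy R (F i)) ->
  hardy R (\sum_(i < n) F i).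
Proof.
by move=> hF; elim/big_ind: _ => [|f g|i _]; [exact: hardy0|exact: hardyD|exact: hF].
Qed.

(** The parameter [t] dominates both ratios: r |z| for the positive powers and r / |z| for the
    negative ones. *)
Lemma laurent_le f s z (r : K) (N : K) k : R < s < 1 -> 0 < r -> 0 <= N ->
  (forall e k, modulus (pair s e f (monom k)) <= N * r ^+ k) ->
  forall t, modulus z * r <= t -> r <= t * modulus z ->
  modulus (laurent s f z k) <= N * (r + (modulus z)^-1) * t ^+ k.
Proof.
move=> hs r0 N0 hN t t1 t2.
have z0 : 0 < modulus z.
  rewrite lt_neqAle modulus_ge0 andbT eq_sym; apply/eqP => z0.
  by move: t2; rewrite z0 mulr0 leNgt r0.
have t0 : 0 <= t by apply: le_trans t1; rewrite mulr_ge0 // ltW.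
apply: le_trans (modulusD _ _) _.
rewrite (modulusM (z ^+ k)) (modulusM (z^-1 ^+ k.+1)) !modulusX modulusV mulrDr mulrDl; apply: lerD.
  have -> : N * r * t ^+ k = t ^+ k * (N * r) by rewrite mulrC.
  apply: le_trans (_ : _ <= modulus z ^+ k * (N * r ^+ k.+1)) _.
    by rewrite ler_wpM2l ?hN // exprn_ge0 // ltW.
  have -> : modulus z ^+ k * (N * r ^+ k.+1) = (modulus z * r) ^+ k * (N * r).
    by rewrite exprMn exprS; ring.
  rewrite ler_wpM2r ?mulr_ge0 ?(ltW r0) // lerXn2r ?nnegrE //.
  by rewrite mulr_ge0 // ltW.
apply: le_trans (_ : _ <= (modulus z)^-1 ^+ k.+1 * (N * r ^+ k)) _.
  by rewrite ler_wpM2l ?hN // exprn_ge0 // invr_ge0 ltW.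
have -> : (modulus z)^-1 ^+ k.+1 * (N * r ^+ k) = N * (modulus z)^-1 * (r / modulus z) ^+ k.
  by rewrite exprMn exprS; ring.
rewrite ler_wpM2l ?mulr_ge0 ?invr_ge0 ?(ltW z0) // lerXn2r ?nnegrE //.
  by rewrite divr_ge0 // ltW.
by rewrite ler_pdivrMr.
Qed.

Lemma laurent_sup f s z (r N t : K) : analytic_annulus R f -> R < s < 1 ->
  s < modulus z < s^-1 -> 0 < r -> 0 <= N ->
  (forall e k, modulus (pair s e f (monom k)) <= N * r ^+ k) ->
  modulus z * r <= t -> r <= t * modulus z -> t < 1 ->
  modulus (f z) <= N * (r + (modulus z)^-1) / (1 - t).
Proof.
move=> hf hs hz r0 N0 hN t1 t2 tlt.
have t0 : 0 <= t by apply: le_trans t1; rewrite mulr_ge0 ?modulus_ge0 // ltW.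
have t01 : 0 <= t < 1 by rewrite t0.
have b k := laurent_le k hs r0 N0 hN t1 t2.
rewrite (cvg_series_unique (laurent_series hR hf hs hz) (cvg_csum t01 b)).
exact: csum_bound.
Qed.

Lemma between (z : cplx K) : annulus R z -> exists2 u, R < u < 1 & u < modulus z < u^-1.
Proof.
move=> /andP[Rz zR]; have z0 : 0 < modulus z := lt_trans R0 Rz.
have Rzi : R < (modulus z)^-1 by rewrite -[R]invrK ltf_pV2 ?posrE ?invr_gt0.
(* Both |z| and 1/|z| exceed R, so the midpoint of R and the least of |z|, 1/|z| and 1 is a suitable
   radius. *)
pose m := Num.min (Num.min (modulus z) (modulus z)^-1) 1.
have Rm : R < m by rewrite !lt_min Rz Rzi.
have um : (R + m) / 2 < m by lra.
exists ((R + m) / 2).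
  by apply/andP; split; [lra|apply: lt_le_trans um _; rewrite ge_min lexx orbT].
have u0 : 0 < (R + m) / 2 by rewrite divr_gt0 // addr_gt0 // (lt_trans R0).
apply/andP; split; first by apply: lt_le_trans um _; rewrite !ge_min lexx.
rewrite -[modulus z]invrK ltf_pV2 ?posrE ?invr_gt0 //.
by apply: lt_le_trans um _; rewrite !ge_min lexx orbT.
Qed.

(** Pairings are O(R^k), so on the circles of radius s and 1/s the Laurent series is dominated by
    the powers of R/s. *)
Lemma hardy_circle_sup s : R < s < 1 -> exists2 C : K, 0 <= C & forall f e t,
  hardy R f -> modulus (f (pcirc s e t)) <= C * hardy_norm R f.
Proof.
move=> hs; have [Rs s1] : R < s /\ s < 1 by case/andP: hs.
have s0 : 0 < s := lt_trans R0 Rs.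
have tlt : R / s < 1 by rewrite ltr_pdivrMr // mul1r.
exists (2 / R * (R + s^-1) / (1 - R / s)) => [|f e t hf].
  by rewrite !mulr_ge0 ?invr_ge0 ?subr_ge0 ?addr_ge0 ?invr_ge0 ?(ltW R0) ?(ltW s0) ?(ltW tlt).
have N0 := hardy_norm_ge0 R f.
have zm := pcirc_modulus e t s0.
have Rz := pcirc_annulus hR e t hs.
have [u hu huz] := between Rz.
have si : s <= s^-1 by rewrite (le_trans (ltW s1)) // ltW // invf_gt1.
have sz : s <= modulus (pcirc s e t) by rewrite zm; case: (e).
have zs : modulus (pcirc s e t) <= s^-1 by rewrite zm; case: (e).
have z0 : 0 < modulus (pcirc s e t) := lt_le_trans s0 sz.
have := @laurent_sup f u (pcirc s e t) R (2 / R * hardy_norm R f) (R / s)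
  (hardy_analytic hf) hu huz R0.
move: (pcirc s e t) zm Rz huz sz zs z0 => z zm Rz huz sz zs z0 H.
apply: le_trans (H _ _ _ _ tlt) _.
- by rewrite mulr_ge0 // divr_ge0 // ltW.
- by move=> e' k; rewrite mulrAC; exact: pair_le_norm.
- by rewrite mulrC ler_wpM2l // ltW.
- by rewrite mulrAC ler_pdivlMr // ler_wpM2l // ltW.
rewrite [leRHS]mulrAC ler_wpM2r ?invr_ge0 ?subr_ge0 ?(ltW tlt) //.
rewrite mulrAC ler_wpM2r // ler_wpM2l ?divr_ge0 ?(ltW R0) // lerD2l lef_pV2 ?posrE //.
Qed.

(** Pairings of size r^k with r < R make the Laurent series converge uniformly up to both boundary
    circles, so that [f] is bounded on the annulus. Bounds on pairings become bounds on the norm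
    only through this strict gap. *)
Lemma hardy_norm_le (r : K) : 0 < r < R -> exists2 C : K, 0 <= C & forall f s A,
  hardy R f -> R < s < 1 -> 0 <= A ->
  (forall e k, modulus (pair s e f (monom k)) <= A * r ^+ k) -> hardy_norm R f <= C * A.
Proof.
move=> /andP[r0 rR]; have tlt : r / R < 1 by rewrite ltr_pdivrMr // mul1r.
have q0 : 0 <= (r + R^-1) / (1 - r / R).
  apply: divr_ge0; first by rewrite addr_ge0 ?invr_ge0 // ltW.
  by rewrite subr_ge0 ltW.
exists (2 * ((r + R^-1) / (1 - r / R))) => [|f s A hf hs A0 hA]; first by rewrite mulr_ge0.
rewrite -mulrA; apply: (norm_le_sup hR hf).
  by rewrite mulr_ge0.
move=> z az; have [u hu huz] := between az; have /andP[Rz zR] := az.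
have z0 : 0 < modulus z := lt_trans R0 Rz.
have hA' e k : modulus (pair u e f (monom k)) <= A * r ^+ k.
  by rewrite (pair_indep hR k e (hardy_analytic hf) hu hs).
apply: le_trans (laurent_sup (hardy_analytic hf) hu huz r0 A0 hA' _ _ tlt) _.
- by rewrite mulrC ler_wpM2l ?(ltW r0) // ltW.
- by rewrite mulrAC ler_pdivlMr // ler_wpM2l ?(ltW r0) // ltW.
rewrite [leRHS]mulrC mulrA ler_wpM2r ?invr_ge0 ?subr_ge0 ?(ltW tlt) // ler_wpM2l //.
by rewrite lerD2l lef_pV2 ?posrE // ltW.
Qed.

Lemma hardy_eq0 f s : hardy R f -> R < s < 1 ->
  (forall e k, pair s e f (monom k) = 0) -> f = 0.
Proof.
move=> hf hs h; apply/funext => z; have [az|naz] := pselect (annulus R z); last first.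
  by case: hf => ->.
have [u hu huz] := between az; apply: cvg_series_unique.
  exact: (laurent_series hR (hardy_analytic hf) hu huz).
have -> : series (laurent u f z) = (fun=> 0).
  apply/funext => n; rewrite /series /= big1 // => k _; rewrite /laurent.
  by rewrite !(pair_indep hR _ _ (hardy_analytic hf) hu hs) !h !mulr0 addr0.
exact: cvg_cst.
Qed.

Lemma pair_bfunc s e f : analytic_annulus R f -> R < s < 1 -> bfunc s (pair s e f).
Proof.
move=> hf hs; have s0 : 0 < s by case/andP: hs => ? _; exact: lt_trans R0 _.
have cw := continuous_weight hR (e := e) hf hs.
have cp := continuous_parg (e := e) s0.
have pm t : modulus (parg e (pcirc s e t)) <= s by rewrite parg_modulus.
have cg g : dalg s g -> continuous (fun t => g (parg e (pcirc s e t))).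
  by move=> hg; exact: (dalg_continuous hg cp pm).
have [M M0 hM] := sup_circ hR e hf hs.
have r0 : 0 <= (if e then s^-1 else s) by case: (e); rewrite ?invr_ge0 ltW.
split=> [c g h hg hh|].
  rewrite /pair -(avgZ _ (continuousM_fun cw (cg _ hg))).
  rewrite -(avgD (continuousZ_fun (continuousM_fun cw (cg _ hg))) (continuousM_fun cw (cg _ hh))).
  by apply: eq_avg => t; ring.
exists (M * (if e then s^-1 else s)) => [|g x hg gx]; first by rewrite mulr_ge0.
apply: avg_le => [|t _]; first exact: continuousM_fun cw (cg _ hg).
rewrite (modulusM (_ * _)) (modulusM (f _)) (pcirc_modulus _ _ s0).
apply: ler_pM; rewrite ?modulus_ge0 ?mulr_ge0 ?modulus_ge0 //; last exact: gx.
by rewrite ler_wpM2r.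
Qed.

Lemma pair_bound s : R < s < 1 -> exists2 C : K, 0 <= C & forall f e g (x : K),
  hardy R f -> dalg s g -> (forall z, modulus z <= s -> modulus (g z) <= x) ->
  modulus (pair s e f g) <= C * hardy_norm R f * x.
Proof.
move=> hs; have s0 : 0 < s by case/andP: hs => ? _; exact: lt_trans R0 _.
have [C C0 hC] := hardy_circle_sup hs.
have si : s <= s^-1 by case/andP: hs => _ s1; rewrite (le_trans (ltW s1)) // ltW // invf_gt1.
have si0 : 0 <= s^-1 by rewrite invr_ge0 ltW.
exists (C * s^-1) => [|f e g x hf hg gx]; first by rewrite mulr_ge0.
have cw := continuous_weight hR (e := e) (hardy_analytic hf) hs.
have pm t : modulus (parg e (pcirc s e t)) <= s by rewrite parg_modulus.
have cg := dalg_continuous hg (continuous_parg (e := e) s0) pm.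
have N0 := hardy_norm_ge0 R f.
apply: avg_le => [|t _]; first exact: continuousM_fun cw cg.
rewrite (modulusM (_ * _)) (modulusM (f _)) (pcirc_modulus _ _ s0).
apply: ler_pM; rewrite ?modulus_ge0 ?mulr_ge0 ?modulus_ge0 //; last exact: gx.
  by case: (e); rewrite // ltW.
rewrite mulrAC; apply: ler_pM; rewrite ?modulus_ge0 ?hC //; first by case: (e); rewrite // ltW.
by case: (e).
Qed.

Lemma pair_lin s e (c : K[i]) f g h : analytic_annulus R f -> analytic_annulus R g ->
  R < s < 1 -> dalg s h -> pair s e (c *: f + g) h = c * pair s e f h + pair s e g h.
Proof.
move=> hf hg hs hh; have s0 : 0 < s by case/andP: hs => ? _; exact: lt_trans R0 _.
have pm t : modulus (parg e (pcirc s e t)) <= s by rewrite parg_modulus.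
have ch := dalg_continuous hh (continuous_parg (e := e) s0) pm.
have c1 := continuousM_fun (continuous_weight hR (e := e) hf hs) ch.
have c2 := continuousM_fun (continuous_weight hR (e := e) hg hs) ch.
rewrite /pair -(avgZ _ c1) -(avgD (continuousZ_fun c1) c2); apply: eq_avg => t.
have -> : (c *: f + g) (pcirc s e t) = (c : cplx K) * f (pcirc s e t) + g (pcirc s e t) by [].
by move: (pcirc s e t) => w; ring.
Qed.

End HardySpace.

(** * Elements with prescribed pairings *)

Section Realization.
Variable K : realType.
Implicit Types (f g : cplx K -> cplx K) (z w : cplx K) (a b s : K).

Lemma avg_series (u : nat -> K -> cplx K) (F : K -> cplx K) (A t : K) :
  (forall k, continuous (u k)) -> 0 <= t < 1 ->
  (forall x N, modulus (F x - \sum_(0 <= k < N) u k x) <= A * t ^+ N) ->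
  series (fun k => avg (u k)) @ \oo --> avg F.
Proof.
move=> cu t01 h; have cF : continuous F.
  apply: continuous_uniform => e e0; have [N hN] := geometric_small A t01 e0.
  exists (fun x => \sum_(0 <= k < N) u k x); first exact: continuous_sum_fun.
  by move=> x; rewrite (le_trans (h x N)) // ltW // hN.
apply/cvg_modulus => e e0; have [N hN] := geometric_small A t01 e0.
exists N => // n /= /hN; apply: le_lt_trans.
rewrite modulusB /series /= -(avg_sum n cu) -(avgB cF (continuous_sum_fun cu)).
by apply: avg_le => [|x _]; [exact: continuousB_fun cF (continuous_sum_fun cu)|exact: h].
Qed.

(** The kernel is expanded in powers of (z - z0) / (tau t - z0), which has modulus below 1 as the
    curve stays at distance d from z0. *)
Lemma cauchy_transform_analytic (F tau : K -> cplx K) (M d : K) (z0 : cplx K) :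
  continuous F -> continuous tau -> 0 < d -> (forall t, modulus (F t) <= M) ->
  (forall t, d <= modulus (tau t - z0)) ->
  analytic_at (fun z => avg (fun t => F t / (tau t - z))) z0.
Proof.
move=> cF ct d0 FM far.
have nz t : tau t - z0 != 0 by rewrite -modulus_gt0 (lt_le_trans d0).
have ck : continuous (fun t => (tau t - z0)^-1).
  by apply: continuousV_fun nz; apply: continuousB_fun ct _; exact: continuous_cst_fun.
have M0 : 0 <= M := le_trans (modulus_ge0 _) (FM 0).
exists (fun n => avg (fun t => F t / (tau t - z0) * (tau t - z0)^-1 ^+ n)); exists d => // z zd.
have t01 : 0 <= modulus (z - z0) / d < 1.
  by rewrite divr_ge0 ?modulus_ge0 ?(ltW d0) //= ltr_pdivrMr // mul1r.
have qt t : modulus ((z - z0) / (tau t - z0)) <= modulus (z - z0) / d.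
  by rewrite modulusM modulusV ler_wpM2l ?modulus_ge0 // lef_pV2 ?posrE // (lt_le_trans d0).
have FM' t : modulus (F t / (tau t - z0)) <= M / d.
  rewrite modulusM modulusV; apply: ler_pM; rewrite ?invr_ge0 ?modulus_ge0 ?FM //.
  by rewrite lef_pV2 ?posrE // (lt_le_trans d0).
have H := avg_geometric (continuousM_fun cF ck)
  (continuousM_fun (@continuous_cst_fun _ (z - z0)) ck) t01 FM' qt.
apply/cvg_modulus => e e0.
have [N hN] := geometric_small (M / d / (1 - modulus (z - z0) / d)) t01 e0.
exists N => // n /= /hN; apply: le_lt_trans; apply: le_trans (H n).
rewrite modulusB le_eqVlt; apply/orP; left; apply/eqP; congr (modulus (_ - _)).
  apply: eq_avg => t; have nzt := nz t.
  have [->|Ft] := eqVneq (F t) 0; first by rewrite !mul0r.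
  have nz2 : tau t - z != 0.
    apply/eqP => tz; have := far t; rewrite (subr0_eq tz) leNgt zd.
    by [].
  have -> : 1 - (z - z0) / (tau t - z0) = (tau t - z) / (tau t - z0) by field.
  by field; rewrite nzt nz2.
apply: eq_bigr => k _; rewrite mulrC -avgZ; last first.
  by apply: continuousM_fun (continuousM_fun cF ck) _; exact: continuousX_fun.
by apply: eq_avg => t; rewrite exprMn; ring.
Qed.

Lemma expr_subVr w (j k : nat) : w != 0 -> (k <= j)%N -> w ^+ j * w^-1 ^+ k = w ^+ (j - k).
Proof.
move=> w0 kj; rewrite -{1}(subnK kj) exprD exprVn mulfK //.
by rewrite expf_neq0.
Qed.

Lemma parg_circ s e t : 0 < s -> parg e (pcirc s e t) =
  of_real s * (if e then (cis t)^-1 else cis t).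
Proof.
move=> s0; rewrite /parg /pcirc /circ; case: e => //.
by rewrite invfM -of_realV invrK.
Qed.

Lemma avg_parg_powers s e (j k : nat) : 0 < s ->
  avg (fun t => (parg e (pcirc s e t))^-1 ^+ j * parg e (pcirc s e t) ^+ k) = (j == k)%:R.
Proof.
move=> s0; have nz t : parg e (pcirc s e t) != 0.
  by rewrite -modulus_gt0 parg_modulus.
have s0' : of_real s != 0 :> cplx K by rewrite -modulus_gt0 modulus_of_real gtr0_norm.
pose v t : cplx K := if e then (cis t)^-1 else cis t.
have v0 t : v t != 0 by rewrite /v; case: (e); rewrite ?invr_eq0 cis_neq0.
have cv : continuous v.
  rewrite /v; case: (e); last exact: continuous_cis.
  by apply: continuousV_fun; [exact: continuous_cis|exact: cis_neq0].
have cvV : continuous (fun t => (v t)^-1) by exact: continuousV_fun.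
have v1 n : (0 < n)%N -> avg (fun t => v t ^+ n) = 0.
  by move=> n0; rewrite /v; case: (e); [exact: avg_cisVX|exact: avg_cisX].
have v2 n : (0 < n)%N -> avg (fun t => (v t)^-1 ^+ n) = 0.
  move=> n0; rewrite /v; case: (e); last exact: avg_cisVX.
  by under eq_avg do rewrite invrK; exact: avg_cisX.
have [jk|kj|->] := ltngtP j k.
- have -> : avg (fun t => (parg e (pcirc s e t))^-1 ^+ j * parg e (pcirc s e t) ^+ k) =
      avg (fun t => of_real s ^+ (k - j) * v t ^+ (k - j)).
    by apply: eq_avg => t; rewrite mulrC (expr_subVr (nz t) (ltnW jk)) parg_circ // exprMn.
  by rewrite (avgZ _ (continuousX_fun cv)) v1 ?subn_gt0 // mulr0.
- have -> : avg (fun t => (parg e (pcirc s e t))^-1 ^+ j * parg e (pcirc s e t) ^+ k) =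
      avg (fun t => (of_real s)^-1 ^+ (j - k) * (v t)^-1 ^+ (j - k)).
    apply: eq_avg => t; have := nz t; rewrite -invr_eq0 => nzV.
    rewrite -[X in _ * X ^+ k]invrK (expr_subVr nzV (ltnW kj)) parg_circ // invfM exprMn.
    by [].
  by rewrite (avgZ _ (continuousX_fun cvV)) v2 ?subn_gt0 // mulr0.
rewrite -[RHS](avg_cst 1); apply: eq_avg => t.
by rewrite exprVn mulVf // expf_neq0.
Qed.

Lemma series_delta (c : cplx K) k : series (fun j => (j == k)%:R * c) @ \oo --> c.
Proof.
apply: cvg_near_cst; near=> n; rewrite /series /=.
have kn : (k < n)%N by near: n; exact: nbhs_infty_gt.
rewrite big_mkord (bigD1 (Ordinal kn)) //= eqxx mul1r big1 ?addr0 // => i ik.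
by rewrite [_ == k](_ : _ = false) ?mul0r //; apply: contraNF ik => /eqP ik; apply/eqP/val_inj.
Unshelve. all: by end_near. Qed.

Variable R : K.
Hypothesis hR : 0 < R < 1.
Let R0 : 0 < R. Proof. by case/andP: hR. Qed.
Let R1 : R < 1. Proof. by case/andP: hR. Qed.

Section Coefficients.
Variables (alpha : bool -> nat -> cplx K) (A rho : K).
Hypothesis hrho : 0 < rho < R.
Hypothesis A0 : 0 <= A.
Hypothesis halpha : forall e k, modulus (alpha e k) <= A * rho ^+ k.
Hypothesis alpha0 : alpha true 0%N = alpha false 0%N.

Let r0 : 0 < rho. Proof. by case/andP: hrho. Qed.
Let rR : rho < R. Proof. by case/andP: hrho. Qed.
(** Strictly between rho and R: above rho the boundary data converge, and below R the auxiliary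
    circles, of radii sig and 1/sig, stay at a positive distance from the closed annulus. *)
Let sig := (rho + R) / 2.
Let sig0 : 0 < sig. Proof. by rewrite divr_gt0 // addr_gt0. Qed.
Let sigR : sig < R. Proof. by rewrite /sig; move: rR; lra. Qed.
Let rsig : rho < sig. Proof. by rewrite /sig; move: rR; lra. Qed.
Let t01 : 0 <= rho / sig < 1.
Proof. by rewrite divr_ge0 ?(ltW r0) ?(ltW sig0) //= ltr_pdivrMr // mul1r. Qed.

(** The shift for [true] is the one in [laurent]: the power z^j carries the coefficient of order j +
    1. *)
Let cc (e : bool) j := alpha e (if e then j.+1 else j).
Let u e t := parg e (pcirc sig e t).
Let u0 e t : u e t != 0. Proof. by rewrite -modulus_gt0 parg_modulus. Qed.
Let cu e : continuous (u e). Proof. exact: continuous_parg. Qed.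

Let Fterm e t j := (u e t)^-1 ^+ j * cc e j.
Let Fterm_le e t j : modulus (Fterm e t j) <= A * (rho / sig) ^+ j.
Proof.
have c1 : modulus (cc e j) <= A * rho ^+ j.
  rewrite /cc; case: e => //; apply: le_trans (halpha _ _) _.
  rewrite exprS ler_wpM2l // ler_piMl ?exprn_ge0 ?(ltW r0) //.
  by rewrite ltW // (lt_trans rR).
rewrite /Fterm modulusM modulusX modulusV parg_modulus //.
have -> : A * (rho / sig) ^+ j = sig^-1 ^+ j * (A * rho ^+ j) by rewrite exprMn; ring.
by rewrite ler_wpM2l // exprn_ge0 // invr_ge0 ltW.
Qed.

(* On an auxiliary circle outside the annulus, the boundary data whose Cauchy
   transform has the prescribed Laurent coefficients. *)
Let F e t := csum (Fterm e t).
Let Ftail e t N : modulus (F e t - \sum_(0 <= k < N) Fterm e t k) <=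
  A / (1 - rho / sig) * (rho / sig) ^+ N.
Proof. by have := csum_tail N t01 (Fterm_le e t); rewrite mulrAC. Qed.

Let cterm e k : continuous (fun t => Fterm e t k).
Proof.
apply: continuousM_fun; last exact: continuous_cst_fun.
by apply: continuousX_fun; apply: continuousV_fun (u0 e); exact: cu.
Qed.

Let cF e : continuous (F e).
Proof.
apply: continuous_uniform => x x0.
have [N hN] := geometric_small (A / (1 - rho / sig)) t01 x0.
exists (fun t => \sum_(0 <= k < N) Fterm e t k).
  exact: continuous_sum_fun (fun k => @cterm e k).
by move=> t; rewrite (le_trans (Ftail e t N)) // ltW // hN.
Qed.

Let M := A / (1 - rho / sig).
Let FM e t : modulus (F e t) <= M.
Proof. by have := Ftail e t 0; rewrite big_geq // subr0 expr0 mulr1. Qed.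
Let M0 : 0 <= M. Proof. exact: le_trans (modulus_ge0 _) (FM true 0). Qed.

Let F_coef e k : avg (fun t => F e t * u e t ^+ k) = cc e k.
Proof.
have cw : continuous (fun t => u e t ^+ k) by apply: continuousX_fun; exact: cu.
have H := @avg_series (fun j t => Fterm e t j * u e t ^+ k)
  (fun t => F e t * u e t ^+ k) (M * sig ^+ k) (rho / sig) _ t01 _.
apply: (cvg_series_unique (H _ _)).
- by move=> j; exact: continuousM_fun (@cterm e j) cw.
- move=> t N; rewrite -mulr_suml -mulrBl modulusM mulrAC modulusX parg_modulus //.
  by rewrite ler_wpM2r ?exprn_ge0 ?(ltW sig0).
have -> : (fun j => avg (fun t => Fterm e t j * u e t ^+ k)) =
    (fun j => (j == k)%:R * cc e k).
  apply/funext => j; have -> : (j == k)%:R * cc e k = cc e j * (j == k)%:R.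
    by have [->|_] := eqVneq j k; rewrite ?mul1r ?mulr1 ?mul0r ?mulr0.
  rewrite -(avg_parg_powers e j k sig0) -avgZ; last first.
    apply: continuousM_fun cw.
    by apply: continuousX_fun; apply: continuousV_fun (u0 e); exact: cu.
  by apply: eq_avg => t; rewrite /Fterm -/(u e t) mulrAC mulrC.
exact: series_delta.
Qed.

Let H z := avg (fun t => F true t * pcirc sig true t / (pcirc sig true t - z)) -
  avg (fun t => F false t / (pcirc sig false t - z)).

Definition lterm z k : cplx K := z ^+ k * alpha true k.+1 + z^-1 ^+ k.+1 * alpha false k.

Let d := Num.min (R - sig) (sig^-1 - R^-1).
Let d0 : 0 < d. Proof. by rewrite lt_min !subr_gt0 sigR ltf_pV2 ?posrE. Qed.

Let far e z t : R <= modulus z <= R^-1 -> d <= modulus (pcirc sig e t - z).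
Proof.
move=> /andP[Rz zR]; rewrite /pcirc; case: e.
  have := circ_dist t z (_ : 0 <= sig^-1); rewrite invr_ge0 => /(_ (ltW sig0)); apply: le_trans.
  rewrite ger0_norm; first by rewrite /d ge_min lerD2l lerN2 zR orbT.
  by rewrite subr_ge0 (le_trans zR) // lef_pV2 ?posrE // ltW.
have := circ_dist t z (ltW sig0); apply: le_trans.
rewrite distrC ger0_norm; first by rewrite /d ge_min lerD2r Rz.
by rewrite subr_ge0 (le_trans _ Rz) // ltW.
Qed.

Let Hseries z N : R <= modulus z <= R^-1 ->
  modulus (H z - \sum_(0 <= k < N) lterm z k) <=
    (M / (1 - sig / R) + M / R / (1 - sig / R)) * (sig / R) ^+ N.
Proof.
move=> hz; have /andP[Rz zR] := hz.
have z0 : 0 < modulus z := lt_le_trans R0 Rz.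
have nz0 : z != 0 by rewrite -modulus_gt0.
have t1 : 0 <= sig / R < 1 by rewrite divr_ge0 ?(ltW sig0) ?(ltW R0) //= ltr_pdivrMr // mul1r.
have p0 e t : pcirc sig e t != 0 by exact: pcirc_neq0.
have pz e t : pcirc sig e t - z != 0 by rewrite -modulus_gt0 (lt_le_trans d0) // far.
have cp e : continuous (pcirc sig e) by exact: continuous_pcirc.
have ck := @continuous_cst_fun K.
have g1 := @avg_geometric K (F true) (fun t => z * u true t) M (sig / R) (@cF true)
  (continuousZ_fun (@cu true)) t1 (FM true) _ N.
have g2 := @avg_geometric K (fun t => z^-1 * F false t) (fun t => z^-1 * u false t) (M / R)
  (sig / R) (continuousZ_fun (@cF false)) (continuousZ_fun (@cu false)) t1 _ _ N.
have e1 : \sum_(0 <= k < N) avg (fun t => F true t * (z * u true t) ^+ k) =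
    \sum_(0 <= k < N) z ^+ k * alpha true k.+1.
  apply: eq_bigr => k _; rewrite -[alpha _ _](F_coef true k) -avgZ.
    by apply: eq_avg => t; rewrite exprMn mulrCA.
  by apply: continuousM_fun; [exact: cF|apply: continuousX_fun; exact: cu].
have e2 : \sum_(0 <= k < N) avg (fun t => z^-1 * F false t * (z^-1 * u false t) ^+ k) =
    \sum_(0 <= k < N) z^-1 ^+ k.+1 * alpha false k.
  apply: eq_bigr => k _; rewrite -[alpha _ _](F_coef false k) -avgZ.
    by apply: eq_avg => t; rewrite exprMn exprS; ring.
  by apply: continuousM_fun; [exact: cF|apply: continuousX_fun; exact: cu].
have e3 : avg (fun t => F true t / (1 - z * u true t)) =
    avg (fun t => F true t * pcirc sig true t / (pcirc sig true t - z)).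
  apply: eq_avg => t; rewrite /u /parg; move: (pcirc sig true t) (p0 true t) (pz true t) => w w0 wz.
  by field; rewrite w0 wz.
have e4 : avg (fun t => z^-1 * F false t / (1 - z^-1 * u false t)) =
    - avg (fun t => F false t / (pcirc sig false t - z)).
  rewrite -mulN1r -avgZ; last first.
    apply: continuousM_fun; first exact: cF.
    by apply: continuousV_fun (pz false); exact: continuousB_fun (cp false) (ck z).
  apply: eq_avg => t; rewrite /u /parg; move: (pcirc sig false t) (pz false t) => w wz.
  have zw : z - w != 0 by rewrite -opprB oppr_eq0.
  by field; rewrite nz0 wz zw.
rewrite e1 e3 in g1; rewrite e2 e4 in g2.
have -> : H z - \sum_(0 <= k < N) lterm z k =
  (avg (fun t => F true t * pcirc sig true t / (pcirc sig true t - z)) -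
     \sum_(0 <= k < N) z ^+ k * alpha true k.+1) +
  (- avg (fun t => F false t / (pcirc sig false t - z)) -
     \sum_(0 <= k < N) z^-1 ^+ k.+1 * alpha false k).
  by rewrite /lterm big_split /= /H; ring.
apply: le_trans (modulusD _ _) _; rewrite mulrDl; apply: lerD.
  apply: g1 => t; rewrite modulusM parg_modulus // mulrC.
  by rewrite ler_wpM2l // ltW.
have zi : (modulus z)^-1 <= R^-1 by rewrite lef_pV2 ?posrE.
apply: g2 => t; rewrite modulusM modulusV mulrC.
  by apply: ler_pM; rewrite ?modulus_ge0 ?invr_ge0 ?modulus_ge0.
by rewrite parg_modulus // ler_wpM2l // ltW.
Qed.

(** On the closed annulus the Cauchy transforms are Lipschitz. The traces of [f] therefore converge
    uniformly to those of [H] at the boundary, which gives the L^2 boundary values. *)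
Let Hlip : exists2 L : K, 0 <= L & forall z w, R <= modulus z <= R^-1 ->
  R <= modulus w <= R^-1 -> modulus (H z - H w) <= L * modulus (z - w).
Proof.
exists (M * sig^-1 / d ^+ 2 + M / d ^+ 2).
  by rewrite addr_ge0 // divr_ge0 ?sqr_ge0 // mulr_ge0 // invr_ge0 ltW.
move=> z w hz hw.
have pz e t : pcirc sig e t - z != 0 by rewrite -modulus_gt0 (lt_le_trans d0) // far.
have pw e t : pcirc sig e t - w != 0 by rewrite -modulus_gt0 (lt_le_trans d0) // far.
have key e (G : K -> cplx K) (B : K) : continuous G -> (forall t, modulus (G t) <= B) ->
    modulus (avg (fun t => G t / (pcirc sig e t - z)) - avg (fun t => G t / (pcirc sig e t - w)))
      <= B / d ^+ 2 * modulus (z - w).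
  move=> cG GB; have cp : continuous (pcirc sig e) by exact: continuous_pcirc.
  have c1 : continuous (fun t => G t / (pcirc sig e t - z)).
    apply: continuousM_fun cG _; apply: continuousV_fun (pz e).
    by apply: continuousB_fun cp _; exact: continuous_cst_fun.
  have c2 : continuous (fun t => G t / (pcirc sig e t - w)).
    apply: continuousM_fun cG _; apply: continuousV_fun (pw e).
    by apply: continuousB_fun cp _; exact: continuous_cst_fun.
  rewrite -(avgB c1 c2); apply: avg_le => [|t _]; first exact: continuousB_fun c1 c2.
  have f1 := far e t hz; have f2 := far e t hw; have n1 := pz e t; have n2 := pw e t.
  move: (pcirc sig e t) f1 f2 n1 n2 => v f1 f2 n1 n2.
  have -> : G t / (v - z) - G t / (v - w) = G t / ((v - z) * (v - w)) * (z - w).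
    by field; rewrite n1 n2.
  rewrite modulusM ler_wpM2r ?modulus_ge0 // modulusM modulusV modulusM.
  apply: ler_pM; rewrite ?invr_ge0 ?mulr_ge0 ?modulus_ge0 ?GB //.
  by rewrite lef_pV2 ?posrE ?mulr_gt0 ?exprn_gt0 ?(lt_le_trans d0) // expr2 ler_pM // ltW.
have k1 := key true (fun t => F true t * pcirc sig true t) (M * sig^-1) _ _.
have k2 := key false (F false) M (@cF false) (FM false).
have -> : H z - H w =
  (avg (fun t => F true t * pcirc sig true t / (pcirc sig true t - z)) -
   avg (fun t => F true t * pcirc sig true t / (pcirc sig true t - w))) -
  (avg (fun t => F false t / (pcirc sig false t - z)) -
   avg (fun t => F false t / (pcirc sig false t - w))).
  by rewrite /H; ring.
apply: le_trans (modulusB_le _ _) _; rewrite [leRHS]mulrDl; apply: lerD k2.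
apply: k1; first by apply: continuousM_fun; [exact: cF|exact: continuous_pcirc].
move=> t; rewrite (modulusM (F true t)) pcirc_modulus //.
by rewrite ler_wpM2r // invr_ge0 ltW.
Qed.

Let f z : cplx K := if R < modulus z < R^-1 then H z else 0.

Let f_analytic : analytic_annulus R f.
Proof.
move=> z az; have az' : R <= modulus z <= R^-1 by case/andP: az => ? ?; rewrite !ltW.
have H_an : analytic_at H z.
  have a1 : analytic_at (fun z => avg (fun t => F true t * pcirc sig true t / (pcirc sig true t - z))) z.
    apply: (@cauchy_transform_analytic _ _ (M * sig^-1) d) => //.
    - by apply: continuousM_fun; [exact: cF|exact: continuous_pcirc].
    - exact: continuous_pcirc.
    - move=> t; rewrite (modulusM (F true t)) pcirc_modulus //.
      by rewrite ler_wpM2r // invr_ge0 ltW.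
    - by move=> t; exact: far.
  have a2 : analytic_at (fun z => avg (fun t => F false t / (pcirc sig false t - z))) z.
    apply: (@cauchy_transform_analytic _ _ M d) => //.
    - exact: continuous_pcirc.
    - by move=> t; exact: far.
  have -> : H = (fun z => -1 * avg (fun t => F false t / (pcirc sig false t - z)) +
      avg (fun t => F true t * pcirc sig true t / (pcirc sig true t - z))).
    by apply/funext => x; rewrite /H mulN1r addrC.
  exact: analytic_at_lin.
have [a [x x0 hx]] := H_an; exists a.
have az0 := az; move: az0 => /andP[Rz zR].
exists (Num.min x (Num.min (modulus z - R) (R^-1 - modulus z))).
  by rewrite !lt_min x0 !subr_gt0 Rz.
move=> y; rewrite !lt_min => /and3P[yx y1 y2].
have -> : f y = H y; last exact: hx.
rewrite /f ifT //; have h1 := modulus_subl z y; have h2 := modulus_subl y z.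
by rewrite modulusB in h1; apply/andP; split; lra.
Qed.

Let f_boundary e : exists b : K -> cplx K, boundary_value f (bfilter R e) b.
Proof.
have Rp t : R <= modulus (pcirc R e t) <= R^-1.
  have RRi : R <= R^-1 by rewrite (le_trans (ltW R1)) // ltW // invf_gt1.
  by rewrite pcirc_modulus //; case: (e); rewrite lexx RRi.
exists (fun t => H (pcirc R e t)).
have [L L0 hL] := Hlip.
have cb : continuous (fun t => H (pcirc R e t)).
  move=> t; apply/cvg_modulus => x x0.
  have L1 : 0 < x / (L + 1) by rewrite divr_gt0 // ltr_wpDl.
  have /cvg_modulus/(_ _ L1) := @continuous_pcirc K R e t; apply: filterS => y.
  rewrite ltr_pdivlMr ?ltr_wpDl // => hy; apply: le_lt_trans (hL _ _ (Rp y) (Rp t)) _.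
  by apply: le_lt_trans hy; rewrite mulrC ler_wpM2l ?modulus_ge0 // lerDl.
have [bm1 bm2] := continuous_trace_measurable cb.
split.
  split=> //; have [B hB] : exists B : K, 0 <= B /\ forall t, modulus (H (pcirc R e t)) <= B.
    exists (modulus (H (pcirc R e 0)) + L * (2 * R^-1)); split.
      by rewrite addr_ge0 ?modulus_ge0 // !mulr_ge0 // invr_ge0 ltW.
    move=> t; rewrite -[H (pcirc R e t)](subrK (H (pcirc R e 0))) addrC.
    apply: le_trans (modulusD _ _) _; rewrite lerD2l.
    apply: le_trans (hL _ _ (Rp t) (Rp 0)) _; rewrite ler_wpM2l //.
    apply: le_trans (modulusB_le _ _) _.
    by have /andP[_ ?] := Rp t; have /andP[_ ?] := Rp 0; lra.
  have [B0 hB'] := hB; apply: le_lt_trans (energy_le_sup B0 _ (fun t _ => hB' t)) _ => //.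
  by rewrite ltry.
have fl : Filter (bfilter R e) by exact: (bfilter_proper R e).
pose rad : K := if e then R^-1 else R.
have radc : s @[s --> bfilter R e] --> rad.
  rewrite /rad /bfilter; case: (e); [apply: cvg_at_left_filter|apply: cvg_at_right_filter]; exact: cvg_id.
have lim0 : (2 * pi * (L * `|s - rad|) ^+ 2)%:E @[s --> bfilter R e] --> 0%E.
  apply: cvg_EFin; first by near=> s.
  rewrite -[X in _ --> X](_ : 2 * pi * (L * `|rad - rad|) ^+ 2 = 0); last first.
    by rewrite subrr normr0 mulr0 expr0n mulr0.
  apply: cvgMr; apply: cvg_pow; apply: cvgMr; apply: cvg_norm.
  by apply: cvgB radc _; exact: cvg_cst.
apply: (squeeze_cvge _ (cvg_cst 0%E) lim0); near=> s.
apply/andP; split; first exact: energy_ge0.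
have hs : R < bradius e s < 1 by near: s; exact: near_bfilter.
have ctE := circle_trace_pcirc f e s.
apply: energy_le_sup.
- by rewrite mulr_ge0.
- apply: trace_measurableB; last by split.
  rewrite ctE; apply: continuous_trace_measurable; exact: (analytic_continuous hR f_analytic hs).
move=> t _; have -> : (circle_trace f s - (fun t => H (pcirc R e t))) t =
    f (circ s t) - H (pcirc R e t) by [].
have az := pcirc_annulus hR e t hs; rewrite /pcirc bradiusK in az.
have -> : f (circ s t) = H (circ s t) by rewrite /f ifT.
have az' : R <= modulus (circ s t) <= R^-1 by case/andP: az => ? ?; rewrite !ltW.
apply: le_trans (hL _ _ az' (Rp t)) _; rewrite ler_wpM2l //.
have -> : circ s t - pcirc R e t = of_real (s - rad) * cis t.
  by rewrite /pcirc /circ of_realB -/rad; ring.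
by rewrite (modulusM (of_real _)) modulus_cis mulr1 modulus_of_real.
Unshelve. all: by end_near. Qed.

Let f_hardy : hardy R f.
Proof.
apply: hardyP => [z nz||e]; [|exact: f_analytic|exact: f_boundary].
by rewrite /f ifF //; apply/negP.
Qed.

Let f_pair s e k : R < s < 1 -> pair s e f (monom k) = alpha e k.
Proof.
move=> hs; have [Rs s1] : R < s /\ s < 1 by case/andP: hs.
have s0 : 0 < s := lt_trans R0 Rs.
have si : s^-1 < R^-1 by rewrite ltf_pV2 ?posrE.
have sis : s < s^-1 by rewrite (lt_trans s1) // invf_gt1.
have t1 : 0 <= sig / R < 1 by rewrite divr_ge0 ?(ltW sig0) ?(ltW R0) //= ltr_pdivrMr // mul1r.
have p0 t : pcirc s e t != 0 by exact: pcirc_neq0.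
have cp : continuous (pcirc s e) by exact: continuous_pcirc.
have cv : continuous (fun t => parg e (pcirc s e t)) by exact: continuous_parg.
have v0 t : parg e (pcirc s e t) != 0 by rewrite -modulus_gt0 parg_modulus.
have pa t := pcirc_annulus hR e t hs.
have pa' t : R <= modulus (pcirc s e t) <= R^-1 by have /andP[? ?] := pa t; rewrite !ltW.
have fH t : f (pcirc s e t) = H (pcirc s e t) by rewrite /f ifT //; exact: pa.
have ccst := @continuous_cst_fun K.
pose W t := pcirc s e t * parg e (pcirc s e t) ^+ k.
have cW : continuous W by apply: continuousM_fun cp _; exact: continuousX_fun.
have cl j : continuous (fun t => lterm (pcirc s e t) j * W t).
  apply: continuousM_fun cW; apply: continuousD_fun; apply: continuousM_fun (ccst _).
    exact: continuousX_fun.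
  by apply: continuousX_fun; exact: continuousV_fun.
have HH := @avg_series (fun j t => lterm (pcirc s e t) j * W t)
  (fun t => H (pcirc s e t) * W t)
  ((M / (1 - sig / R) + M / R / (1 - sig / R)) * (s^-1 * s ^+ k)) (sig / R) cl t1 _.
have -> : pair s e f (monom k) = avg (fun t => H (pcirc s e t) * W t).
  by apply: eq_avg => t; rewrite fH /W /monom mulrA.
apply: (cvg_series_unique (HH _)).
  move=> t N; rewrite -mulr_suml -mulrBl modulusM mulrAC.
  apply: ler_pM; rewrite ?modulus_ge0 //; first exact: Hseries.
  rewrite /W modulusM modulusX (pcirc_modulus _ _ s0) (parg_modulus _ _ s0).
  by rewrite ler_wpM2r ?exprn_ge0 ?(ltW s0) //; case: (e); rewrite // ltW.
pose Tm j := avg (fun t => lterm (pcirc s e t) j * W t).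
have term j : Tm j =
   if e then (j.+1 == k)%:R * alpha true j.+1 + (0%N == (j + k)%N)%:R * alpha false j
   else (0%N == (j.+1 + k)%N)%:R * alpha true j.+1 + (j == k)%:R * alpha false j.
  have pp i l := avg_parg_powers e i l s0.
  have cpw i l : continuous (fun t => (parg e (pcirc s e t))^-1 ^+ i * parg e (pcirc s e t) ^+ l).
    apply: continuousM_fun; last exact: (continuousX_fun cv).
    exact: (continuousX_fun (continuousV_fun cv v0)).
  have two i l i' l' (x y : cplx K) :
      avg (fun t => x * ((parg e (pcirc s e t))^-1 ^+ i * parg e (pcirc s e t) ^+ l) +
        y * ((parg e (pcirc s e t))^-1 ^+ i' * parg e (pcirc s e t) ^+ l')) =
      (i == l)%:R * x + (i' == l')%:R * y.
    rewrite (avgD (continuousZ_fun (cpw _ _)) (continuousZ_fun (cpw _ _))).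
    by rewrite (avgZ _ (cpw _ _)) (avgZ _ (cpw _ _)) !pp mulrC [y * _]mulrC.
  rewrite /Tm; case ee : e; rewrite -two; apply: eq_avg => t; rewrite /lterm /W ee /parg.
    have := p0 t; rewrite ee; move: (pcirc s true t) => w w0.
    rewrite invrK !exprS expr0 mul1r exprD mulrDl; congr (_ + _); first by ring.
    by move: (w^-1 ^+ j) (w^-1 ^+ k) => x y; field.
  have := p0 t; rewrite ee; move: (pcirc s false t) => w w0.
  rewrite expr0 mul1r exprD (exprS w) (exprS w^-1) mulrDl; congr (_ + _); first by ring.
  by move: (w^-1 ^+ j) (w ^+ k) => x y; field.
(* Exactly one term of the series survives. For [e = true] and order 0 it is the inner term j = 0,
   with coefficient [alpha false 0]; here the compatibility [alpha0] enters. *)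
have tE : exists j0, forall j, Tm j = (j == j0)%:R * alpha e k.
  case ee : (e); last first.
    exists k => j; rewrite term ee addSn /= mul0r add0r.
    by have [->|_] := eqVneq j k; rewrite ?mul0r.
  case kk : k => [|k'].
    exists 0%N => j; rewrite term ee kk /= mul0r add0r addn0 alpha0 eq_sym.
    by have [->|_] := eqVneq j 0%N; rewrite ?mul0r.
  exists k' => j; rewrite term ee kk eqSS addnS /= mul0r addr0.
  by have [->|_] := eqVneq j k'; rewrite ?mul0r.
have [j0 hj0] := tE.
have -> : (fun j => avg (fun t => lterm (pcirc s e t) j * W t)) = (fun j => (j == j0)%:R * alpha e k).
  exact/funext.
exact: series_delta.
Qed.

(** Images under transfer and noise, limits of pullbacks and Taylor elements are all obtained from
    this existence statement: decay strictly faster than R^k and a common order 0 suffice. It stands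
    in for completeness. *)
Lemma hardy_realize : exists2 f, hardy R f &
  forall s e k, R < s < 1 -> pair s e f (monom k) = alpha e k.
Proof. by exists f => // s e k hs; exact: f_pair. Qed.

End Coefficients.
End Realization.

(** * The transfer operator *)

Arguments blaschke : simpl never.
Section Transfer.
Variable K : realType.
Implicit Types (f g : cplx K -> cplx K) (z w y v : cplx K) (a s : K).

Lemma derive1_second_order f (w c : cplx K) (d M : K) : 0 < d ->
  (forall z, modulus (z - w) < d ->
     modulus (f z - f w - c * (z - w)) <= M * modulus (z - w) ^+ 2) ->
  derive1 f w = c.
Proof.
move=> d0 h; rewrite /derive1; apply/cvg_lim; first exact: norm_hausdorff.
apply/cvg_modulus => e e0.
have M1 : 0 < `|M| + 1 by rewrite ltr_wpDl.
exists (of_real (Num.min d (e / (`|M| + 1)))).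
  by rewrite /= [X in _ < X]of_real_rcomplex ltcR lt_min d0 divr_gt0.
move=> x /=; rewrite /ball_ /= sub0r normrN cplx_norm of_real_rcomplex ltcR lt_min => /andP[xd xe] x0.
have xw : (x + w) - w = x by rewrite addrK.
have := h (x + w); rewrite xw => /(_ xd) {}h.
have -> : x^-1 *: (f (x + w) - f w) - c = x^-1 * (f (x + w) - f w - c * x).
  by rewrite /GRing.scale /=; field.
rewrite modulusM modulusV ltr_pdivrMl ?modulus_gt0 //.
apply: le_lt_trans h _; rewrite expr2 mulrA [X in _ < X]mulrC ltr_pM2r ?modulus_gt0 //.
apply: le_lt_trans (_ : _ <= (`|M| + 1) * modulus x) _.
  by rewrite ler_wpM2r ?modulus_ge0 // ler_wpDr // ler_norm.
by rewrite mulrC -ltr_pdivlMr.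
Qed.

Definition mobius z : cplx K := (z + 4^-1) / (1 + z / 4).

Lemma blaschke0E z : @blaschke K false z = z ^+ 2. Proof. by []. Qed.
Lemma blaschke1E z : @blaschke K true z = mobius z ^+ 2. Proof. by []. Qed.

Lemma derive_blaschke0 y : derive1 (@blaschke K false) y = 2 * y.
Proof.
apply: (@derive1_second_order _ _ _ 1 1) => // z _; rewrite !blaschke0E mul1r -modulusX.
by apply: eq_leW; congr modulus; ring.
Qed.

Lemma derive1_comp_sqr f (w c : cplx K) (d M : K) : 0 < d -> 0 <= M ->
  (forall z, modulus (z - w) < d ->
     modulus (f z - f w - c * (z - w)) <= M * modulus (z - w) ^+ 2) ->
  derive1 (fun z => f z ^+ 2) w = 2 * f w * c.
Proof.
move=> d0 M0 h.
set L := M * d + modulus c.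
apply: (@derive1_second_order _ _ _ d (L ^+ 2 + 2 * modulus (f w) * M)) => // z zd.
have hz := h z zd; set e := modulus (z - w) in zd hz *.
have e0 : 0 <= e by apply: modulus_ge0.
have Dz : modulus (f z - f w) <= L * e.
  have -> : f z - f w = (f z - f w - c * (z - w)) + c * (z - w) by ring.
  apply: le_trans (modulusD _ _) _; rewrite (modulusM c) -/e.
  apply: le_trans (lerD hz (lexx _)) _.
  rewrite /L mulrDl lerD2r expr2 mulrA ler_wpM2r // ler_wpM2l // ltW //.
have -> : f z ^+ 2 - f w ^+ 2 - 2 * f w * c * (z - w) =
  (f z - f w) ^+ 2 + 2 * f w * (f z - f w - c * (z - w)) by ring.
apply: le_trans (modulusD _ _) _.
rewrite (modulusX (f z - f w)) (modulusM (2 * f w)) (modulusM 2) (modulus_nat K 2) [leRHS]mulrDl.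
have -> : L ^+ 2 * e ^+ 2 = (L * e) ^+ 2 by rewrite exprMn.
apply: lerD; first by rewrite lerXn2r ?nnegrE ?modulus_ge0 ?mulr_ge0 ?addr_ge0 ?mulr_ge0 ?modulus_ge0 // ltW.
by rewrite -[leRHS]mulrA ler_wpM2l // mulr_ge0 ?modulus_ge0.
Qed.

Lemma nz15 : (15 : cplx K) != 0. Proof. by rewrite pnatr_eq0. Qed.

Lemma derive_blaschke1 y : 1 + y / 4 != 0 ->
  derive1 (@blaschke K true) y = 2 * mobius y * (15 / 16 / (1 + y / 4) ^+ 2).
Proof.
move=> y0; have y4 : 4 + y != 0.
  have e : 1 + y / 4 = (4 + y) / 4 by field.
  by apply: contra_neq y0 => h; rewrite e h mul0r.
set a := modulus (4 + y); have a0 : 0 < a by rewrite modulus_gt0.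
apply: (@derive1_comp_sqr mobius y (15 / 16 / (1 + y / 4) ^+ 2) (a / 2) (15 * (2 / a * (a^-1 ^+ 2)))).
- by rewrite divr_gt0.
- by rewrite !mulr_ge0 ?invr_ge0 ?exprn_ge0 ?invr_ge0 ?ltW.
move=> z zd; have az : a / 2 <= modulus (4 + z).
  have := modulus_subl (4 + y) (y - z); have -> : 4 + y - (y - z) = 4 + z by ring.
  by rewrite -/a (modulusB y z); move: zd; lra.
have z4 : 4 + z != 0 by rewrite -modulus_gt0; apply: lt_le_trans az; rewrite divr_gt0.
have -> : mobius z - mobius y - 15 / 16 / (1 + y / 4) ^+ 2 * (z - y) =
    - (15 * ((4 + z)^-1 * (4 + y)^-1 ^+ 2)) * (z - y) ^+ 2.
  by rewrite /mobius; field; rewrite y4 z4.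
rewrite (modulusM _ ((z - y) ^+ 2)) modulusX ler_wpM2r ?exprn_ge0 ?modulus_ge0 //.
rewrite modulusN (modulusM 15) (modulus_nat K 15) ler_wpM2l //.
rewrite (modulusM (4 + z)^-1) modulusX !modulusV -/a ler_wpM2r ?exprn_ge0 ?invr_ge0 ?(ltW a0) //.
rewrite -[leRHS]invf_div lef_pV2 ?posrE ?modulus_gt0 // ?divr_gt0 //.
Qed.

Lemma nz_quarter z : modulus z < 4 -> 1 + z / 4 != 0.
Proof.
move=> z4; apply/eqP => h; have e : z = - 4.
  have -> : z = 4 * (1 + z / 4) - 4 by field.
  by rewrite h; ring.
by move: z4; rewrite e modulusN (modulus_nat K 4) ltxx.
Qed.

Lemma mobius_eq y v : modulus v = 1 -> mobius y = v -> y = (v - 4^-1) / (1 - v / 4).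
Proof.
move=> v1 yv; have v4 : 1 - v / 4 != 0.
  have -> : 1 - v / 4 = 1 + (- v) / 4 by rewrite mulNr.
  by apply: nz_quarter; rewrite modulusN v1; lra.
have y4 : 1 + y / 4 != 0.
  apply/eqP => y4; move: yv; rewrite /mobius y4 invr0 mulr0 => v0.
  by move: v1; rewrite -v0 modulus0; lra.
have : y + 4^-1 = v * (1 + y / 4) by rewrite -yv /mobius divfK.
move=> h; apply: (mulIf v4); rewrite divfK //.
have -> : y * (1 - v / 4) = (y + 4^-1) - 4^-1 - v * y / 4 by field.
by rewrite h; field.
Qed.

Lemma mobius_denom v : modulus v = 1 -> 4 - v != 0.
Proof. by move=> v1; apply/eqP => /subr0_eq h; move: v1; rewrite -h (modulus_nat K 4); lra. Qed.

Lemma mobius_K v : modulus v = 1 -> mobius ((v - 4^-1) / (1 - v / 4)) = v.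
Proof.
move=> /mobius_denom v4; rewrite /mobius; field.
rewrite v4 /=.
by have -> : (4 - v) * 4 + (v * 4 - 1) = 15 by [ring]; rewrite nz15.
Qed.

Lemma modulus_mobius_inv v : modulus v = 1 -> modulus ((v - 4^-1) / (1 - v / 4)) = 1.
Proof.
move=> v1; have v4 : 1 - v / 4 != 0.
  have -> : 1 - v / 4 = 1 + (- v) / 4 by rewrite mulNr.
  by apply: nz_quarter; rewrite modulusN v1; lra.
rewrite modulusM modulusV; apply: (canLR (mulfK _)); first by rewrite modulus_eq0.
rewrite mul1r; apply/eqP; rewrite -(@eqrXn2 _ 2) ?modulus_ge0 // !modulus_sqr.
have := congr1 (fun x => x ^+ 2) v1; rewrite modulus_sqr expr1n => h.
have e4 : (4^-1 : cplx K) = of_real 4^-1 by rewrite of_realV of_real_nat.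
have r4 : complex.Re (of_real 4^-1 : cplx K) = 4^-1 by [].
have i4 : complex.Im (of_real 4^-1 : cplx K) = 0 by [].
have r1 : complex.Re (1 : cplx K) = 1 by []. have i1 : complex.Im (1 : cplx K) = 0 by [].
rewrite e4 !(Re_sub, Im_sub, Re_mul, Im_mul) r4 i4 r1 i1.
by apply/eqP; move: (complex.Re v) (complex.Im v) h => x y h; nra.
Qed.

(** The value of (T w - z)^-1 at w = infinity, that is, the constant term of its partial fractions.
    T_1 takes the value 16 at infinity and T_0 has a pole there. *)
Definition pole b z : cplx K := if b then (16 - z)^-1 else 0.

(** Both maps are squares, so the fibre is found from the two square roots of z. The identities are
    the partial fractions of (T w - z)^-1 in w, whose residues are 1 / T' on the fibre; the second
    is the first at 1/w, since T (1/w) = 1 / T w. *)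
Lemma fibre_blaschke b z : modulus z = 1 -> exists y1 y2,
  [/\ y1 != y2, modulus y1 = 1 /\ modulus y2 = 1,
      [set y | @blaschke K b y = z] = [set y1; y2],
      forall w, modulus w < 1 ->
        (derive1 (@blaschke K b) y1)^-1 * (w - y1)^-1 +
        (derive1 (@blaschke K b) y2)^-1 * (w - y2)^-1 = (@blaschke K b w - z)^-1 - pole b z &
      forall w, w != 0 -> modulus w < 1 -> 1 - z * @blaschke K b w != 0 ->
        (derive1 (@blaschke K b) y1)^-1 * (w^-1 - y1)^-1 +
        (derive1 (@blaschke K b) y2)^-1 * (w^-1 - y2)^-1 =
          @blaschke K b w / (1 - z * @blaschke K b w) - pole b z].
Proof.
move=> z1; pose v : cplx K := sqrtC (z : K[i]).
have zv : z = v ^+ 2 by rewrite /v; apply/esym; exact: sqrtCK.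
have v1 : modulus v = 1.
  by apply/eqP; rewrite -(@eqrXn2 _ 2) ?modulus_ge0 // expr1n -modulusX -zv z1.
have Nv1 : modulus (- v) = 1 by rewrite modulusN.
have v0 : v != 0 by rewrite -modulus_gt0 v1.
have Nv0 : - v != 0 by rewrite oppr_eq0.
have vNv : v != - v by rewrite -subr_eq0 opprK -mulr2n mulrn_eq0.
have ne x y : modulus x = 1 -> modulus y < 1 -> y - x != 0.
  by move=> x1; rewrite subr_eq0; apply: contraTneq => ->; rewrite x1 ltxx.
have ne' x y : y != 0 -> modulus x = 1 -> modulus y < 1 -> 1 - x * y != 0.
  move=> y0 x1 y1; rewrite subr_eq0; apply: contraTneq y1 => h.
  have -> : modulus y = 1 by rewrite -[modulus y]mul1r -x1 -(modulusM x) -h modulus1.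
  by rewrite ltxx.
have lin (a b' c d a' b2 c' d' : cplx K) : a = a' -> b' = b2 -> c = c' -> d = d' ->
    a * b' + c * d = a' * b2 + c' * d' by move=> -> -> -> ->.
case: b.
- pose q u : cplx K := (u - 4^-1) / (1 - u / 4).
  have q1 u : modulus u = 1 -> modulus (q u) = 1 by exact: modulus_mobius_inv.
  have qK u : modulus u = 1 -> mobius (q u) = u by exact: mobius_K.
  have qn u : modulus u = 1 -> 1 + q u / 4 != 0.
    by move=> /q1 h; apply: nz_quarter; rewrite h; lra.
  have dq u : modulus u = 1 -> (derive1 (@blaschke K true) (q u))^-1 = 15 / 16 / (2 * u * (1 - u / 4) ^+ 2).
    move=> u1; have u0 : u != 0 by rewrite -modulus_gt0 u1.
    rewrite derive_blaschke1 ?qn // qK //.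
    have -> : 1 + q u / 4 = 15 / 16 / (1 - u / 4).
      by rewrite /q; field; exact: mobius_denom.
    by field; rewrite mobius_denom // u0.
  have p1 : 16 - z != 0.
    by apply/eqP => /subr0_eq h; move: z1; rewrite -h (modulus_nat K 16); lra.
  have d4 := mobius_denom v1; have d4' := mobius_denom Nv1; rewrite opprK in d4'.
  have dy w u : modulus u = 1 -> w != q u -> (w - q u)^-1 = (1 - u / 4) / (w + 4^-1 - u * (1 + w / 4)).
    move=> u1 h; have u4 := mobius_denom u1.
    have -> : w + 4^-1 - u * (1 + w / 4) = (w - q u) * (1 - u / 4) by rewrite /q; field.
    have n0 : w - q u != 0 by rewrite subr_eq0.
    move: (w - q u) n0 => x n0.
    by field; rewrite u4 n0.
  exists (q v), (q (- v)); split; [|by rewrite !q1| | |].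
  + by apply: contra_neq vNv => /(congr1 mobius); rewrite !qK.
  + apply/seteqP; split => y /=.
      rewrite blaschke1E zv => /eqP; rewrite eqf_sqr => /orP[]/eqP h.
        by left; apply: mobius_eq.
      by right; apply: mobius_eq.
    by case=> ->; rewrite blaschke1E qK // ?sqrrN -zv.
  + move=> w w1.
    have w4 : 1 + w / 4 != 0 by apply: nz_quarter; lra.
    have W4 : 4 + w != 0.
      have e : 1 + w / 4 = (4 + w) / 4 by field.
      by apply: contra_neq w4 => h; rewrite e h mul0r.
    have nw u : modulus u = 1 -> w != q u by move=> u1; rewrite -subr_eq0 ne ?q1.
    apply: etrans (lin _ _ _ _ _ _ _ _ (dq v v1) (dy w v v1 (nw _ v1)) (dq _ Nv1) (dy w (- v) Nv1 (nw _ Nv1))) _.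
    have nq u : modulus u = 1 -> w * 4 + 1 - u * (4 + w) != 0.
      move=> u1; have -> : w * 4 + 1 - u * (4 + w) = (w - q u) * (4 - u) by rewrite /q; field; exact: mobius_denom.
      by rewrite mulf_neq0 ?mobius_denom // ne ?q1.
    rewrite blaschke1E /mobius /pole zv; field.
    rewrite -zv p1 W4 v0 d4 (opprK v) d4' (nq _ v1) (nq _ Nv1) zv mulNr -exprMn subr_sqr /= andbT.
    by rewrite mulf_neq0 ?(nq _ v1) //; have := nq _ Nv1; rewrite mulNr opprK.
  move=> w w0 w1 h.
  have w4 : 1 + w / 4 != 0 by apply: nz_quarter; lra.
  have W4 : 4 + w != 0.
    have e : 1 + w / 4 = (4 + w) / 4 by field.
    by apply: contra_neq w4 => h'; rewrite e h' mul0r.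
  have nV u : modulus u = 1 -> w^-1 != u.
    move=> u1; apply: contraTneq w1 => e.
    by rewrite -[w]invrK modulusV e u1 invr1 ltxx.
  apply: etrans (lin _ _ _ _ _ _ _ _ (dq v v1) (dy w^-1 v v1 (nV _ (q1 _ v1))) (dq _ Nv1) (dy w^-1 (- v) Nv1 (nV _ (q1 _ Nv1)))) _.
  have nq u : modulus u = 1 -> 4 + w - u * (4 * w + 1) != 0.
    move=> u1; have -> : 4 + w - u * (4 * w + 1) = (w^-1 - q u) * w * (4 - u) by rewrite /q; field; rewrite w0 mobius_denom.
    by rewrite !mulf_neq0 ?mobius_denom // subr_eq0 nV ?q1.
  move: h; rewrite blaschke1E /mobius /pole zv => h; field.
  have n1 : 4 + w - v * (w * 4 + 1) != 0 by rewrite (mulrC w); exact: nq.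
  have n2 : 4 + w - (- v) * (w * 4 + 1) != 0 by rewrite (mulrC w); exact: nq.
  rewrite -zv p1 w0 W4 v0 d4 (opprK v) d4' n1 n2 subr_sqr /= andbT.
  by rewrite (mulf_neq0 n1) //; move: n2; rewrite mulNr opprK.
exists v, (- v); split => //.
- apply/seteqP; split => y /=.
    by rewrite blaschke0E zv => /eqP; rewrite eqf_sqr => /orP[]/eqP; [left|right].
  by case=> ->; rewrite blaschke0E ?sqrrN -zv.
- move=> w w1; rewrite !derive_blaschke0 blaschke0E zv /pole; field.
  have n1 := ne _ _ v1 w1; have n2 := ne _ _ Nv1 w1.
  by rewrite v0 n1 n2 subr_sqr mulf_neq0 //; move: n2; rewrite opprK.
move=> w w0 w1; rewrite !derive_blaschke0 blaschke0E zv /pole => h; field.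
have n1 := ne' _ _ w0 v1 w1; have n2 := ne' _ _ w0 Nv1 w1.
have e : 1 - (v * w) ^+ 2 != 0.
  have -> : 1 - (v * w) ^+ 2 = (1 - v * w) * (1 - (- v) * w) by ring.
  by rewrite mulf_neq0.
have n1' : 1 + - v * w != 0 by rewrite mulNr.
have n2' : 1 + - - v * w != 0 by rewrite (mulNr (- v)).
by rewrite e w0 n2' v0 n1'.
Qed.

End Transfer.

(** * Duality between transfer and composition *)

Section PerronFrobenius.
Variable K : realType.
Implicit Types (f g : cplx K -> cplx K) (z w y v : cplx K) (a s : K).

Lemma avg_geometric_series (F q : K -> cplx K) (M t : K) : continuous F -> continuous q ->
  0 <= t < 1 -> (forall x, modulus (F x) <= M) -> (forall x, modulus (q x) <= t) ->
  series (fun k => avg (fun x => F x * q x ^+ k)) @ \oo --> avg (fun x => F x / (1 - q x)).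
Proof.
move=> cF cq t01 FM qt.
have h := avg_geometric cF cq t01 FM qt.
have := @avg_series K (fun k _ => avg (fun x => F x * q x ^+ k))
  (fun=> avg (fun x => F x / (1 - q x))) (M / (1 - t)) t.
rewrite (avg_cst (avg _)).
have -> : (fun k => avg (fun=> avg (fun x => F x * q x ^+ k))) = (fun k => avg (fun x => F x * q x ^+ k)).
  by apply/funext => k; exact: avg_cst.
apply; [|exact: t01|by move=> _; exact: h].
by move=> k; exact: continuous_cst_fun.
Qed.

Variable R : K.
Hypothesis hR : 0 < R < 1.

Let R0 : 0 < R. Proof. by case/andP: hR. Qed.

(** The unit circle lies in the annulus, and pairings may be evaluated on it by [pair_radius]. *)
Lemma pair_circle f g s e k : analytic_annulus R f -> analytic_annulus R g -> R < s < 1 ->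
  (forall z, modulus z = 1 -> f z = g z) -> pair s e f (monom k) = pair s e g (monom k).
Proof.
move=> hf hg hs fg.
have RR : R < 1 < R^-1 by case/andP: hR => ? ?; rewrite invf_gt1 ?andbT //; apply/andP.
rewrite (pair_radius hR k e hf hs RR) (pair_radius hR k e hg hs RR).
by apply: eq_avg => t; rewrite fg // modulus_circ.
Qed.

Section Kernels.
Variables (f : cplx K -> cplx K) (s : K).
Hypothesis hf : analytic_annulus R f.
Hypothesis hs : R < s < 1.

Definition wavg e (h : K -> cplx K) := avg (fun t => f (pcirc s e t) * pcirc s e t * h t).

Let s0 : 0 < s. Proof. by case/andP: hs => ? _; exact: lt_trans R0 _. Qed.

Lemma wavg_lin e c d (h k : K -> cplx K) : continuous h -> continuous k ->
  wavg e (fun t => c * h t + d * k t) = c * wavg e h + d * wavg e k.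
Proof.
move=> ch ck; have cw := continuous_weight hR (e := e) hf hs.
have c1 := continuousM_fun cw ch; have c2 := continuousM_fun cw ck.
rewrite /wavg -(avgZ c c1) -(avgZ d c2) -(avgD (continuousZ_fun (c := c) c1) (continuousZ_fun (c := d) c2)).
by apply: eq_avg => t; ring.
Qed.

Lemma eq_wavg e (h k : K -> cplx K) : (forall t, h t = k t) -> wavg e h = wavg e k.
Proof. by move=> hk; apply: eq_avg => t; rewrite hk. Qed.

Lemma pcirc_sub_neq0 e t y : modulus y = 1 -> pcirc s e t - y != 0.
Proof.
move=> y1; rewrite subr_eq0; apply/eqP => h.
have := pcirc_modulus e t s0; rewrite h y1; case/andP: hs => _ s1.
by case: e {h} => e1; [have := invf_gt1 s0; rewrite s1 -e1 ltxx|move: s1; rewrite -e1 ltxx].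
Qed.

Lemma continuous_kernel e y : modulus y = 1 -> continuous (fun t => (pcirc s e t - y)^-1).
Proof.
move=> y1; apply: continuousV_fun => [|t]; last exact: pcirc_sub_neq0.
by apply: continuousB_fun; [exact: continuous_pcirc|exact: (@continuous_cst_fun _ y)].
Qed.

Lemma cauchy_unit_circle y : modulus y = 1 ->
  f y = wavg true (fun t => (pcirc s true t - y)^-1) - wavg false (fun t => (pcirc s false t - y)^-1).
Proof.
move=> y1; case/andP: (hs) => Rs s1.
have RV : s^-1 < R^-1 by rewrite ltf_pV2 ?posrE.
have sV : 1 < s^-1 by rewrite invf_gt1.
rewrite (@cauchy_annulus _ f R R^-1 s s^-1 y) ?y1 ?Rs ?s1 ?sV //.
by congr (_ - _); apply: eq_avg => t; rewrite [LHS]mulrA.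
Qed.

End Kernels.

Section Symbol.
Variables (b : bool) (s r : K).
Local Notation T := (@blaschke K b).
Hypothesis hs : R < s < 1.
Hypothesis hr : 0 < r < R.
Hypothesis Tr : forall z, modulus z <= s -> modulus (T z) <= r.

Let s0 : 0 < s. Proof. by case/andP: hs => ? _; exact: lt_trans R0 _. Qed.
Let r1 : r < 1. Proof. by case/andP: hr => _ rR; case/andP: hR => _; exact: lt_trans. Qed.

Lemma dalg_blaschke : dalg s T.
Proof.
case: b; last exact: (dalgX s0 2 (dalg_id s)).
apply: (@dalgX _ _ s0 (@mobius K)); apply: (dalgM s0); first exact: dalgD (dalg_id s) (dalg_cst s _).
have h : modulus (4^-1 : cplx K) * s < 1.
  by rewrite modulusV (modulus_nat K 4); case/andP: hs => _; lra.
by apply: dalg_ext (dalg_inv s0 h) => z _; rewrite (mulrC z).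
Qed.

Lemma continuous_symbol e : continuous (fun t => T (parg e (pcirc s e t))).
Proof.
apply: dalg_continuous dalg_blaschke _ _; first exact: continuous_parg.
by move=> t; rewrite parg_modulus.
Qed.

Lemma dalg_power k : dalg s (fun z => T z ^+ k).
Proof. exact: (dalgX s0 k dalg_blaschke). Qed.

(** The powers T^k are at most r^k on the disc with r < R, so their pairings with [f] are admissible
    data. In order 0 they agree on both circles because T^0 = 1. *)
Lemma perron_frobenius_realized f : hardy R f -> exists2 g, hardy R g &
  forall e k, pair s e g (monom k) = pair s e f (fun z => T z ^+ k).
Proof.
move=> hf; have [C C0 hC] := pair_bound hR hs.
have af := hardy_analytic hf.
have [|e k||g hg gp] := hardy_realize hR (alpha := fun e k => pair s e f (fun z => T z ^+ k))
  hr (A := C * hardy_norm R f).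
- by rewrite mulr_ge0 ?hardy_norm_ge0.
- apply: hC => //; first exact: dalg_power.
  by move=> z /Tr h; rewrite modulusX lerXn2r ?nnegrE ?modulus_ge0 // (le_trans (modulus_ge0 _) h).
- have := pair_const hR af hs; rewrite /pair /monom => h.
  by under eq_avg do rewrite expr0; under [RHS]eq_avg do rewrite expr0.
exists g; first exact: hg.
by move=> e k; exact: gp.
Qed.

(** Cauchy's formula at the two points of the fibre, whose kernels are then added by partial
    fractions. The constant [pole b z] multiplies the difference of the two pairings of order 0,
    which vanishes. *)
Lemma fibre_sum f z : analytic_annulus R f -> modulus z = 1 ->
  \sum_(y \in [set y | T y = z]) f y / derive1 T y =
  wavg f s true (fun t => T (parg true (pcirc s true t)) / (1 - z * T (parg true (pcirc s true t)))) -
  wavg f s false (fun t => (T (parg false (pcirc s false t)) - z)^-1).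
Proof.
move=> af z1; have [y1 [y2 [y12 [y1m y2m] -> inner outer]]] := fibre_blaschke b z1.
have -> : \sum_(y \in [set y1; y2]) f y / derive1 T y = f y1 / derive1 T y1 + f y2 / derive1 T y2.
  rewrite fsbigU0 ?fsbig_set1 //; last 1 first.
  - by move=> y [/= -> e]; move: y12; rewrite e eqxx.
have ck e y : modulus y = 1 -> continuous (fun t => (pcirc s e t - y)^-1).
  by move=> h; apply: (continuous_kernel (y := y) hs (e := e)).
pose kap := pole b z.
suff main (c1 c2 : cplx K) :
    (forall w, modulus w < 1 -> c1 * (w - y1)^-1 + c2 * (w - y2)^-1 = (T w - z)^-1 - kap) ->
    (forall w, w != 0 -> modulus w < 1 -> 1 - z * T w != 0 ->
      c1 * (w^-1 - y1)^-1 + c2 * (w^-1 - y2)^-1 = T w / (1 - z * T w) - kap) ->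
    f y1 * c1 + f y2 * c2 =
      wavg f s true (fun t => T (parg true (pcirc s true t)) / (1 - z * T (parg true (pcirc s true t)))) -
      wavg f s false (fun t => (T (parg false (pcirc s false t)) - z)^-1).
  exact: main inner outer.
move=> {}inner {}outer; rewrite (cauchy_unit_circle af hs y1m) (cauchy_unit_circle af hs y2m).
have E e : c1 * wavg f s e (fun t => (pcirc s e t - y1)^-1) +
    c2 * wavg f s e (fun t => (pcirc s e t - y2)^-1) =
    wavg f s e (fun t => (if e then T (parg true (pcirc s true t)) / (1 - z * T (parg true (pcirc s true t)))
       else (T (parg false (pcirc s false t)) - z)^-1) - kap).
  rewrite -(wavg_lin af hs e c1 c2 (ck e _ y1m) (ck e _ y2m)); apply: eq_wavg => t.
  have := parg_modulus e t s0; have := pcirc_neq0 e t s0.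
  case: e => /= [w0 ws|w0 ws]; last by rewrite inner // /parg ws; case/andP: hs.
  rewrite -[pcirc s true t]invrK outer -/(parg true _) ?ws ?invrK //.
  - by rewrite /parg invr_eq0.
  - by case/andP: hs.
  - rewrite /parg -/(parg true (pcirc s true t)); apply/eqP => /subr0_eq h.
    have : modulus (z * T (parg true (pcirc s true t))) <= r by rewrite (modulusM z) z1 mul1r; apply: Tr; rewrite ws.
    by rewrite -h modulus1; move: r1; lra.
have cK e : continuous (fun t => if e then T (parg true (pcirc s true t)) / (1 - z * T (parg true (pcirc s true t)))
       else (T (parg false (pcirc s false t)) - z)^-1).
  have cT e' := continuous_symbol (e := e').
  case: e {E}.
    apply: continuousM_fun (cT true) _; apply: continuousV_fun => [|t].
      by apply: continuousB_fun (continuousZ_fun (c := z) (cT true)); exact: continuous_cst_fun.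
    apply/eqP => /subr0_eq h.
    have : modulus (z * T (parg true (pcirc s true t))) <= r.
      by rewrite (modulusM z) z1 mul1r; apply: Tr; rewrite parg_modulus.
    by rewrite -h modulus1; move: r1; lra.
  apply: continuousV_fun => [|t].
    by apply: continuousB_fun (cT false) _; exact: continuous_cst_fun.
  apply/eqP => /subr0_eq h.
  have : modulus (T (parg false (pcirc s false t))) <= r by apply: Tr; rewrite parg_modulus.
  by rewrite h z1; move: r1; lra.
have L e (k : K -> cplx K) : continuous k ->
    wavg f s e (fun t => k t - kap) = wavg f s e k - kap * pair s e f (monom 0).
  move=> ck'; have := wavg_lin af hs e 1 (- kap) ck' (@continuous_cst_fun _ 1).
  have -> : wavg f s e (fun=> 1) = pair s e f (monom 0) by [].
  move=> h; apply: etrans (etrans h _); first by apply: eq_wavg => t; rewrite mul1r mulr1.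
  by rewrite mul1r mulNr.
have := E true; have := E false; rewrite (L _ _ (cK true)) (L _ _ (cK false)) (pair_const hR af hs).
move: (wavg f s true (fun t => (pcirc s true t - y1)^-1)) (wavg f s true (fun t => (pcirc s true t - y2)^-1)).
move: (wavg f s false (fun t => (pcirc s false t - y1)^-1)) (wavg f s false (fun t => (pcirc s false t - y2)^-1)).
move: (wavg f s true _) (wavg f s false _) => X Y a1 a2 a3 a4 e1 e2.
have -> : (a3 - a1) * c1 + (a4 - a2) * c2 = (c1 * a3 + c2 * a4) - (c1 * a1 + c2 * a2) by ring.
by rewrite e1 e2; ring.
Qed.

(** On the unit circle the Laurent series of g is a geometric series under the mean, in powers of z
    T on the outer circle and of T / z on the inner one, both of ratio at most r. *)
Lemma realized_series f g z : analytic_annulus R f -> analytic_annulus R g ->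
  (forall e k, pair s e g (monom k) = pair s e f (fun z => T z ^+ k)) -> modulus z = 1 ->
  g z = wavg f s true (fun t => T (parg true (pcirc s true t)) / (1 - z * T (parg true (pcirc s true t)))) -
  wavg f s false (fun t => (T (parg false (pcirc s false t)) - z)^-1).
Proof.
move=> af ag gp z1.
have [M M0 hM] : exists2 M : K, 0 <= M & forall e t, modulus (f (pcirc s e t) * pcirc s e t) <= M.
  have [M1 M10 h1] := sup_circ hR true af hs; have [M2 M20 h2] := sup_circ hR false af hs.
  have sV : 0 <= s^-1 by rewrite invr_ge0 ltW.
  exists ((M1 + M2) * s^-1) => [|e t]; first by rewrite mulr_ge0 ?addr_ge0.
  rewrite (modulusM (f _)); apply: ler_pM; rewrite ?modulus_ge0 //.
    by case: e; [apply: le_trans (h1 t) _|apply: le_trans (h2 t) _]; lra.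
  rewrite pcirc_modulus //; case: e => //.
  by apply: le_trans (_ : _ <= 1) _; case/andP: hs => _ s1; [exact: ltW|rewrite ltW // invf_gt1].
have cw e := continuous_weight hR (e := e) af hs.
have cT e := continuous_symbol (e := e).
have z0 : z != 0 by rewrite -modulus_gt0 z1.
have Tt e t : modulus (T (parg e (pcirc s e t))) <= r by apply: Tr; rewrite parg_modulus.
have r01 : 0 <= r < 1 by rewrite r1 andbT; case/andP: hr => /ltW.
have S1 := @avg_geometric_series
  (fun t => f (pcirc s true t) * pcirc s true t * T (parg true (pcirc s true t)))
  (fun t => z * T (parg true (pcirc s true t))) (M * r) r
  (continuousM_fun (cw true) (cT true)) (continuousZ_fun (c := z) (cT true)) r01.
have S2 := @avg_geometric_series
  (fun t => z^-1 * (f (pcirc s false t) * pcirc s false t))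
  (fun t => z^-1 * T (parg false (pcirc s false t))) M r
  (continuousZ_fun (c := z^-1) (cw false)) (continuousZ_fun (c := z^-1) (cT false)) r01.
apply: (cvg_series_unique (u := laurent s g z)).
  apply: (laurent_series hR ag hs); rewrite z1; case/andP: hs => Rs s1.
  by rewrite s1 invf_gt1.
have {}S1 : series (fun k => z ^+ k * pair s true g (monom k.+1)) @ \oo -->
    wavg f s true (fun t => T (parg true (pcirc s true t)) / (1 - z * T (parg true (pcirc s true t)))).
  have -> : (fun k => z ^+ k * pair s true g (monom k.+1)) = (fun k => avg (fun x =>
      f (pcirc s true x) * pcirc s true x * T (parg true (pcirc s true x)) *
      (z * T (parg true (pcirc s true x))) ^+ k)).
    apply/funext => k; rewrite gp /pair -avgZ; last first.
      by apply: continuousM_fun (cw true) _; exact: continuousX_fun (cT true).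
    by apply: eq_avg => t; rewrite exprMn exprS; ring.
  rewrite (_ : wavg _ _ _ _ = avg (fun x => f (pcirc s true x) * pcirc s true x *
    T (parg true (pcirc s true x)) / (1 - z * T (parg true (pcirc s true x))))); last first.
    by apply: eq_avg => t; rewrite mulrA.
  apply: S1 => x; last by rewrite (modulusM z) z1 mul1r.
  by rewrite (modulusM (f _ * _)); apply: ler_pM; rewrite ?modulus_ge0.
have {}S2 : series (fun k => z^-1 ^+ k.+1 * pair s false g (monom k)) @ \oo -->
    - wavg f s false (fun t => (T (parg false (pcirc s false t)) - z)^-1).
  have -> : (fun k => z^-1 ^+ k.+1 * pair s false g (monom k)) = (fun k => avg (fun x =>
      z^-1 * (f (pcirc s false x) * pcirc s false x) *
      (z^-1 * T (parg false (pcirc s false x))) ^+ k)).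
    apply/funext => k; rewrite gp /pair -avgZ; last first.
      by apply: continuousM_fun (cw false) _; exact: continuousX_fun (cT false).
    by apply: eq_avg => t; rewrite exprMn exprS; ring.
  have nz t : T (parg false (pcirc s false t)) - z != 0.
    apply/eqP => /subr0_eq h; have := Tt false t; rewrite h z1; move: r1; lra.
  rewrite (_ : - wavg _ _ _ _ = avg (fun x => z^-1 * (f (pcirc s false x) * pcirc s false x) /
    (1 - z^-1 * T (parg false (pcirc s false x))))); last first.
    rewrite -mulN1r /wavg -avgZ; last first.
      apply: continuousM_fun (cw false) _; apply: continuousV_fun nz.
      by apply: continuousB_fun (cT false) _; exact: continuous_cst_fun.
    apply: eq_avg => t; move: (nz t); move: (f _ * _) (T _) => F q h.
    by field; rewrite h z0 -oppr_eq0 opprB h.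
  apply: S2 => x; last by rewrite (modulusM z^-1) modulusV z1 invr1 mul1r.
  by rewrite (modulusM z^-1) modulusV z1 invr1 mul1r.
have -> : laurent s g z = (fun k => z ^+ k * pair s true g (monom k.+1)) +
    (fun k => z^-1 ^+ k.+1 * pair s false g (monom k)) by [].
by rewrite seriesD; exact: cvgD S1 S2.
Qed.

(** The chosen element is prescribed on the unit circle only. There it agrees with the realised
    element, hence so do the pairings with monomials, and density gives all test functions. *)
Theorem perron_frobenius_pair f : hardy R f -> hardy R (perron_frobenius R T f) /\
  forall e g, dalg s g -> pair s e (perron_frobenius R T f) g = pair s e f (fun z => g (T z)).
Proof.
move=> hf; have af := hardy_analytic hf.
have [g hg gp] := perron_frobenius_realized hf; have ag := hardy_analytic hg.
set D := [set h | hardy R h /\ forall z, circle 1 z -> h z =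
  \sum_(y \in [set y | T y = z]) f y / derive1 T y].
have : D (perron_frobenius R T f).
  apply: xgetPex; exists g; split => // z z1.
  by rewrite (fibre_sum af z1) (realized_series af ag gp z1).
move: (perron_frobenius R T f) => h [hh hE]; split => // e; have ah := hardy_analytic hh.
have Ts z : modulus z <= s -> modulus (T z) <= s.
  by move/Tr => h1; apply: le_trans h1 _; case/andP: hs => + _; case/andP: hr => _; lra.
apply: (bfunc_eq s0 (pair_bfunc hR e ah hs)).
- have [lin [M M0 hM]] := pair_bfunc hR e af hs.
  split=> [c u v hu hv|]; first by rewrite lin //; apply: dalg_comp => //; exact: dalg_blaschke.
  exists M => // u x hu ux; apply: hM => [|z zs]; last exact/ux/Ts.
  by apply: dalg_comp => //; exact: dalg_blaschke.
move=> k; rewrite -gp; apply: (pair_circle _ _ ah ag hs) => z z1.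
by rewrite (hE z z1) (fibre_sum af z1) (realized_series af ag gp z1).
Qed.

End Symbol.
End PerronFrobenius.

(** * Gaussian noise *)

Section GaussianAverage.
Variable K : realType.
Local Notation mu := (@lebesgue_measure K).
Implicit Types (b c t : K).

Definition gweight t : K := expR (- (t ^+ 2 / 2)).

(** A Gaussian of doubled variance; it absorbs factors of linear growth in [t] and serves as
    dominating function. *)
Let half_gweight t : K := expR (- (t ^+ 2 / 4)).

Lemma integrable_normal_fun (s : K) : s != 0 -> mu.-integrable setT (EFin \o normal_fun 0 s).
Proof.
move=> s0; have := @integrable_normal_pdf K 0 s.
rewrite (normal_pdfE 0 s0) => /(integrable_scale (normal_peak s)^-1 measurableT).
apply: eq_integrable => // t _ /=; congr EFin; rewrite mulKf // gt_eqF // normal_peak_gt0 //.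
Qed.

Lemma integrable_gweight : mu.-integrable setT (EFin \o gweight).
Proof.
have := integrable_normal_fun (oner_neq0 K); apply: eq_integrable => // t _ /=.
by rewrite /normal_fun /gweight subr0 expr1n mulNr.
Qed.

Lemma integrable_half_gweight : mu.-integrable setT (EFin \o half_gweight).
Proof.
have s0 : Num.sqrt 2 != 0 :> K by rewrite sqrtr_eq0 -ltNge.
have := integrable_normal_fun s0; apply: eq_integrable => // t _ /=.
rewrite /normal_fun /half_gweight subr0 sqr_sqrtr // mulNr; congr ((expR (- (_ / _)))%:E).
by rewrite -mulr_natl; ring.
Qed.

Lemma integral_gweight : \int[mu]_t gweight t = Num.sqrt (2 * pi).
Proof.
have h := @integral_normal_pdf K 0 1; have p0 := normal_peak_gt0 (oner_neq0 K).
have : normal_peak 1 * \int[mu]_t gweight t = 1.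
  rewrite -RintegralZl //; last exact: integrable_gweight.
  rewrite /Rintegral -[RHS]/(fine 1%:E) -h; congr fine; apply: eq_integral => t _.
  by rewrite normal_pdfE ?oner_neq0 // /normal_fun /gweight subr0 expr1n mulNr.
rewrite -[Num.sqrt _](mulKf (lt0r_neq0 p0)) => h1.
apply: (mulfI (lt0r_neq0 p0)); rewrite h1 mulKf ?gt_eqF //.
rewrite /normal_peak expr1n mul1r -mulr_natl mulVf // sqrtr_eq0 -ltNge.
exact: twopi_gt0.
Qed.

Lemma gweight_ge0 t : 0 <= gweight t. Proof. exact: expR_ge0. Qed.

Lemma gweight_decay t : (1 + `|t|) * gweight t <= 2 * half_gweight t.
Proof.
have h : 1 + t ^+ 2 / 4 <= expR (t ^+ 2 / 4) by exact: expR_ge1Dx.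
have -> : half_gweight t = expR (t ^+ 2 / 4) * gweight t.
  by rewrite /half_gweight /gweight -expRD; congr expR; field.
rewrite mulrA ler_wpM2r ?gweight_ge0 //.
apply: le_trans (_ : _ <= 2 * (1 + t ^+ 2 / 4)) _; last by rewrite ler_pM2l.
have : t ^+ 2 = `|t| ^+ 2 by rewrite real_normK ?num_real.
by move=> ->; nra.
Qed.

Lemma continuous_gweight : continuous gweight.
Proof.
move=> t; apply: (@continuous_comp _ _ _ (fun t => - (t ^+ 2 / 2)) expR); last exact: continuous_expR.
apply: (@cvgN _ K^o); apply: cvgM; last exact: cvg_cst.
exact: exprn_continuous.
Qed.

Lemma gweight_domin (g : K -> K) (M : K) : continuous g -> 0 <= M ->
  (forall t, `|g t| <= M * (1 + `|t|)) -> mu.-integrable setT (EFin \o (fun t => g t * gweight t)).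
Proof.
move=> cg M0 hg.
apply: (le_integrable measurableT _ _ (integrable_scale (M * 2) measurableT integrable_half_gweight)).
  apply/measurable_EFinP; apply: continuous_measurable_fun => t.
  by apply: cvgM; [exact: cg|exact: continuous_gweight].
move=> t _; rewrite /= lee_fin normrM (ger0_norm (gweight_ge0 t)).
rewrite [leRHS]ger0_norm ?mulr_ge0 ?expR_ge0 //.
apply: le_trans (ler_wpM2r (gweight_ge0 t) (hg t)) _.
by rewrite -!mulrA ler_wpM2l // gweight_decay.
Qed.

(** The fundamental theorem on the interval from -n to n, with both boundary terms tending to 0, and
    dominated convergence. *)
Lemma integral_deriv0 (f F : K -> K) : mu.-integrable setT (EFin \o f) -> continuous f ->
  (forall t, is_derive t (1 : K) F (f t)) ->
  F n%:R @[n --> \oo] --> (0 : K) -> F (- n%:R) @[n --> \oo] --> (0 : K) ->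
  \int[mu]_t f t = 0.
Proof.
move=> itf cf dF F1 F2.
pose f_ (n : nat) (t : K) : \bar K := ((EFin \o f) \_ `[- n%:R, n%:R]) t.
have mf : measurable_fun setT (EFin \o f) by case/integrableP: itf.
have mf_ n : measurable_fun setT (f_ n).
  by rewrite /f_; apply/(measurable_restrictT _ (measurable_itv _)); exact: measurable_funS mf.
have cv : {ae mu, forall x, setT x -> f_ ^~ x @ \oo --> (EFin \o f) x}.
  apply/aeW => x _; apply: cvg_near_cst; near=> n; rewrite /f_ patchE ifT // inE /= in_itv /=.
  by rewrite -ler_norml; near: n; exact: nbhs_infty_ger.
have iaf : mu.-integrable setT (fun x => (`|f x|)%:E).
  by have := integrable_abse itf; apply: eq_integrable.
have dom : {ae mu, forall x n, setT x -> (`|f_ n x| <= (`|f x|)%:E)%E}.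
  apply/aeW => x n _; rewrite /f_ patchE; case: ifP => _; first by rewrite abse_EFin.
  by rewrite abse0 lee_fin.
have [_ _ lim] := @dominated_convergence _ _ K mu setT measurableT f_ (EFin \o f) (fun x => (`|f x|)%:E) mf_ mf cv iaf dom.
have dF' t : derivable F t 1 by have := dF t => /(@ex_derive _ _ _ _ _ _ _).
have cF : continuous F by move=> t; apply: differentiable_continuous; apply/derivable1_diffP.
have E n : (0 < n)%N -> (\int[mu]_x f_ n x = (F n%:R - F (- n%:R))%:E)%E.
  move=> n0; rewrite /f_ -integral_mkcond.
  rewrite (@continuous_FTC2 _ f F) //.
  - by rewrite ltrNl -subr_gt0 opprK addr_gt0 // ltr0n.
  - exact: continuous_subspaceT.
  - split; first by move=> x _; exact: dF'.
      by apply: cvg_at_right_filter; exact: cF.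
    by apply: cvg_at_left_filter; exact: cF.
  - by move=> x _; rewrite derive1E; exact: (@derive_val _ _ _ _ _ _ _ (dF x)).
rewrite /Rintegral; have -> // : (\int[mu]_x (f x)%:E = 0%:E)%E.
apply: (cvg_unique _ lim) => //.
apply: (@cvg_trans _ ((F n%:R - F (- n%:R))%:E @[n --> \oo])).
  by apply: near_eq_cvg; near=> n; rewrite -E //; near: n; exact: nbhs_infty_gt.
apply: cvg_EFin; first by apply/nearW.
by rewrite -[0](subrr 0); apply: cvgB.
Unshelve. all: by end_near. Qed.

Lemma half_square_derive t : is_derive t (1 : K) (fun t : K => t ^+ 2 / 2) t.
Proof.
have -> : (fun t : K => t ^+ 2 / 2) = (fun t => (t * t) * 2^-1) by [].
apply: is_derive_eq (@is_deriveM _ _ (fun t : K => t * t) (fun=> 2^-1) t (1 : K) _ _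
  (@is_deriveM _ _ id id t (1 : K) _ _ (is_derive_id _ _) (is_derive_id _ _)) (is_derive_cst _ _ _)) _.
by rewrite /GRing.scale /=; field.
Qed.

Lemma gweight_derive t : is_derive t (1 : K) gweight (- t * gweight t).
Proof.
have h : is_derive t (1 : K) (fun t : K => - (t ^+ 2 / 2)) (- t).
  by apply: is_derive_eq (is_deriveN (half_square_derive t)) _.
apply: is_derive_eq (@is_derive1_comp _ expR (fun t : K => - (t ^+ 2 / 2)) t _ _ (is_derive_expR _) h) _.
by rewrite mulrC.
Qed.

Lemma linear_derive b c t : is_derive t (1 : K) (fun t => t * b + c) b.
Proof.
apply: is_derive_eq (is_deriveD (is_deriveM (is_derive_id t (1 : K)) (is_derive_cst b t (1 : K)))
  (is_derive_cst c t (1 : K))) _.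
by rewrite /GRing.scale /=; ring.
Qed.

Lemma sin_derive b c t : is_derive t (1 : K) (fun t => sin (t * b + c)) (b * cos (t * b + c)).
Proof.
apply: is_derive_eq (@is_derive1_comp _ sin (fun t : K => t * b + c) t _ _ (is_derive_sin _) (linear_derive b c t)) _.
by rewrite mulrC.
Qed.

Lemma cos_derive b c t : is_derive t (1 : K) (fun t => cos (t * b + c)) (- b * sin (t * b + c)).
Proof.
apply: is_derive_eq (@is_derive1_comp _ cos (fun t : K => t * b + c) t _ _ (is_derive_cos _) (linear_derive b c t)) _.
by rewrite mulrC mulNr mulrN.
Qed.

Lemma abs_cos_le1 (x : K) : `|cos x| <= 1.
Proof. by rewrite ler_norml cos_geN1 cos_le1. Qed.

Lemma abs_sin_le1 (x : K) : `|sin x| <= 1.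
Proof. by rewrite ler_norml sin_geN1 sin_le1. Qed.

Lemma continuous_lin b c : continuous (fun t => t * b + c).
Proof.
move=> t; apply: cvgD; last exact: cvg_cst.
by apply: cvgM; [exact: cvg_id|exact: cvg_cst].
Qed.

Lemma continuous_cosl b c : continuous (fun t => cos (t * b + c)).
Proof.
move=> t; apply: (@continuous_comp _ _ _ (fun t => t * b + c) cos); first exact: continuous_lin.
exact: continuous_cos.
Qed.

Lemma continuous_sinl b c : continuous (fun t => sin (t * b + c)).
Proof.
move=> t; apply: (@continuous_comp _ _ _ (fun t => t * b + c) sin); first exact: continuous_lin.
exact: continuous_sin.
Qed.

Lemma gweight_cvg0 (u : nat -> K) (g : K -> K) : (forall n, `|u n| = n%:R) -> (forall t, `|g t| <= 1) ->
  g (u n) * gweight (u n) @[n --> \oo] --> (0 : K).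
Proof.
move=> hu hg; apply/cvgr0Pnorm_lt => e e0; near=> n.
have nbig : 2 / e < n%:R by near: n; exact: nbhs_infty_gtr.
have d1 : 0 < 1 + n%:R :> K by rewrite ltr_wpDr.
have h : (1 + n%:R) * gweight (u n) <= 2.
  rewrite -(hu n); apply: le_trans (gweight_decay _) _; rewrite ger_pMr //.
  by rewrite -[leRHS]expR0 ler_expR oppr_le0 divr_ge0 // sqr_ge0.
rewrite normrM (ger0_norm (gweight_ge0 _)).
apply: le_lt_trans (ler_piMl (gweight_ge0 _) (hg _)) _.
rewrite -(ltr_pM2l d1); apply: le_lt_trans h _.
by move: nbig; rewrite ltr_pdivrMr //; nra.
Unshelve. all: by end_near. Qed.

(** Stein's identity: the difference of the two integrands is the derivative of sin (t b + c) times
    the Gaussian weight, up to sign. *)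
Lemma gauss_stein b c : \int[mu]_t (t * sin (t * b + c) * gweight t) =
  b * \int[mu]_t (cos (t * b + c) * gweight t).
Proof.
have ic : mu.-integrable setT (EFin \o (fun t => b * (cos (t * b + c) * gweight t))).
  apply: integrable_scale => //; apply: (gweight_domin (M := 1)) => //; first exact: continuous_cosl.
  by move=> t; have := abs_cos_le1 (t * b + c); have := normr_ge0 t; lra.
have is' : mu.-integrable setT (EFin \o (fun t => t * sin (t * b + c) * gweight t)).
  apply: (gweight_domin (M := 1)) => //.
    by move=> t; apply: cvgM; [exact: cvg_id|exact: continuous_sinl].
  move=> t; rewrite normrM; have := abs_sin_le1 (t * b + c); have := normr_ge0 t; nra.
apply/eqP; rewrite eq_sym -subr_eq0 -RintegralZl //; last first.
  apply: (gweight_domin (M := 1)) => //; first exact: continuous_cosl.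
  by move=> t; have := abs_cos_le1 (t * b + c); have := normr_ge0 t; lra.
rewrite -RintegralB //; apply/eqP.
apply: (integral_deriv0 (F := fun t => sin (t * b + c) * gweight t)).
- by have := integrableB measurableT ic is'; apply: eq_integrable.
- move=> t; apply: cvgB.
    apply: cvgM; first exact: cvg_cst.
    by apply: cvgM; [exact: continuous_cosl|exact: continuous_gweight].
  apply: cvgM; last exact: continuous_gweight.
  by apply: cvgM; [exact: cvg_id|exact: continuous_sinl].
- move=> t; apply: is_derive_eq (is_deriveM (sin_derive b c t) (gweight_derive t)) _.
  by rewrite /GRing.scale /=; ring.
- apply: (@gweight_cvg0 (fun n => n%:R) (fun t => sin (t * b + c))) => t; last exact: abs_sin_le1.
  by rewrite ger0_norm.
apply: (@gweight_cvg0 (fun n => - n%:R) (fun t => sin (t * b + c))) => t; last exact: abs_sin_le1.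
by rewrite normrN ger0_norm.
Qed.

(** Differentiation under the integral and [gauss_stein] give F' = - b F, so F b exp (b^2 / 2) is
    constant. The phase [c] covers the sine as well. *)
Lemma gauss_cos b c : \int[mu]_t (cos (t * b + c) * gweight t) =
  cos c * Num.sqrt (2 * pi) * expR (- (b ^+ 2 / 2)).
Proof.
pose F b := \int[mu]_t (cos (t * b + c) * gweight t).
have it x : mu.-integrable setT (EFin \o (fun t => cos (t * x + c) * gweight t)).
  apply: (gweight_domin (M := 1)) => //; first exact: continuous_cosl.
  by move=> t; have := abs_cos_le1 (t * x + c); have := normr_ge0 t; lra.
have dt x t : is_derive x (1 : K) (fun x => cos (t * x + c) * gweight t) (- t * sin (t * x + c) * gweight t).
  have -> : (fun x => cos (t * x + c) * gweight t) = (fun x => gweight t * cos (x * t + c)).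
    by apply/funext => y; rewrite mulrC (mulrC t).
  apply: is_derive_eq (is_deriveM (is_derive_cst (gweight t) x (1 : K)) (cos_derive t c x)) _.
  by rewrite /GRing.scale /= mulr0 addr0 (mulrC x); ring.
have dF x : is_derive x (1 : K) F (- x * F x).
  have Ia : `]x - 1, x + 1[%classic x by rewrite /= in_itv /=; apply/andP; split; lra.
  have d1 y t : derivable (fun x => cos (t * x + c) * gweight t) y 1.
    exact: (@ex_derive _ _ _ _ _ _ _ (dt y t)).
  have E y t : partial1of2 (fun x t => cos (t * x + c) * gweight t) y t = - t * sin (t * y + c) * gweight t.
    by rewrite partial1of2E; exact: (@derive_val _ _ _ _ _ _ _ (dt y t)).
  have G0 t : 0 <= 2 * half_gweight t by rewrite mulr_ge0 // expR_ge0.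
  have bd y t : `|partial1of2 (fun x t => cos (t * x + c) * gweight t) y t| <= 2 * half_gweight t.
    rewrite E normrM (ger0_norm (gweight_ge0 t)) normrM normrN.
    apply: le_trans (gweight_decay t); rewrite ler_wpM2r ?gweight_ge0 //.
    have := abs_sin_le1 (t * y + c); have := normr_ge0 t; nra.
  have iG := integrable_scale 2 measurableT integrable_half_gweight.
  have D1 := derivable_under_integral measurableT Ia (fun y _ => it y) (fun y t _ _ => d1 y t) G0 iG
    (fun y t _ _ => bd y t).
  have D2 := differentiation_under_integral measurableT Ia (fun y _ => it y) (fun y t _ _ => d1 y t) G0 iG
    (fun y t _ _ => bd y t).
  apply: DeriveDef => //; rewrite -derive1E.
  apply: etrans D2 _; rewrite mulNr /F -gauss_stein.
  rewrite -[RHS]mulN1r -RintegralZl //; last first.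
    apply: (gweight_domin (M := 1)) => //.
      by move=> t; apply: cvgM; [exact: cvg_id|exact: continuous_sinl].
    by move=> t; rewrite normrM; have := abs_sin_le1 (t * x + c); have := normr_ge0 t; nra.
  by apply: eq_Rintegral => t _; rewrite E; ring.
have cst x : F x * expR (x ^+ 2 / 2) = F 0 * expR (0 ^+ 2 / 2).
  apply: (@is_derive_0_is_cst _ (fun x => F x * expR (x ^+ 2 / 2))) => y.
  have h2 := @is_derive1_comp _ expR (fun t : K => t ^+ 2 / 2) y _ _ (is_derive_expR _) (half_square_derive y).
  apply: is_derive_eq (is_deriveM (dF y) h2) _.
  by rewrite /GRing.scale /=; ring.
have F0 : F 0 = cos c * Num.sqrt (2 * pi).
  rewrite /F -integral_gweight -RintegralZl //; last exact: integrable_gweight.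
  by apply: eq_Rintegral => t _; rewrite mulr0 add0r.
have := cst b; rewrite F0 expr0n /= mul0r expR0 mulr1 => <-.
by rewrite -mulrA -expRD subrr expR0 mulr1.
Qed.

Definition gavg (g : K -> cplx K) : cplx K :=
  of_real (Num.sqrt (2 * pi))^-1 * cintegral setT (fun t => g t * of_real (gweight t)).

Lemma eq_gavg (g h : K -> cplx K) : (forall t, g t = h t) -> gavg g = gavg h.
Proof. by move=> gh; congr (_ * _); apply: eq_cintegral => t _; rewrite gh. Qed.

Section Bounded.
Implicit Types (g h : K -> cplx K).

Definition cbounded g := continuous g /\ exists M : K, forall t, modulus (g t) <= M.

Lemma Re_weighted g t : complex.Re (g t * of_real (gweight t)) = complex.Re (g t) * gweight t.
Proof. by rewrite Re_mul /of_real /= mulr0 subr0. Qed.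

Lemma Im_weighted g t : complex.Im (g t * of_real (gweight t)) = complex.Im (g t) * gweight t.
Proof. by rewrite Im_mul /of_real /= mulr0 add0r. Qed.

Lemma gavg_cintegrable g : cbounded g -> cintegrable setT (fun t => g t * of_real (gweight t)).
Proof.
move=> [cg [M hM]]; have M0 : 0 <= M := le_trans (modulus_ge0 _) (hM 0).
have le (x : K) t : `|x| <= modulus (g t) -> `|x| <= M * (1 + `|t|).
  move=> h; apply: le_trans h _; apply: le_trans (hM t) _.
  by rewrite ler_peMr // lerDl.
split.
  have := gweight_domin (continuous_Re cg) M0 (fun t => le _ t (Re_le_modulus (g t))).
  by apply: eq_integrable => // t _; rewrite /= Re_weighted.
have := gweight_domin (continuous_Im cg) M0 (fun t => le _ t (Im_le_modulus (g t))).
by apply: eq_integrable => // t _; rewrite /= Im_weighted.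
Qed.

Lemma gavgD g h : cbounded g -> cbounded h -> gavg (fun t => g t + h t) = gavg g + gavg h.
Proof.
move=> /gavg_cintegrable ig /gavg_cintegrable ih.
rewrite /gavg -mulrDr -cintegralD //; congr (_ * _).
by apply: eq_cintegral => t _; rewrite mulrDl.
Qed.

Lemma gavgZ (c : cplx K) g : cbounded g -> gavg (fun t => c * g t) = c * gavg g.
Proof.
move=> /gavg_cintegrable ig; have h := cintegralZ c measurableT ig.
apply: etrans (_ : of_real (Num.sqrt (2 * pi))^-1 * (c * _) = _); last exact: mulrCA.
congr (_ * _); apply: etrans h.
by apply: eq_cintegral => t _; rewrite mulrA.
Qed.

Lemma gavg_le g M : continuous g -> (forall t, modulus (g t) <= M) -> modulus (gavg g) <= M.
Proof.
move=> cg hM; have ig : cbounded g by split; last by exists M.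
have p0 : 0 < Num.sqrt (2 * pi) :> K by rewrite sqrtr_gt0 twopi_gt0.
rewrite /gavg (modulusM (of_real _)) modulus_of_real normfV (gtr0_norm p0) ler_pdivrMl //.
rewrite -integral_gweight mulrC -RintegralZl //; last exact: integrable_gweight.
apply: modulus_cintegral_le => //; first exact: gavg_cintegrable.
  exact: integrable_scale integrable_gweight.
move=> t _; rewrite (modulusM (g t)) modulus_of_real (ger0_norm (gweight_ge0 t)).
by rewrite ler_wpM2r ?gweight_ge0.
Qed.

Lemma cbounded_sum (u : nat -> K -> cplx K) n : (forall k, cbounded (u k)) ->
  cbounded (fun t => \sum_(0 <= k < n) u k t).
Proof.
move=> hu; split; first by apply: continuous_sum_fun => k; have [] := hu k.
elim: n => [|n [M hM]].
  by exists 0 => t; rewrite big_geq // modulus0.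
have [_ [L hL]] := hu n; exists (M + L) => t; rewrite big_nat_recr //=.
by apply: le_trans (modulusD _ _) _; exact: lerD.
Qed.

Lemma gavg_sum (u : nat -> K -> cplx K) n : (forall k, cbounded (u k)) ->
  gavg (fun t => \sum_(0 <= k < n) u k t) = \sum_(0 <= k < n) gavg (u k).
Proof.
move=> hu; elim: n => [|n IH].
  have z : cbounded (fun=> 0).
    by split; [exact: (@continuous_cst_fun _ 0)|exists 0 => t; rewrite modulus0].
  rewrite [RHS]big_geq //; apply: etrans (etrans (gavgZ 0 z) (mul0r _)).
  by apply: eq_gavg => t; rewrite big_geq // mul0r.
rewrite big_nat_recr //= -IH -gavgD //; last exact: cbounded_sum.
by apply: eq_gavg => t; rewrite big_nat_recr.
Qed.

Lemma gavg_series (u : nat -> K -> cplx K) (F : K -> cplx K) (A r : K) :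
  (forall k, cbounded (u k)) -> continuous F -> 0 <= r < 1 ->
  (forall x N, modulus (F x - \sum_(0 <= k < N) u k x) <= A * r ^+ N) ->
  series (fun k => gavg (u k)) @ \oo --> gavg F.
Proof.
move=> cu cF r01 h; apply/cvg_modulus => e e0; have [N hN] := geometric_small A r01 e0.
have bF : cbounded F.
  split=> //; exists (A * r ^+ 0) => t; have := h t 0%N.
  by rewrite big_geq // subr0.
exists N => // n /= /hN; apply: le_lt_trans.
have [cs [M bs]] := cbounded_sum n cu.
rewrite modulusB /series /= -(gavg_sum n cu).
have bs' : cbounded (fun t => \sum_(0 <= k < n) u k t) by split=> //; exists M.
have bN : cbounded (fun t => (-1) * \sum_(0 <= k < n) u k t).
  split; first exact: (continuousZ_fun (c := -1) cs).
  by exists M => t; rewrite mulN1r modulusN.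
have -> : gavg F - gavg (fun t => \sum_(0 <= k < n) u k t) =
    gavg (fun t => F t - \sum_(0 <= k < n) u k t).
  have := gavgD bF bN; rewrite (gavgZ (-1) bs') mulN1r => <-.
  by apply: eq_gavg => t; rewrite mulN1r.
by apply: gavg_le => [|x]; [exact: continuousB_fun cF cs|exact: h].
Qed.

End Bounded.

Lemma cis_scale_continuous b : continuous (fun t => cis (b * t) : cplx K).
Proof.
move=> t; apply: (@continuous_comp _ _ _ (fun t => b * t) (@cis K)); last exact: continuous_cis.
by apply: cvgM; [exact: cvg_cst|exact: cvg_id].
Qed.

Lemma gavg_cis b : gavg (fun t => cis (b * t)) = of_real (expR (- (b ^+ 2 / 2))).
Proof.
have p0 : Num.sqrt (2 * pi) != 0 :> K by rewrite sqrtr_eq0 -ltNge twopi_gt0.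
rewrite /gavg; have -> : cintegral setT (fun t => cis (b * t) * of_real (gweight t)) =
    of_real (Num.sqrt (2 * pi) * expR (- (b ^+ 2 / 2))).
  apply: eq_ReIm; rewrite (Re_cintegral, Im_cintegral).
    have := gauss_cos b 0; rewrite cos0 mul1r => h; apply: etrans h; apply: eq_Rintegral => t _.
    by rewrite (Re_weighted (fun t => cis (b * t))) addr0 (mulrC b).
  (* A sine is a cosine with phase - pi / 2, and the result carries the factor cos (pi / 2) = 0. *)
  have := gauss_cos b (- (pi / 2)); rewrite cosN cos_pihalf !mul0r => h; apply: etrans h.
  apply: eq_Rintegral => t _.
  rewrite (Im_weighted (fun t => cis (b * t))) cosD cosN sinN cos_pihalf sin_pihalf (mulrC b).
  by rewrite mulr0 mulrN mulr1 add0r opprK.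
by rewrite -of_realM mulKf.
Qed.

End GaussianAverage.

(** * The noise operator on Laurent modes *)

Section Noise.
Variables (K : realType) (R eps : K).
Hypothesis hR : 0 < R < 1.
Implicit Types (f g : cplx K -> cplx K) (z : cplx K).

Let R0 : 0 < R. Proof. by case/andP: hR. Qed.

Definition damping (k : nat) : K := expR (- ((2 * pi * eps * k%:R) ^+ 2 / 2)).

Lemma damping0 : damping 0 = 1.
Proof. by rewrite /damping mulr0 expr0n /= mul0r oppr0 expR0. Qed.

Lemma damping_ge0 k : 0 <= damping k. Proof. exact: expR_ge0. Qed.

Lemma damping_le1 k : damping k <= 1.
Proof. by rewrite -[leRHS]expR0 ler_expR oppr_le0 divr_ge0 // sqr_ge0. Qed.

Lemma cis_powers (c : cplx K) t j : c = cis (- (2 * pi * eps * t)) ->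
  c ^+ j = cis ((- (2 * pi * eps * j%:R)) * t) /\ c^-1 ^+ j = cis ((2 * pi * eps * j%:R) * t).
Proof.
move=> ->; split; first by rewrite cisX; congr cis; ring.
by rewrite -cisN opprK cisX; congr cis; ring.
Qed.

(** The damped pairings are realised by an element [g]; averaging the Laurent series term by term
    identifies [g] with the defining formula. As an element vanishes outside the annulus, the
    formula determines it. *)
Lemma noise_pair f s A r : hardy R f -> R < s < 1 -> 0 < r < R -> 0 <= A ->
  (forall e k, modulus (pair s e f (monom k)) <= A * r ^+ k) ->
  hardy R (noise R eps f) /\
  forall e k, pair s e (noise R eps f) (monom k) = of_real (damping k) * pair s e f (monom k).
Proof.
move=> hf hs hr A0 hA; have af := hardy_analytic hf.
have [e k| |g hg gp] := hardy_realize hR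
  (alpha := fun e k => of_real (damping k) * pair s e f (monom k)) hr A0.
- rewrite (modulusM (of_real _)) modulus_of_real ger0_norm ?damping_ge0 //.
  by apply: le_trans (hA e k); rewrite ler_piMl ?modulus_ge0 ?damping_le1.
- exact: (congr1 (fun x => of_real (damping 0) * x) (pair_const hR af hs)).
have ag := hardy_analytic hg.
pose F z := of_real (Num.sqrt (2 * pi))^-1 *
      cintegral setT (fun t => f (z * cis (- (2 * pi * eps * t))) *
        (cis (- (2 * pi * eps * t)) * of_real (expR (- (t ^+ 2 / 2))))).
have gF z : annulus R z -> g z = F z.
  move=> az; have [u hu uz] := between hR az.
  have z0 : 0 < modulus z by case/andP: az => Rz _; exact: lt_trans R0 Rz.
  pose c t := cis (- (2 * pi * eps * t)) : cplx K.
  have cc : continuous c.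
    have -> : c = fun t => cis ((- (2 * pi * eps)) * t) by apply/funext => t; rewrite mulNr.
    exact: cis_scale_continuous.
  have czm t : modulus (z * c t) = modulus z by rewrite (modulusM z) modulus_cis mulr1.
  have -> : F z = gavg (fun t => f (z * c t) * c t).
    by congr (_ * _); apply: eq_cintegral => t _; rewrite mulrA.
  pose p e k := pair u e f (monom k).
  have pE e k : p e k = pair s e f (monom k) by exact: (pair_indep hR k e af hu hs).
  pose t0 := Num.max (modulus z * r) (r / modulus z).
  have t01 : 0 <= t0 < 1.
    case/andP: hr => r0 rR; case/andP: az => Rz zR.
    rewrite le_max mulr_ge0 ?(ltW z0) ?(ltW r0) //= gt_max ltr_pdivrMr // mul1r (lt_trans rR Rz) andbT.
    apply: lt_le_trans (_ : modulus z * R <= 1); first by rewrite ltr_pM2l.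
    by rewrite -ler_pdivlMr // mul1r ltW.
  have lb t k : modulus (laurent u f (z * c t) k) <= A * (r + (modulus z)^-1) * t0 ^+ k.
    have r0 : 0 < r by case/andP: hr.
    have hb e j : modulus (pair u e f (monom j)) <= A * r ^+ j by rewrite -/(p e j) pE; exact: hA.
    have h1 : modulus (z * c t) * r <= t0 by rewrite czm le_max lexx.
    have h2 : r <= t0 * modulus (z * c t) by rewrite czm -ler_pdivrMr // le_max lexx orbT.
    by have := laurent_le k hu r0 A0 hb h1 h2; rewrite czm.
  have cf : continuous (fun t => f (z * c t)).
    apply: c2at_continuous => [|t]; first exact: (continuousZ_fun (c := z) cc).
    by apply/analytic_c2at/af; rewrite /annulus /= czm.
  have c0 t : c t != 0 by exact: cis_neq0.
  have bX j : cbounded (fun t => c t ^+ j) /\ gavg (fun t => c t ^+ j) = of_real (damping j).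
    have E t : c t ^+ j = cis ((- (2 * pi * eps * j%:R)) * t) by have [] := cis_powers (c := c t) (t := t) j erefl.
    split; last by rewrite (eq_gavg E) gavg_cis sqrrN.
    by split; [exact: continuousX_fun|exists 1 => t; rewrite E modulus_cis].
  have bV j : cbounded (fun t => (c t)^-1 ^+ j) /\ gavg (fun t => (c t)^-1 ^+ j) = of_real (damping j).
    have E t : (c t)^-1 ^+ j = cis ((2 * pi * eps * j%:R) * t) by have [] := cis_powers (c := c t) (t := t) j erefl.
    split; last by rewrite (eq_gavg E) gavg_cis.
    split; last by exists 1 => t; rewrite E modulus_cis.
    exact: continuousX_fun (continuousV_fun cc c0).
  have bZ (a : cplx K) (h : K -> cplx K) : cbounded h -> cbounded (fun t => a * h t).
    move=> [ch [M hM]]; split; first exact: (continuousZ_fun (c := a) ch).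
    by exists (modulus a * M) => t; rewrite (modulusM a) ler_wpM2l ?modulus_ge0.
  (* The extra factor [c t] in the noise turns the powers k and - k - 1 of the rotation into k + 1
     and - k, which up to sign are the orders of the corresponding pairings. *)
  have lE t k : laurent u f (z * c t) k * c t =
      (z ^+ k * p true k.+1) * c t ^+ k.+1 + (z^-1 ^+ k.+1 * p false k) * (c t)^-1 ^+ k.
    rewrite /laurent -/(p true k.+1) -/(p false k) invfM !exprMn.
    rewrite (exprS (c t)) (exprS (c t)^-1); move: (c t) (c0 t) => x x0.
    move: (p true _) (p false _) (z^-1 ^+ _) => P Q Z.
    have -> : z ^+ k * x ^+ k * P + Z * (x^-1 * x^-1 ^+ k) * Q = z ^+ k * x ^+ k * P + Z * x^-1 ^+ k * Q * x^-1 by ring.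
    by rewrite mulrDl divfK //; ring.
  have hk k : gavg (fun t => laurent u f (z * c t) k * c t) = laurent u g z k.
    have [b1 e1] := bX k.+1; have [b2 e2] := bV k.
    rewrite (eq_gavg (fun t => lE t k)) gavgD; [|exact: bZ|exact: bZ].
    by rewrite (gavgZ _ b1) (gavgZ _ b2) e1 e2 /laurent !gp // -!pE; ring.
  apply: (cvg_series_unique (u := laurent u g z)); first exact: (laurent_series hR ag hu uz).
  have -> : laurent u g z = (fun k => gavg (fun t => laurent u f (z * c t) k * c t)).
    by apply/funext => k; rewrite hk.
  have bu k : cbounded (fun t => laurent u f (z * c t) k * c t).
    have [b1 _] := bX k.+1; have [b2 _] := bV k.
    rewrite (_ : (fun t => _) = (fun t => (z ^+ k * p true k.+1) * c t ^+ k.+1 + (z^-1 ^+ k.+1 * p false k) * (c t)^-1 ^+ k)).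
      have [c1 [M1 h1]] := bZ (z ^+ k * p true k.+1) _ b1.
      have [c2 [M2 h2]] := bZ (z^-1 ^+ k.+1 * p false k) _ b2.
      split; first exact: continuousD_fun c1 c2.
      by exists (M1 + M2) => t; apply: le_trans (modulusD _ _) _; exact: lerD (h1 t) (h2 t).
    by apply/funext => t; exact: lE.
  have tail t N : modulus (f (z * c t) * c t - \sum_(0 <= k < N) laurent u f (z * c t) k * c t) <=
      A * (r + (modulus z)^-1) / (1 - t0) * t0 ^+ N.
    have huz : u < modulus (z * c t) < u^-1 by rewrite czm.
    have e := cvg_series_unique (laurent_series hR af hu huz) (cvg_csum t01 (lb t)).
    rewrite -mulr_suml -mulrBl (modulusM (_ - _)) modulus_cis mulr1 e.
    by apply: le_trans (csum_tail N t01 (lb t)) _; rewrite mulrAC.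
  exact: (gavg_series bu (continuousM_fun cf cc) t01 tail).
have : [set h | hardy R h /\ forall z, annulus R z -> h z = F z] (noise R eps f).
  by apply: xgetPex; exists g.
move: (noise R eps f) => h [hh hF].
have -> : h = g.
  apply/funext => z; have [az|naz] := pselect (annulus R z); first by rewrite hF // gF.
  by case: hh => -> //; case: hg => ->.
by split => // e k; exact: gp.
Qed.

End Noise.

(** * Birkhoff's theorem *)

Section Birkhoff.
Context d (T : measurableType d) (K : realType).
Variables (P : probability T K) (th : T -> T).
Hypothesis mth : measurable_fun setT th.
Hypothesis pth : forall A, measurable A -> P (th @^-1` A) = P A.
Hypothesis eth : forall A, measurable A -> th @^-1` A = A -> P A = 0%E \/ P A = 1%E.
Implicit Types f g : T -> K.

Definition bsum f n w : K := \sum_(0 <= i < n) f (iter i th w).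

Lemma bsum_rec f n w : bsum f n.+1 w = f w + bsum f n (th w).
Proof.
rewrite /bsum big_nat_recl //=; congr (_ + _).
by apply: eq_bigr => i _; rewrite -iterSr.
Qed.

Lemma integral_preserving g : P.-integrable setT (EFin \o g) ->
  P.-integrable setT (EFin \o (g \o th)) /\
  (\int[P]_w (g (th w))%:E = \int[P]_w (g w)%:E)%E.
Proof.
move=> ig; have mg : measurable_fun setT (EFin \o g) by case/integrableP: ig.
pose phi : {mfun T >-> T} := HB.pack th (isMeasurableFun.Build _ _ _ _ _ mth).
have E (h : T -> \bar K) : (\int[pushforward P phi]_w h w = \int[P]_w h w)%E.
  by apply: eq_measure_integral => A mA _; exact: pth.
have ig' : P.-integrable setT (EFin \o (g \o th)).
  apply/integrableP; split; first exact: (measurableT_comp mg mth).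
  have := ge0_integral_pushforward mth P (f := fun w => `|(g w)%:E|%E) measurableT.
  rewrite preimage_setT => h; rewrite -[X in (X < _)%E]h ?E; last by [].
    by case/integrableP: ig.
  exact: measurableT_comp.
split=> //; rewrite -[RHS]E; apply/esym.
by have := integral_pushforward mth (mu := P) mg (D := setT); rewrite preimage_setT; apply.
Qed.

(** The maximum of the Birkhoff sums of length at most n, the empty sum included. *)
Fixpoint bmax f n w : K := if n is k.+1 then Num.max 0 (f w + bmax f k (th w)) else 0.

Lemma bmax_ge0 f n w : 0 <= bmax f n w.
Proof. by case: n => //= n; rewrite le_max lexx. Qed.

Lemma bmax_mono f n w : bmax f n w <= bmax f n.+1 w.
Proof.
elim: n w => [|n IH] w; first exact: bmax_ge0.
by rewrite [leRHS]/= [leLHS]/= ge_max le_max lexx /= le_max lerD2l IH orbT.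
Qed.

Lemma bsum_le_max f n w : bsum f n w <= bmax f n w.
Proof.
elim: n w => [|n IH] w; first by rewrite /bsum big_geq.
by rewrite bsum_rec /= le_max lerD2l IH orbT.
Qed.

Lemma measurable_bmax f n : measurable_fun setT f -> measurable_fun setT (bmax f n).
Proof.
move=> mf; elim: n => [|n IH] /=; first exact: measurable_cst.
apply: measurable_maxr; first exact: measurable_cst.
apply: measurable_funD => //.
by apply: (@measurable_comp _ _ _ _ _ _ setT).
Qed.

Lemma integrable_bmax f n : P.-integrable setT (EFin \o f) ->
  P.-integrable setT (EFin \o bmax f n).
Proof.
move=> itf; elim: n => [|n IH] /=; first exact: integrable0.
have [ith _] := integral_preserving IH.
have := integrableD measurableT itf ith; apply: le_integrable => //.
  apply/measurable_EFinP; apply: (@measurable_bmax f n.+1).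
  by apply/measurable_EFinP; case/integrableP: itf.
move=> w _; rewrite /= lee_fin; case: (leP 0 (f w + bmax f n (th w))) => //.
by rewrite normr0.
Qed.

Definition unbounded_sums f : set T := [set w | forall m : nat, exists n, m%:R < bmax f n w].

Lemma measurable_unbounded f : measurable_fun setT f -> measurable (unbounded_sums f).
Proof.
move=> mf; have -> : unbounded_sums f = \bigcap_m \bigcup_n [set w | m%:R < bmax f n w].
  apply/seteqP; split => [w h m _|w h m]; last by have [n _ ?] := h m I; exists n.
  by have [n ?] := h m; exists n.
apply: bigcap_measurable => // m _; apply: bigcup_measurable => n _.
have := measurable_bmax n mf measurableT (measurable_itv `]m%:R, +oo[).
rewrite setTI; congr measurable; apply/seteqP; split => w /=.
  by rewrite in_itv /= andbT.
by rewrite in_itv /= andbT.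
Qed.

Lemma unbounded_invariant f : th @^-1` unbounded_sums f = unbounded_sums f.
Proof.
apply/seteqP; split => w h m.
  have [k hk] : exists k : nat, m%:R - f w <= k%:R.
    exists (Num.truncn `|m%:R - f w|).+1; apply: le_trans (ler_norm _) _.
    by rewrite ltW // truncnS_gt.
  have [n hn] := h k; exists n.+1; rewrite /= lt_max; apply/orP; right.
  by move: hk hn; lra.
have [k hk] : exists k : nat, m%:R + `|f w| + 1 <= k%:R.
  exists (Num.truncn (m%:R + `|f w| + 1)).+1; by rewrite ltW // truncnS_gt.
have [[|n] hn] := h k; first by move: hn; rewrite /= ltNge ler0n.
exists n; move: hn; rewrite /= lt_max ltNge ler0n /= => hn.
by have := ler_norm (f w); have := normr_ge0 (f w); move: hk hn; lra.
Qed.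

(** The function [bmax f n.+1 w - bmax f n (th w)] equals the maximum of - bmax f n (th w) and f w.
    It is dominated by |f| and tends to f where the sums are unbounded; by invariance of the measure
    its integral is that of bmax f n.+1 - bmax f n, hence nonnegative. *)
Lemma maximal_ergodic f : P.-integrable setT (EFin \o f) -> P (unbounded_sums f) = 1%E ->
  (0 <= \int[P]_w (f w)%:E)%E.
Proof.
move=> itf PA; have mf : measurable_fun setT (EFin \o f) by case/integrableP: itf.
have mf' : measurable_fun setT f by apply/measurable_EFinP.
have mA := measurable_unbounded mf'.
pose D n w : \bar K := (bmax f n.+1 w - bmax f n (th w))%:E.
have DE n w : D n w = (Num.max (- bmax f n (th w)) (f w))%:E.
  congr EFin; rewrite /= /Num.max /Order.max.
  case: ltP => h1; case: ltP => h2; move: h1 h2; lra.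
have iD n : P.-integrable setT (D n).
  have [h _] := integral_preserving (integrable_bmax n itf).
  by have := integrableB measurableT (integrable_bmax n.+1 itf) h; apply: eq_integrable.
have mD n : measurable_fun setT (D n) by case/integrableP: (iD n).
have aeA : {ae P, forall w, unbounded_sums f w}.
  exists (~` unbounded_sums f); split; [exact: measurableC| |by []].
  by rewrite probability_setC // PA subee.
have cv : {ae P, forall w, setT w -> D ^~ w @ \oo --> (EFin \o f) w}.
  have aeA' : {ae P, forall w, unbounded_sums f (th w)}.
    by apply: filterS aeA => w; rewrite -[in X in X -> _]unbounded_invariant.
  apply: filterS aeA' => w h _; apply: cvg_near_cst.
  have [N hN] : exists N, - f w <= bmax f N (th w).
    have [n hn] := h (Num.truncn `|f w|).+1; exists n.
    apply: le_trans (ltW hn); apply: le_trans (ler_norm _) _; rewrite normrN.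
    by rewrite ltW // truncnS_gt.
  exists N => // n /= Nn; rewrite DE /=; congr EFin; apply/max_idPr.
  rewrite lerNl; apply: le_trans hN _.
  exact: (homo_leq (@lexx _ _) (@le_trans _ _) (fun k => bmax_mono f k (th w))).
have dom : {ae P, forall w n, setT w -> (`|D n w| <= (`|f w|)%:E)%E}.
  apply/aeW => w n _; rewrite DE abse_EFin lee_fin; have := bmax_ge0 f n (th w).
  rewrite /Num.max /Order.max; case: ltP => // h b.
  rewrite normrN (ger0_norm b); have f0 : f w <= 0 by lra.
  by rewrite (ler0_norm f0) lerNr.
have iaf : P.-integrable setT (fun w => (`|f w|)%:E).
  by have := integrable_abse itf; apply: eq_integrable.
have [_ _ lim] := @dominated_convergence _ _ K P setT measurableT D (EFin \o f)
  (fun w => (`|f w|)%:E) mD mf cv iaf dom.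
have D0 n : (0 <= \int[P]_w D n w)%E.
  have [h e] := integral_preserving (integrable_bmax n itf).
  have -> : (\int[P]_w D n w = \int[P]_w (bmax f n.+1 w)%:E - \int[P]_w (bmax f n w)%:E)%E.
    rewrite -e -integralB_EFin //; exact: integrable_bmax.
  have i1 := integrable_bmax n itf; have i2 := integrable_bmax n.+1 itf.
  rewrite -integralB_EFin //; apply: integral_ge0 => w _.
  by rewrite /= -EFinB lee_fin subr_ge0; exact: bmax_mono.
have -> : (\int[P]_w (f w)%:E)%E = limn (fun n => \int[P]_x D n x)%E by apply/esym/cvg_lim.
apply: lime_ge; first by apply/cvg_ex; exists (\int[P]_x (EFin \o f) x)%E.
by apply: nearW => n; exact: D0.
Qed.

(** By ergodicity the invariant set of unbounded sums has probability 0 or 1, and the negative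
    integral excludes 1. *)
Lemma birkhoff_upper f : P.-integrable setT (EFin \o f) -> (\int[P]_w (f w)%:E < 0)%E ->
  {ae P, forall w, exists C : K, forall n, bsum f n w <= C}.
Proof.
move=> itf neg; have mf' : measurable_fun setT f by apply/measurable_EFinP; case/integrableP: itf.
have mA := measurable_unbounded mf'.
have [P0|P1] := eth mA (unbounded_invariant f); last first.
  by have := maximal_ergodic itf P1; rewrite leNgt neg.
exists (unbounded_sums f); split => // w h m; apply: contrapT => hm; apply: h.
exists m%:R => n; apply: le_trans (bsum_le_max f n w) _.
by rewrite leNgt; apply/negP => ?; apply: hm; exists n.
Qed.

(** The upper bound is applied to f - mu and mu - f, each lowered by 1 / (k + 1), for countably many
    k. The form with an error n e + C is the one used for exponential rates. *)
Theorem birkhoff f (mu : K) : P.-integrable setT (EFin \o f) -> (\int[P]_w (f w)%:E = mu%:E)%E ->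
  {ae P, forall w, forall e : K, 0 < e -> exists C : K, forall n,
    `|bsum f n w - n%:R * mu| <= n%:R * e + C}.
Proof.
move=> itf fmu.
have ic (c : K) : P.-integrable setT (EFin \o (fun=> c)).
  by apply: finite_measure_integrable_cst.
have intc (c : K) : (\int[P]_w c%:E = c%:E)%E.
  have := @integral_cst _ _ _ P setT measurableT c%:E; rewrite /cst => ->.
  by apply: etrans (congr1 (fun x => (c%:E * x)%E) _) (mule1 _); exact: probability_setT.
have key (c x : K) : 0 < x -> P.-integrable setT (EFin \o (fun w => c * (f w - mu) - x)) /\
    (\int[P]_w (c * (f w - mu) - x)%:E = (- x)%:E)%E.
  move=> x0; have i1 : P.-integrable setT (EFin \o (fun w => f w - mu)).
    by have := integrableB measurableT itf (ic mu); apply: eq_integrable.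
  have i2 : P.-integrable setT (EFin \o (fun w => c * (f w - mu))).
    by have := integrableZl measurableT c i1; apply: eq_integrable.
  split; first by have := integrableB measurableT i2 (ic x); apply: eq_integrable.
  have -> : (\int[P]_w (c * (f w - mu) - x)%:E = \int[P]_w (c * (f w - mu))%:E - \int[P]_w x%:E)%E.
    by rewrite -integralB_EFin // ; apply: eq_integral.
  have -> : (\int[P]_w (c * (f w - mu))%:E = c%:E * \int[P]_w (f w - mu)%:E)%E.
    by rewrite -(integralZl measurableT i1); apply: eq_integral.
  have -> : (\int[P]_w (f w - mu)%:E = \int[P]_w (f w)%:E - \int[P]_w mu%:E)%E.
    by rewrite -integralB_EFin // ; apply: eq_integral.
  by rewrite fmu !intc subee // mule0 sub0e.
have neg (c : K) : {ae P, forall w, forall k : nat, exists C : K, forall n,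
    bsum (fun w => c * (f w - mu) - k.+1%:R^-1) n w <= C}.
  apply: ae_foralln => k; have x0 : 0 < k.+1%:R^-1 :> K by rewrite invr_gt0.
  have [i e] := key c _ x0.
  by apply: birkhoff_upper => //; rewrite e lte_fin oppr_lt0.
have bsE (c x : K) n w : bsum (fun w => c * (f w - mu) - x) n w = c * (bsum f n w - n%:R * mu) - n%:R * x.
  elim: n w => [|n IH] w; first by rewrite /bsum !big_geq // !mul0r subrr mulr0 subr0.
  by rewrite !bsum_rec IH -natr1; ring.
have n1 := neg 1; have n2 := neg (-1).
apply: filterS2 n1 n2 => w h1 h2 e e0.
pose k := Num.truncn e^-1; have ke : k.+1%:R^-1 <= e.
  by rewrite -[e]invrK lef_pV2 ?posrE ?invr_gt0 // ltW // truncnS_gt.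
have [C1 H1] := h1 k; have [C2 H2] := h2 k.
exists (`|C1| + `|C2|) => n; have := H1 n; have := H2 n; rewrite !bsE.
have : n%:R * k.+1%:R^-1 <= n%:R * e by rewrite ler_wpM2l.
move: (bsum f n w - n%:R * mu) => z; move: (n%:R * k.+1%:R^-1) (n%:R * e) => x y xy.
have := ler_norm C1; have := ler_norm C2; have := normr_ge0 C1; have := normr_ge0 C2.
move: `|C1| `|C2| => c1 c2 a1 a2 a3 a4 a5 a6.
by rewrite ler_norml; apply/andP; split; lra.
Qed.

End Birkhoff.

(** * The Bernoulli shift *)

Section Bernoulli.
Variables (K : realType) (p : K) (P : probability Omega K).
Hypothesis hP : bernoulli_measure p P.
Hypothesis hp : 0 <= p <= 1.

Definition shift_by (c : int) (w : Omega) : Omega := fun i => w (i + c).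

Definition cyl (s : seq int) (a : int -> bool) : set Omega :=
  [set w | forall i, i \in s -> w i = a i].

Definition weight (s : seq int) (a : int -> bool) : K :=
  \prod_(i <- s) (if a i then 1 - p else p).

Lemma measurable_coordinate i b : measurable [set w : Omega | w i = b].
Proof. by apply: sub_sigma_algebra; exists i, b. Qed.

Lemma measurable_cyl s a : measurable (cyl s a).
Proof.
elim: s => [|i s IH].
  by have -> : cyl [::] a = setT by apply/seteqP; split.
have -> : cyl (i :: s) a = [set w | w i = a i] `&` cyl s a.
  apply/seteqP; split => w.
    by move=> h; split => [|j js]; apply: h; rewrite inE ?eqxx // js orbT.
  by move=> [h1 h2] j; rewrite inE => /predU1P[->|/h2].
by apply: measurableI => //; exact: measurable_coordinate.
Qed.

(** The empty set is included because two cylinders may prescribe conflicting symbols; this makes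
    the family stable under intersection. *)
Definition cylinders : set (set Omega) :=
  [set A | A = set0 \/ exists s a, uniq s /\ A = cyl s a].

Lemma measurable_cylinders A : cylinders A -> measurable A.
Proof. by move=> [->|[s [a [_ ->]]]]; [exact: measurable0|exact: measurable_cyl]. Qed.

Lemma cylinders_setI : setI_closed cylinders.
Proof.
move=> A B [->|[s [a [us ->]]]]; first by rewrite set0I; left.
move=> [->|[t [b [ut ->]]]]; first by rewrite setI0; left.
have [h|h] := pselect (forall i, i \in s -> i \in t -> a i = b i); last first.
  left; apply/seteqP; split => // w [h1 h2]; apply: h => i si ti.
  by rewrite -(h1 i si) (h2 i ti).
right; exists (undup (s ++ t)), (fun i => if i \in s then a i else b i); split.
  exact: undup_uniq.
apply/seteqP; split => w.
  move=> [h1 h2] i; rewrite mem_undup mem_cat; case: ifP => [si _|_ /= ti]; first exact: h1.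
  exact: h2.
move=> hw; split => i si; have := hw i; rewrite mem_undup mem_cat si ?orbT => /(_ isT) //.
by case: ifP => // si'; rewrite h.
Qed.

Lemma measurable_generated : (measurable : set (set Omega)) = <<s cylinders >>.
Proof.
apply/seteqP; split.
  apply: smallest_sub; first exact: smallest_sigma_algebra.
  move=> A [i [b ->]]; apply: sub_sigma_algebra; right; exists [:: i], (fun=> b); split => //.
  by apply/seteqP; split => w /= h; [move=> j; rewrite inE => /eqP ->|apply: h; rewrite inE].
apply: smallest_sub; first exact: sigma_algebra_measurable.
exact: measurable_cylinders.
Qed.

Lemma measurable_shift c : measurable_fun setT (shift_by c).
Proof.
apply: (@measurability _ _ Omega Omega setT (shift_by c) coordinate_sets erefl).
move=> _ [_ [i [b ->]] <-]; rewrite setTI.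
exact: (measurable_coordinate (i + c) b).
Qed.

Local Notation pr A := (fine (P A)).

Lemma prE A : measurable A -> P A = (pr A)%:E.
Proof. by move=> mA; rewrite fineK // fin_num_measure. Qed.

Lemma pr_ge0 A : 0 <= pr A. Proof. by rewrite fine_ge0. Qed.

Lemma pr_mono A B : measurable A -> measurable B -> A `<=` B -> pr A <= pr B.
Proof. by move=> mA mB AB; rewrite -lee_fin -!prE // le_measure ?inE. Qed.

Lemma prU A B : measurable A -> measurable B -> A `&` B = set0 -> pr (A `|` B) = pr A + pr B.
Proof.
move=> mA mB AB; apply: EFin_inj; rewrite EFinD -!prE //; last exact: measurableU.
exact: measureU.
Qed.

Lemma prC A : measurable A -> pr (~` A) = 1 - pr A.
Proof.
move=> mA; apply: EFin_inj; rewrite EFinB -!prE //; last exact: measurableC.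
exact: probability_setC.
Qed.

Lemma pr_le1 A : measurable A -> pr A <= 1.
Proof. by move=> mA; rewrite -lee_fin -prE // probability_le1. Qed.

Lemma pr_cyl s a : uniq s -> pr (cyl s a) = weight s a.
Proof. by move=> us; rewrite /cyl hP. Qed.

Lemma shift_cyl c s a : shift_by c @^-1` cyl s a =
  cyl [seq i + c | i <- s] (fun i => a (i - c)).
Proof.
apply/seteqP; split => w h i.
  by move=> /mapP[j js ->]; rewrite addrK; exact: h.
by move=> si; rewrite /shift_by (h (i + c)) ?addrK //; apply/mapP; exists i.
Qed.

Lemma measurable_preshift c A : measurable A -> measurable (shift_by c @^-1` A).
Proof. by move=> mA; rewrite -[X in measurable X]setTI; exact: measurable_shift. Qed.

Lemma weight_map c s a : weight [seq i + c | i <- s] (fun i => a (i - c)) = weight s a.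
Proof. by rewrite /weight big_map; apply: eq_bigr => i _; rewrite addrK. Qed.

Lemma uniq_shift c (s : seq int) : uniq s -> uniq [seq i + c | i <- s].
Proof. by move=> us; rewrite map_inj_uniq // => i j /addIr. Qed.

Lemma shift_preserving c A : measurable A -> P (shift_by c @^-1` A) = P A.
Proof.
rewrite measurable_generated; move: A; apply: (dynkin_induction measurable_generated cylinders_setI).
- by rewrite preimage_setT.
- move=> A [->|[s [a [us ->]]]]; first by rewrite preimage_set0.
  rewrite shift_cyl [LHS](prE (measurable_cyl _ _)) [RHS](prE (measurable_cyl s a)).
  by congr EFin; rewrite (pr_cyl _ us) pr_cyl ?uniq_shift // weight_map.
- move=> A mA h; rewrite preimage_setC !probability_setC //; last exact: measurable_preshift.
  by rewrite h.
move=> F mF tF h; rewrite preimage_bigcup !measure_bigcup //.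
- by apply: eq_eseriesr => k _; exact: h.
- by move=> k _; exact: measurable_preshift.
- by move=> i j _ _ [w [wi wj]]; apply: tF => //; exists (shift_by c w).
Qed.

Lemma iter_shift c n : iter n (shift_by c) = shift_by (c *+ n) :> (Omega -> Omega).
Proof.
elim: n => [|n IH]; first by apply/funext => w; apply/funext => i; rewrite /shift_by addr0.
apply/funext => w; rewrite iterS IH; apply/funext => i; rewrite /shift_by mulrS -addrA; congr (w _).
Qed.

Lemma disjoint_shift (c : int) (s t : seq int) : c != 0 ->
  exists N : nat, forall n, (N <= n)%N -> forall i, i \in s -> i \notin [seq j + c *+ n | j <- t].
Proof.
have bd (u : seq int) : exists M : nat, forall i, i \in u -> (`|i| <= M)%N.
  elim: u => [|i u [M hM]]; first by exists 0%N.
  exists (`|i| + M)%N => j; rewrite inE => /predU1P[->|/hM]; first exact: leq_addr.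
  by move=> h; apply: leq_trans h _; exact: leq_addl.
move=> c0; have [M hM] := bd s; have [L hL] := bd t.
exists (M + L).+1 => n nN i /hM iM; apply/negP => /mapP[j /hL jL e].
have c1 : (0 < `|c|)%N by rewrite absz_gt0.
have : (`|c *+ n| <= `|i| + `|j|)%N.
  by have -> : c *+ n = i - j by [rewrite e addrC addrA addNr add0r|lia]; lia.
rewrite -mulr_natr abszM => h.
have : (n <= `|c| * `|n%:R : int|)%N by rewrite natz absz_nat leq_pmull.
by move: nN iM jL h; lia.
Qed.

Definition mixes c B A := forall e : K, 0 < e -> exists N : nat, forall n, (N <= n)%N ->
  `|pr (A `&` shift_by (c *+ n) @^-1` B) - pr A * pr B| <= e.

(** Induction on the measurable set A by Dynkin's argument. A cylinder becomes independent of B once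
    the shift makes their coordinates disjoint; complements are immediate, and countable unions are
    approximated by finite ones. *)
Lemma mixing_cyl c s a A : c != 0 -> uniq s -> measurable A -> mixes c (cyl s a) A.
Proof.
move=> c0 us; set B := cyl s a; have mB : measurable B := measurable_cyl s a.
have mX n : measurable (shift_by (c *+ n) @^-1` B) by exact: measurable_preshift.
have pX n : pr (shift_by (c *+ n) @^-1` B) = pr B by rewrite shift_preserving.
rewrite measurable_generated; move: A; apply: (dynkin_induction measurable_generated cylinders_setI).
- by move=> e e0; exists 0%N => n _; rewrite setTI pX probability_setT mul1r subrr normr0 ltW.
- move=> A [->|[t [b [ut ->]]]] e e0.
    by exists 0%N => n _; rewrite set0I measure0 mul0r subrr normr0 ltW.
  have [N hN] := disjoint_shift t s c0.
  exists N => n /hN dis; rewrite shift_cyl.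
  have -> : cyl t b `&` cyl [seq i + c *+ n | i <- s] (fun i => a (i - c *+ n)) =
     cyl (t ++ [seq i + c *+ n | i <- s]) (fun i => if i \in t then b i else a (i - c *+ n)).
    apply/seteqP; split => w.
      move=> [h1 h2] i; rewrite mem_cat; case: ifP => [ti _|_ /= si]; first exact: h1.
      exact: h2.
    move=> hw; split => i ti; have := hw i; rewrite mem_cat ti ?orbT => /(_ isT) //.
    by case: ifP => // /dis; rewrite ti.
  rewrite !pr_cyl //; last first.
    rewrite cat_uniq ut uniq_shift // andbT /=; apply/hasPn => i si.
    by apply/negP => /dis; rewrite si.
  have -> : weight (t ++ [seq i + c *+ n | i <- s]) (fun i => if i \in t then b i else a (i - c *+ n)) =
      weight t b * weight s a.
    rewrite -(weight_map (c *+ n) s a) /weight big_cat /=; congr (_ * _).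
      by apply: eq_big_seq => i ->.
    apply: eq_big_seq => i si; have [ti|//] := boolP (i \in t).
    by have := dis i ti; rewrite si.
  by rewrite subrr normr0 ltW.
- move=> A mA hA e /hA[N hN]; exists N => n /hN.
  move: (shift_by (c *+ n) @^-1` B) (mX n) (pX n) => X mXn pXn.
  have E : pr B = pr (A `&` X) + pr (~` A `&` X).
    rewrite -pXn -prU; first by rewrite -setIUl setUv setTI.
    - exact: measurableI.
    - by apply: measurableI => //; exact: measurableC.
    - by rewrite setIACA setICr set0I.
  have -> : pr (~` A `&` X) = pr B - pr (A `&` X) by rewrite E; ring.
  by rewrite prC // -normrN => h; apply: le_trans h; apply: eq_leW; congr `|_|; ring.
move=> F mF tF hF e e0.
(* The finite unions increase to the full one. Replacing U by some [G n] costs at most e / 3 in each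
   of two probabilities, and mixing for [G n] costs another e / 3. *)
pose G n := \bigcup_(k < n) F k; pose U := \bigcup_k F k.
have mG n : measurable (G n) by exact: bigcup_measurable.
have mU : measurable U by exact: bigcup_measurable.
have GU n : G n `<=` U by move=> w [k _ Fk]; exists k.
have GS n : G n.+1 = G n `|` F n.
  apply/seteqP; split => w.
    move=> [k /= kn Fk]; move: kn; rewrite ltnS leq_eqVlt => /orP[/eqP <-|kn]; first by right.
    by left; exists k.
  by move=> [[k kn Fk]|Fn]; [exists k => //; exact: leqW|exists n => /=].
have GF n : G n `&` F n = set0.
  apply/seteqP; split => // w [[k /= kn Fk] Fn].
  have kn' : k = n by apply: tF => //; exists w.
  by move: kn; rewrite kn' ltnn.
have hG n : mixes c B (G n).
  elim: n => [|n IH] x x0.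
    have -> : G 0%N = set0 by apply/seteqP; split => // w [].
    by exists 0%N => m _; rewrite set0I measure0 mul0r subrr normr0 ltW.
  have x2 : 0 < x / 2 by rewrite divr_gt0.
  have [N1 h1] := IH _ x2; have [N2 h2] := hF n _ x2.
  exists (maxn N1 N2) => m; rewrite geq_max => /andP[/h1 {}h1 /h2 {}h2].
  rewrite GS setIUl !prU //; last 3 first.
  - exact: measurableI.
  - exact: measurableI.
  - by rewrite setIACA GF set0I.
  have -> : x = x / 2 + x / 2 by lra.
  apply: le_trans (lerD h1 h2); apply: le_trans (ler_normD _ _).
  by apply: eq_leW; congr `|_|; ring.
have [n hn] : exists n, pr U - pr (G n) <= e / 3.
  have cvG : P (G n) @[n --> \oo] --> P U.
    have -> : U = \bigcup_n G n.
      apply/seteqP; split => w [k _ h]; last exact: (GU k).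
      by exists k.+1 => //; exists k => /=.
    apply: nondecreasing_cvg_mu => //; first exact: bigcup_measurable.
    by move=> i j ij; apply/subsetPset => w [k /= ki Fk]; exists k => //=; exact: leq_trans ij.
  have := cvG; rewrite (prE mU); under eq_fun do rewrite (prE (mG _)).
  move=> /fine_cvgP[_] /= /cvgrPdist_le/(_ (e / 3)); rewrite divr_gt0 // => /(_ isT)[n _ hn].
  exists n; have := hn n (leqnn n) => /= h; exact: le_trans (ler_norm _) h.
have e3 : 0 < e / 3 by rewrite divr_gt0.
have [N hN] := hG n _ e3; exists N => m /hN {}hN.
have le1 : 0 <= pr U - pr (G n) by rewrite subr_ge0 pr_mono.
have mUG : measurable (U `\` G n) by exact: measurableD.
have UG : pr U = pr (G n) + pr (U `\` G n).
  rewrite -prU //; last by rewrite setDE setICA setICr setI0.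
  by rewrite (setDUK (GU n)).
have UX : pr (U `&` shift_by (c *+ m) @^-1` B) =
    pr (G n `&` shift_by (c *+ m) @^-1` B) + pr ((U `\` G n) `&` shift_by (c *+ m) @^-1` B).
  rewrite -prU //; try exact: measurableI; last first.
    by rewrite setIACA (setDE U) (setICA (G n)) setICr setI0 set0I.
  by rewrite -setIUl (setDUK (GU n)).
have b1 : pr ((U `\` G n) `&` shift_by (c *+ m) @^-1` B) <= pr (U `\` G n).
  by apply: pr_mono => //; exact: measurableI.
have b2 : 0 <= pr ((U `\` G n) `&` shift_by (c *+ m) @^-1` B) := pr_ge0 _.
have b3 := pr_le1 mB; have b4 := pr_ge0 B; have b5 := pr_ge0 (U `\` G n).
move: hN; rewrite UX UG; move: hn le1; rewrite UG.
move: (pr (G n `&` _)) (pr (_ `&` _)) b1 b2 => X Y.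
move: (pr (U `\` G n)) b5 => Z b5 YZ Y0 h1 h2 h3.
have b6 : 0 <= Z * pr B <= Z by rewrite mulr_ge0 //= ler_piMr.
move: h3; rewrite mulrDl; move: (pr (G n) * pr B) (Z * pr B) b6 => V W /andP[b6 b7].
by rewrite !ler_norml => /andP[h3 h4]; apply/andP; split; lra.
Qed.

(** For an invariant A and a cylinder B, the probability of A intersected with a shifted B does not
    depend on the shift, so mixing makes A and B independent. Dynkin's argument extends this to all
    B, and B = A gives P A = (P A)^2. *)
Lemma shift_ergodic c A : c != 0 -> measurable A -> shift_by c @^-1` A = A ->
  P A = 0%E \/ P A = 1%E.
Proof.
move=> c0 mA inv.
have inv_n n : shift_by (c *+ n) @^-1` A = A.
  elim: n => [|n IH].
    have e w : shift_by (c *+ 0) w = w by apply/funext => i; rewrite /shift_by addr0.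
    by apply/seteqP; split => w /=; rewrite e.
  have e w : shift_by (c *+ n.+1) w = shift_by c (shift_by (c *+ n) w).
    by apply/funext => i; rewrite /shift_by mulrS -addrA; congr (w _).
  rewrite -[RHS]IH -[in RHS]inv; apply/seteqP; split => w /=; by rewrite e.
have indep B : measurable B -> pr (A `&` B) = pr A * pr B.
  rewrite measurable_generated; move: B; apply: (dynkin_induction measurable_generated cylinders_setI).
  - by rewrite setIT probability_setT mulr1.
  - move=> B [->|[s [a [us ->]]]]; first by rewrite setI0 measure0 mulr0.
    apply/eqP; rewrite -subr_eq0 -normr_le0; apply/ler_addgt0Pr => e e0; rewrite add0r.
    have [N /(_ N (leqnn N))] := mixing_cyl a c0 us mA e0.
    rewrite -{1}(inv_n N) -preimage_setI shift_preserving //.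
    by apply: measurableI => //; exact: measurable_cyl.
  - move=> B mB h; rewrite (prC mB).
    have := prU (measurableI _ _ mA mB) (measurableI _ _ mA (measurableC mB)).
    rewrite -setIUr setUv setIT setIACA setICr setI0 => /(_ erefl) hA.
    by rewrite mulrBr mulr1 -h {1}hA addrAC subrr add0r.
  move=> F mF tF h.
  have mAF k : measurable (A `&` F k) by exact: measurableI.
  apply: EFin_inj; rewrite EFinM -!prE //; last 2 first.
  - exact: bigcup_measurable.
  - by apply: measurableI => //; exact: bigcup_measurable.
  rewrite setI_bigcupr !measure_bigcup //; last first.
    by move=> i j _ _ [w [[_ wi] [_ wj]]]; apply: tF => //; exists w.
  rewrite (prE mA) -nneseriesZl //=.
  by apply: eq_eseriesr => k _; rewrite (prE (mAF k)) h EFinM; congr (_ * _)%E; rewrite -prE.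
have := indep A mA; rewrite setIid => /eqP; rewrite -subr_eq0 -{1}[pr A]mulr1 -mulrBr mulf_eq0 subr_eq0.
by move=> /orP[/eqP h|/eqP h]; [left|right]; rewrite (prE mA) ?h // -h.
Qed.

End Bernoulli.

(** * Exponential rates *)

Section Rates.
Variable K : realType.
Implicit Types (x : nat -> \bar K) (C a l : K).

Lemma limn_esup_near x (b : \bar K) : (\forall n \near \oo, (x n <= b)%E) -> (limn_esup x <= b)%E.
Proof.
move=> h; apply: le_trans (_ : _ <= ereal_sup (x @` [set n | (x n <= b)%E]))%E _.
  by apply: ereal_inf_lbound; exists [set n | (x n <= b)%E].
by apply: ge_ereal_sup => _ [n hn <-].
Qed.

Lemma log_rate_mono (y z : \bar K) n : (0 <= y)%E -> (y <= z)%E -> (log_rate y n <= log_rate z n)%E.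
Proof.
move=> y0 yz; rewrite /log_rate lee_wpmul2l ?lee_fin ?invr_ge0 //.
by rewrite lee_lne // in_itv /= ?y0 ?leey //= (le_trans y0 yz).
Qed.

Lemma log_rate_expR C a n : 0 < C -> (0 < n)%N ->
  log_rate (C * expR (n%:R * a))%:E n = (n%:R^-1 * ln C + a)%:E.
Proof.
move=> C0 n0; rewrite /log_rate lne_EFin ?mulr_gt0 ?expR_gt0 // lnM ?posrE ?expR_gt0 // expRK.
by rewrite -EFinM mulrDr mulKf // pnatr_eq0 -lt0n.
Qed.

(** Constant factors of exponential bounds disappear from the rates. *)
Lemma ln_div_small C (e : K) : 0 < e -> \forall n \near \oo, `|n%:R^-1 * ln C| < e.
Proof.
move=> e0; near=> n.
have n0 : 0 < n%:R :> K by near: n; exact: nbhs_infty_gtr.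
rewrite normrM gtr0_norm ?invr_gt0 // ltr_pdivrMl // mulrC -ltr_pdivrMl //.
by near: n; exact: nbhs_infty_gtr.
Unshelve. all: by end_near. Qed.

Lemma upper_rate x l : (forall n, (0 <= x n)%E) ->
  (forall e : K, 0 < e -> exists2 C, 0 < C & \forall n \near \oo, (x n <= (C * expR (n%:R * (l + e)))%:E)%E) ->
  forall e : K, 0 < e -> \forall n \near \oo, (log_rate (x n) n <= (l + e)%:E)%E.
Proof.
move=> x0 h e e0; have e2 : 0 < e / 2 by rewrite divr_gt0.
have [C C0 hC] := h _ e2; near=> n.
have n0 : (0 < n)%N by near: n; exact: nbhs_infty_gt.
apply: le_trans (log_rate_mono n (x0 n) (_ : _ <= (C * expR (n%:R * (l + e / 2)))%:E)%E) _.
  by near: n.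
rewrite log_rate_expR // lee_fin.
have : `|n%:R^-1 * ln C| < e / 2 by near: n; exact: ln_div_small.
by rewrite ltr_norml => /andP[_]; lra.
Unshelve. all: by end_near. Qed.

Lemma limn_esup_rate x l : (forall n, (0 <= x n)%E) ->
  (forall e : K, 0 < e -> exists2 C, 0 < C & \forall n \near \oo, (x n <= (C * expR (n%:R * (l + e)))%:E)%E) ->
  (limn_esup (fun n => log_rate (x n) n) <= l%:E)%E.
Proof.
move=> x0 h; apply/lee_addgt0Pr => e e0; rewrite -EFinD.
exact/limn_esup_near/upper_rate.
Qed.

Lemma limn_esup_ninfty x : (forall n, (0 <= x n)%E) ->
  (forall l, exists2 C, 0 < C & \forall n \near \oo, (x n <= (C * expR (n%:R * l))%:E)%E) ->
  (limn_esup (fun n => log_rate (x n) n) <= -oo)%E.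
Proof.
move=> x0 h; rewrite leeNy_eq; apply/eqP; apply: eq_ninfty => l.
by apply: limn_esup_rate => // e _; exact: h.
Qed.

Lemma cvg_log_rate x l : (forall n, (0 <= x n)%E) ->
  (forall e : K, 0 < e -> exists2 C, 0 < C & \forall n \near \oo, (x n <= (C * expR (n%:R * (l + e)))%:E)%E) ->
  (forall e : K, 0 < e -> exists2 C, 0 < C & \forall n \near \oo, ((C * expR (n%:R * (l - e)))%:E <= x n)%E) ->
  log_rate (x n) n @[n --> \oo] --> l%:E.
Proof.
move=> x0 up lo.
have U := upper_rate x0 up.
have L (e : K) : 0 < e -> \forall n \near \oo, ((l - e)%:E <= log_rate (x n) n)%E.
  move=> e0; have e2 : 0 < e / 2 by rewrite divr_gt0.
  have [C C0 hC] := lo _ e2; near=> n.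
  have n0 : (0 < n)%N by near: n; exact: nbhs_infty_gt.
  apply: le_trans (log_rate_mono n _ (_ : (C * expR (n%:R * (l - e / 2)))%:E <= _)%E).
  - rewrite log_rate_expR // lee_fin.
    have : `|n%:R^-1 * ln C| < e / 2 by near: n; exact: ln_div_small.
    by rewrite ltr_norml => /andP[]; lra.
  - by rewrite lee_fin mulr_ge0 ?expR_ge0 // ltW.
  - by near: n.
apply/fine_cvgP; split.
  near=> n; rewrite fin_numElt; apply/andP; split.
    by apply: lt_le_trans (_ : (l - 1)%:E <= _)%E; [rewrite ltNyr|near: n; exact: L].
  by apply: le_lt_trans (_ : _ <= (l + 1)%:E)%E _; [near: n; exact: U|rewrite ltry].
apply/cvgrPdist_le => e e0; near=> n.
have h1 : ((l - e)%:E <= log_rate (x n) n)%E by near: n; exact: L.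
have h2 : (log_rate (x n) n <= (l + e)%:E)%E by near: n; exact: U.
move: h1 h2; rewrite /=; case: (log_rate (x n) n) => [y| |] //=.
by rewrite !lee_fin ler_distl => h1 h2; apply/andP; split; lra.
Unshelve. all: by end_near. Qed.

End Rates.

(** * The adjoint of the noise on the disc algebra *)

Section NoiseDual.
Variables (K : realType) (R eps s : K).
Hypothesis hR : 0 < R < 1.
Hypothesis hs : R < s < 1.
Implicit Types (f g : cplx K -> cplx K) (z : cplx K).

Let s0 : 0 < s. Proof. by case/andP: hs => ? _; case/andP: hR => ? _; lra. Qed.

Definition rotation_average g z : cplx K := gavg (fun t => g (z * cis (- (2 * pi * eps) * t))).

Lemma rotation_cbounded g z : dalg s g -> modulus z <= s ->
  cbounded (fun t => g (z * cis (- (2 * pi * eps) * t))).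
Proof.
move=> hg zs; split.
  apply: (dalg_continuous hg (gam := fun t => z * cis (- (2 * pi * eps) * t))) => [|t].
    exact: (continuousZ_fun (c := z) (@cis_scale_continuous K _)).
  by rewrite (modulusM z) modulus_cis mulr1.
have [M M0 hM] := dalg_bounded s0 hg.
by exists M => t; apply: hM; rewrite (modulusM z) modulus_cis mulr1.
Qed.

Lemma rotation_average_le g (x : K) z : dalg s g ->
  (forall z, modulus z <= s -> modulus (g z) <= x) -> modulus z <= s ->
  modulus (rotation_average g z) <= x.
Proof.
move=> hg gx zs; apply: gavg_le => [|t]; first by case: (rotation_cbounded hg zs).
by apply: gx; rewrite (modulusM z) modulus_cis mulr1.
Qed.

Lemma rotation_averageZ (c : cplx K) g h z : dalg s g -> dalg s h -> modulus z <= s ->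
  rotation_average (fun z => c * g z + h z) z = c * rotation_average g z + rotation_average h z.
Proof.
move=> hg hh zs; have bg := rotation_cbounded hg zs.
have bcg := rotation_cbounded (dalgZ s0 c hg) zs; have bh := rotation_cbounded hh zs.
by rewrite /rotation_average (gavgD bcg bh) (gavgZ c bg).
Qed.

Lemma rotation_average_monom k z : modulus z <= s ->
  rotation_average (monom k) z = of_real (damping eps k) * monom k z.
Proof.
move=> zs; rewrite /rotation_average.
have E t : monom k (z * cis (- (2 * pi * eps) * t)) = z ^+ k * cis (- (2 * pi * eps * k%:R) * t).
  by rewrite /monom exprMn cisX; congr (_ * cis _); ring.
have b : cbounded (fun t => cis (- (2 * pi * eps * k%:R) * t) : cplx K).
  by split; [exact: cis_scale_continuous|exists 1 => t; rewrite modulus_cis].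
by rewrite (eq_gavg E) (gavgZ (z ^+ k) b) gavg_cis sqrrN mulrC.
Qed.

Lemma rotation_average_dalg g : dalg s g -> dalg s (rotation_average g).
Proof.
move=> hg; apply: dalg_lim => e e0; have [p hp] := hg e e0.
have dF i : dalg s (fun z => p`_i * (of_real (damping eps i) * monom i z)).
  exact: (dalgZ s0 _ (dalgZ s0 _ (dalg_monom s0 i))).
exists (fun z => \sum_(0 <= i < size p) p`_i * (of_real (damping eps i) * monom i z)); first exact: dalg_sum.
move=> z zs; have dp := dalg_poly s p.
have -> : \sum_(0 <= i < size p) p`_i * (of_real (damping eps i) * monom i z) = rotation_average (fun z => p.[z]) z.
  have dm i : dalg s (fun z => p`_i * monom i z) by exact: (dalgZ s0 _ (dalg_monom s0 i)).
  rewrite /rotation_average.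
  have -> : (fun t => p.[z * cis (- (2 * pi * eps) * t)]) =
      (fun t => \sum_(0 <= i < size p) p`_i * monom i (z * cis (- (2 * pi * eps) * t))).
    by apply/funext => t; rewrite horner_coef big_mkord.
  rewrite (gavg_sum (u := fun i t => p`_i * monom i (z * cis (- (2 * pi * eps) * t)))); last first.
    by move=> i; exact: (rotation_cbounded (dm i) zs).
  apply: eq_bigr => i _; rewrite (gavgZ _ (rotation_cbounded (dalg_monom s0 i) zs)).
  by rewrite -(rotation_average_monom i zs).
have -> : rotation_average g z - rotation_average (fun z => p.[z]) z =
    rotation_average (fun z => (-1) * p.[z] + g z) z.
  by rewrite (rotation_averageZ (-1) dp hg zs) mulN1r addrC.
apply: rotation_average_le zs; first exact: (dalgD (dalgZ s0 (-1) dp) hg).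
by move=> v /hp; rewrite mulN1r addrC.
Qed.

Lemma noise_dual f A r : hardy R f -> 0 < r < R -> 0 <= A ->
  (forall e k, modulus (pair s e f (monom k)) <= A * r ^+ k) ->
  forall e g, dalg s g -> pair s e (noise R eps f) g = pair s e f (rotation_average g).
Proof.
move=> hf hr A0 hA e; have [hn np] := noise_pair eps hR hf hs hr A0 hA.
have af := hardy_analytic hf; have an := hardy_analytic hn.
have [lin [M M0 hM]] := pair_bfunc hR e af hs.
have bf := pair_bfunc hR e af hs.
apply: (bfunc_eq s0 (pair_bfunc hR e an hs)).
- split=> [c g h hg hh|].
    rewrite -lin; [|exact: rotation_average_dalg|exact: rotation_average_dalg].
    apply: (bfunc_ext s0 bf); first exact: (rotation_average_dalg (dalgD (dalgZ s0 c hg) hh)).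
    by move=> z zs; rewrite rotation_averageZ.
  exists M => // g x hg gx; apply: hM; first exact: rotation_average_dalg.
  by move=> z; apply: rotation_average_le.
move=> k; rewrite np -(bfuncZ s0 _ bf (dalg_monom s0 k)).
apply: (bfunc_ext s0 bf); first exact: (dalgZ s0 _ (dalg_monom s0 k)).
by move=> z zs; rewrite rotation_average_monom.
Qed.

End NoiseDual.

(** * Cocycles dual to contractions of the disc algebra *)

Section DualCocycle.
Variables (K : realType) (R r s : K).
Hypothesis hR : 0 < R < 1.
Hypothesis hs : R < s < 1.
Hypothesis hr : 0 < r < R.
Implicit Types (f g h : cplx K -> cplx K) (z : cplx K) (w : Omega).

Let s0 : 0 < s. Proof. by case/andP: hs => ? _; case/andP: hR => ? _; lra. Qed.

(** What both cocycles have in common: the adjoint [S] acts on the disc algebra, contracts the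
    supremum, shrinks z^k to size r^k and preserves 1. The last clause conserves the pairing of
    order 0, the source of the exponent 0. *)
Definition dual_step (A S : (cplx K -> cplx K) -> cplx K -> cplx K) : Prop :=
  [/\ forall f, hardy R f -> hardy R (A f),
      forall g, dalg s g -> dalg s (S g) /\ forall x, (forall z, modulus z <= s -> modulus (g z) <= x) ->
        forall z, modulus z <= s -> modulus (S g z) <= x,
      forall f g e, hardy R f -> dalg s g -> pair s e (A f) g = pair s e f (S g),
      forall k z, modulus z <= s -> modulus (S (monom k) z) <= r ^+ k &
      forall z, modulus z <= s -> S (monom 0) z = 1].

Lemma hardy_inj f g : hardy R f -> hardy R g ->
  (forall e k, pair s e f (monom k) = pair s e g (monom k)) -> f = g.
Proof.
move=> hf hg h; apply/eqP; rewrite -subr_eq0; apply/eqP.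
apply: (hardy_eq0 hR (hardyB hR hf hg) hs) => e k.
have -> : f - g = (-1) *: g + f by rewrite scaleN1r addrC.
have := pair_lin hR e (-1) (hardy_analytic hg) (hardy_analytic hf) hs (dalg_monom s0 k).
by move=> ->; rewrite h mulN1r addNr.
Qed.

Lemma pair_scale_add (c : K[i]) f g e h : hardy R f -> hardy R g -> dalg s h ->
  pair s e (c *: f + g) h = c * pair s e f h + pair s e g h.
Proof. by move=> hf hg; exact: (pair_lin hR e c (hardy_analytic hf) (hardy_analytic hg) hs). Qed.

Lemma hardy_scale_add (c : K[i]) f g : hardy R f -> hardy R g -> hardy R (c *: f + g).
Proof. exact: hardy_lin. Qed.

Lemma pair_zero e h : dalg s h -> pair s e 0 h = 0.
Proof.
move=> dh; have h0 := @hardy0 K R; have := pair_scale_add (-1) e h0 h0 dh.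
by rewrite scaler0 addr0 mulN1r addNr.
Qed.

Lemma pair_scale (c : K[i]) f e h : hardy R f -> dalg s h -> pair s e (c *: f) h = c * pair s e f h.
Proof.
move=> hf dh; have := pair_scale_add c e hf (@hardy0 K R) dh.
by rewrite addr0 pair_zero // addr0.
Qed.

Lemma pair_sub f g e h : hardy R f -> hardy R g -> dalg s h ->
  pair s e (f - g) h = pair s e f h - pair s e g h.
Proof.
move=> hf hg dh; have := pair_scale_add (-1) e hg hf dh.
by rewrite scaleN1r mulN1r addrC => ->; rewrite addrC.
Qed.

Lemma pair_add f g e h : hardy R f -> hardy R g -> dalg s h ->
  pair s e (f + g) h = pair s e f h + pair s e g h.
Proof.
move=> hf hg dh; have := pair_scale_add 1 e hf hg dh.
by rewrite scale1r mul1r.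
Qed.

Lemma pair_one f : hardy R f -> pair s true f (monom 0) = pair s false f (monom 0).
Proof. by move=> hf; exact: (pair_const hR (hardy_analytic hf) hs). Qed.

(** The two passages between norm and pairings: from pairings of size r^k to the norm, and from the
    norm to pairings with bounded test functions. *)
Variables C1 C2 : K.
Hypothesis C10 : 0 < C1.
Hypothesis C20 : 0 < C2.
Hypothesis norm_le : forall f A, hardy R f -> 0 <= A ->
  (forall e k, modulus (pair s e f (monom k)) <= A * r ^+ k) -> hardy_norm R f <= C1 * A.
Hypothesis pair_le : forall f e g (x : K), hardy R f -> dalg s g ->
  (forall z, modulus z <= s -> modulus (g z) <= x) -> modulus (pair s e f g) <= C2 * hardy_norm R f * x.

Lemma monom0_le z : modulus (monom 0 z) <= 1 :> K.
Proof. by rewrite /monom expr0 modulus1. Qed.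

Lemma pair_one_le f e : hardy R f -> modulus (pair s e f (monom 0)) <= C2 * hardy_norm R f.
Proof.
move=> hf; have := pair_le e hf (dalg_monom s0 0) (fun z _ => monom0_le z).
by rewrite mulr1.
Qed.

Section Step.
Variables A S : (cplx K -> cplx K) -> cplx K -> cplx K.
Hypothesis hA : dual_step A S.

Lemma step_linear (c : K[i]) f g : hardy R f -> hardy R g -> A (c *: f + g) = c *: A f + A g.
Proof.
case: hA => A1 A2 A3 _ _ hf hg; have hfg := hardy_scale_add c hf hg.
apply: hardy_inj => [||e k]; first exact: A1.
  exact: hardy_scale_add (A1 _ hf) (A1 _ hg).
have dk := dalg_monom s0 k; have [dS _] := A2 _ dk.
by rewrite (pair_scale_add c e (A1 _ hf) (A1 _ hg) dk) !A3 // (pair_scale_add c e hf hg dS).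
Qed.

Lemma step_coef_le f e k : hardy R f ->
  modulus (pair s e (A f) (monom k)) <= C2 * hardy_norm R f * r ^+ k.
Proof.
case: hA => A1 A2 A3 A4 _ hf; have dk := dalg_monom s0 k; have [dS _] := A2 _ dk.
by rewrite A3 //; apply: pair_le => // z; exact: A4.
Qed.

Lemma step_norm f : hardy R f -> hardy_norm R (A f) <= C1 * C2 * hardy_norm R f.
Proof.
move=> hf; rewrite -mulrA; apply: norm_le => [||e k]; first by case: hA => A1 _ _ _ _; exact: A1.
  by rewrite mulr_ge0 ?hardy_norm_ge0 // ltW.
exact: step_coef_le.
Qed.

Lemma step_one f e : hardy R f -> pair s e (A f) (monom 0) = pair s e f (monom 0).
Proof.
case: hA => A1 A2 A3 _ A5 hf; have dk := dalg_monom s0 0; have [dS _] := A2 _ dk.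
rewrite A3 //; apply: (bfunc_ext s0 (pair_bfunc hR e (hardy_analytic hf) hs) dS).
by move=> z zs; rewrite A5 // /monom expr0.
Qed.

End Step.

Variables (A S : Omega -> (cplx K -> cplx K) -> cplx K -> cplx K) (ok : set Omega).
Hypothesis ok_shift : forall w c, ok w -> ok (shift_by c w).
Hypothesis hAS : forall w, ok w -> dual_step (A w) (S w).
Local Notation it := (iterate bernoulli_shift A).

Lemma bernoulli_shiftE : bernoulli_shift = shift_by 1. Proof. by []. Qed.

Lemma ok_iter n w : ok w -> ok (iter n bernoulli_shift w).
Proof. by elim: n => //= n IH /IH; rewrite bernoulli_shiftE; exact: ok_shift. Qed.

Lemma it_first n w f : it n.+1 w f = it n (bernoulli_shift w) (A w f).
Proof. elim: n => // n IH; rewrite -[RHS]/(A (iter n bernoulli_shift (bernoulli_shift w)) (it n (bernoulli_shift w) (A w f))).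
by rewrite -IH -iterSr. Qed.

Lemma it_hardy n w f : ok w -> hardy R f -> hardy R (it n w f).
Proof. by move=> ow hf; elim: n => //= n IH; case: (hAS (ok_iter n ow)) => A1 _ _ _ _; exact: A1. Qed.

Lemma it_linear n w (c : K[i]) f g : ok w -> hardy R f -> hardy R g ->
  it n w (c *: f + g) = c *: it n w f + it n w g.
Proof.
move=> ow hf hg; elim: n => //= n ->.
by apply: (step_linear (hAS (ok_iter n ow))); exact: it_hardy.
Qed.

Lemma step_sub A1 S1 f g : dual_step A1 S1 -> hardy R f -> hardy R g -> A1 (f - g) = A1 f - A1 g.
Proof.
move=> hA hf hg; have := step_linear hA (-1) hg hf.
by rewrite !scaleN1r addrC => ->; rewrite addrC.
Qed.

Lemma it_sub n w f g : ok w -> hardy R f -> hardy R g -> it n w (f - g) = it n w f - it n w g.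
Proof.
move=> ow hf hg; have := it_linear n (-1) ow hg hf.
by rewrite !scaleN1r addrC => ->; rewrite addrC.
Qed.

Lemma it_one n w f e : ok w -> hardy R f -> pair s e (it n w f) (monom 0) = pair s e f (monom 0).
Proof.
move=> ow hf; elim: n => //= n IH.
by rewrite (step_one (hAS (ok_iter n ow))) //; exact: it_hardy.
Qed.

Lemma it_pair_le n w f e g (x : K) : ok w -> hardy R f -> dalg s g ->
  (forall z, modulus z <= s -> modulus (g z) <= x) ->
  modulus (pair s e (it n w f) g) <= C2 * hardy_norm R f * x.
Proof.
move=> ow hf; elim: n g => [|n IH] g hg gx; first exact: pair_le.
case: (hAS (ok_iter n ow)) => A1 A2 A3 _ _; have [dS Sx] := A2 _ hg.
by rewrite /= A3 //; [apply: IH => //; exact: Sx|exact: it_hardy].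
Qed.

Lemma it_coef_le n w f e k : ok w -> hardy R f ->
  modulus (pair s e (it n.+1 w f) (monom k)) <= C2 * hardy_norm R f * r ^+ k.
Proof.
move=> ow hf; case: (hAS (ok_iter n ow)) => A1 A2 A3 A4 _.
have [dS _] := A2 _ (dalg_monom s0 k).
rewrite /= A3 //; [|exact: it_hardy|exact: dalg_monom].
by apply: it_pair_le => // z; exact: A4.
Qed.

(** The bound C1 C2 of a single step would compound to a power. The adjoints are contractions, so
    they are composed first and the conversion constants are paid only once; the summand 1 covers n
    = 0. *)
Lemma it_norm n w f : ok w -> hardy R f -> hardy_norm R (it n w f) <= (1 + C1 * C2) * hardy_norm R f.
Proof.
move=> ow hf; have N0 := hardy_norm_ge0 R f; have CC : 0 <= C1 * C2 by rewrite mulr_ge0 // ltW.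
case: n => [|n]; first by rewrite /= ler_peMl // lerDl.
apply: le_trans (_ : _ <= C1 * (C2 * hardy_norm R f)) _.
  apply: norm_le => [||e k]; [exact: it_hardy|by rewrite mulr_ge0 // ltW|exact: it_coef_le].
by rewrite mulrA ler_wpM2r // lerDr.
Qed.

Lemma vacuum_exists (t : K) : 0 <= t -> exists2 f, hardy R f &
  hardy_norm R f <= C1 * t /\ forall e k, pair s e f (monom k) = (k == 0%N)%:R * of_real t.
Proof.
move=> t0; have b (e : bool) k : modulus ((k == 0%N)%:R * of_real t : cplx K) <= t * r ^+ k.
  case: k => [|k]; first by rewrite eqxx mul1r expr0 mulr1 modulus_of_real ger0_norm.
  by rewrite mul0r modulus0 mulr_ge0 // exprn_ge0 //; case/andP: hr => /ltW.
have [f hf fp] := hardy_realize hR (alpha := fun e k => (k == 0%N)%:R * of_real t) hr t0 b erefl.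
have fE e k : pair s e f (monom k) = (k == 0%N)%:R * of_real t by exact: fp.
by exists f => //; split => //; apply: norm_le => // e k; rewrite fE; exact: b.
Qed.

Lemma rate_nonneg_const (x : nat -> K) (c C : K) : 0 < c -> (forall n, c <= x n <= C) ->
  log_rate (x n)%:E n @[n --> \oo] --> (0 : \bar K).
Proof.
move=> c0 h; have C0 : 0 < C by have /andP[h1 h2] := h 0%N; exact: lt_le_trans (le_trans h1 h2).
apply: (cvg_log_rate (x := fun n => (x n)%:E)) => [n|e e0|e e0].
- by rewrite lee_fin; have /andP[h1 _] := h n; rewrite (le_trans (ltW c0)).
- exists C => //; apply: nearW => n; rewrite lee_fin; have /andP[_ h2] := h n; apply: le_trans h2 _.
  by rewrite ler_peMr ?(ltW C0) // -[leLHS]expR0 ler_expR add0r mulr_ge0 // ltW.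
- exists c => //; apply: nearW => n; rewrite lee_fin; have /andP[h1 _] := h n; apply: le_trans h1.
  by rewrite ler_piMr ?(ltW c0) // -[leRHS]expR0 ler_expR sub0r mulrN oppr_le0 mulr_ge0 // ltW.
Qed.

(** The norms are bounded above by [it_norm] and below by the conserved pairing of order 0 of an
    element scaled into the unit ball. *)
Lemma operator_norm_rate w : ok w ->
  log_rate (operator_norm (hardy R) (hardy_norm R) (it n w)) n @[n --> \oo] --> (0 : \bar K).
Proof.
move=> ow; pose t := C1^-1; have t0 : 0 < t by rewrite invr_gt0.
have [f hf [Nf fp]] := vacuum_exists (ltW t0).
have Nf1 : hardy_norm R f <= 1 by apply: le_trans Nf _; rewrite /t divff // gt_eqF.
have lo n : ((t / C2)%:E <= operator_norm (hardy R) (hardy_norm R) (it n w))%E.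
  apply: le_trans (_ : _ <= (hardy_norm R (it n w f))%:E)%E _; last first.
    by apply: ereal_sup_ubound; exists f.
  rewrite lee_fin ler_pdivrMr // mulrC.
  have := pair_one_le true (it_hardy n ow hf); rewrite it_one // fp eqxx mul1r modulus_of_real.
  by rewrite ger0_norm ?(ltW t0).
have up n : (operator_norm (hardy R) (hardy_norm R) (it n w) <= (1 + C1 * C2)%:E)%E.
  apply: ge_ereal_sup => _ [g [hg Ng] <-]; rewrite lee_fin.
  apply: le_trans (it_norm n ow hg) _; rewrite ler_piMr // addr_ge0 // mulr_ge0 // ltW //.
have E n : operator_norm (hardy R) (hardy_norm R) (it n w) =
    (fine (operator_norm (hardy R) (hardy_norm R) (it n w)))%:E.
  rewrite fineK // fin_numElt; apply/andP; split.
    by apply: lt_le_trans (lo n); rewrite ltNyr.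
  by apply: le_lt_trans (up n) _; rewrite ltry.
under eq_fun do rewrite E.
apply: (@rate_nonneg_const _ (t / C2) (1 + C1 * C2)) => [|n]; first by rewrite divr_gt0.
by rewrite -!lee_fin -E lo up.
Qed.

Lemma rate_one w f : ok w -> hardy R f -> pair s true f (monom 0) != 0 ->
  log_rate (hardy_norm R (it n w f))%:E n @[n --> \oo] --> (0 : \bar K).
Proof.
move=> ow hf f0; apply: (@rate_nonneg_const _ (modulus (pair s true f (monom 0)) / C2)
   ((1 + C1 * C2) * hardy_norm R f)) => [|n]; first by rewrite divr_gt0 // modulus_gt0.
rewrite it_norm // andbT ler_pdivrMr // mulrC -(it_one n true ow hf).
exact: pair_one_le (it_hardy n ow hf).
Qed.

End DualCocycle.

(** * Runs of zeros *)

Definition fwd : Omega -> Omega := bernoulli_shift.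
Definition bwd : Omega -> Omega := shift_by (-1).

Lemma bwd_fwd w : bwd (fwd w) = w.
Proof. by apply/funext => i; rewrite /bwd /fwd /shift_by /bernoulli_shift; congr (w _); lia. Qed.

Lemma fwd_bwd w : fwd (bwd w) = w.
Proof. by apply/funext => i; rewrite /bwd /fwd /shift_by /bernoulli_shift; congr (w _); lia. Qed.

Section ZeroRuns.
Variables (K : realType) (p : K) (P : probability Omega K).
Hypothesis hp : 0 <= p <= 1.
Hypothesis hP : bernoulli_measure p P.

(** The run is read backwards from position 0, so it consists of the most recent symbols. *)
Definition zero_run (j : nat) : set Omega :=
  cyl [seq - (i%:Z) | i <- iota 0 j.+1] (fun=> false).

Lemma zero_run0 v : zero_run 0 v <-> v 0 = false.
Proof.
split=> [h|h i]; first by apply: h; rewrite inE.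
by rewrite inE => /eqP ->.
Qed.

Lemma zero_runS j v : zero_run j.+1 v <-> v 0 = false /\ zero_run j (shift_by (-1) v).
Proof.
split=> [h|[h0 h] i /mapP[n]].
  split; first by apply: h; rewrite inE.
  move=> i /mapP[n]; rewrite mem_iota add0n => nj ->; rewrite /shift_by.
  have -> : - n%:Z + -1 = - (n.+1)%:Z by lia.
  by apply: h; apply/mapP; exists n.+1 => //; rewrite mem_iota.
rewrite mem_iota add0n /= => nj ->; case: n nj => [|n] nj; first by rewrite oppr0.
have := h (- n%:Z); rewrite /shift_by.
have -> : - n%:Z + -1 = - (n.+1)%:Z by lia.
by apply; apply/mapP; exists n => //; rewrite mem_iota.
Qed.

Lemma measurable_zero_run j : measurable (zero_run j). Proof. exact: measurable_cyl. Qed.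

Lemma zero_run_prob j : fine (P (zero_run j)) = p ^+ j.+1.
Proof.
rewrite /zero_run (pr_cyl hP); last first.
  by rewrite map_inj_uniq ?iota_uniq // => i k /eqP; rewrite eqr_opp => /eqP [].
by rewrite /weight big_map big_const_seq count_predT size_iota iter_mulr_1.
Qed.

(** The sum 1 + c + ... + c^(l-1), where l is the length of the run of zeros ending at position 0,
    truncated at M + 1. The base is 4 for damping weights and 2 for the logarithm of the fixed
    point. *)
Definition run_sum (c : K) (M : nat) (v : Omega) : K := \sum_(0 <= j < M.+1) c ^+ j * \1_(zero_run j) v.

Lemma run_sum_recr c M v : run_sum c M.+1 v = run_sum c M v + c ^+ M.+1 * \1_(zero_run M.+1) v.
Proof. by rewrite /run_sum big_nat_recr. Qed.

Lemma run_sum_indic j v : \1_(zero_run j) v = (if asbool (zero_run j v) then 1 else 0) :> K.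
Proof. by rewrite indicE; case: asboolP => h; [rewrite mem_set|rewrite memNset]. Qed.

Lemma run_sum_ge0 c M v : 0 <= c -> 0 <= run_sum c M v.
Proof. by move=> c0; apply: sumr_ge0 => j _; rewrite mulr_ge0 // exprn_ge0. Qed.

Lemma run_sum0 c v : run_sum c 0 v = if v 0 then 0 else 1.
Proof.
rewrite /run_sum big_nat1 expr0 mul1r run_sum_indic.
case: asboolP; [move=> /zero_run0 -> //|case v0: (v 0) => // h].
by exfalso; apply: h; apply/zero_run0.
Qed.

Lemma run_sumS c M v : run_sum c M.+1 v = if v 0 then 0 else 1 + c * run_sum c M (shift_by (-1) v).
Proof.
rewrite /run_sum big_nat_recl // -/(run_sum c 0 v).
have -> : c ^+ 0 * \1_(zero_run 0) v = run_sum c 0 v by rewrite /run_sum big_nat1.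
rewrite run_sum0; case v0: (v 0).
  rewrite add0r big1_seq // => j _; rewrite run_sum_indic; case: asboolP; last by rewrite mulr0.
  by move=> /zero_runS[]; rewrite v0.
congr (_ + _); rewrite mulr_sumr; apply: eq_bigr => j _; rewrite !run_sum_indic exprS -mulrA.
congr (_ * (_ * _)); case: asboolP; case: asboolP => // h1 h2; exfalso.
  by apply: h1; move/zero_runS: h2 => [].
by apply: h2; apply/zero_runS; split.
Qed.

Lemma run_sum_integral c M : P.-integrable setT (EFin \o run_sum c M) /\
  (\int[P]_v (run_sum c M v)%:E = (\sum_(0 <= j < M.+1) c ^+ j * p ^+ j.+1)%:E)%E.
Proof.
have one j : P.-integrable setT (EFin \o (fun v => c ^+ j * \1_(zero_run j) v)) /\
    (\int[P]_v (c ^+ j * \1_(zero_run j) v)%:E = (c ^+ j * p ^+ j.+1)%:E)%E.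
  have i1 : P.-integrable setT (EFin \o \1_(zero_run j)).
    by apply: integrable_indic => //; [exact: measurable_zero_run].
  split; first by have := integrableZl measurableT (c ^+ j) i1; apply: eq_integrable.
  have -> : (\int[P]_v (c ^+ j * \1_(zero_run j) v)%:E = (c ^+ j)%:E * \int[P]_v (\1_(zero_run j) v)%:E)%E.
    by rewrite -(integralZl measurableT i1); apply: eq_integral.
  rewrite integral_indic // ?setIT; last exact: measurable_zero_run.
  rewrite EFinM -zero_run_prob; congr (_ * _)%E; exact: (prE P (measurable_zero_run j)).
elim: M => [|M [i e]].
  have [i e] := one 0%N; rewrite big_nat1 -e; split.
    by move: i; apply: eq_integrable => // v _; rewrite /= /run_sum big_nat1.
  by apply: eq_integral => v _; rewrite /run_sum big_nat1.
have [i1 e1] := one M.+1; split.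
  by have := integrableD measurableT i i1; apply: eq_integrable => // v _; rewrite /= run_sum_recr.
rewrite big_nat_recr //= EFinD -e -e1 -integralD_EFin //.
by apply: eq_integral => v _; rewrite run_sum_recr EFinD.
Qed.

(* The symbol 0 moves the mode 2k to the mode k, hence multiplies by 4 the
   Gaussian damping that the k-th mode has accumulated. *)
Fixpoint run_weight (w : Omega) (n : nat) : K :=
  if n is m.+1 then (if iter n fwd w 0 then 1 else 1 + 4 * run_weight w m) else 1.

Lemma run_weight_ge1 w n : 1 <= run_weight w n.
Proof. by elim: n => //= n IH; case: ifP => // _; move: IH; lra. Qed.

(** Both satisfy y |-> 1 + 4 y at a zero; the condition on M keeps the window of the truncated run
    inside the times 0 to n, where the weight is defined. *)
Lemma run_sum_le_weight M w n : (M <= n)%N -> run_sum 4 M (iter n fwd w) <= run_weight w n.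
Proof.
elim: n M => [|n IH] [|M] // Mn.
- by rewrite run_sum0 /=; case: ifP.
- by rewrite run_sum0; apply: le_trans (run_weight_ge1 w n.+1); case: ifP.
rewrite run_sumS -/(bwd _) [iter n.+1 fwd w]iterS bwd_fwd -iterS /=.
by case: ifP => // _; rewrite lerD2l ler_pM2l // IH.
Qed.

Definition total_weight w n : K := \sum_(0 <= t < n.+1) run_weight w t.

Lemma total_weight_fwd M w n : (M <= n)%N ->
  bsum fwd (run_sum 4 M) n.+1 w - bsum fwd (run_sum 4 M) M w <= total_weight w n.
Proof.
move=> Mn; rewrite /bsum /total_weight (big_cat_nat (n := M)) //=; last exact: leqW.
rewrite addrAC subrr add0r (big_cat_nat (n := M) (m := 0%N) (p := n.+1)) //=; last exact: leqW.
apply: ler_wpDl; first by apply: sumr_ge0 => t _; apply: le_trans (run_weight_ge1 w t).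
by apply: ler_sum_nat => t /andP[Mt _]; exact: run_sum_le_weight.
Qed.

(** The orbit started at the (n+1)-st preimage visits the preimages of [w] in reverse order, so
    reversing the sum gives a Birkhoff sum of the inverse shift. The term at [w] itself is not
    visited and is subtracted. *)
Lemma total_weight_bwd M w n : (M <= n)%N ->
  bsum bwd (run_sum 4 M) (n.+1 - M).+1 w - run_sum 4 M w <= total_weight (iter n.+1 bwd w) n.
Proof.
move=> Mn; rewrite /bsum big_nat_recl // addrC addKr.
rewrite /total_weight (big_cat_nat (n := M) (m := 0%N) (p := n.+1)) //=; last exact: leqW.
apply: ler_wpDl; first by apply: sumr_ge0 => t _; apply: le_trans (run_weight_ge1 _ t).
have -> : \sum_(M <= i < n.+1) run_weight (iter n.+1 bwd w) i =
    \sum_(0 <= i < n.+1 - M) run_weight (iter n.+1 bwd w) (i + M) by rewrite -{1}[M]add0n big_addn.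
rewrite big_nat_rev /= add0n.
apply: ler_sum_nat => t /andP[_ tn].
apply: le_trans (run_sum_le_weight (M := M) (iter n.+1 bwd w) (n := t + M) (leq_addl _ _)).
apply: eq_leW; congr (run_sum 4).
have fb k v : iter k fwd (iter k bwd v) = v.
  by elim: k v => // k IH v; rewrite iterSr iterS fwd_bwd IH.
rewrite [RHS](_ : _ = iter (n.+1 - M - t.+1).+1 bwd w); first by [].
have E : (t + M + (n.+1 - M - t.+1).+1)%N = n.+1 by lia.
by rewrite -[RHS](fb (t + M)%N) -iterD E.
Qed.

Hypothesis hp4 : 4^-1 <= p.

(** The second half concerns orbits that start in the past and end at [w]; it is what makes the
    pullbacks converge. *)
Definition heavy_runs w := (forall L : K, exists C : K, forall n, n%:R * L - C <= total_weight w n) /\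
  (forall L : K, exists C : K, forall n, n%:R * L - C <= total_weight (iter n.+1 bwd w) n).

(** Each term of the mean of the truncated run sum is p (4 p)^j >= 1/4, so the mean is at least (M +
    1) / 4. As M is arbitrary, Birkhoff's theorem for the shift and for its inverse gives
    superlinear growth. *)
Lemma heavy_runs_ae : {ae P, forall w, heavy_runs w}.
Proof.
pose mean M : K := \sum_(0 <= j < M.+1) 4 ^+ j * p ^+ j.+1.
have mean_ge M : M.+1%:R / 4 <= mean M.
  elim: M => [|M IH]; first by rewrite /mean big_nat1 expr0 mul1r expr1 mul1r.
  rewrite /mean big_nat_recr //= -natr1 mulrDl lerD // mul1r.
  have p4 : 1 <= 4 * p by move: hp4; lra.
  rewrite (exprSr p) mulrA -exprMn; apply: le_trans hp4 _.
  by rewrite ler_peMl ?exprn_ege1 //; move: hp4; lra.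
have B (c : int) : c != 0 -> {ae P, forall w, forall M : nat, forall e : K, 0 < e -> exists C : K, forall n,
    `|bsum (shift_by c) (run_sum 4 M) n w - n%:R * mean M| <= n%:R * e + C}.
  move=> c0; apply: ae_foralln => M; have [i e] := run_sum_integral 4 M.
  apply: birkhoff => //.
  - exact: measurable_shift.
  - by move=> A mA; exact: (shift_preserving hP).
  - by move=> A mA; exact: (shift_ergodic hP).
have nz : (-1 : int) != 0 by [].
apply: filterS2 (B 1 (oner_neq0 _)) (B (-1) nz) => w h1 h2.
(* The mean exceeds |L| by 1, which absorbs the error rate 1 taken in Birkhoff's theorem. *)
have pick (L : K) : exists M : nat, `|L| + 1 <= mean M.
  exists (Num.truncn (4 * (`|L| + 1))); apply: le_trans (mean_ge _).
  by rewrite ler_pdivlMr // mulrC ltW // truncnS_gt.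
split=> L; have [M hM] := pick L.
  have [C hC] := h1 M 1 ltr01.
  pose D := bsum fwd (run_sum 4 M) M w; have D0 : 0 <= D by apply: sumr_ge0 => *; exact: run_sum_ge0.
  exists (`|C| + D + M%:R * `|L|) => n.
  have T0 : 0 <= total_weight w n by apply: sumr_ge0 => t _; apply: le_trans (run_weight_ge1 w t).
  have LL := ler_norm L; have L0 := normr_ge0 L; have C0 := normr_ge0 C; have CC := ler_norm C.
  have [Mn|nM] := leqP M n.
    apply: le_trans (total_weight_fwd w Mn); have := hC n.+1.
    rewrite ler_distl => /andP[+ _]; rewrite -/D -[shift_by 1]/fwd.
    move: (bsum _ _ _ _) => X; rewrite -natr1; have n0 : 0 <= n%:R :> K by [].
    have M0 : 0 <= M%:R * `|L| by rewrite mulr_ge0.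
    have e1 : (n%:R + 1) * (`|L| + 1) <= (n%:R + 1) * mean M by rewrite ler_wpM2l // addr_ge0.
    have e2 : n%:R * L <= n%:R * `|L| by rewrite ler_wpM2l.
    by move: (n%:R * L) (M%:R * _) e1 e2 M0 => u v; nra.
  apply: le_trans T0; have : n%:R * L <= M%:R * `|L|.
    by apply: le_trans (_ : n%:R * `|L| <= _); [rewrite ler_wpM2l|rewrite ler_wpM2r // ler_nat ltnW].
  by move: (n%:R * L) (M%:R * _) => u v; lra.
have [C hC] := h2 M 1 ltr01.
pose D := run_sum 4 M w; have D0 : 0 <= D by exact: run_sum_ge0.
exists (`|C| + D + M%:R * `|L|) => n.
have T0 : 0 <= total_weight (iter n.+1 bwd w) n by apply: sumr_ge0 => t _; apply: le_trans (run_weight_ge1 _ t).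
have LL := ler_norm L; have L0 := normr_ge0 L; have C0 := normr_ge0 C; have CC := ler_norm C.
have [Mn|nM] := leqP M n.
  apply: le_trans (total_weight_bwd w Mn); have := hC (n.+1 - M).+1.
  rewrite ler_distl => /andP[+ _]; rewrite -/D -[shift_by (-1)]/bwd.
  move: (bsum _ _ _ _) => X.
  have -> : n%:R * L = (n.+1 - M)%N%:R * L + (M%:R - 1) * L :> K.
    by rewrite natrB ?(leqW Mn) // -natr1; ring.
  rewrite -natr1; move: ((n.+1 - M)%N) => k; have k0 : 0 <= k%:R :> K by [].
  have e1 : (k%:R + 1) * (`|L| + 1) <= (k%:R + 1) * mean M by rewrite ler_wpM2l // addr_ge0.
  have e2 : k%:R * L <= k%:R * `|L| by rewrite ler_wpM2l.
  have e3 : M%:R * L <= M%:R * `|L| by rewrite ler_wpM2l.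
  have e4 : - L <= `|L| by rewrite -normrN ler_norm.
  rewrite mulrBl mul1r; move: (k%:R * L) (M%:R * L) (M%:R * `|L|) e2 e3 => u v t e2 e3.
  by move: CC C0 D0 e1 e2 e3 e4; lra.
apply: le_trans T0; have : n%:R * L <= M%:R * `|L|.
  by apply: le_trans (_ : n%:R * `|L| <= _); [rewrite ler_wpM2l|rewrite ler_wpM2r // ler_nat ltnW].
by move: (n%:R * L) (M%:R * _) => u v; lra.
Qed.

End ZeroRuns.

(** * Collapse of the perturbed spectrum *)

Lemma cvg0_le_scale (K : realType) (u v : nat -> K) (c : K) :
  (forall n, 0 <= v n <= c * u n) -> u n @[n --> \oo] --> (0 : K) -> v n @[n --> \oo] --> (0 : K).
Proof.
move=> h hu; apply: (squeeze_cvgr (f := fun=> 0) (h := fun n => c * u n)).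
- by apply: nearW.
- exact: cvg_cst.
- by rewrite -[X in _ --> X](mulr0 c); apply: cvgMr.
Qed.

Section Collapse.
Variables (K : realType) (R r s eps : K).
Hypothesis hR : 0 < R < 1.
Hypothesis hs : R < s < 1.
Hypothesis hr : 0 < r < R.
Hypothesis eps0 : 0 < eps.
Implicit Types (f g h : cplx K -> cplx K) (z : cplx K) (w : Omega).

Let s0 : 0 < s. Proof. by case/andP: hs => ? _; case/andP: hR => ? _; lra. Qed.
Let r0 : 0 < r. Proof. by case/andP: hr. Qed.
Let r1 : r < 1. Proof. by case/andP: hr => ? ?; case/andP: hR => ? ?; lra. Qed.

Definition contracting b := forall z, modulus z <= s -> modulus (@blaschke K b z) <= r.
(** The essential supremum says nothing about a symbol of probability 0, so contraction is required
    along the sequence rather than for both symbols. *)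
Definition ok_symbols : set Omega := [set w | forall i, contracting (w i)].

Lemma ok_symbols_shift w c : ok_symbols w -> ok_symbols (shift_by c w).
Proof. by move=> h i; exact: h. Qed.

Variables C1 C2 : K.
Hypothesis C10 : 0 < C1.
Hypothesis C20 : 0 < C2.
Hypothesis norm_le : forall f A, hardy R f -> 0 <= A ->
  (forall e k, modulus (pair s e f (monom k)) <= A * r ^+ k) -> hardy_norm R f <= C1 * A.
Hypothesis pair_le : forall f e g (x : K), hardy R f -> dalg s g ->
  (forall z, modulus z <= s -> modulus (g z) <= x) -> modulus (pair s e f g) <= C2 * hardy_norm R f * x.

Lemma contracting_le b z : contracting b -> modulus z <= s -> modulus (@blaschke K b z) <= s.
Proof. by move=> h /h h1; apply: le_trans h1 _; case/andP: hr => _ ?; case/andP: hs => ? _; lra. Qed.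

Lemma power_le b z k : contracting b -> modulus z <= s -> modulus (monom k (@blaschke K b z)) <= r ^+ k.
Proof. by move=> h zs; rewrite modulusX lerXn2r ?nnegrE ?modulus_ge0 ?(ltW r0) // h. Qed.

Lemma pf_dual_step b : contracting b ->
  dual_step R r s (perron_frobenius R (@blaschke K b)) (fun g z => g (@blaschke K b z)).
Proof.
move=> hb; have dT := dalg_blaschke hR b hs.
split => [f hf|g hg|f g e hf hg|k z zs|z zs].
- by have [] := perron_frobenius_pair hR hs hr hb hf.
- split; first by apply: (dalg_comp s0 hg dT) => z; exact: contracting_le.
  by move=> x gx z zs; apply: gx; exact: contracting_le.
- by have [_] := perron_frobenius_pair hR hs hr hb hf; apply.
- exact: power_le.
- by rewrite /monom expr0.
Qed.

Lemma noisy_dual_step b : contracting b ->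
  dual_step R r s (noise R eps \o perron_frobenius R (@blaschke K b))
    (fun g z => rotation_average eps g (@blaschke K b z)).
Proof.
move=> hb; have dT := dalg_blaschke hR b hs; have [p1 p2 p3 p4 p5] := pf_dual_step hb.
have coef f : hardy R f -> forall e k, modulus (pair s e (perron_frobenius R (@blaschke K b) f) (monom k)) <=
    C2 * hardy_norm R f * r ^+ k by move=> hf e k; exact: (step_coef_le hR hs pair_le (pf_dual_step hb)).
have A0 f : 0 <= C2 * hardy_norm R f by rewrite mulr_ge0 ?hardy_norm_ge0 // ltW.
have rm k z : modulus z <= s -> rotation_average eps (monom k) (@blaschke K b z) =
    of_real (damping eps k) * monom k (@blaschke K b z).
  by move=> zs; apply: rotation_average_monom; exact: contracting_le.
split => [f hf|g hg|f g e hf hg|k z zs|z zs].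
- by have [] := noise_pair eps hR (p1 _ hf) hs hr (A0 f) (coef f hf).
- have dr := rotation_average_dalg eps hR hs hg.
  split; first by apply: (dalg_comp s0 dr dT) => z; exact: contracting_le.
  by move=> x gx z zs; apply: (rotation_average_le eps hR hs hg gx); exact: contracting_le.
- have dr := rotation_average_dalg eps hR hs hg.
  exact: (etrans (noise_dual eps hR hs (p1 _ hf) hr (A0 f) (coef f hf) e hg) (p3 _ _ e hf dr)).
- rewrite rm // (modulusM (of_real _)) modulus_of_real ger0_norm ?damping_ge0 //.
  apply: le_trans (ler_piMl (modulus_ge0 _) (damping_le1 eps k)) _; exact: power_le.
- by rewrite rm // damping0 mul1r /monom expr0.
Qed.

Local Notation A := (noisy_pf_cocycle R eps).
Let S w g z := rotation_average eps g (@blaschke K (w 0) z).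

Lemma noisy_step w : ok_symbols w -> dual_step R r s (A w) (S w).
Proof. by move=> ow; exact: noisy_dual_step. Qed.

Local Notation it := (iterate bernoulli_shift A).
Local Notation N := (hardy_norm R).

Let q34 : (3 / 4 : K) <= 1. Proof. by lra. Qed.

Definition kap : K := (2 * pi * eps) ^+ 2 / 2.

Lemma kap_gt0 : 0 < kap. Proof. by rewrite divr_gt0 // exprn_gt0 // mulr_gt0 // twopi_gt0. Qed.

Lemma damping_kap k : damping eps k = expR (- (kap * k%:R ^+ 2)).
Proof. by rewrite /damping /kap; congr expR; rewrite exprMn; ring. Qed.

Lemma noisy_coef w f e k : ok_symbols w -> hardy R f ->
  pair s e (A w f) (monom k) = of_real (damping eps k) * pair s e f (fun z => @blaschke K (w 0) z ^+ k).
Proof.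
move=> ow hf; have [p1 _ p3 _ _] := pf_dual_step (ow 0).
have A0 : 0 <= C2 * N f by rewrite mulr_ge0 ?hardy_norm_ge0 // ltW.
have coef e' k' : modulus (pair s e' (perron_frobenius R (@blaschke K (w 0)) f) (monom k')) <=
    C2 * N f * r ^+ k' by exact: (step_coef_le hR hs pair_le (pf_dual_step (ow 0))).
have [_ np] := noise_pair eps hR (p1 _ hf) hs hr A0 coef.
by rewrite [A w f]/(noise R eps _) np p3 //; exact: dalg_monom.
Qed.

Definition centred : set (cplx K -> cplx K) :=
  [set f | hardy R f /\ pair s true f (monom 0) = 0].

Lemma centred_pair f e : centred f -> pair s e f (monom 0) = 0.
Proof. by case=> hf h; case: e; [exact: h|]; exact: (etrans (esym (pair_one hR hs hf)) h). Qed.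

Lemma centred_it n w f : ok_symbols w -> centred f -> centred (it n w f).
Proof.
move=> ow [hf f0]; split; first exact: (it_hardy ok_symbols_shift noisy_step).
by rewrite (it_one hR hs ok_symbols_shift noisy_step).
Qed.

(** Gaussian decay in the order k with accumulated weight c, in addition to the geometric factor;
    order 0 is left to [centred]. *)
Definition gauss_bound f (B c : K) := forall e k, (0 < k)%N ->
  modulus (pair s e f (monom k)) <= B * expR (- (kap * c * k%:R ^+ 2)) * r ^+ k.

Lemma gauss_bound_norm f B c : centred f -> 0 <= B -> 0 <= c -> gauss_bound f B c ->
  N f <= C1 * (B * expR (- (kap * c))).
Proof.
move=> cf B0 c0 h; have [hf _] := cf; apply: norm_le => // [|e [|k]].
- by rewrite mulr_ge0 // expR_ge0.
- by rewrite centred_pair // modulus0 !mulr_ge0 // ?expR_ge0.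
apply: le_trans (h e k.+1 isT) _; rewrite ler_wpM2r ?exprn_ge0 ?(ltW r0) // ler_wpM2l // ler_expR lerN2.
rewrite ler_peMr //; first by rewrite mulr_ge0 // ltW // kap_gt0.
by rewrite exprn_ege1 // ler1n.
Qed.

(** After any symbol the noise guarantees weight 1, at the price of replacing the old constant by
    the norm. *)
Lemma gauss_bound_step w f : ok_symbols w -> hardy R f -> gauss_bound (A w f) (C2 * N f) 1.
Proof.
move=> ow hf e k k0; rewrite noisy_coef // (modulusM (of_real _)) modulus_of_real.
rewrite ger0_norm ?damping_ge0 // damping_kap mulr1.
rewrite [leRHS]mulrAC [leRHS]mulrC ler_wpM2l ?expR_ge0 //; apply: pair_le => //.
  exact: (dalgX s0 k (dalg_blaschke hR (w 0) hs)).
by move=> z zs; exact: power_le (ow 0) zs.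
Qed.

(** T_0^k is the monomial of order 2k, whose exponent c (2k)^2 equals 4 c k^2; the new damping adds
    k^2. The constant [B] is kept, so a run of zeros costs nothing. *)
Lemma gauss_bound_false w f B c : ok_symbols w -> hardy R f -> 0 <= B -> w 0 = false ->
  gauss_bound f B c -> gauss_bound (A w f) B (1 + 4 * c).
Proof.
move=> ow hf B0 w0 h e k k0; rewrite noisy_coef // w0 (modulusM (of_real _)) modulus_of_real.
rewrite ger0_norm ?damping_ge0 // damping_kap.
have -> : (fun z => @blaschke K false z ^+ k) = monom (2 * k).
  by apply/funext => z; rewrite blaschke0E /monom exprM.
have k20 : (0 < 2 * k)%N by rewrite muln_gt0.
apply: le_trans (ler_wpM2l (expR_ge0 _) (h e _ k20)) _.
have -> : - (kap * (1 + 4 * c) * k%:R ^+ 2) = - (kap * k%:R ^+ 2) + - (kap * c * (2 * k)%:R ^+ 2).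
  by rewrite natrM; ring.
rewrite expRD; move: (expR _) (expR _) (expR_ge0 (- (kap * k%:R ^+ 2))) (expR_ge0 (- (kap * c * (2 * k)%:R ^+ 2))) => E2 E1 h1 h2.
have -> : E1 * (B * E2 * r ^+ (2 * k)) = B * (E1 * E2) * r ^+ (2 * k) by ring.
rewrite ler_wpM2l ?mulr_ge0 //.
by rewrite ler_wiXn2l ?(ltW r0) ?(ltW r1) // leq_pmull.
Qed.

(** At a symbol 1 the current weight is converted into a norm estimate, with a factor C1 C2, and the
    weight restarts at 1. Within a run of zeros the weight c becomes 1 + 4 c, and its last value
    must pay for the whole run: this is possible up to the factor 3/4. *)
Lemma collapse_bound w f n : ok_symbols w -> centred f ->
  N (it n.+1 w f) <= C1 * (C2 * N f * (1 + C1 * C2) ^+ n * expR (- (kap * (3 / 4) * total_weight K w n))).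
Proof.
move=> ow cf; have [hf _] := cf; have k0 := kap_gt0; have N0 := hardy_norm_ge0 R f.
suff [B [B0 gb hB]] : exists B, [/\ 0 <= B, gauss_bound (it n.+1 w f) B (run_weight K w n) &
    B * expR (- (kap * run_weight K w n)) <= C2 * N f * (1 + C1 * C2) ^+ n * expR (- (kap * (3 / 4) * total_weight K w n))].
  apply: le_trans (gauss_bound_norm (centred_it n.+1 ow cf) B0 _ gb) _; last by rewrite ler_pM2l.
  by apply: le_trans (run_weight_ge1 _ _ _).
elim: n => [|n [B [B0 gb hB]]].
  exists (C2 * N f); split; first by rewrite mulr_ge0 // ltW.
    exact: gauss_bound_step.
  rewrite /total_weight big_nat1 expr0 mulr1 /= ler_wpM2l ?mulr_ge0 ?(ltW C20) //.
  by rewrite ler_expR lerN2 !mulr1 -[leRHS]mulr1 ler_wpM2l // ltW.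
set f' := it n.+1 w f in gb *; have hf' : hardy R f' by exact: (it_hardy ok_symbols_shift noisy_step).
have ow' := ok_iter ok_symbols_shift n.+1 ow.
have cf' : centred f' by exact: centred_it.
have tw : total_weight K w n.+1 = total_weight K w n + run_weight K w n.+1 by rewrite /total_weight big_nat_recr.
have Q0 : 0 <= C2 * N f by rewrite mulr_ge0 // ltW.
have C0 : 0 <= C1 * C2 by rewrite mulr_ge0 // ltW.
have P0 : 0 <= (1 + C1 * C2) ^+ n by rewrite exprn_ge0 // addr_ge0.
have rw1 := run_weight_ge1 K w n.
rewrite [it n.+2 w f]/(A (iter n.+1 bernoulli_shift w) f') tw.
have rwS : run_weight K w n.+1 = if iter n.+1 bernoulli_shift w 0 then 1 else 1 + 4 * run_weight K w n by [].
case wn: (iter n.+1 bernoulli_shift w 0); rewrite wn in rwS; rewrite rwS.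
  have Nf' := gauss_bound_norm cf' B0 (le_trans ler01 rw1) gb.
  exists (C2 * N f'); split; first by rewrite mulr_ge0 ?hardy_norm_ge0 // ltW.
    exact: gauss_bound_step.
  rewrite mulr1 mulrDr opprD expRD.
  have e1 : expR (- kap) <= expR (- (kap * (3 / 4) * 1)) by rewrite ler_expR lerN2 mulr1 -[leRHS]mulr1 ler_wpM2l // ltW.
  have E0 := expR_ge0 (- (kap * (3 / 4) * total_weight K w n)).
  have h1 : C2 * N f' <= C2 * N f * (1 + C1 * C2) ^+ n.+1 * expR (- (kap * (3 / 4) * total_weight K w n)).
    apply: le_trans (_ : _ <= C2 * (C1 * (C2 * N f * (1 + C1 * C2) ^+ n * expR (- (kap * (3 / 4) * total_weight K w n))))) _.
      by rewrite (ler_pM2l C20); apply: le_trans Nf' _; rewrite (ler_pM2l C10).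
    rewrite exprS; move: (expR _) E0 => E E0.
    have X0 : 0 <= C2 * N f * (1 + C1 * C2) ^+ n * E by rewrite mulr_ge0 // mulr_ge0.
    have -> : C2 * N f * ((1 + C1 * C2) * (1 + C1 * C2) ^+ n) * E = (1 + C1 * C2) * (C2 * N f * (1 + C1 * C2) ^+ n * E) by ring.
    by rewrite mulrA (mulrC C2) ler_wpM2r // lerDr.
  have a0 : 0 <= C2 * N f' by rewrite mulr_ge0 ?hardy_norm_ge0 // (ltW C20).
  by apply: le_trans (ler_pM a0 (expR_ge0 _) h1 e1) _; rewrite mulrA.
exists B; split => //; first exact: gauss_bound_false.
(* The gain 1 + 3 c in weight is at least 3/4 of the new weight 1 + 4 c; this inequality fixes the
   constant 3/4. *)
rewrite exprS; have -> : - (kap * (1 + 4 * run_weight K w n)) = - (kap * run_weight K w n) + - (kap * (1 + 3 * run_weight K w n)) by ring.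
rewrite (expRD (- (kap * run_weight K w n))) (mulrDr (kap * (3 / 4))) opprD.
rewrite (expRD (- (kap * (3 / 4) * total_weight K w n))).
have h1 : B * expR (- (kap * run_weight K w n)) <=
    C2 * N f * ((1 + C1 * C2) * (1 + C1 * C2) ^+ n) * expR (- (kap * (3 / 4) * total_weight K w n)).
  apply: le_trans hB _; move: (expR _) (expR_ge0 (- (kap * (3 / 4) * total_weight K w n))) => E E0.
  by rewrite ler_wpM2r // ler_wpM2l // ler_peMl // lerDl.
have h2 : expR (- (kap * (1 + 3 * run_weight K w n))) <= expR (- (kap * (3 / 4) * (1 + 4 * run_weight K w n))).
  rewrite ler_expR lerN2 -mulrA ler_wpM2l ?(ltW k0) //; move: rw1; move: (run_weight K w n) => ?; lra.
have a0 : 0 <= B * expR (- (kap * run_weight K w n)) by rewrite mulr_ge0 ?expR_ge0.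
by rewrite [X in X <= _]mulrA [X in _ <= X]mulrA; exact: (ler_pM a0 (expR_ge0 _) h1 h2).
Qed.

Lemma superlinear_decay (T : nat -> K) : (forall L : K, exists C : K, forall n, n%:R * L - C <= T n) ->
  forall L : K, exists2 C : K, 0 < C & forall n x, 0 <= x ->
    C1 * (C2 * x * (1 + C1 * C2) ^+ n * expR (- (kap * (3 / 4) * T n))) <= C * x * expR (n.+1%:R * L).
Proof.
move=> hT L; have k0 : 0 < kap * (3 / 4) by rewrite mulr_gt0 ?kap_gt0 // divr_gt0.
have Q0 : 0 < 1 + C1 * C2 by rewrite addr_gt0 // mulr_gt0.
(* The slope is chosen so that the damping cancels the growth (1 + C1 C2)^n and still leaves exp (n
   L). *)
have [C hC] := hT ((ln (1 + C1 * C2) - L) / (kap * (3 / 4))).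
exists (C1 * C2 * expR (kap * (3 / 4) * C - L)) => [|n x x0]; first by rewrite !mulr_gt0 ?expR_gt0.
have -> : (1 + C1 * C2) ^+ n = expR (n%:R * ln (1 + C1 * C2)) by rewrite expRM_natl lnK.
have -> : C1 * C2 * expR (kap * (3 / 4) * C - L) * x * expR (n.+1%:R * L) =
    C1 * C2 * x * (expR (kap * (3 / 4) * C - L) * expR (n.+1%:R * L)) by ring.
have -> : C1 * (C2 * x * expR (n%:R * ln (1 + C1 * C2)) * expR (- (kap * (3 / 4) * T n))) =
    C1 * C2 * x * (expR (n%:R * ln (1 + C1 * C2)) * expR (- (kap * (3 / 4) * T n))) by ring.
rewrite ler_wpM2l ?mulr_ge0 ?(ltW C10) ?(ltW C20) // -!expRD ler_expR -(natr1 n).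
have := hC n; rewrite -(ler_pM2l k0) mulrBr mulrCA [kap * (3 / 4) * (_ / _)]mulrC divfK ?gt_eqF //.
move: (kap * (3 / 4) * C) (kap * (3 / 4) * T n) (ln _) => u v l; lra.
Qed.

Lemma collapse_fwd w : ok_symbols w -> heavy_runs K w -> forall L : K, exists2 C : K, 0 < C &
  forall n f, centred f -> N (it n w f) <= C * N f * expR (n%:R * L).
Proof.
move=> ow [hw _] L; have [C C0 hC] := superlinear_decay hw L.
exists (1 + C) => [|[|n] f cf]; first by rewrite addr_gt0.
  by rewrite mul0r expR0 mulr1 ler_peMl ?hardy_norm_ge0 // lerDl ltW.
apply: le_trans (collapse_bound n ow cf) _; apply: le_trans (hC n _ (hardy_norm_ge0 R f)) _.
by rewrite ler_wpM2r ?expR_ge0 // ler_wpM2r ?hardy_norm_ge0 // lerDr.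
Qed.

Lemma ok_bwd n w : ok_symbols w -> ok_symbols (iter n bwd w).
Proof. by move=> ow; elim: n => //= n IH; exact: ok_symbols_shift. Qed.

Lemma collapse_bwd w : ok_symbols w -> heavy_runs K w -> forall L : K, exists2 C : K, 0 < C &
  forall n f, centred f -> N (it n (iter n bwd w) f) <= C * N f * expR (n%:R * L).
Proof.
move=> ow [_ hw] L; have [C C0 hC] := superlinear_decay hw L.
exists (1 + C) => [|[|n] f cf]; first by rewrite addr_gt0.
  by rewrite mul0r expR0 mulr1 ler_peMl ?hardy_norm_ge0 // lerDl ltW.
apply: le_trans (collapse_bound n (ok_bwd n.+1 ow) cf) _; apply: le_trans (hC n _ (hardy_norm_ge0 R f)) _.
by rewrite ler_wpM2r ?expR_ge0 // ler_wpM2r ?hardy_norm_ge0 // lerDr.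
Qed.

(* The invariant vector at w is the limit of the images of the constant mode
   that start further and further in the past of w. *)
Definition pullback n w f := it n (iter n bwd w) f.

Definition is_vacuum v := hardy R v /\ forall e k, pair s e v (monom k) = (k == 0%N)%:R.

(** Quantifying over all vacua avoids a choice; they coincide, because pairings determine an
    element. *)
Definition is_invariant w v := hardy R v /\ forall v0, is_vacuum v0 ->
  N (pullback n w v0 - v) @[n --> \oo] --> (0 : K).

Lemma vacuum : exists v0, is_vacuum v0.
Proof.
have [v hv [_ vp]] := vacuum_exists hR hs hr norm_le (@ler01 K).
by exists v; split => // e k; rewrite vp of_real1 mulr1.
Qed.

Lemma pullback_hardy n w f : ok_symbols w -> hardy R f -> hardy R (pullback n w f).
Proof. by move=> ow hf; exact: (it_hardy ok_symbols_shift noisy_step n (ok_bwd n ow) hf). Qed.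

Lemma fwd_iter_bwd n w : iter n fwd (iter n bwd w) = w.
Proof. by elim: n w => // n IH w; rewrite iterSr iterS fwd_bwd IH. Qed.

Lemma pullback_last n w f : pullback n.+1 w f = A (bwd w) (pullback n (bwd w) f).
Proof.
rewrite /pullback iterSr -[LHS]/(A (iter n fwd (iter n bwd (bwd w))) (it n (iter n bwd (bwd w)) f)).
by rewrite fwd_iter_bwd.
Qed.

(** The step in the remotest past is split off, which exhibits consecutive pullbacks as images of
    different initial vectors under the same iterate. *)
Lemma pullback_first n w f : pullback n.+1 w f = pullback n w (A (iter n.+1 bwd w) f).
Proof. by rewrite /pullback it_first iterS -/(fwd _) fwd_bwd. Qed.

Lemma pair_cvg (u : nat -> cplx K -> cplx K) v e g : (forall n, hardy R (u n)) -> hardy R v -> dalg s g ->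
  N (u n - v) @[n --> \oo] --> (0 : K) ->
  forall d : K, 0 < d -> \forall n \near \oo, modulus (pair s e (u n) g - pair s e v g) <= d.
Proof.
move=> hu hv hg uv d d0; have [M M0 hM] := dalg_bounded s0 hg.
have d1 : 0 < d / (C2 * (M + 1)) by rewrite divr_gt0 // mulr_gt0 // ltr_wpDl.
have /cvgr0Pnorm_lt/(_ _ d1) := uv; apply: filterS => n.
rewrite ger0_norm ?hardy_norm_ge0 // ltr_pdivlMr ?mulr_gt0 ?ltr_wpDl // => h.
rewrite -(pair_sub hR hs e (hu n) hv hg).
apply: le_trans (pair_le e (hardyB hR (hu n) hv) hg hM) _; apply: le_trans (ltW h).
have Nu := hardy_norm_ge0 R (u n - v).
have -> : N (u n - v) * (C2 * (M + 1)) = C2 * N (u n - v) * (M + 1) by ring.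
by rewrite ler_wpM2l ?mulr_ge0 ?(ltW C20) // lerDl.
Qed.

Lemma invariant_pair w v : ok_symbols w -> is_invariant w v -> forall e, pair s e v (monom 0) = 1.
Proof.
move=> ow [hv iv] e; have [v0 V0] := vacuum; have [h0 p0] := V0.
apply/eqP; rewrite eq_sym -subr_eq0; apply/eqP; apply: modulus_le_small => d d0.
have [n _ /(_ n (leqnn n))] := pair_cvg e (fun n => pullback_hardy n ow h0) hv (dalg_monom s0 0) (iv v0 V0) d0.
by rewrite /pullback /= (it_one hR hs ok_symbols_shift noisy_step n e (ok_bwd n ow) h0) p0.
Qed.

Lemma invariant_unique w v v' : ok_symbols w -> is_invariant w v -> is_invariant w v' -> v = v'.
Proof.
move=> ow [hv iv] [hv' iv']; have [v0 V0] := vacuum; have [h0 p0] := V0.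
apply: (hardy_inj hR hs hv hv') => e k; apply/eqP; rewrite -subr_eq0; apply/eqP.
apply: modulus_le_small => d d0; have d2 : 0 < d / 2 by rewrite divr_gt0.
have hp n := pullback_hardy n ow h0; have dk := dalg_monom s0 k.
have [n [h1 h2]] := @filter_ex _ _ _ _ (filterI (pair_cvg e hp hv dk (iv v0 V0) d2) (pair_cvg e hp hv' dk (iv' v0 V0) d2)).
apply: le_trans (modulus_triangle (pair s e (pullback n w v0) (monom k)) _ _) _.
by rewrite modulusB [leRHS](_ : d = d / 2 + d / 2) ?lerD //; field.
Qed.

Lemma invariant_step w v : ok_symbols w -> is_invariant w v -> is_invariant (fwd w) (A w v).
Proof.
move=> ow [hv iv]; have [p1 _ _ _ _] := noisy_step ow; split; first exact: p1.
move=> v0 V0; have [h0 _] := V0.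
rewrite -(@cvg_shiftS _ (fun n => N (pullback n (fwd w) v0 - A w v))).
apply: (cvg0_le_scale (c := C1 * C2)) (iv v0 V0) => n; rewrite hardy_norm_ge0 /=.
have hpn := pullback_hardy n ow h0.
have -> : pullback n.+1 (fwd w) v0 - A w v = A w (pullback n w v0 - v).
  by rewrite pullback_last bwd_fwd (step_sub hR hs (noisy_step ow) hpn hv).
exact: (step_norm hR hs C20 norm_le pair_le (noisy_step ow) (hardyB hR hpn hv)).
Qed.

(** Consecutive pullbacks differ by the pullback of A v0 - v0, which is centred because order 0 is
    conserved, and hence decays by the collapse estimate. The pairings converge geometrically and
    their limits are realised by an element. *)
Lemma invariant_exists w : ok_symbols w -> heavy_runs K (bwd w) -> exists v, is_invariant w v.
Proof.
move=> ow hw; have [v0 V0] := vacuum; have [h0 p0] := V0.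
have ow1 : ok_symbols (bwd w) by exact: ok_symbols_shift.
pose u n := A (iter n.+1 bwd w) v0 - v0.
have hA n : hardy R (A (iter n.+1 bwd w) v0) by have [p1 _ _ _ _] := noisy_step (ok_bwd n.+1 ow); exact: p1.
have N0 := hardy_norm_ge0 R v0.
have cu n : centred (u n).
  split; first exact: (hardyB hR (hA n) h0).
  rewrite (pair_sub hR hs true (hA n) h0 (dalg_monom s0 0)).
  by rewrite (step_one hR hs (noisy_step (ok_bwd n.+1 ow)) true h0) subrr.
have B0 : 0 <= C2 * N v0 + 1 by rewrite addr_ge0 // mulr_ge0 // ltW.
have Nu n : N (u n) <= C1 * (C2 * N v0 + 1).
  apply: norm_le => // [|e k]; first by case: (cu n).
  rewrite (pair_sub hR hs e (hA n) h0 (dalg_monom s0 k)) mulrDl mul1r.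
  apply: le_trans (modulusB_le _ _) _; apply: lerD.
    exact: (step_coef_le hR hs pair_le (noisy_step (ok_bwd n.+1 ow)) e k h0).
  by rewrite p0; case: k => [|k]; rewrite ?modulus1 ?expr0 // modulus0 exprn_ge0 // ltW.
(* Any negative rate would do; -1 makes the increments summable. The estimate is taken at [bwd w] so
   that one further step remains, which supplies the factor r^k. *)
have [C C0 hC] := collapse_bwd ow1 hw (-1).
pose t : K := expR (-1); have t01 : 0 <= t < 1.
  by rewrite expR_ge0 /= -expR0 ltr_expR.
pose D := C2 * (C * (C1 * (C2 * N v0 + 1))).
have D0 : 0 <= D by rewrite /D mulr_ge0 ?(ltW C20) // mulr_ge0 ?(ltW C0) // mulr_ge0 // ltW.
pose dn n := pullback n.+1 w (u n.+1).
have hdn n : hardy R (dn n) := pullback_hardy n.+1 ow (cu n.+1).1.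
have dn_le e k n : modulus (pair s e (dn n) (monom k)) <= D * r ^+ k * t ^+ n.
  have cn := cu n.+1; rewrite /dn pullback_last.
  apply: le_trans (step_coef_le hR hs pair_le (noisy_step ow1) e k (pullback_hardy n ow1 _)) _; first by case: cn.
  have h : N (pullback n (bwd w) (u n.+1)) <= C * (C1 * (C2 * N v0 + 1)) * t ^+ n.
    apply: le_trans (hC n _ cn) _; rewrite /t -expRM_natl.
    by rewrite ler_wpM2r ?expR_ge0 // ler_wpM2l ?(ltW C0).
  rewrite [leRHS]mulrAC ler_wpM2r ?exprn_ge0 ?(ltW r0) // /D -(mulrA C2).
  by rewrite ler_wpM2l ?(ltW C20).
have dnE n : pullback n.+2 w v0 = pullback n.+1 w v0 + dn n.
  rewrite pullback_first; have h : dn n = pullback n.+1 w (A (iter n.+2 bwd w) v0) - pullback n.+1 w v0.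
    exact: (it_sub hR hs ok_symbols_shift noisy_step n.+1 (ok_bwd n.+1 ow) (hA n.+1) h0).
  by rewrite h addrC subrK.
have pS e k n : pair s e (pullback n.+1 w v0) (monom k) =
    pair s e (pullback 1 w v0) (monom k) + series (fun j => pair s e (dn j) (monom k)) n.
  elim: n => [|n IH]; first by rewrite /series /= big_geq // addr0.
  apply: etrans (congr1 (fun x => pair s e x (monom k)) (dnE n)) _.
  apply: etrans (pair_add hR hs e (pullback_hardy n.+1 ow h0) (hdn n) (dalg_monom s0 k)) _.
  apply: etrans (congr1 (fun x => x + pair s e (dn n) (monom k)) IH) _.
  by rewrite -addrA; congr (_ + _); rewrite /series /= big_nat_recr.
pose alpha e k := pair s e (pullback 1 w v0) (monom k) + csum (fun j => pair s e (dn j) (monom k)).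
have al e k : modulus (alpha e k) <= (C2 * N v0 + D / (1 - t)) * r ^+ k.
  apply: le_trans (modulusD _ _) _; rewrite mulrDl; apply: lerD.
    exact: (step_coef_le hR hs pair_le (noisy_step ow1) e k h0).
  by apply: le_trans (csum_bound t01 (dn_le e k)) _; rewrite mulrAC.
have al0 : alpha true 0%N = alpha false 0%N.
  have e1 := pair_one hR hs (pullback_hardy 1 ow h0).
  have e2 : (fun j => pair s true (dn j) (monom 0)) = (fun j => pair s false (dn j) (monom 0)).
    by apply/funext => j; exact: (pair_one hR hs (hdn j)).
  exact: (congr2 (fun x y => x + csum y) e1 e2).
have t1 : 0 < 1 - t by rewrite subr_gt0; case/andP: t01.
have E0 : 0 <= C2 * N v0 + D / (1 - t) := addr_ge0 (mulr_ge0 (ltW C20) N0) (divr_ge0 D0 (ltW t1)).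
have [v hv vp] := hardy_realize hR hr E0 al al0.
exists v; split; [exact: hv|move=> v1 V1].
have -> : v1 = v0.
  have [h1 p1] := V1; apply: (hardy_inj hR hs h1 h0) => e k; by rewrite p1 p0.
rewrite -(@cvg_shiftS _ (fun n => N (pullback n w v0 - v))).
have bd n : N (pullback n.+1 w v0 - v) <= C1 * (D / (1 - t)) * t ^+ n.
  have hpn := pullback_hardy n.+1 ow h0.
  rewrite -mulrA; apply: norm_le => [||e k]; first exact: (hardyB hR hpn hv).
    by apply: mulr_ge0; [exact: divr_ge0 D0 (ltW t1)|apply: exprn_ge0; case/andP: t01].
  rewrite (pair_sub hR hs e hpn hv (dalg_monom s0 k)) (vp s e k hs) pS /alpha.
  rewrite opprD addrACA subrr add0r modulusB.
  apply: le_trans (csum_tail n t01 (dn_le e k)) _.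
  by apply: eq_leW; move: (t ^+ n) (r ^+ k) (1 - t)^-1 => a b c; ring.
apply: (@cvg0_le_scale _ (fun n => t ^+ n) _ (C1 * (D / (1 - t)))).
  by move=> n; apply/andP; split; [exact: hardy_norm_ge0|exact: bd].
by apply: cvg_expr; case/andP: t01 => t0 tl; rewrite (ger0_norm t0).
Qed.

Definition fast_space w (j : nat) : set (cplx K -> cplx K) :=
  [set f | exists c : K[i], exists2 v, is_invariant w v & f = c *: v].

(** The pairing of order 0 is the coordinate along the invariant vector, normalised to pair to 1,
    and its kernel is the complement. *)
Theorem collapse_oseledets w : ok_symbols w -> heavy_runs K w -> heavy_runs K (bwd w) ->
  oseledets_at (hardy R) N bernoulli_shift A (fun j => if j is 0%N then 0%E else -oo%E) (fun=> 1%N)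
    fast_space (fun _ _ => centred) w.
Proof.
move=> ow hw hw1; split.
  exact: (operator_norm_rate hR hs hr C10 C20 norm_le pair_le ok_symbols_shift noisy_step ow).
move=> [_|j /=]; last by rewrite ltxx.
have [v iv] := invariant_exists ow hw1; have [hv _] := iv.
have v1 e := invariant_pair ow iv e.
have VE f : fast_space w 0 f <-> exists c : K[i], f = c *: v.
  split=> [[c [v' iv' ->]]|[c ->]]; last by exists c, v.
  by exists c; rewrite (invariant_unique ow iv iv').
have pc (c : K[i]) e : pair s e (c *: v) (monom 0) = c.
  by rewrite (pair_scale hR hs c e hv (dalg_monom s0 0)) v1 mulr1.
have hc (c : K[i]) : hardy R (c *: v) by exact: (hardyZ hR c hv).
have AZ (c : K[i]) : A w (c *: v) = c *: A w v.
  have h00 := hardy0 R; have := step_linear hR hs (noisy_step ow) c hv h00.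
  rewrite addr0 => ->.
  have := step_linear hR hs (noisy_step ow) (-1) h00 h00.
  by rewrite scaler0 addr0 scaleN1r addNr => ->; rewrite addr0.
split; split.
- split=> [f /VE[c ->]||a f g /VE[c ->] /VE[d ->]] //.
    by apply/VE; exists 0; rewrite scale0r.
  by apply/VE; exists (a * c + d); rewrite scalerDl scalerA.
- exists (fun=> v); split.
    apply/seteqP; split=> f.
      by move=> /VE[c ->]; exists (fun=> c); rewrite big_ord1.
    by move=> [c ->]; apply/VE; exists (c ord0); rewrite big_ord1.
  by move=> c; rewrite big_ord1 => h i; rewrite ord1 -(pc (c ord0) true) h (pair_zero hR hs) //; exact: (dalg_monom s0 0).
- apply/seteqP; split=> f.
    by move=> [g /VE[c ->] <-]; exists c, (A w v); [exact: invariant_step|exact: AZ].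
  move=> [c [v' iv' ->]]; exists (c *: v); first by apply/VE; exists c.
  rewrite AZ; congr (_ *: _); exact: (invariant_unique (ok_symbols_shift 1 ow) (invariant_step ow iv) iv').
- move=> f /VE[c ->] c0; apply: (rate_one hR hs C10 C20 norm_le pair_le ok_symbols_shift noisy_step ow (hc c)).
  by rewrite pc; apply: contra_notN c0 => /eqP ->; rewrite scale0r.
- split.
    split=> [f [] //||a f g [hf f0] [hg g0]]; first by split; [exact: hardy0|exact: (pair_zero hR hs true (dalg_monom s0 0))].
    split; first exact: (hardy_lin hR a hf hg).
    by rewrite (pair_scale_add hR hs a true hf hg (dalg_monom s0 0)) f0 g0 mulr0 addr0.
  move=> u f cu hf uf; split => //; apply: modulus_le_small => d d0.
  have [n _ /(_ n (leqnn n))] := pair_cvg true (fun n => (cu n).1) hf (dalg_monom s0 0) uf d0.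
  by rewrite (cu n).2 sub0r modulusN.
- split=> [f hf|w' g Vw' Fg sum0].
    pose c : K[i] := pair s true f (monom 0); exists (fun=> c *: v), (f - c *: v); split.
    + by move=> i; rewrite ord1; apply/VE; exists c.
    + split; first exact: (hardyB hR hf (hc c)).
      by rewrite (pair_sub hR hs true hf (hc c) (dalg_monom s0 0)) pc subrr.
    + by rewrite big_ord1 addrC subrK.
  have [c cE] := (VE _).1 (Vw' ord0); rewrite big_ord1 cE in sum0.
  have c0 : c = 0.
    have := pair_scale_add hR hs c true hv Fg.1 (dalg_monom s0 0).
    by rewrite sum0 (pair_zero hR hs true (dalg_monom s0 0)) v1 mulr1 Fg.2 addr0.
  split=> [i|]; first by rewrite ord1 cE c0 scale0r.
  by move: sum0; rewrite c0 scale0r add0r.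
- by move=> _ [f cf <-]; have := centred_it 1 ow cf.
- move=> f cf; apply: (@limn_esup_ninfty _ (fun n => (N (it n w f))%:E)) => [n|L].
    by rewrite lee_fin hardy_norm_ge0.
  have [C C0 hC] := collapse_fwd ow hw L; exists (C * (N f + 1)).
    by rewrite mulr_gt0 // ltr_wpDl ?hardy_norm_ge0.
  apply: nearW => n; rewrite lee_fin; apply: le_trans (hC n f cf) _.
  by rewrite ler_wpM2r ?expR_ge0 // ler_pM2l // lerDl.
Qed.

End Collapse.

(** * Orbits in the hyperbolic disc *)

Section HyperbolicGeometry.
Variable K : realType.
Implicit Types (a c m u x : K) (z h : cplx K).

(** The addition law of the hyperbolic tangent: pseudo-hyperbolic distances to 0 add in this way
    along a diameter. *)
Definition gain a c : K := (a + c) / (1 + a * c).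

Lemma gain_lt1 a c : 0 <= a < 1 -> 0 <= c < 1 -> 0 <= gain a c < 1.
Proof.
move=> /andP[a0 a1] /andP[c0 c1]; have d : 0 < 1 + a * c by rewrite ltr_wpDr // mulr_ge0.
rewrite /gain; apply/andP; split; first exact: divr_ge0 (addr_ge0 a0 c0) (ltW d).
rewrite ltr_pdivrMr // mul1r -subr_gt0.
have -> : 1 + a * c - (a + c) = (1 - a) * (1 - c) by ring.
by rewrite mulr_gt0 // subr_gt0.
Qed.

Lemma gain_mono a a' c c' : 0 <= a <= a' -> 0 <= c <= c' -> a' < 1 -> c' < 1 -> gain a c <= gain a' c'.
Proof.
move=> /andP[a0 aa] /andP[c0 cc] a1 c1.
have d : 0 < 1 + a * c by rewrite ltr_wpDr // mulr_ge0.
have d' : 0 < 1 + a' * c' by rewrite ltr_wpDr // mulr_ge0 //; [exact: le_trans aa|exact: le_trans cc].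
rewrite ler_pdivrMr // mulrAC ler_pdivlMr //.
have h1 : a * (1 - c * c') <= a' * (1 - c * c').
  by rewrite ler_wpM2r // subr_ge0; nra.
have h2 : c * (1 - a * a') <= c' * (1 - a * a').
  by rewrite ler_wpM2r // subr_ge0; nra.
by nra.
Qed.

(** After squaring, the difference of the two sides is 2 c (1 - a^2) (1 - c^2) (Re z + a) with a =
    |z|, which is nonnegative because Re z >= - |z|. *)
Lemma mobius_modulus c z : 0 <= c < 1 -> modulus z < 1 ->
  modulus (z - of_real c) * (1 + modulus z * c) <= (modulus z + c) * modulus (1 - of_real c * z).
Proof.
move=> /andP[c0 c1] z1; have z0 := modulus_ge0 z.
have p1 : 0 <= 1 + modulus z * c by rewrite addr_ge0 // mulr_ge0.
suff : (modulus (z - of_real c) * (1 + modulus z * c)) ^+ 2 <=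
    ((modulus z + c) * modulus (1 - of_real c * z)) ^+ 2.
  have p2 := mulr_ge0 (modulus_ge0 (z - of_real c)) p1.
  have p3 := mulr_ge0 (addr_ge0 z0 c0) (modulus_ge0 (1 - of_real c * z)).
  by rewrite ler_pXn2r // nnegrE.
rewrite exprMn [leRHS]exprMn !modulus_sqr.
have zz := modulus_sqr z; have zr := Re_le_modulus z.
rewrite !(Re_sub, Im_sub, Re_mul, Im_mul).
have -> : complex.Re (of_real c) = c by []. have -> : complex.Im (of_real c) = 0 by [].
have -> : complex.Re (1 : cplx K) = 1 by []. have -> : complex.Im (1 : cplx K) = 0 by [].
move: (complex.Re z) (complex.Im z) (modulus z) zz zr z0 z1 {p1} => t y a zz zr a0 a1.
rewrite -subr_ge0.
have -> : (a + c) ^+ 2 * ((1 - (c * t - 0 * y)) ^+ 2 + (0 - (c * y + 0 * t)) ^+ 2) -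
    ((t - c) ^+ 2 + (y - 0) ^+ 2) * (1 + a * c) ^+ 2 = 2 * c * (1 - a ^+ 2) * (1 - c ^+ 2) * (t + a).
  have -> : y - 0 = y by rewrite subr0.
  have y2 : y ^+ 2 = a ^+ 2 - t ^+ 2 by rewrite zz; ring.
  have -> : (1 - (c * t - 0 * y)) ^+ 2 + (0 - (c * y + 0 * t)) ^+ 2 = 1 - 2 * c * t + c ^+ 2 * (t ^+ 2 + y ^+ 2) by ring.
  by rewrite y2; ring.
rewrite ler_norml in zr; case/andP: zr => zr _.
by rewrite !mulr_ge0 //; [nra|nra|lra].
Qed.

Definition hmap c z : cplx K := (z - of_real c) / (1 - of_real c * z).

Lemma hmap_den c z : 0 <= c < 1 -> modulus z < 1 -> 1 - of_real c * z != 0.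
Proof.
move=> /andP[c0 c1] z1; apply/eqP => /subr0_eq h.
have : modulus (of_real c * z) < 1.
  by rewrite (modulusM (of_real c)) modulus_of_real ger0_norm // mulr_ilt1 ?modulus_ge0.
by rewrite -h modulus1 ltxx.
Qed.

Lemma hmap_le c z : 0 <= c < 1 -> modulus z < 1 -> modulus (hmap c z) <= gain (modulus z) c.
Proof.
move=> hc z1; have := hmap_den hc z1; rewrite -modulus_gt0 => d.
rewrite /hmap (modulusM (z - _)) modulusV ler_pdivrMr // /gain mulrAC ler_pdivlMr; last first.
  by rewrite ltr_wpDr // mulr_ge0 ?modulus_ge0 //; case/andP: hc.
exact: mobius_modulus.
Qed.

Definition real_blaschke (b : bool) x : K := if b then ((x + 4^-1) / (1 + x / 4)) ^+ 2 else x ^+ 2.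
Definition branch (b : bool) x : K := if b then (x + 4^-1) / (1 + x / 4) else x.
(** With u the branch at x this is 2 u / (1 + u^2), the hyperbolic derivative of T at x: the inner
    Moebius map is an isometry and the rest is the squaring at u. *)
Definition multiplier (b : bool) x : K := gain (branch b x) (branch b x).

Lemma branch_sqr b x : branch b x ^+ 2 = real_blaschke b x. Proof. by case: b. Qed.

Lemma branch_ge0 b x : 0 <= x -> 0 <= branch b x.
Proof. by case: b => // x0; rewrite divr_ge0 // addr_ge0 // divr_ge0. Qed.

Lemma of_real_blaschke b x : of_real (real_blaschke b x) = @blaschke K b (of_real x).
Proof.
have q : of_real 4^-1 = 4^-1 :> cplx K by rewrite of_realV of_real_nat.
case: b; last by rewrite blaschke0E -of_realX.
by rewrite blaschke1E /mobius /real_blaschke of_realX of_realM of_realV !of_realD of_realM q.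
Qed.

Lemma real_blaschke_mono b x x' : 0 <= x <= x' -> real_blaschke b x <= real_blaschke b x'.
Proof.
move=> /andP[x0 xx]; have x'0 := le_trans x0 xx; rewrite -!branch_sqr.
rewrite lerXn2r ?nnegrE ?branch_ge0 //; case: b => //=.
have d : 0 < 1 + x / 4 by rewrite ltr_wpDr // divr_ge0.
have d' : 0 < 1 + x' / 4 by rewrite ltr_wpDr // divr_ge0.
by rewrite ler_pdivrMr // mulrAC ler_pdivlMr //; nra.
Qed.

(** The squaring map in hyperbolic coordinates: h is the coordinate of v centred at u, the left side
    that of v^2 centred at u^2. *)
Lemma half_angle (u h v : cplx K) : 1 + u * h != 0 -> 1 + u ^+ 2 != 0 -> 1 - u ^+ 2 != 0 ->
  1 + u ^+ 2 + 2 * u * h != 0 ->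
  v = (h + u) / (1 + u * h) ->
  (v ^+ 2 - u ^+ 2) / (1 - u ^+ 2 * v ^+ 2) =
  h * ((h + (u + u) / (1 + u * u)) / (1 + (u + u) / (1 + u * u) * h)).
Proof.
move=> n1 n2 n3 n4 ->.
have e : 1 + (u + u) / (1 + u * u) * h = (1 + u ^+ 2 + 2 * u * h) / (1 + u ^+ 2).
  by field.
rewrite e.
have e' : 1 - u ^+ 2 * ((h + u) / (1 + u * h)) ^+ 2 =
   (1 - u ^+ 2) * (1 + u ^+ 2 + 2 * u * h) / (1 + u * h) ^+ 2 by field.
rewrite e'; field.
by rewrite n1 n2 n3 n4.
Qed.

(* In the coordinate hmap c the degree two map becomes the Blaschke product
   h (h + m) / (1 + m h), which fixes 0. *)
Lemma hmap_blaschke b x z : 0 <= x < 1 -> modulus z < 1 -> branch b x < 1 ->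
  hmap (real_blaschke b x) (@blaschke K b z) =
    hmap x z * ((hmap x z + of_real (multiplier b x)) / (1 + of_real (multiplier b x) * hmap x z)).
Proof.
move=> hx z1 u1; have u0 : 0 <= branch b x by apply: branch_ge0; case/andP: hx.
pose u := branch b x; pose h := hmap x z; have hu : 0 <= u < 1 by rewrite /u u0.
have xz := hmap_den hx z1.
have h1 : modulus h < 1.
  apply: le_lt_trans (hmap_le hx z1) _; have := @gain_lt1 (modulus z) x.
  by rewrite modulus_ge0 z1 hx => /(_ isT isT)/andP[].
have n1 : 1 + of_real u * h != 0.
  have := @hmap_den u (- h) hu; rewrite modulusN mulrN opprK; exact.
have n2 : 1 + of_real u ^+ 2 != 0.
  rewrite -of_realX -(of_real1 K) -of_realD -modulus_gt0 modulus_of_real normr_gt0 gt_eqF //.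
  by rewrite ltr_wpDr // sqr_ge0.
have n3 : 1 - of_real u ^+ 2 != 0.
  rewrite -of_realX -(of_real1 K) -of_realB -modulus_gt0 modulus_of_real normr_gt0 gt_eqF //.
  by rewrite subr_gt0 expr_lt1 //; case/andP: hu.
have hg := gain_lt1 hu hu.
have n4 : 1 + of_real u ^+ 2 + 2 * of_real u * h != 0.
  have := @hmap_den (gain u u) (- h) hg; rewrite modulusN mulrN opprK => /(_ h1).
  apply: contra_neq => n4; rewrite /gain of_realM of_realV !of_realD of_real1 of_realM.
  have -> : 1 + (of_real u + of_real u) / (1 + of_real u * of_real u) * h =
    (1 + of_real u ^+ 2 + 2 * of_real u * h) / (1 + of_real u ^+ 2) by field.
  by rewrite n4 mul0r.
pose v := if b then mobius z else z.
have Tv : @blaschke K b z = v ^+ 2 by rewrite /v; case: b {u1 u0 u hu n1 n2 n3 hg n4 v}.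
have vE : v = (h + of_real u) / (1 + of_real u * h).
  have [x0 x1] := andP hx.
  have nx : 1 - of_real x ^+ 2 != 0.
    rewrite -of_realX -(of_real1 K) -of_realB -modulus_gt0 modulus_of_real normr_gt0 gt_eqF //.
    by rewrite subr_gt0 expr_lt1.
  move: n1; rewrite /v /u /h /branch /hmap; case: b {u1 u0 u hu n2 n3 hg n4 v h h1 Tv} => n1.
    have q : of_real 4^-1 = 4^-1 :> cplx K by rewrite of_realV of_real_nat.
    have z4 : 4 + z != 0.
      rewrite -modulus_gt0; have := modulus_subl 4 (- z); rewrite opprK modulusN (modulus_nat K 4).
      by move: z1; lra.
    have x4 : 4 + of_real x != 0.
      by rewrite -(of_real_nat K 4) -of_realD -modulus_gt0 modulus_of_real normr_gt0 gt_eqF //; move: x0; lra.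
    move: n1; rewrite of_realM of_realV !of_realD of_realM of_real1 q.
    move: (of_real x) xz nx x4 => X xz nx x4 n1; rewrite /mobius; field.
    rewrite xz x4 z4 /=; apply/andP; split.
      have -> : (4 + X) * (1 - X * z) + (X * 4 + 1) * (z - X) = (1 - X ^+ 2) * (4 + z) by ring.
      by rewrite mulf_neq0.
    by [].
  move: (of_real x) xz nx n1 => X xz nx n1; field; rewrite xz /=.
  have -> : 1 - X * z + X * (z - X) = 1 - X ^+ 2 by ring.
  by [].
rewrite -branch_sqr -/u {1}/hmap Tv of_realX (half_angle n1 n2 n3 n4 vE) -/h.
by rewrite /multiplier -/u /gain of_realM of_realV !of_realD of_real1 of_realM.
Qed.

(** Expands z at x in the coordinate h; its powers give the test functions z^k as expansions in
    h. *)
Lemma hmapK x z : 0 <= x < 1 -> modulus z < 1 ->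
  z = of_real x + hmap x z * (of_real (1 - x ^+ 2) / (1 + of_real x * hmap x z)).
Proof.
move=> hx z1; have xz := hmap_den hx z1; have [x0 x1] := andP hx.
have nx : 1 - of_real x ^+ 2 != 0.
  rewrite -of_realX -(of_real1 K) -of_realB -modulus_gt0 modulus_of_real normr_gt0 gt_eqF //.
  by rewrite subr_gt0 expr_lt1.
rewrite of_realB of_realX of_real1 /hmap; move: (of_real x) xz nx => X xz nx; field.
rewrite xz /=; have -> : 1 - X * z + X * (z - X) = 1 - X ^+ 2 by ring.
by [].
Qed.

End HyperbolicGeometry.

(** * Linearisation along an orbit *)

Section Orbit.
Variable K : realType.
Implicit Types (a c x e A C q R r s : K) (z : cplx K) (n : nat).

Lemma product_bound (u : nat -> K) A q : 0 <= A -> 0 <= q < 1 -> (forall n, 0 <= u n) ->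
  (forall n, u n.+1 <= u n * (1 + A * q ^+ n)) -> forall n, u n <= u 0%N * expR (A / (1 - q)).
Proof.
move=> A0 hq u0 h n; have [q0 q1] := andP hq.
suff H : u n <= u 0%N * expR (\sum_(0 <= i < n) A * q ^+ i).
  apply: le_trans H _; rewrite ler_wpM2l // ler_expR.
  by have := geometric_partial 0 n hq A0; rewrite expr0 mulr1.
elim: n => [|n IH]; first by rewrite big_geq // expR0 mulr1.
apply: le_trans (h n) _; rewrite big_nat_recr //= expRD mulrA.
apply: ler_pM => //; first by rewrite addr_ge0 // mulr_ge0 // exprn_ge0.
exact: expR_ge1Dx.
Qed.

Lemma geometric_limit (u : nat -> cplx K) A q : 0 <= q < 1 ->
  (forall n, modulus (u n.+1 - u n) <= A * q ^+ n) -> exists l : cplx K, u @ \oo --> l.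
Proof.
move=> hq h; pose v n := u n.+1 - u n.
have sv n : series v n = u n - u 0%N.
  by rewrite /series /= telescope_sumr.
exists (csum v + u 0%N); apply/cvg_modulus => e e0.
have /cvg_modulus/(_ _ e0) := cvg_csum hq h; apply: filterS => n.
by rewrite sv opprD addrA addrAC.
Qed.

Lemma geometric_null (u : nat -> cplx K) A q n0 : 0 <= q < 1 -> 0 <= A ->
  (forall n, (n0 <= n)%N -> modulus (u n.+1 - u n) <= A * q ^+ n) -> u @ \oo --> (0 : cplx K) ->
  forall n, (n0 <= n)%N -> modulus (u n) <= A / (1 - q) * q ^+ n.
Proof.
move=> hq A0 h u0 n nn; have [q0 q1] := andP hq.
have P N : (n <= N)%N -> modulus (u N - u n) <= \sum_(n <= i < N) A * q ^+ i.
  elim: N => [|N IH]; first by rewrite leqn0 => /eqP->; rewrite subrr modulus0 big_geq.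
  rewrite leq_eqVlt => /orP[/eqP<-|]; first by rewrite subrr modulus0 big_geq.
  rewrite ltnS => nN; rewrite big_nat_recr //=; apply: le_trans (modulus_triangle (u N) _ _) _.
  by rewrite addrC lerD ?IH // h // (leq_trans nn).
apply/ler_addgt0Pr => e e0; have /cvg_modulus/(_ _ e0)[N _ hN] := u0.
have h1 := hN (maxn n N) (leq_maxr _ _); rewrite subr0 in h1.
have h2 := P _ (leq_maxl n N); have h3 := geometric_partial n (maxn n N) hq A0.
have := modulus_triangle (u (maxn n N)) (u n) 0; rewrite !subr0 (modulusB (u n)) mulrAC => h4.
apply: le_trans h4 _; apply: lerD; [exact: le_trans h2 h3|exact: ltW].
Qed.

Variables (R r s : K).
Hypothesis hR : 0 < R < 1.
Hypothesis hs : R < s < 1.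
Hypothesis hr : 0 < r < R.

Let s0 : 0 < s. Proof. by case/andP: hs => ? _; case/andP: hR => ? _; lra. Qed.
Let s1 : s < 1. Proof. by case/andP: hs. Qed.
Let r0 : 0 < r. Proof. by case/andP: hr. Qed.
Let rs : r < s. Proof. by case/andP: hs => ? _; case/andP: hr => _ ?; lra. Qed.
Let r1 : r < 1. Proof. exact: lt_trans rs s1. Qed.

Definition fixed_orbit (b : nat -> bool) (x : nat -> K) := forall n,
  [/\ contracting r s (b n), 0 < x n <= r & x n.+1 = real_blaschke (b n) (x n)].

Fixpoint orb (b : nat -> bool) n z : cplx K := if n is k.+1 then @blaschke K (b k) (orb b k z) else z.

Variables (b : nat -> bool) (x : nat -> K).
Hypothesis hbx : fixed_orbit b x.

Definition mult n : K := multiplier (b n) (x n).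
Definition lam n : K := \prod_(i < n) mult i.
Definition coord n z : cplx K := hmap (x n) (orb b n z).

Lemma orb_le n z : modulus z <= s -> modulus (orb b n z) <= s.
Proof.
move=> zs; elim: n => //= n IH; have [hb _ _] := hbx n.
exact: le_trans (hb _ IH) (ltW rs).
Qed.

Lemma x_bound n : 0 <= x n < 1.
Proof. by have [_ /andP[/ltW x0 xr] _] := hbx n; rewrite x0 (le_lt_trans xr). Qed.

(** The branch u satisfies u^2 <= r, and u <= (1 + u^2) / 2 bounds it below 1 without a square
    root. *)
Definition branch_bound : K := (1 + r) / 2.

Lemma branch_bound_lt1 : 0 <= branch_bound < 1.
Proof. by rewrite /branch_bound; apply/andP; split; move: r0 r1; lra. Qed.

Lemma branch_le n : 0 < branch (b n) (x n) <= branch_bound.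
Proof.
have [hb /andP[x0 xr] _] := hbx n; apply/andP; split.
  by case: (b n) => //=; rewrite divr_gt0 // addr_gt0 // divr_gt0.
have := hb (of_real (x n)); rewrite modulus_of_real ger0_norm ?(ltW x0) // (le_trans xr) ?(ltW rs) //.
move=> /(_ isT); rewrite -of_real_blaschke modulus_of_real -branch_sqr ger0_norm ?sqr_ge0 //.
have : (branch (b n) (x n) - 1) ^+ 2 >= 0 by exact: sqr_ge0.
by rewrite /branch_bound; move: (branch _ _) => u; nra.
Qed.

Definition mult_bound : K := gain branch_bound branch_bound.

Lemma mult_bound_lt1 : 0 <= mult_bound < 1.
Proof. exact: gain_lt1 branch_bound_lt1 branch_bound_lt1. Qed.

Lemma mult_gt0 n : 0 < mult n.
Proof.
have /andP[u0 _] := branch_le n.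
by rewrite /mult /multiplier /gain divr_gt0 ?addr_gt0 // mulr_gt0.
Qed.

Lemma mult_le n : mult n <= mult_bound.
Proof.
have /andP[u0 ub] := branch_le n; have /andP[_ b1] := branch_bound_lt1.
by apply: gain_mono => //; rewrite (ltW u0).
Qed.

Lemma mult_lt1 n : 0 <= mult n < 1.
Proof. by rewrite (ltW (mult_gt0 n)) (le_lt_trans (mult_le n)) //; case/andP: mult_bound_lt1. Qed.

Lemma lam_gt0 n : 0 < lam n.
Proof. by apply: prodr_gt0 => i _; exact: mult_gt0. Qed.

Lemma lamS n : lam n.+1 = lam n * mult n.
Proof. by rewrite /lam big_ord_recr. Qed.

Lemma orb_lt1 n z : modulus z <= s -> modulus (orb b n z) < 1.
Proof. by move=> /(orb_le n) h; exact: le_lt_trans h s1. Qed.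

Lemma coord_lt1 n z : modulus z <= s -> modulus (coord n z) < 1.
Proof.
move=> zs; apply: le_lt_trans (hmap_le (x_bound n) (orb_lt1 n zs)) _.
have := @gain_lt1 K (modulus (orb b n z)) (x n).
by rewrite modulus_ge0 orb_lt1 // => /(_ isT (x_bound n))/andP[].
Qed.

Lemma coord_step n z : modulus z <= s -> coord n.+1 z =
  coord n z * ((coord n z + of_real (mult n)) / (1 + of_real (mult n) * coord n z)).
Proof.
move=> zs; have [_ _ xS] := hbx n; have /andP[_ ub] := branch_le n; have /andP[_ b1] := branch_bound_lt1.
rewrite /coord xS; apply: (hmap_blaschke (x_bound n) (orb_lt1 n zs)).
exact: le_lt_trans ub b1.
Qed.

Lemma factor_le n (h : cplx K) : modulus h < 1 ->
  modulus ((h + of_real (mult n)) / (1 + of_real (mult n) * h)) <= gain (modulus h) (mult n).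
Proof.
move=> h1; have := hmap_le (mult_lt1 n) (z := - h); rewrite modulusN => /(_ h1); congr (_ <= _).
by rewrite /hmap -opprD mulrN opprK mulNr modulusN.
Qed.

(** The hyperbolic distance between a point of the disc of radius s and a fixed point of modulus at
    most r; [contraction] is the uniform factor of one step inside this bound. *)
Definition init_bound : K := gain s r.
Definition contraction : K := gain init_bound mult_bound.

Lemma init_bound_lt1 : 0 < init_bound < 1.
Proof.
have /andP[_ ->] : 0 <= init_bound < 1 by apply: gain_lt1; apply/andP; split => //; exact: ltW.
by rewrite andbT divr_gt0 ?addr_gt0 // mulr_gt0.
Qed.

Lemma contraction_lt1 : 0 < contraction < 1.
Proof.
have /andP[i0 i1] := init_bound_lt1; have /andP[m0 m1] := mult_bound_lt1.
have /andP[_ ->] : 0 <= contraction < 1 by apply: gain_lt1; apply/andP; split => //; exact: ltW.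
by rewrite andbT divr_gt0 ?ltr_pwDl // mulr_ge0 // ltW.
Qed.

Lemma coord_le n z : modulus z <= s -> modulus (coord n z) <= init_bound * contraction ^+ n.
Proof.
move=> zs; have /andP[i0 i1] := init_bound_lt1; have /andP[m0 m1] := mult_bound_lt1.
have /andP[k0 k1] := contraction_lt1.
elim: n => [|n IH].
  rewrite expr0 mulr1; apply: le_trans (hmap_le (x_bound 0%N) (orb_lt1 0 zs)) _.
  have [_ /andP[x0 xr] _] := hbx 0%N; rewrite /=.
  by apply: gain_mono => //; rewrite ?modulus_ge0 ?(ltW x0).
have h1 := coord_lt1 n zs.
have hi : modulus (coord n z) <= init_bound.
  by apply: le_trans IH _; rewrite ler_piMr ?(ltW i0) // exprn_ile1 // ltW.
rewrite coord_step // (modulusM (coord n z)) exprSr mulrA.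
apply: ler_pM => //; rewrite ?modulus_ge0 //; apply: le_trans (factor_le n h1) _.
by apply: gain_mono => //; rewrite ?modulus_ge0 // ltW ?mult_gt0 ?mult_le.
Qed.

Lemma dalg_orb n : dalg s (orb b n).
Proof.
elim: n => [|n IH] /=; first exact: dalg_id.
have dT := dalg_blaschke hR (b n) hs.
by apply: (dalg_comp s0 dT IH) => z; exact: orb_le.
Qed.

Lemma dalg_hmap c : 0 <= c < 1 -> dalg s (hmap c).
Proof.
move=> /andP[c0 c1].
have h1 : modulus (- of_real c : cplx K) * s < 1.
  by rewrite modulusN modulus_of_real ger0_norm // mulr_ilt1 // ltW.
have H := dalgM s0 (dalgB s0 (dalg_id s) (dalg_cst s (of_real c))) (dalg_inv s0 h1).
apply: (dalg_ext _ H) => z _.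
by rewrite /hmap mulNr.
Qed.

Lemma dalg_coord n : dalg s (coord n).
Proof. by apply: (dalg_comp s0 (dalg_hmap (x_bound n)) (dalg_orb n)) => z; exact: orb_le. Qed.

Variable Lam : K.
Definition growth (u : nat -> K) := forall e, 0 < e -> exists2 C, 0 < C &
  forall n, C^-1 * expR (n%:R * (Lam - e)) <= u n <= C * expR (n%:R * (Lam + e)).
Hypothesis hlam : growth lam.

(** The coordinates decay at a uniform exponential rate, whereas mult n is a quotient of consecutive
    products of known growth and so decays slower than any exponential. Their quotient is still
    geometrically small. *)
Lemma coord_mult : exists A q, [/\ 0 < A, 0 < q < 1 & forall n z, modulus z <= s ->
  modulus (coord n z) <= A * q ^+ n * mult n].
Proof.
have /andP[k0 k1] := contraction_lt1; have /andP[i0 i1] := init_bound_lt1.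
pose L := ln contraction; have L0 : L < 0 by apply: ln_lt0; rewrite k0.
have kE : contraction = expR L by rewrite lnK.
(* The growth bound enters twice, for lam n and lam n.+1; two errors of - L / 4 leave the rate L /
   2. *)
have e0 : 0 < - L / 4 by rewrite divr_gt0 // oppr_gt0.
have [C C0 hC] := hlam e0.
exists (init_bound * (C * C * expR (- L / 4 - Lam))), (expR (L / 2)); split.
- exact: mulr_gt0 i0 (mulr_gt0 (mulr_gt0 C0 C0) (expR_gt0 _)).
- by rewrite expR_gt0 /= expR_lt1; move: L0; lra.
move=> n z zs; apply: le_trans (coord_le n zs) _.
suff : contraction ^+ n <= C * C * expR (- L / 4 - Lam) * expR (L / 2) ^+ n * mult n.
  by rewrite -(mulrA init_bound) -(mulrA init_bound) (ler_pM2l i0).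
rewrite kE -!expRM_natl.
have /andP[h1 _] := hC n.+1; have /andP[_ h2] := hC n.
have C'0 : 0 < C^-1 by rewrite invr_gt0.
have mE : mult n = lam n.+1 / lam n by rewrite lamS mulrC mulKf // gt_eqF // lam_gt0.
rewrite mE [leRHS]mulrA (ler_pdivlMr _ _ (lam_gt0 n)).
apply: le_trans (_ : _ <= expR (n%:R * L) * (C * expR (n%:R * (Lam + - L / 4)))) _.
  by rewrite ler_wpM2l ?expR_ge0.
apply: le_trans (_ : _ <= C * C * expR (- L / 4 - Lam) * expR (n%:R * (L / 2)) *
    (C^-1 * expR (n.+1%:R * (Lam - - L / 4)))) _; last first.
  by rewrite ler_wpM2l // ?mulr_ge0 ?expR_ge0 // ltW.
rewrite mulrCA.
have -> : C * C * expR (- L / 4 - Lam) * expR (n%:R * (L / 2)) * (C^-1 * expR (n.+1%:R * (Lam - - L / 4))) =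
  C * (expR (- L / 4 - Lam) * expR (n%:R * (L / 2)) * expR (n.+1%:R * (Lam - - L / 4))).
  by move: (expR _) (expR _) (expR _) => u v w; field; rewrite gt_eqF.
have nS : n.+1%:R = n%:R + 1 :> K by rewrite natr1.
rewrite ler_pM2l // -!expRD ler_expR nS.
by apply: eq_leW; field.
Qed.

(** One step multiplies |h| / lam by at most 1 + |h| / m, and by [coord_mult] these corrections have
    a convergent product. *)
Lemma coord_lam : exists2 A, 0 < A & forall n z, modulus z <= s -> modulus (coord n z) <= A * lam n.
Proof.
have [A [q [A0 /andP[q0 q1] h]]] := coord_mult; exists (expR (A / (1 - q))) => [|n z zs]; first exact: expR_gt0.
rewrite -ler_pdivrMr ?lam_gt0 //.
have hq : 0 <= q < 1 by rewrite (ltW q0).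
have u0 k : 0 <= modulus (coord k z) / lam k by rewrite divr_ge0 ?modulus_ge0 // ltW // lam_gt0.
have hu k : modulus (coord k.+1 z) / lam k.+1 <= modulus (coord k z) / lam k * (1 + A * q ^+ k).
  have hk := h k z zs; have m0 := mult_gt0 k.
  rewrite coord_step // (modulusM (coord k z)) lamS invfM mulrACA ler_wpM2l //.
  rewrite ler_pdivrMr //; apply: le_trans (factor_le k (coord_lt1 k zs)) _.
  rewrite mulrDl mul1r /gain ler_pdivrMr; last by rewrite ltr_wpDr // mulr_ge0 ?modulus_ge0 // ltW.
  rewrite addrC; apply: le_trans (_ : _ <= mult k + A * q ^+ k * mult k) _; first by rewrite lerD2l.
  have t0 : 0 <= mult k + A * q ^+ k * mult k by exact: addr_ge0 (ltW m0) (le_trans (modulus_ge0 _) hk).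
  rewrite ler_peMr //.
  by rewrite lerDl mulr_ge0 ?modulus_ge0 // ltW.
apply: le_trans (product_bound (ltW A0) hq u0 hu n) _.
rewrite /lam big_ord0 divr1 ler_piMl ?expR_ge0 // ltW //; exact: (coord_lt1 0 zs).
Qed.

(** The relative change of h / lam in one step is h (1 - m^2) / (m (1 + m h)), of size |h| / m. *)
Lemma coord_increment : exists A q, [/\ 0 < A, 0 < q < 1 & forall n z, modulus z <= s ->
  modulus (coord n.+1 z / of_real (lam n.+1) - coord n z / of_real (lam n)) <= A * q ^+ n].
Proof.
have [A [q [A0 hq h]]] := coord_mult; have [C C0 hC] := coord_lam.
have /andP[i0 i1] := init_bound_lt1; have d0 : 0 < 1 - init_bound by rewrite subr_gt0.
exists (C * (A / (1 - init_bound))), q; split => //; first by rewrite mulr_gt0 // divr_gt0.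
move=> n z zs; have m0 := mult_gt0 n; have l0 := lam_gt0 n; have /andP[_ m1] := mult_lt1 n.
have /andP[k0 k1] := contraction_lt1; have /andP[q0 q1] := hq.
have dn : 1 - init_bound <= modulus (1 + of_real (mult n) * coord n z).
  have := modulus_subl 1 (- (of_real (mult n) * coord n z)); rewrite opprK modulusN modulus1.
  apply: le_trans; rewrite lerD2l lerN2 (modulusM (of_real _)) modulus_of_real ger0_norm ?(ltW m0) //.
  apply: le_trans (_ : _ <= modulus (coord n z)) _; first by rewrite ler_piMl ?modulus_ge0 // ltW.
  apply: le_trans (coord_le n zs) _; rewrite ler_piMr ?(ltW i0) // exprn_ile1 // ltW //.
have dn0 : 1 + of_real (mult n) * coord n z != 0 by rewrite -modulus_gt0; exact: lt_le_trans d0 dn.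
have R0 a : 0 < a -> of_real a != 0 :> cplx K.
  by move=> a0; rewrite -modulus_gt0 modulus_of_real normr_gt0 gt_eqF.
rewrite coord_step // lamS of_realM.
have -> : coord n z * ((coord n z + of_real (mult n)) / (1 + of_real (mult n) * coord n z)) /
   (of_real (lam n) * of_real (mult n)) - coord n z / of_real (lam n) =
   coord n z / of_real (lam n) * (coord n z * of_real (1 - mult n ^+ 2) /
     (of_real (mult n) * (1 + of_real (mult n) * coord n z))).
  rewrite of_realB of_real1 of_realX; field.
  by rewrite dn0 !R0.
rewrite (modulusM (coord n z / _)) -[leRHS]mulrA; apply: ler_pM; rewrite ?modulus_ge0 //.
  by rewrite (modulusM (coord n z)) modulusV modulus_of_real ger0_norm ?(ltW l0) // ler_pdivrMr // hC.
rewrite (modulusM (coord n z * _)) (modulusM (coord n z)) modulusV (modulusM (of_real _)) !modulus_of_real.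
rewrite (ger0_norm (ltW m0)) ger0_norm; last first.
  by rewrite subr_ge0 exprn_ile1 // ltW.
rewrite ler_pdivrMr; last by rewrite mulr_gt0 // modulus_gt0.
apply: le_trans (_ : _ <= modulus (coord n z)) _.
  by rewrite ler_piMr ?modulus_ge0 // lerBlDr lerDl sqr_ge0.
apply: le_trans (h n z zs) _.
rewrite [leLHS]mulrC.
have -> : A / (1 - init_bound) * q ^+ n * (mult n * modulus (1 + of_real (mult n) * coord n z)) =
  mult n * (A * q ^+ n) * ((1 - init_bound)^-1 * modulus (1 + of_real (mult n) * coord n z)).
  by move: (_^-1) (modulus _) => u v; ring.
have p0 : 0 <= mult n * (A * q ^+ n) by rewrite (mulr_ge0 (ltW m0)) // (mulr_ge0 (ltW A0)) // exprn_ge0 // ltW.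
rewrite ler_peMr //.
by rewrite mulrC ler_pdivlMr // mul1r.
Qed.

End Orbit.

(** * Jets along an orbit *)

Section Jets.
Variables (K : realType) (s tau : K) (h : cplx K -> cplx K).
Hypothesis s0 : 0 < s.
Hypothesis s1 : s < 1.
Hypothesis htau : 0 < tau <= s.
Hypothesis dh : dalg s h.
Hypothesis hh : forall z, modulus z <= s -> modulus (h z) <= tau.
Implicit Types (g q : cplx K -> cplx K) (M : K) (j : nat).

Let t0 : 0 < tau. Proof. by case/andP: htau. Qed.
Let t1 : tau < 1. Proof. by case/andP: htau => _ h1; exact: le_lt_trans h1 s1. Qed.

(* g = c_0 + c_1 h + ... + c_(j-1) h^(j-1) + h^j q, with
   |c_0| + |c_1| tau + ... + |c_(j-1)| tau^(j-1) + tau^j sup |q| <= M. *)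
Fixpoint jet j M g : Prop := if j is i.+1 then
    exists c q M', [/\ jet i M' q, forall z, modulus z <= s -> g z = c + h z * q z &
      modulus c + tau * M' <= M]
  else dalg s g /\ forall z, modulus z <= s -> modulus (g z) <= M.

Lemma jet_dalg j M g : jet j M g -> dalg s g.
Proof.
elim: j M g => [|j IH] M g /=; first by case.
move=> [c [q [M' [/IH dq gE _]]]]; have H := dalgD (dalg_cst s c) (dalgM s0 dh dq).
by apply: (dalg_ext _ H) => z /gE.
Qed.

Lemma jet_bound j M g z : jet j M g -> modulus z <= s -> modulus (g z) <= M.
Proof.
elim: j M g => [|j IH] M g /=; first by case=> _ H; exact: H.
move=> [c [q [M' [jq gE cM]]]] zs; rewrite gE //; apply: le_trans cM.
apply: le_trans (modulusD _ _) _; rewrite lerD2l (modulusM (h z)).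
by apply: ler_pM; rewrite ?modulus_ge0 ?hh //; exact: IH.
Qed.

Lemma jet_ge0 j M g : jet j M g -> 0 <= M.
Proof.
move=> jg; have := jet_bound (z := 0) jg; rewrite modulus0 => /(_ (ltW s0)).
exact: le_trans (modulus_ge0 _).
Qed.

Lemma jet_mono j M M' g : M <= M' -> jet j M g -> jet j M' g.
Proof.
move=> MM; case: j => [|j] /=; first by case=> dg gM; split => // z /gM h1; exact: le_trans h1 MM.
by move=> [c [q [L [jq gE cM]]]]; exists c, q, L; split => //; exact: le_trans cM MM.
Qed.

Lemma jet_ext j M g g' : (forall z, modulus z <= s -> g z = g' z) -> jet j M g -> jet j M g'.
Proof.
move=> gg; case: j => [|j] /=.
  case=> dg gM; split; first exact: dalg_ext gg dg.
  by move=> z zs; rewrite -gg // gM.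
move=> [c [q [L [jq gE cM]]]]; exists c, q, L; split => // z zs.
by rewrite -gg // gE.
Qed.

Lemma jet_cst j c : jet j (modulus c) (fun=> c).
Proof.
elim: j c => [|j IH] c /=; first by split => [|z _ //]; exact: dalg_cst.
exists c, (fun=> 0), 0; split => [|z _|]; last by rewrite mulr0 addr0.
  by have := IH 0; rewrite modulus0.
by rewrite mulr0 addr0.
Qed.

Lemma jet_add j M M' g g' : jet j M g -> jet j M' g' -> jet j (M + M') (fun z => g z + g' z).
Proof.
elim: j M M' g g' => [|j IH] M M' g g' /=.
  move=> [dg gM] [dg' gM']; split; first exact: dalgD.
  by move=> z zs; apply: le_trans (modulusD _ _) (lerD (gM z zs) (gM' z zs)).
move=> [c [q [L [jq gE cM]]]] [c' [q' [L' [jq' gE' cM']]]].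
exists (c + c'), (fun z => q z + q' z), (L + L'); split; first exact: IH.
  by move=> z zs; rewrite gE // gE' //; ring.
apply: le_trans (lerD cM cM'); rewrite mulrDr addrACA lerD2r; exact: modulusD.
Qed.

Lemma jet_coord j : jet j tau h.
Proof.
case: j => [//|j] /=; exists 0, (fun=> 1), 1; split => [|z _|].
- by have := jet_cst j 1; rewrite modulus1.
- by rewrite add0r mulr1.
by rewrite modulus0 add0r mulr1.
Qed.

(** The weighted sum of coefficients is submultiplicative: the bounds multiply as (|c| + tau L)
    (|c'| + tau L'). A k-th power therefore costs M^k, without any factor that grows with j or
    polynomially with k. *)
Lemma jet_mul j M M' g g' : jet j M g -> jet j M' g' -> jet j (M * M') (fun z => g z * g' z).
Proof.
elim: j M M' g g' => [|j IH] M M' g g' /=.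
  move=> [dg gM] [dg' gM']; split; first exact: dalgM.
  by move=> z zs; rewrite (modulusM (g z)); apply: ler_pM; rewrite ?modulus_ge0 ?gM ?gM'.
move=> [c [q [L [jq gE cM]]]] [c' [q' [L' [jq' gE' cM']]]].
have L0 := jet_ge0 jq; have L'0 := jet_ge0 jq'.
exists (c * c'), (fun z => (c * q' z + c' * q z) + h z * (q z * q' z)),
  ((modulus c * L' + modulus c' * L) + tau * (L * L')); split.
- apply: jet_add; first by apply: jet_add; apply: IH => //; exact: jet_cst.
  by apply: (IH _ _ _ _ (jet_coord j)); exact: IH.
- by move=> z zs; rewrite gE // gE' //; ring.
have -> : modulus (c * c') + tau * (modulus c * L' + modulus c' * L + tau * (L * L')) =
   (modulus c + tau * L) * (modulus c' + tau * L').
  by rewrite (modulusM c); ring.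
by apply: ler_pM => //; rewrite addr_ge0 ?modulus_ge0 // mulr_ge0 // ltW.
Qed.

Lemma jet_scale j M g c : jet j M g -> jet j (modulus c * M) (fun z => c * g z).
Proof. by move=> jg; exact: jet_mul (jet_cst j c) jg. Qed.

Lemma jet_pow j M g k : jet j M g -> jet j (M ^+ k) (fun z => g z ^+ k).
Proof.
move=> jg; elim: k => [|k IH].
  by rewrite expr0; have := jet_cst j 1; rewrite modulus1; apply: jet_ext => z _; rewrite expr0.
by rewrite exprS; have := jet_mul jg IH; apply: jet_ext => z _; rewrite exprS.
Qed.

(** The bound is the fixed point of y |-> 1 + tau y, hence the same for every j. *)
Lemma jet_inv j a : modulus a <= 1 -> jet j (1 - tau)^-1 (fun z => (1 + a * h z)^-1).
Proof.
move=> a1; have d0 : 0 < 1 - tau by rewrite subr_gt0.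
have low z : modulus z <= s -> 1 - tau <= modulus (1 + a * h z).
  move=> zs; have := modulus_subl 1 (- (a * h z)); rewrite opprK modulusN modulus1.
  apply: le_trans; rewrite lerD2l lerN2 (modulusM a).
  by apply: le_trans (hh zs); rewrite ler_piMl ?modulus_ge0.
elim: j => [|j IH] /=.
  split; last by move=> z zs; rewrite modulusV lef_pV2 ?posrE ?low // (lt_le_trans d0) ?low.
  have as1 : modulus a * s < 1 by apply: le_lt_trans s1; rewrite ler_piMl // ltW.
  apply: (dalg_comp s0 (dalg_inv s0 as1) dh) => z zs; apply: le_trans (hh zs) _.
  by case/andP: htau.
exists 1, (fun z => - a * (1 + a * h z)^-1), (modulus (- a) * (1 - tau)^-1); split.
- exact: jet_scale.
- move=> z zs; have n0 : 1 + a * h z != 0 by rewrite -modulus_gt0; exact: lt_le_trans d0 (low z zs).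
  by move: (h z) n0 => y n0; field.
rewrite modulus1 modulusN.
have e : (1 - tau)^-1 = 1 + tau * (1 - tau)^-1 by field; rewrite gt_eqF.
rewrite [leRHS]e.
by rewrite lerD2l (ler_pM2l t0) ler_piMl // invr_ge0 ltW.
Qed.

(** The remainder is bounded independently of m and hence of the time, since m enters only through m
    <= 1. *)
Lemma jet_factor j k (m : K) : 0 <= m < 1 ->
  exists2 q, jet j (\sum_(l < k) (1 - tau)^-1 ^+ l.+1) q & forall z, modulus z <= s ->
    ((h z + of_real m) / (1 + of_real m * h z)) ^+ k = of_real m ^+ k + h z * q z.
Proof.
move=> /andP[m0 m1]; set B := (1 - tau)^-1.
have am : modulus (of_real m : cplx K) <= 1 by rewrite modulus_of_real ger0_norm // ltW.
have d0 : 0 < 1 - tau by rewrite subr_gt0.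
have n0 z : modulus z <= s -> 1 + of_real m * h z != 0.
  move=> zs; rewrite -modulus_gt0; apply: lt_le_trans d0 _.
  have := modulus_subl 1 (- (of_real m * h z)); rewrite opprK modulusN modulus1.
  apply: le_trans; rewrite lerD2l lerN2 (modulusM (of_real m)).
  by apply: le_trans (hh zs); rewrite ler_piMl ?modulus_ge0.
pose w z := of_real (1 - m ^+ 2) * (1 + of_real m * h z)^-1.
have jw : jet j B w.
  apply: jet_mono (jet_scale _ (jet_inv j am)).
  rewrite modulus_of_real ger0_norm ?subr_ge0 ?exprn_ile1 ?(ltW m1) //.
  by rewrite ler_piMl ?invr_ge0 ?(ltW d0) // lerBlDr lerDl sqr_ge0.
pose a z := (h z + of_real m) / (1 + of_real m * h z).
have aE z : modulus z <= s -> a z = of_real m + h z * w z.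
  move=> zs; have := n0 z zs; rewrite /a /w of_realB of_realX of_real1.
  by move: (h z) (of_real m) => y M yn; field.
have ja : jet j B a.
  have H := jet_add (jet_cst j (of_real m)) (jet_mul (jet_coord j) jw).
  apply: (jet_ext _ (jet_mono _ H)) => [z zs|]; first by rewrite aE.
  have e : B = 1 + tau * B by rewrite /B; field; rewrite gt_eqF.
  by rewrite [leRHS]e lerD2r.
elim: k => [|k [q jq qE]].
  exists (fun=> 0) => [|z zs]; last by rewrite !expr0 mulr0 addr0.
  by rewrite big_ord0; have := jet_cst j 0; rewrite modulus0.
exists (fun z => of_real m * q z + w z * a z ^+ k) => [|z zs].
  rewrite big_ord_recr /= exprS; apply: jet_add; last exact: jet_mul (jet_pow k ja).
  apply: jet_mono (jet_scale _ jq); rewrite ler_piMl //; exact: jet_ge0 jq.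
have ak : a z ^+ k = of_real m ^+ k + h z * q z := qE z zs.
rewrite -/(a z).
have -> : of_real m ^+ k.+1 + h z * (of_real m * q z + w z * a z ^+ k) =
  of_real m * (of_real m ^+ k + h z * q z) + h z * w z * a z ^+ k by rewrite exprS; ring.
by rewrite -ak -mulrDl -aE // exprS.
Qed.

Lemma jet_functional (phi : (cplx K -> cplx K) -> cplx K) j M g i (E : K) : bfunc s phi -> jet j M g ->
  (forall k, (i <= k < i + j)%N -> modulus (phi (fun z => h z ^+ k)) <= E) ->
  (forall q L, dalg s q -> (forall z, modulus z <= s -> modulus (q z) <= L) ->
     modulus (phi (fun z => h z ^+ (i + j) * q z)) <= L * E) ->
  modulus (phi (fun z => h z ^+ i * g z)) <= M * tau^-1 ^+ j * E.
Proof.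
move=> bp; elim: j i M g => [|j IH] i M g.
  move=> /= [dg gM] _; rewrite addn0 expr0 mulr1 => H; exact: H.
move=> /= [c [q [L [jq gE cM]]]] hk hq; have dq := jet_dalg jq; have L0 := jet_ge0 jq.
have E0 : 0 <= E by apply: le_trans (hk i _); rewrite ?modulus_ge0 // leqnn addnS ltnS leq_addr.
have -> : phi (fun z => h z ^+ i * g z) = c * phi (fun z => h z ^+ i) + phi (fun z => h z ^+ i.+1 * q z).
  rewrite -bp.1; [|exact: dalgX|exact: dalgM (dalgX s0 _ dh) dq].
  apply/esym; apply: (bfunc_ext s0 bp) => [|z zs].
    exact: dalgD (dalgZ s0 c (dalgX s0 i dh)) (dalgM s0 (dalgX s0 _ dh) dq).
  by rewrite gE // exprSr; ring.
apply: le_trans (modulusD _ _) _; rewrite (modulusM c).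
have iq : modulus (phi (fun z => h z ^+ i.+1 * q z)) <= L * tau^-1 ^+ j * E.
  apply: IH => // [k hk1|q' L' dq' hL]; first by apply: hk; lia.
  by rewrite addSnnS; exact: hq.
have ic := hk i; rewrite leqnn addnS ltnS leq_addr in ic.
apply: le_trans (lerD (ler_wpM2l (modulus_ge0 c) (ic isT)) iq) _.
rewrite -mulrDl ler_wpM2r //.
have T1 : 1 <= tau^-1 ^+ j.+1 by rewrite exprn_ege1 // invf_ge1 // ltW.
apply: le_trans (_ : _ <= (modulus c + tau * L) * tau^-1 ^+ j.+1) _; last first.
  by rewrite ler_wpM2r // exprn_ge0 // invr_ge0 ltW.
rewrite mulrDl; apply: lerD; first by rewrite ler_peMr // modulus_ge0.
by rewrite exprS mulrA (mulrC tau L) -(mulrA L) mulfV ?mulr1 // gt_eqF.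
Qed.

End Jets.

(** * Exponential upper rates of sequences *)

Section Rates.
Variable K : realType.
Implicit Types (u v : nat -> K) (a c : K).

Definition rate_le u a := forall d : K, 0 < d -> exists2 C, 0 < C &
  \forall n \near \oo, u n <= C * expR (n%:R * (a + d)).

Lemma rate_near u v a : (\forall n \near \oo, u n <= v n) -> rate_le v a -> rate_le u a.
Proof.
move=> uv hv d /hv[C C0 hC]; exists C => //.
by apply: filterS2 uv hC => n; exact: le_trans.
Qed.

Lemma rate_add u v a : rate_le u a -> rate_le v a -> rate_le (fun n => u n + v n) a.
Proof.
move=> hu hv d d0; have [C C0 hC] := hu d d0; have [D D0 hD] := hv d d0.
exists (C + D); first exact: addr_gt0.
by apply: filterS2 hC hD => n h1 h2; rewrite mulrDl lerD.
Qed.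

Lemma rate_mul u v a c : (forall n, 0 <= u n) -> (forall n, 0 <= v n) ->
  rate_le u a -> rate_le v c -> rate_le (fun n => u n * v n) (a + c).
Proof.
move=> u0 v0 hu hv d d0; have d2 : 0 < d / 2 by rewrite divr_gt0.
have [C C0 hC] := hu _ d2; have [D D0 hD] := hv _ d2.
exists (C * D); first exact: mulr_gt0.
apply: filterS2 hC hD => n h1 h2; apply: le_trans (ler_pM (u0 n) (v0 n) h1 h2) _.
rewrite mulrACA -expRD -mulrDr.
by have -> : a + d / 2 + (c + d / 2) = a + c + d by field.
Qed.

Lemma rate_cst c : 0 <= c -> rate_le (fun=> c) 0.
Proof.
move=> c0 d d0; exists (c + 1) => [|]; first by rewrite ltr_wpDl.
apply: nearW => n; apply: le_trans (_ : _ <= c + 1) _; first by rewrite lerDl.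
rewrite ler_peMr ?addr_ge0 // add0r -expR0 ler_expR mulr_ge0 //; exact: ltW.
Qed.

Lemma rate_scale u a c : 0 <= c -> (forall n, 0 <= u n) -> rate_le u a -> rate_le (fun n => c * u n) a.
Proof. by move=> c0 u0 hu; rewrite -[a]add0r; exact: rate_mul (rate_cst c0) hu. Qed.

Lemma rate_pow u a i : (forall n, 0 <= u n) -> rate_le u a -> rate_le (fun n => u n ^+ i) (i%:R * a).
Proof.
move=> u0 hu; elim: i => [|i IH].
  by rewrite mul0r; apply: rate_near (rate_cst ler01); apply: nearW => n; rewrite expr0.
have -> : i.+1%:R * a = a + i%:R * a by rewrite -(natr1 i) mulrDl mul1r addrC.
apply: rate_near (rate_mul u0 _ hu IH) => [|n]; last by rewrite exprn_ge0.
by apply: nearW => n; rewrite exprS.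
Qed.

(** A sequence that tends to 0 is bounded by the tail of its increments. The error is capped at - a
    / 2 so that the rate a + e stays negative and the tail is geometric. *)
Lemma rate_null (u : nat -> cplx K) (v : nat -> K) a : a < 0 ->
  (\forall n \near \oo, modulus (u n.+1 - u n) <= v n) -> rate_le v a -> u @ \oo --> (0 : cplx K) ->
  rate_le (fun n => modulus (u n)) a.
Proof.
move=> a0 uv hv u0 d d0; pose e := Num.min d (- a / 2).
have e0 : 0 < e by rewrite lt_min d0 divr_gt0 // oppr_gt0.
have [C C0 hC] := hv e e0.
have q1 : expR (a + e) < 1.
  by rewrite expR_lt1; have : e <= - a / 2 by [rewrite ge_min lexx orbT]; move: a0; lra.
have hq : 0 <= expR (a + e) < 1 by rewrite expR_ge0.
have [N _ hN] := filterI uv hC.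
have H := @geometric_null K u C (expR (a + e)) N hq (ltW C0).
exists (C / (1 - expR (a + e))) => [|]; first by rewrite divr_gt0 // subr_gt0.
exists N => // n /= Nn; apply: le_trans (H _ u0 n Nn) _.
  by move=> k /hN[h1 h2]; rewrite -expRM_natl; exact: le_trans h1 h2.
have D0 : 0 <= C / (1 - expR (a + e)) by rewrite divr_ge0 ?subr_ge0 ?(ltW C0) ?(ltW q1).
rewrite -expRM_natl (ler_wpM2l D0) //.
by rewrite ler_expR ler_wpM2l // lerD2l ge_min lexx.
Qed.

End Rates.

(** * Decay of functionals along an orbit *)

Section OrbitFunctionals.
Variable K : realType.
Variables (R r s tau : K).
Hypothesis hR : 0 < R < 1.
Hypothesis hs : R < s < 1.
Hypothesis hr : 0 < r < R.
Hypothesis htau : 0 < tau <= s.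
Variables (b : nat -> bool) (x : nat -> K) (Lam : K).
Hypothesis hbx : fixed_orbit r s b x.
Hypothesis Lam0 : Lam < 0.
Local Notation lam := (lam b x).
Local Notation h := (coord b x).
Local Notation m := (mult b x).
Hypothesis hlam : growth Lam lam.

Let s0 : 0 < s. Proof. by case/andP: hs => ? _; case/andP: hR => ? _; lra. Qed.
Let s1 : s < 1. Proof. by case/andP: hs. Qed.
Let t0 : 0 < tau. Proof. by case/andP: htau. Qed.
Let t1 : tau < 1. Proof. by case/andP: htau => _ h1; exact: le_lt_trans h1 s1. Qed.
Let l0 n : 0 < lam n. Proof. exact: (lam_gt0 hs hr hbx n). Qed.
Let dh n : dalg s (h n). Proof. exact: (dalg_coord hR hs hr hbx n). Qed.
Let dhX n i : dalg s (fun z => h n z ^+ i). Proof. exact: (dalgX s0 i (dh n)). Qed.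

Lemma lam_rate : rate_le lam Lam.
Proof.
by move=> d /hlam[C C0 hC]; exists C => //; apply: nearW => n; case/andP: (hC n).
Qed.

Lemma lamV_rate : rate_le (fun n => (lam n.+1)^-1) (- Lam).
Proof.
move=> d /hlam[C C0 hC]; exists (C * expR (d - Lam)) => [|]; first by rewrite mulr_gt0 // expR_gt0.
apply: nearW => n; have /andP[h1 _] := hC n.+1.
have p0 : 0 < C^-1 * expR (n.+1%:R * (Lam - d)) by rewrite mulr_gt0 ?invr_gt0 // expR_gt0.
apply: le_trans (_ : _ <= (C^-1 * expR (n.+1%:R * (Lam - d)))^-1) _; first by rewrite lef_pV2 ?posrE ?l0.
rewrite invfM invrK -mulrA (ler_pM2l C0) -expRN -expRD ler_expR.
by apply: eq_leW; rewrite -(natr1 n); ring.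
Qed.

(* As h_n / lam_n converges geometrically (a random Koenigs linearisation), so
   does phi (h_n^i) / lam_n^i for every functional phi. *)
Definition normalized (phi : (cplx K -> cplx K) -> cplx K) i n : cplx K :=
  phi (fun z => h n z ^+ i) / of_real (lam n) ^+ i.

Lemma power_diff (y w : cplx K) (C D : K) i : 1 <= C -> modulus y <= C -> modulus w <= C ->
  modulus (y - w) <= D -> modulus (y ^+ i - w ^+ i) <= i%:R * C ^+ i * D.
Proof.
move=> C1 yC wC yw; have C0 : 0 <= C := le_trans ler01 C1; have D0 := le_trans (modulus_ge0 _) yw.
elim: i => [|i IH]; first by rewrite !expr0 subrr modulus0 !mul0r.
have -> : y ^+ i.+1 - w ^+ i.+1 = y * (y ^+ i - w ^+ i) + (y - w) * w ^+ i by rewrite !exprS; ring.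
apply: le_trans (modulusD _ _) _; rewrite (modulusM y) (modulusM (y - w)) modulusX.
have e1 : modulus y * modulus (y ^+ i - w ^+ i) <= C * (i%:R * C ^+ i * D).
  by apply: ler_pM; rewrite ?modulus_ge0.
have e2 : modulus (y - w) * modulus w ^+ i <= D * C ^+ i.+1.
  apply: ler_pM; rewrite ?modulus_ge0 ?exprn_ge0 ?modulus_ge0 //.
  apply: le_trans (_ : _ <= C ^+ i) _; first by rewrite lerXn2r ?nnegrE ?modulus_ge0.
  by rewrite exprS ler_peMl ?exprn_ge0.
apply: le_trans (lerD e1 e2) _; rewrite -(natr1 i) exprS.
by apply: eq_leW; ring.
Qed.

Lemma quotient_le : exists2 C, 1 <= C & forall n z, modulus z <= s -> modulus (h n z / of_real (lam n)) <= C.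
Proof.
have [A A0 hA] := coord_lam hR hs hr hbx hlam; exists (A + 1) => [|n z zs]; first by rewrite lerDr ltW.
rewrite (modulusM (h n z)) modulusV modulus_of_real ger0_norm ?(ltW (l0 n)) // ler_pdivrMr //.
by apply: le_trans (hA n z zs) _; rewrite (ler_pM2r (l0 n)) lerDl.
Qed.

Lemma normalizedE phi i n : bfunc s phi ->
  normalized phi i n = phi (fun z => (h n z / of_real (lam n)) ^+ i).
Proof.
move=> bp; rewrite /normalized mulrC -(bfuncZ s0 _ bp (dhX n i)); apply: (bfunc_ext s0 bp) => [|z zs].
  exact: (dalgZ s0 _ (dhX n i)).
by move: (h n z) (of_real (lam n)) => y l; rewrite [LHS]mulrC [RHS]exprMn exprVn.
Qed.

Lemma quotient_dalg i n : dalg s (fun z => (h n z / of_real (lam n)) ^+ i).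
Proof. by apply: dalgX => //; apply: (dalgM s0 (dh n)); exact: dalg_cst. Qed.

Lemma normalized_cvg phi i : bfunc s phi -> exists l : cplx K, normalized phi i @ \oo --> l.
Proof.
move=> bp; have [_ [M M0 hM]] := bp; have [C C1 hC] := quotient_le.
have [A [q [A0 /andP[q0 q1] hq]]] := coord_increment hR hs hr hbx hlam.
apply: (@geometric_limit _ _ (M * (i%:R * C ^+ i * A)) q) => [|n]; first by rewrite (ltW q0).
rewrite !normalizedE // -(bfuncB s0 bp); [|exact: quotient_dalg|exact: quotient_dalg].
have H z : modulus z <= s -> modulus ((h n.+1 z / of_real (lam n.+1)) ^+ i - (h n z / of_real (lam n)) ^+ i) <=
    i%:R * C ^+ i * (A * q ^+ n).
  by move=> zs; apply: power_diff => //; [exact: hC|exact: hC|exact: hq].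
apply: le_trans (hM _ _ (dalgB s0 (quotient_dalg i n.+1) (quotient_dalg i n)) H) _.
by rewrite !mulrA.
Qed.

Definition beta phi i : cplx K := lim (normalized phi i n @[n --> \oo]).

Lemma betaP phi i : bfunc s phi -> normalized phi i @ \oo --> beta phi i.
Proof. by move=> /(normalized_cvg i)[l hl]; apply/cvg_ex; exists l. Qed.

Lemma beta_eq phi i (l : cplx K) : normalized phi i @ \oo --> l -> beta phi i = l.
Proof. by move=> hl; apply/cvg_lim => //; exact: norm_hausdorff. Qed.

Lemma normalized_bound : exists2 C, 1 <= C & forall phi i n (M : K), bfunc s phi ->
  (forall g (e : K), dalg s g -> (forall z, modulus z <= s -> modulus (g z) <= e) -> modulus (phi g) <= M * e) ->
  modulus (normalized phi i n) <= M * C ^+ i.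
Proof.
have [C C1 hC] := quotient_le; exists C => // phi i n M bp hM.
rewrite normalizedE //; apply: hM; first exact: quotient_dalg.
move=> z zs; rewrite modulusX lerXn2r ?nnegrE ?modulus_ge0 ?(le_trans ler01 C1) //.
exact: hC.
Qed.

Section Decay.
Variables (phi : (cplx K -> cplx K) -> cplx K) (j : nat).
Hypothesis bp : bfunc s phi.
Hypothesis hbeta : forall i, (i < j)%N -> beta phi i = 0.

(** The intermediate powers together with a bound [T] for multiples of h_n^j: the data that
    [jet_functional] needs from order i on. *)
Definition envelope (T : nat -> K) i n : K := \sum_(i <= k < j) modulus (phi (fun z => h n z ^+ k)) + T n.

Lemma envelope_tail T i n : T n <= envelope T i n.
Proof. by rewrite lerDr sumr_ge0 // => k _; exact: modulus_ge0. Qed.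

Lemma envelope_term T i k n : (forall n, 0 <= T n) -> (i <= k < j)%N ->
  modulus (phi (fun z => h n z ^+ k)) <= envelope T i n.
Proof.
move=> T0 /andP[ik kj]; rewrite /envelope (big_cat_nat ik (ltnW kj)) /= (big_ltn kj) -!addrA addrCA lerDl.
by rewrite !addr_ge0 ?sumr_ge0 // => l _; exact: modulus_ge0.
Qed.

(** From some time on the coordinate is at most [tau], which may be prescribed as small as the
    comparison with R requires. *)
Lemma small_coord : \forall n \near \oo, forall z, modulus z <= s -> modulus (h n z) <= tau.
Proof.
have /andP[k0 k1] := contraction_lt1 hR hs hr.
have [|N hN] := @geometric_small K (init_bound r s) (contraction r s) tau _ t0; first by rewrite (ltW k0).
exists N => // n /= Nn z zs; apply: le_trans (coord_le hR hs hr hbx n zs) _.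
exact: ltW (hN n Nn).
Qed.

Lemma tail_exists : exists T : nat -> K, [/\ forall n, 0 <= T n, rate_le T (j%:R * Lam) &
  forall n q L, dalg s q -> (forall z, modulus z <= s -> modulus (q z) <= L) ->
     modulus (phi (fun z => h n z ^+ j * q z)) <= L * T n].
Proof.
have [_ [M M0 hM]] := bp; have [A A0 hA] := coord_lam hR hs hr hbx hlam.
have al n : 0 <= A * lam n by exact: mulr_ge0 (ltW A0) (ltW (l0 n)).
exists (fun n => M * (A * lam n) ^+ j); split => [n||n q L dq qL].
- by rewrite mulr_ge0 // exprn_ge0.
- apply: rate_scale => // [n|]; first by rewrite exprn_ge0.
  by apply: rate_pow => //; apply: rate_scale lam_rate => [|n]; [exact: ltW|exact: ltW (l0 n)].
rewrite mulrCA; apply: hM; first exact: dalgM (dhX n j) dq.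
move=> z zs; rewrite (modulusM (_ ^+ j)) modulusX mulrC; apply: ler_pM; rewrite ?exprn_ge0 ?modulus_ge0 ?qL //.
by rewrite lerXn2r ?nnegrE ?modulus_ge0 //; exact: hA.
Qed.

(* Downward induction on i: the increments of phi (h_n^i) / lam_n^i only involve
   higher powers of h_n, so the sequence is bounded by their tail if its limit
   vanishes. *)
Lemma envelope_rate : exists T : nat -> K, [/\ forall n, 0 <= T n, forall i, (i <= j)%N -> rate_le (envelope T i) (j%:R * Lam) &
  forall n q L, dalg s q -> (forall z, modulus z <= s -> modulus (q z) <= L) ->
     modulus (phi (fun z => h n z ^+ j * q z)) <= L * T n].
Proof.
have [T [T0 rT hT]] := tail_exists; exists T; split => // i ij.
rewrite -(subKn ij); elim: (j - i)%N => [|c IH].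
  by rewrite subn0; apply: rate_near rT; apply: nearW => n; rewrite /envelope big_geq // add0r.
have [cj|jc] := ltnP c j; last first.
  have /eqP e0 : (j - c == 0)%N by rewrite subn_eq0.
  have /eqP -> : (j - c.+1 == 0)%N by rewrite subn_eq0 leqW.
  by rewrite -e0.
move: IH; rewrite -(subnSK cj).
have kj : (j - c.+1 < j)%N by rewrite ltn_subrL (leq_ltn_trans _ cj).
move: (j - c.+1)%N kj => {ij cj}k kj IH.
have E0 l n : 0 <= envelope T l n.
  by rewrite addr_ge0 // sumr_ge0 // => l' _; exact: modulus_ge0.
apply: (rate_near (v := fun n => modulus (phi (fun z => h n z ^+ k)) + envelope T k.+1 n)).
  by apply: nearW => n; rewrite /envelope [leLHS](_ : _ = modulus (phi (fun z => h n z ^+ k)) + (\sum_(k.+1 <= l < j) modulus (phi (fun z => h n z ^+ l)) + T n)) // big_ltn // addrA.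
apply: rate_add => //.
pose B : K := (1 - tau)^-1; pose Q : K := \sum_(l < k) B ^+ l.+1.
have B0 : 0 <= B by rewrite invr_ge0 subr_ge0 ltW.
have Q0 : 0 <= Q by apply: sumr_ge0 => l _; exact: exprn_ge0.
(* Normalisation at order k divides by lam^k, which turns the rate j Lam of the higher orders into
   (j - k) Lam. This is still negative, so the normalised sequence can be summed from infinity. *)
pose V n := Q * tau^-1 ^+ (j - k.+1) * envelope T k.+1 n * (lam n.+1)^-1 ^+ k.
have V0 n : 0 <= Q * tau^-1 ^+ (j - k.+1) * envelope T k.+1 n.
  by rewrite !mulr_ge0 // exprn_ge0 // invr_ge0 ltW.
have rV : rate_le V ((j - k)%N%:R * Lam).
  have -> : (j - k)%N%:R * Lam = j%:R * Lam + k%:R * - Lam by rewrite natrB ?(ltnW kj) // mulrBl mulrN.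
  apply: rate_mul => // [n||].
  - by rewrite exprn_ge0 // invr_ge0 (ltW (l0 _)).
  - by apply: rate_scale IH => //; rewrite mulr_ge0 // exprn_ge0 // invr_ge0 ltW.
  by apply: rate_pow lamV_rate => n; rewrite invr_ge0 (ltW (l0 _)).
have neg : (j - k)%N%:R * Lam < 0 by rewrite pmulr_rlt0 // ltr0n subn_gt0.
have inc : \forall n \near \oo, modulus (normalized phi k n.+1 - normalized phi k n) <= V n.
  apply: filterS small_coord => n hn.
  have mn := mult_lt1 hs hr hbx n; have mn0 := mult_gt0 hs hr hbx n.
  have [q jq qE] := jet_factor s0 s1 htau (dh n) hn (j - k.+1) k mn.
  have dq := jet_dalg s0 (dh n) jq.
  (* The k-th power of one step is h^k (m^k + h q); the part m^k disappears in the normalisation,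
     and only orders above k remain. *)
  have -> : normalized phi k n.+1 - normalized phi k n =
      phi (fun z => h n z ^+ k.+1 * q z) / of_real (lam n.+1) ^+ k.
    have hE : phi (fun z => h n.+1 z ^+ k) = of_real (m n) ^+ k * phi (fun z => h n z ^+ k) + phi (fun z => h n z ^+ k.+1 * q z).
      rewrite -(bfuncZ s0 _ bp (dhX n k)) -(bfuncD s0 bp); [|exact: dalgZ|exact: dalgM (dhX n _) dq].
      apply: (bfunc_ext s0 bp) => [|z zs]; first exact: dhX.
      by rewrite (coord_step hs hr hbx n zs) exprMn qE // exprSr; ring.
    have ln0 l : of_real (lam l) != 0 :> cplx K by rewrite -modulus_gt0 modulus_of_real normr_gt0 gt_eqF.
    have m0 : of_real (m n) != 0 :> cplx K by rewrite -modulus_gt0 modulus_of_real normr_gt0 gt_eqF.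
    rewrite /normalized hE lamS of_realM exprMn; move: (phi _) (phi _) => y y'.
    by field; rewrite !expf_neq0.
  rewrite (modulusM (phi _)) modulusV modulusX modulus_of_real ger0_norm ?(ltW (l0 _)) // -exprVn.
  rewrite ler_wpM2r ?exprn_ge0 ?invr_ge0 ?(ltW (l0 _)) //.
  apply: (jet_functional s0 s1 htau (dh n) hn bp jq) => [l hl|q' L dq' qL].
    by rewrite subnKC // in hl; exact: envelope_term.
  rewrite subnKC //.
  have L0 : 0 <= L by apply: le_trans (qL 0 _); rewrite ?modulus_ge0 // modulus0 ltW.
  apply: le_trans (hT n q' L dq' qL) _; rewrite (ler_wpM2l L0) //; exact: envelope_tail.
have nul : normalized phi k @ \oo --> (0 : cplx K) by rewrite -(hbeta kj); exact: betaP.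
have rn := rate_null neg inc rV nul.
have -> : j%:R * Lam = k%:R * Lam + (j - k)%N%:R * Lam by rewrite -mulrDl -natrD subnKC // ltnW.
apply: rate_near (rate_mul _ _ (rate_pow k _ lam_rate) rn) => [|n|n|n].
- apply: nearW => n; rewrite /normalized (modulusM (phi _)) modulusV modulusX modulus_of_real.
  by rewrite ger0_norm ?(ltW (l0 _)) // mulrCA divff ?mulr1 // expf_neq0 // gt_eqF.
- by rewrite exprn_ge0 // ltW.
- exact: modulus_ge0.
exact: ltW.
Qed.

(** By [hmapK] the orbit map is x + h (1 - x^2) / (1 + x h), of jet norm at most r + tau / (1 -
    tau). Submultiplicativity gives the k-th power of this number for z^k, uniformly in time. *)
Lemma orb_power_rate : exists E : nat -> K, [/\ forall n, 0 <= E n, rate_le E (j%:R * Lam) &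
  \forall n \near \oo, forall k, modulus (phi (fun z => orb b n z ^+ k)) <= E n * (r + tau / (1 - tau)) ^+ k].
Proof.
have [T [T0 /(_ 0%N (leq0n j)) rT hT]] := envelope_rate.
have E0 n : 0 <= envelope T 0 n by rewrite addr_ge0 // sumr_ge0 // => l' _; exact: modulus_ge0.
have t0j : 0 <= tau^-1 ^+ j by rewrite exprn_ge0 // invr_ge0 ltW.
exists (fun n => tau^-1 ^+ j * envelope T 0 n); split => [n||]; [exact: mulr_ge0|exact: rate_scale|].
apply: filterS small_coord => n hn k.
have xn := x_bound hs hr hbx n; have /andP[x0 x1] := xn.
have J : jet s tau (h n) j (r + tau / (1 - tau)) (orb b n).
  have ax : modulus (of_real (x n)) <= 1 by rewrite modulus_of_real ger0_norm // ltW.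
  have h1 := jet_inv s0 s1 htau (dh n) hn j ax.
  have h2 := jet_mul s0 htau (dh n) hn (jet_coord (dh n) hn j) (jet_scale s0 htau (dh n) hn (of_real (1 - x n ^+ 2)) h1).
  have h3 := jet_add (jet_cst s tau (h n) j (of_real (x n))) h2.
  apply: (jet_ext _ (jet_mono _ h3)) => [z zs|].
    by rewrite [RHS](hmapK xn (orb_lt1 hs hr hbx n zs)).
  rewrite modulus_of_real ger0_norm //; have [_ /andP[_ xr] _] := hbx n; apply: lerD => //.
  rewrite ler_wpM2l ?(ltW t0) // modulus_of_real ger0_norm ?subr_ge0 ?exprn_ile1 ?(ltW x1) //.
  by rewrite ler_piMl ?invr_ge0 ?subr_ge0 ?(ltW t1) // lerBlDr lerDl sqr_ge0.
have Jk := jet_pow s0 htau (dh n) hn k J.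
have H := jet_functional (i := 0) (E := envelope T 0 n) s0 s1 htau (dh n) hn bp Jk.
have -> : phi (fun z => orb b n z ^+ k) = phi (fun z => h n z ^+ 0 * orb b n z ^+ k).
  apply: (bfunc_ext s0 bp) => [|z zs]; last by rewrite expr0 mul1r.
  exact: jet_dalg Jk.
apply: le_trans (H _ _) _ => [l hl|q' L dq' qL|]; last by rewrite -mulrA mulrC.
  by rewrite add0n in hl; exact: envelope_term.
rewrite add0n.
have L0 : 0 <= L by apply: le_trans (qL 0 _); rewrite ?modulus_ge0 // modulus0 ltW.
apply: le_trans (hT n q' L dq' qL) _; rewrite (ler_wpM2l L0) //; exact: envelope_tail.
Qed.

End Decay.
End OrbitFunctionals.

(** * Taylor functionals *)

Section TaylorFunctionals.
Variable K : realType.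
Variables (R s : K).
Hypothesis hR : 0 < R < 1.
Hypothesis hs : R < s < 1.
Implicit Types (phi : (cplx K -> cplx K) -> cplx K) (g h : cplx K -> cplx K).

Let s0 : 0 < s. Proof. by case/andP: hs => ? _; case/andP: hR => ? _; lra. Qed.
Let s1 : s < 1. Proof. by case/andP: hs. Qed.

Lemma bfunc_mul phi a : bfunc s phi -> dalg s a -> bfunc s (fun g => phi (fun z => a z * g z)).
Proof.
move=> bp da; have [lin [M M0 hM]] := bp; split => [c g h dg dh|].
  rewrite -lin; [|exact: dalgM|exact: dalgM].
  apply: (bfunc_ext s0 bp) => [|z _]; last by ring.
  apply: (dalgM s0 da); apply: dalgD dh; exact: (dalgZ s0 c dg).
have [L L0 hL] := dalg_bounded s0 da; exists (M * L) => [|g e dg ge]; first exact: mulr_ge0.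
rewrite -mulrA; apply: hM => [|z zs]; first exact: dalgM.
by rewrite (modulusM (a z)); apply: ler_pM; rewrite ?modulus_ge0 ?hL ?ge.
Qed.

Lemma bfunc_zero : bfunc s (fun=> 0).
Proof.
split => [c g h _ _|]; first by rewrite mulr0 addr0.
by exists 0 => // g e _ _; rewrite modulus0 mul0r.
Qed.

Lemma dalg_inv1 g (t : K) : 0 < t < 1 -> dalg s g -> (forall z, modulus z <= s -> modulus (g z) <= t) ->
  dalg s (fun z => (1 + g z)^-1).
Proof.
move=> /andP[t0 t1] dg gt; pose c : K := t / s.
have c0 : 0 < c by rewrite divr_gt0.
have cs : modulus (of_real c) * s < 1 by rewrite modulus_of_real gtr0_norm // divfK // gt_eqF.
have H := dalg_comp s0 (dalg_inv s0 cs) (dalgZ s0 (of_real c^-1) dg).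
have cn : of_real c != 0 :> cplx K by rewrite -modulus_gt0 modulus_of_real gtr0_norm.
apply: (dalg_ext _ (H _)) => z zs; first by rewrite of_realV mulrA mulfV // mul1r.
rewrite (modulusM (of_real _)) modulus_of_real gtr0_norm ?invr_gt0 //.
by rewrite mulrC ler_pdivrMr // /c mulrC divfK ?gt_eqF // gt.
Qed.

(** The qualitative companion of [jet_factor]: no bounds on [q], but valid also before the
    coordinate becomes small. *)
Lemma power_split (m : cplx K) (a h w : cplx K -> cplx K) : dalg s h -> dalg s w ->
  (forall z, modulus z <= s -> a z = m + h z * w z) ->
  forall i, exists2 q, dalg s q & forall z, modulus z <= s -> a z ^+ i = m ^+ i + h z * q z.
Proof.
move=> dh dw aE; elim=> [|i [q dq qE]].
  by exists (fun=> 0) => [|z _]; [exact: dalg_cst|rewrite !expr0 mulr0 addr0].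
exists (fun z => m * q z + w z * (m ^+ i + h z * q z)) => [|z zs]; last first.
  by rewrite exprS qE // aE // exprS; ring.
apply: dalgD; first exact: dalgZ.
apply: (dalgM s0 dw); apply: dalgD; [exact: dalg_cst|exact: dalgM].
Qed.

Section Point.
Variable x : K.
Hypothesis hx : 0 <= x < 1.
Local Notation H := (hmap x).

(* The coefficient of h^i in the expansion of z^k in powers of
   h = (z - x) / (1 - x z), from (z - x) z^k = h (1 - x z) z^k. *)
Fixpoint taylor (i : nat) : nat -> K := if i is j.+1 then
    (fix inner k := if k is l.+1 then x * inner l + (taylor j l - x * taylor j l.+1) else 0)
  else fun k => x ^+ k.

Lemma taylorS i k : taylor i.+1 k.+1 = x * taylor i.+1 k + (taylor i k - x * taylor i k.+1).
Proof. by []. Qed.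

(** The recursion multiplies by x at each step, so any rate above x is available; it is later taken
    below R. *)
Lemma taylor_bound rho i : x < rho < 1 -> exists2 A, 0 <= A & forall k, `|taylor i k| <= A * rho ^+ k.
Proof.
move=> /andP[xr r1]; have [x0 x1] := andP hx; have r0 : 0 <= rho by exact: le_trans (ltW xr).
elim: i => [|i [A A0 hA]].
  exists 1 => // k; rewrite mul1r /= ger0_norm ?exprn_ge0 // lerXn2r ?nnegrE //; exact: ltW.
have d0 : 0 < rho - x by rewrite subr_gt0.
(* Solves x A' + 2 A = A' rho, the condition for the induction on k to close. *)
pose A' := 2 * A / (rho - x); have A'0 : 0 <= A' by rewrite divr_ge0 ?mulr_ge0 ?(ltW d0).
exists A' => //; elim=> [|k IH]; first by rewrite normr0 expr0 mulr1.
rewrite taylorS; apply: le_trans (ler_normD _ _) _.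
have e1 : `|x * taylor i.+1 k| <= x * (A' * rho ^+ k) by rewrite normrM (ger0_norm x0) ler_wpM2l.
have e2 : `|taylor i k - x * taylor i k.+1| <= 2 * A * rho ^+ k.
  apply: le_trans (ler_normB _ _) _; rewrite normrM (ger0_norm x0).
  have h1 := hA k; have h2 := hA k.+1.
  have h3 : x * `|taylor i k.+1| <= A * rho ^+ k.
    apply: le_trans (_ : _ <= `|taylor i k.+1|) _; first by rewrite ler_piMl // ltW.
    apply: le_trans h2 _; rewrite exprS mulrCA ler_piMl ?(ltW r1) //.
    exact: mulr_ge0 A0 (exprn_ge0 k r0).
  by move: h1 h3; rewrite -mulrA; move: (A * _) `|taylor i k| (x * `|_|) => u v y; lra.
apply: le_trans (lerD e1 e2) _.
have -> : x * (A' * rho ^+ k) + 2 * A * rho ^+ k = (x * A' + 2 * A) * rho ^+ k by ring.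
rewrite exprS mulrA ler_wpM2r ?exprn_ge0 //.
have -> : 2 * A = A' * (rho - x) by rewrite /A' divfK // gt_eqF.
by apply: eq_leW; ring.
Qed.

Let one_sub z : modulus z <= s -> 1 - of_real x * z != 0.
Proof. by move=> zs; apply: hmap_den => //; exact: le_lt_trans zs s1. Qed.

Let dsub : dalg s (fun z => z - of_real x).
Proof. exact: (dalgB s0 (dalg_id s) (dalg_cst s _)). Qed.

Let dden : dalg s (fun z => 1 - of_real x * z).
Proof. exact: (dalgB s0 (dalg_cst s 1) (dalgZ s0 (of_real x) (dalg_id s))). Qed.

Let dinv : dalg s (fun z => (1 - of_real x * z)^-1).
Proof.
have [x0 x1] := andP hx.
have h1 : modulus (- of_real x : cplx K) * s < 1.
  rewrite modulusN modulus_of_real ger0_norm //; apply: le_lt_trans s1.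
  by rewrite ler_piMl ?(ltW s0) ?(ltW x1).
by apply: (dalg_ext _ (dalg_inv s0 h1)) => z _; rewrite mulNr.
Qed.

Let dH : dalg s H. Proof. exact: (dalg_hmap hR hs hx). Qed.

(** On monomials, phi of (z - x) g equals psi of (1 - x z) g by the recursion [taylorS]. By density
    this holds for all g, and it is then applied to g / (1 - x z). *)
Lemma taylor_relation phi psi (c : cplx K) i : bfunc s phi -> bfunc s psi ->
  (forall k, phi (monom k) = c * of_real (taylor i.+1 k)) ->
  (forall k, psi (monom k) = c * of_real (taylor i k)) ->
  forall g, dalg s g -> phi (fun z => H z * g z) = psi g.
Proof.
move=> bp bq hp hq g dg.
have rel := bfunc_eq s0 (bfunc_mul bp dsub) (bfunc_mul bq dden).
have dig : dalg s (fun z => (1 - of_real x * z)^-1 * g z) by exact: dalgM.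
have := rel _ _ dig => {}rel; apply: etrans (etrans (rel _) _).
- apply: (bfunc_ext s0 bp); first exact: dalgM.
  by move=> z zs; rewrite /H mulrA.
- move=> k /=.
  have mk l : dalg s (monom l) := dalg_monom s0 l.
  have -> : phi (fun z => (z - of_real x) * monom k z) = phi (monom k.+1) - of_real x * phi (monom k).
    rewrite -(bfuncZ s0 _ bp (mk k)) -(bfuncB s0 bp (mk k.+1) (dalgZ s0 _ (mk k))).
    by apply: (bfunc_ext s0 bp) => [|z _]; [exact: dalgM|rewrite /monom exprS; ring].
  have -> : psi (fun z => (1 - of_real x * z) * monom k z) = psi (monom k) - of_real x * psi (monom k.+1).
    rewrite -(bfuncZ s0 _ bq (mk k.+1)) -(bfuncB s0 bq (mk k) (dalgZ s0 _ (mk k.+1))).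
    by apply: (bfunc_ext s0 bq) => [|z _]; [exact: dalgM|rewrite /monom exprS; ring].
  rewrite !hp !hq taylorS of_realD of_realB !of_realM; ring.
apply: (bfunc_ext s0 bq) => [|z zs]; first exact: dalgM.
by rewrite mulrA mulfV ?mul1r // one_sub.
Qed.

Lemma taylor_base phi (c : cplx K) : bfunc s phi ->
  (forall k, phi (monom k) = c * of_real (taylor 0 k)) ->
  forall g, dalg s g -> phi (fun z => H z * g z) = 0.
Proof.
move=> bp hp g dg.
have rel := bfunc_eq s0 (bfunc_mul bp dsub) bfunc_zero.
have dig : dalg s (fun z => (1 - of_real x * z)^-1 * g z) by exact: dalgM.
have := rel _ _ dig => {}rel; apply: etrans (rel _).
  apply: (bfunc_ext s0 bp); first exact: dalgM.
  by move=> z zs; rewrite /H mulrA.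
move=> k /=; have mk l : dalg s (monom l) := dalg_monom s0 l.
have -> : phi (fun z => (z - of_real x) * monom k z) = phi (monom k.+1) - of_real x * phi (monom k).
  rewrite -(bfuncZ s0 _ bp (mk k)) -(bfuncB s0 bp (mk k.+1) (dalgZ s0 _ (mk k))).
  by apply: (bfunc_ext s0 bp) => [|z _]; [exact: dalgM|rewrite /monom exprS; ring].
by rewrite !hp /= exprS of_realM; ring.
Qed.

Hypothesis xR : x < R.

Lemma realize_taylor i (t : bool -> cplx K) : (i = 0%N -> t true = t false) ->
  exists2 f, hardy R f & forall e k, pair s e f (monom k) = t e * of_real (taylor i k).
Proof.
move=> ht; have [x0 x1] := andP hx; pose rho := (x + R) / 2.
have [R0 R1] := andP hR.
have rR : 0 < rho < R by rewrite /rho; apply/andP; split; move: x0 xR R0; lra.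
have xr : x < rho < 1 by rewrite /rho; apply/andP; split; move: x0 xR R0 R1; lra.
have [A A0 hA] := taylor_bound i xr.
pose L := modulus (t true) + modulus (t false).
have tL e : modulus (t e) <= L by case: e; rewrite /L ?lerDl ?lerDr modulus_ge0.
have L0 : 0 <= L by exact: le_trans (modulus_ge0 _) (tL true).
have bnd e k : modulus (t e * of_real (taylor i k)) <= L * A * rho ^+ k.
  by rewrite (modulusM (t e)) modulus_of_real -mulrA; apply: ler_pM; rewrite ?modulus_ge0.
have comp : t true * of_real (taylor i 0) = t false * of_real (taylor i 0).
  by case: i ht {hA bnd} => [->//|i _]; rewrite /= of_real0 !mulr0.
have [f hf fp] := hardy_realize hR (alpha := fun e k => t e * of_real (taylor i k)) rR (mulr_ge0 L0 A0) bnd comp.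
by exists f => // e k; exact: fp.
Qed.

(** By [taylor_relation] one factor h lowers the order by one, which gives an induction; the
    functional of order i is supplied as the pairing with a realised element. *)
Lemma taylor_functional i phi (c : cplx K) : bfunc s phi ->
  (forall k, phi (monom k) = c * of_real (taylor i k)) ->
  phi (fun z => H z ^+ i) = c /\ forall g, dalg s g -> phi (fun z => H z ^+ i.+1 * g z) = 0.
Proof.
elim: i phi => [|i IH] phi bp hp.
  split; last by move=> g dg; rewrite -(taylor_base bp hp dg).
  by apply: etrans (hp 0%N) _; rewrite -[taylor 0 0]/(x ^+ 0) expr0 of_real1 mulr1.
have [f hf fp] := @realize_taylor i (fun=> c) (fun=> erefl).
have bq := pair_bfunc hR true (hardy_analytic hf) hs.
have [h1 h2] := IH _ bq (fp true); have rel := taylor_relation bp bq hp (fp true).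
split; first by rewrite -h1 -rel; [congr phi; apply/funext => z; rewrite exprS|exact: dalgX].
move=> g dg; rewrite -(h2 g dg) -rel; first by congr phi; apply/funext => z; rewrite exprS mulrA.
exact: (dalgM s0 (dalgX s0 _ dH) dg).
Qed.

Lemma taylor_element i (t : bool -> cplx K) : (i = 0%N -> t true = t false) ->
  exists f, [/\ hardy R f, forall e, pair s e f (fun z => H z ^+ i) = t e &
    forall e g, dalg s g -> pair s e f (fun z => H z ^+ i.+1 * g z) = 0].
Proof.
move=> ht; have [f hf fp] := realize_taylor ht; exists f.
have bq e := pair_bfunc hR e (hardy_analytic hf) hs.
by split => // e; have [h1 h2] := taylor_functional (bq e) (fp e).
Qed.

End Point.
End TaylorFunctionals.

(** * The unperturbed spectrum *)

Lemma cvg_scale_shift (K : realType) (c l : cplx K) (u : nat -> cplx K) :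
  u @ \oo --> l -> (fun n => c * u n.+1) @ \oo --> c * l.
Proof.
move=> ul; apply/cvg_modulus => e e0.
have c1 : 0 < modulus c + 1 by rewrite ltr_wpDl ?modulus_ge0.
have /cvg_modulus/(_ _ (divr_gt0 e0 c1)) [n _ hn] := ul.
exists n => // k /= nk; have := hn k.+1 (leq_trans nk (leqnSn k)) => /=.
rewrite -mulrBr (modulusM c) ltr_pdivlMr // mulrC; apply: le_lt_trans.
by rewrite ler_wpM2r ?modulus_ge0 // lerDl.
Qed.

Section CompleteSpectrum.
Variable K : realType.
Variables (R r s tau : K).
Hypothesis hR : 0 < R < 1.
Hypothesis hs : R < s < 1.
Hypothesis hr : 0 < r < R.
Hypothesis htau : 0 < tau <= s.
(** The jet norm bounds the orbit maps by this number instead of r; it must stay below R for the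
    norm to be controlled. *)
Local Notation rho := (r + tau / (1 - tau)).
Hypothesis hrho : rho < R.
Variables C1 C2 : K.
Hypothesis C10 : 0 < C1.
Hypothesis C20 : 0 < C2.
Hypothesis norm_le : forall f A, hardy R f -> 0 <= A ->
  (forall e k, modulus (pair s e f (monom k)) <= A * rho ^+ k) -> hardy_norm R f <= C1 * A.
Hypothesis pair_le : forall f e g (x : K), hardy R f -> dalg s g ->
  (forall z, modulus z <= s -> modulus (g z) <= x) -> modulus (pair s e f g) <= C2 * hardy_norm R f * x.
Variables (X : Omega -> K) (Lam : K).
Hypothesis Lam0 : Lam < 0.
Implicit Types (f g : cplx K -> cplx K) (w : Omega) (e : bool).

Let s0 : 0 < s. Proof. by case/andP: hs => ? _; case/andP: hR => ? _; lra. Qed.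
Let s1 : s < 1. Proof. by case/andP: hs. Qed.
Let t1 : tau < 1. Proof. by case/andP: htau => _ h1; exact: le_lt_trans h1 s1. Qed.

Let half_le (a c l : K) : c < l / 2 -> l <= c + a -> l / 2 <= a. Proof. lra. Qed.

Definition symbols w n : bool := iter n fwd w 0.
Definition points w n : K := X (iter n fwd w).

Definition good w : Prop := [/\ ok_symbols r s w, fixed_orbit r s (symbols w) (points w) &
  growth Lam (lam (symbols w) (points w))].

Local Notation A := (pf_cocycle R).
Local Notation it := (iterate bernoulli_shift A).
Local Notation N := (hardy_norm R).
Local Notation H w := (coord (symbols w) (points w)).
Local Notation L w := (lam (symbols w) (points w)).
Local Notation nrm w e f := (normalized (symbols w) (points w) (pair s e f)).
Local Notation B w e f := (beta (symbols w) (points w) (pair s e f)).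

Definition pullback_disc w g (z : cplx K) : cplx K := g (@blaschke K (w 0) z).

Lemma pf_step w : ok_symbols r s w -> dual_step R r s (A w) (pullback_disc w).
Proof. by move=> ow; exact: (pf_dual_step hR hs hr (ow 0)). Qed.

Let okS w (c : int) : ok_symbols r s w -> ok_symbols r s (shift_by c w).
Proof. exact: ok_symbols_shift. Qed.

Lemma symbols_shift w n : symbols (fwd w) n = symbols w n.+1.
Proof. by rewrite /symbols -iterSr. Qed.
Lemma points_shift w n : points (fwd w) n = points w n.+1.
Proof. by rewrite /points -iterSr. Qed.

Lemma orb_shift w n z : orb (symbols (fwd w)) n (@blaschke K (w 0) z) = orb (symbols w) n.+1 z.
Proof. by elim: n => // n IH; rewrite -[LHS]/(@blaschke K (symbols (fwd w) n) (orb (symbols (fwd w)) n (@blaschke K (w 0) z))) IH symbols_shift. Qed.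

Lemma coord_shift w n z : H (fwd w) n (@blaschke K (w 0) z) = H w n.+1 z.
Proof. by rewrite /coord orb_shift points_shift. Qed.

Lemma mult_shift w n : mult (symbols (fwd w)) (points (fwd w)) n = mult (symbols w) (points w) n.+1.
Proof. by rewrite /mult symbols_shift points_shift. Qed.

Lemma lam_shift w n : L w n.+1 = mult (symbols w) (points w) 0 * L (fwd w) n.
Proof.
rewrite /lam big_ord_recl; congr (_ * _); apply: eq_bigr => i _.
by rewrite mult_shift.
Qed.

(** The adjoint of the last step acts first on the test function, so the disc maps compose in the
    forward order of the symbols. *)
Lemma iterate_pair w n f e g : ok_symbols r s w -> hardy R f -> dalg s g ->
  (forall n, dalg s (orb (symbols w) n)) -> (forall n z, modulus z <= s -> modulus (orb (symbols w) n z) <= s) ->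
  pair s e (it n w f) g = pair s e f (fun z => g (orb (symbols w) n z)).
Proof.
move=> ow hf dg dorb orbs; elim: n g dg => [|n IH] g dg; first by [].
have own : ok_symbols r s (iter n bernoulli_shift w) by exact: (ok_iter okS n ow).
have [_ p2 p3 _ _] := pf_step own.
have [dS _] := p2 g dg.
apply: etrans (p3 _ _ e (it_hardy okS pf_step n ow hf) dg) _.
exact: (IH _ dS).
Qed.

Section AtPoint.
Variable w : Omega.
Hypothesis gw : good w.

Let ow : ok_symbols r s w. Proof. by case: gw. Qed.
Let hbx : fixed_orbit r s (symbols w) (points w). Proof. by case: gw. Qed.
Let hlam : growth Lam (L w). Proof. by case: gw. Qed.
Let dh n : dalg s (H w n). Proof. exact: (dalg_coord hR hs hr hbx n). Qed.
Let dhX n i : dalg s (fun z => H w n z ^+ i). Proof. exact: (dalgX s0 i (dh n)). Qed.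
Let l0 n : 0 < L w n. Proof. exact: (lam_gt0 hs hr hbx n). Qed.
Let bp e f (hf : hardy R f) : bfunc s (pair s e f) := pair_bfunc hR e (hardy_analytic hf) hs.

Lemma it_pair n f e g : hardy R f -> dalg s g ->
  pair s e (it n w f) g = pair s e f (fun z => g (orb (symbols w) n z)).
Proof.
move=> hf dg; apply: (iterate_pair n e ow hf dg) => [n'|n' z].
  exact: (dalg_orb hR hs hr hbx n').
exact: (orb_le hs hr hbx n').
Qed.

Lemma beta_scale_add e (c : K[i]) f g i : hardy R f -> hardy R g ->
  B w e (c *: f + g) i = c * B w e f i + B w e g i.
Proof.
move=> hf hg; apply: beta_eq.
have cf : nrm w e f i @ \oo --> B w e f i :=
  betaP hR hs hr hbx hlam (bp e hf).
have cg : nrm w e g i @ \oo --> B w e g i :=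
  betaP hR hs hr hbx hlam (bp e hg).
apply/cvg_modulus => d d0.
have d2 : 0 < d / 2 by rewrite divr_gt0.
have d1 : 0 < d / 2 / (modulus (c : cplx K) + 1) by rewrite divr_gt0 // ltr_wpDl ?modulus_ge0.
have /cvg_modulus/(_ _ d1) h1 := cf; have /cvg_modulus/(_ _ d2) h2 := cg.
apply: filterS2 h1 h2 => n h1 h2.
have e1 : normalized (symbols w) (points w) (pair s e (c *: f + g)) i n =
    c * nrm w e f i n + nrm w e g i n.
  rewrite /normalized (pair_scale_add hR hs c e hf hg (dhX n i)).
    by move: (pair _ _ _ _) (pair _ _ _ _) (of_real _ ^+ i) => a a' y; rewrite mulrDl -mulrA.
rewrite e1; move: (normalized _ _ (pair s e g) _ _) (normalized _ _ (pair s e f) _ _) (B w e f i) (B w e g i) h1 h2 => a' a l l' h1 h2.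
have -> : c * a + a' - (c * l + l') = c * (a - l) + (a' - l') by ring.
apply: le_lt_trans (modulusD _ _) _; rewrite [d]splitr (modulusM (c : cplx K)); apply: ler_ltD => //.
move: h1; rewrite ltr_pdivlMr; last by rewrite ltr_wpDl ?modulus_ge0.
move=> h1; apply: le_trans (ltW h1); rewrite mulrC ler_wpM2l ?modulus_ge0 // lerDl //.
Qed.

Lemma beta0 e i : B w e 0 i = 0.
Proof.
have h0 := @hardy0 K R; have := beta_scale_add e (-1) i h0 h0.
by rewrite scaler0 addr0 mulN1r addNr.
Qed.

Lemma beta_scale e (c : K[i]) f i : hardy R f -> B w e (c *: f) i = c * B w e f i.
Proof. by move=> hf; have := beta_scale_add e c i hf (@hardy0 K R); rewrite addr0 beta0 addr0. Qed.

Lemma beta_add e f g i : hardy R f -> hardy R g -> B w e (f + g) i = B w e f i + B w e g i.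
Proof. by move=> hf hg; have := beta_scale_add e 1 i hf hg; rewrite scale1r mul1r. Qed.

Lemma beta_sub e f g i : hardy R f -> hardy R g -> B w e (f - g) i = B w e f i - B w e g i.
Proof.
by move=> hf hg; have := beta_scale_add e (-1) i hg hf; rewrite scaleN1r addrC mulN1r => ->; rewrite addrC.
Qed.

Lemma beta_bound i : exists2 C, 0 < C & forall e f, hardy R f -> modulus (B w e f i) <= C * N f.
Proof.
have [C C1' hC] := normalized_bound hR hs hr hbx hlam.
have Ci : 0 < C ^+ i by rewrite exprn_gt0 // (lt_le_trans ltr01).
exists (C2 * C ^+ i) => [|e f hf]; first by rewrite mulr_gt0.
apply/ler_addgt0Pr => d d0.
have cf : nrm w e f i @ \oo --> B w e f i :=
  betaP hR hs hr hbx hlam (bp e hf).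
have /cvg_modulus/(_ _ d0) [n _ /(_ n (leqnn n)) h1] := cf.
have h2 := hC _ i n (C2 * N f) (bp e hf) (fun g u dg gu => pair_le e hf dg gu).
have := modulus_triangle (nrm w e f i n) (B w e f i) 0.
rewrite !subr0 (modulusB (B w e f i)) => h3; apply: le_trans h3 _.
rewrite mulrAC addrC; exact: lerD h2 (ltW h1).
Qed.

(** The pairings of [f] annihilate the ideal generated by h^i, that is, they are combinations of the
    Taylor functionals of order below i at the fixed point. *)
Definition kills i f : Prop := forall e k, pair s e f (fun z => H w 0 z ^+ i * monom k z) = 0.

Lemma kills_dalg i f e g : hardy R f -> kills i f -> dalg s g -> pair s e f (fun z => H w 0 z ^+ i * g z) = 0.
Proof.
move=> hf kf dg.
exact: (bfunc_eq s0 (bfunc_mul hR hs (bp e hf) (dhX 0 i)) (bfunc_zero s) (kf e) dg).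
Qed.

Lemma killsS i f : hardy R f -> kills i f -> kills i.+1 f.
Proof.
move=> hf kf e k; apply: etrans _ (kills_dalg e hf kf (dalgM s0 (dh 0) (dalg_monom s0 k))).
by congr pair; apply/funext => z; rewrite exprSr mulrA.
Qed.

Lemma kills_scale_add i (c : K[i]) f g : hardy R f -> hardy R g -> kills i f -> kills i g -> kills i (c *: f + g).
Proof.
move=> hf hg kf kg e k; have dk := dalgM s0 (dhX 0 i) (dalg_monom s0 k).
by rewrite (pair_scale_add hR hs c e hf hg dk) kf kg mulr0 addr0.
Qed.

(** The number lam n is the derivative of h_n with respect to h_0 at the fixed point. Nothing is
    claimed uniformly in n; the expansion is only evaluated on annihilators of an ideal. *)
Lemma coord_expand n : exists2 v, dalg s v & forall z, modulus z <= s ->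
  H w n z = H w 0 z * (of_real (L w n) + H w 0 z * v z).
Proof.
elim: n => [|n [v dv vE]].
  exists (fun=> 0) => [|z _]; first exact: dalg_cst.
  by rewrite /lam big_ord0 mulr0 addr0 of_real1 mulr1.
pose m := mult (symbols w) (points w) n.
have ib := init_bound_lt1 hR hs hr; have /andP[i0 i1] := ib; have /andP[k0 k1] := contraction_lt1 hR hs hr.
have /andP[m0 m1] : 0 <= m < 1 by exact: (mult_lt1 hs hr hbx n).
have mh z : modulus z <= s -> modulus (of_real m * H w n z) <= init_bound r s.
  move=> zs; rewrite (modulusM (of_real m)) modulus_of_real ger0_norm //.
  apply: le_trans (_ : _ <= modulus (H w n z)) _; first by rewrite ler_piMl ?modulus_ge0 // ltW.
  apply: le_trans (coord_le hR hs hr hbx n zs) _; rewrite ler_piMr ?(ltW i0) // exprn_ile1 // ltW //.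
have dm := dalgZ s0 (of_real m) (dh n).
have dI := dalg_inv1 hR hs ib dm mh.
pose u z := of_real (1 - m ^+ 2) * (1 + of_real m * H w n z)^-1.
have du : dalg s u by exact: (dalgZ s0 _ dI).
have dlv : dalg s (fun z => of_real (L w n) + H w 0 z * v z).
  exact: (dalgD (dalg_cst s _) (dalgM s0 (dh 0) dv)).
exists (fun z => of_real m * v z + (of_real (L w n) + H w 0 z * v z) ^+ 2 * u z) => [|z zs].
  exact: (dalgD (dalgZ s0 _ dv) (dalgM s0 (dalgX s0 2 dlv) du)).
have n0 : 1 + of_real m * H w n z != 0.
  rewrite -modulus_gt0; have := modulus_subl 1 (- (of_real m * H w n z)); rewrite opprK modulusN modulus1.
  by apply: lt_le_trans; rewrite subr_gt0; exact: le_lt_trans (mh z zs) i1.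
rewrite (coord_step hs hr hbx n zs) -/m.
have -> : (H w n z + of_real m) / (1 + of_real m * H w n z) = of_real m + H w n z * u z.
  rewrite /u of_realB of_realX of_real1; move: (H w n z) n0 => y n0; field; exact: n0.
rewrite (vE z zs) lamS of_realM -/m; move: (H w 0 z) (v z) (u z) (of_real _) (of_real _) => y V U l M.
by ring.
Qed.

(** Modulo h_0^(i+1) the power h_n^i is lam_n^i h_0^i, so the normalised sequence is constant. *)
Lemma kills_beta i f e : hardy R f -> kills i.+1 f -> B w e f i = pair s e f (fun z => H w 0 z ^+ i).
Proof.
move=> hf kf; apply: beta_eq.
suff E n : nrm w e f i n = pair s e f (fun z => H w 0 z ^+ i).
  by rewrite (funext E : _ = fun=> _); exact: cvg_cst.
have ln0 : of_real (L w n) ^+ i != 0 :> cplx K.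
  by rewrite expf_neq0 // -modulus_gt0 modulus_of_real normr_gt0 gt_eqF.
rewrite /normalized; apply: (canLR (mulfK ln0)); rewrite mulrC.
have [v dv vE] := coord_expand n.
have [q dq qE] := power_split hR hs (dh 0) dv (fun z _ => erefl (of_real (L w n) + H w 0 z * v z)) i.
have dHq := dalgM s0 (dhX 0 i.+1) dq.
have z0 := kills_dalg e hf kf dq.
rewrite -[RHS]addr0 -[in RHS]z0 -(bfuncZ s0 _ (bp e hf) (dhX 0 i)) -(bfuncD s0 (bp e hf) (dalgZ s0 _ (dhX 0 i)) dHq).
apply: (bfunc_ext s0 (bp e hf) (dhX n i)) => z zs.
by rewrite vE // exprMn qE // exprSr; ring.
Qed.

(** From z = x + h (1 - x z) one has z^k = x^k + h q, so the pairings with h^i z^k are multiples of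
    the one with h^i, which is beta_i = 0. *)
Lemma kills_down i f : hardy R f -> kills i.+1 f -> (forall e, B w e f i = 0) -> kills i f.
Proof.
move=> hf kf b0 e k.
have xn := x_bound hs hr hbx 0; have [x0 x1] := andP xn.
pose x : cplx K := of_real (points w 0).
have dv : dalg s (fun z => 1 - x * z) by exact: (dalgB s0 (dalg_cst s 1) (dalgZ s0 x (dalg_id s))).
have zE z : modulus z <= s -> z = x + H w 0 z * (1 - x * z).
  move=> zs; have d := hmap_den xn (le_lt_trans zs s1).
  by apply/esym; apply: etrans (congr1 (fun y => x + y) (divfK d (z - x))) _; rewrite addrC subrK.
have [q dq qE] := power_split hR hs (dh 0) dv zE k.
have z0 := kills_dalg e hf kf dq.
apply: etrans (_ : _ = x ^+ k * pair s e f (fun z => H w 0 z ^+ i) + 0) _; last first.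
  by rewrite -(kills_beta e hf kf) b0 mulr0 addr0.
have dHq := dalgM s0 (dhX 0 i.+1) dq.
rewrite -[in RHS]z0 -(bfuncZ s0 _ (bp e hf) (dhX 0 i)) -(bfuncD s0 (bp e hf) (dalgZ s0 _ (dhX 0 i)) dHq).
apply: (bfunc_ext s0 (bp e hf) (dalgM s0 (dhX 0 i) (dalg_monom s0 k))) => z zs.
by rewrite /monom qE // exprSr; ring.
Qed.

Lemma kills_zero f j : hardy R f -> kills j f -> (forall e i, (i < j)%N -> B w e f i = 0) -> f = 0.
Proof.
move=> hf; elim: j => [|j IH] kf b0; last first.
  by apply: IH => [|e i ij]; [apply: kills_down => // e; exact: b0|exact: b0 (ltnW ij)].
apply: (hardy_eq0 hR hf hs) => e k; apply: etrans (kf e k).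
by congr pair; apply/funext => z; rewrite expr0 mul1r.
Qed.

(** A triangular system: the top order is prescribed by a Taylor element, whose lower values are
    subtracted from the target; the lower solution does not contribute to the top order. *)
Lemma interpolate j (t : bool -> nat -> cplx K) : t true 0%N = t false 0%N ->
  exists f, [/\ hardy R f, kills j.+1 f & forall e i, (i <= j)%N -> B w e f i = t e i].
Proof.
have xn := x_bound hs hr hbx 0.
have xR : points w 0 < R by have [_ /andP[_ xr] _] := hbx 0; case/andP: hr => _ h1; exact: le_lt_trans xr h1.
have el i (u : bool -> cplx K) : (i = 0%N -> u true = u false) -> exists f, [/\ hardy R f, kills i.+1 f &
    forall e, B w e f i = u e].
  move=> hu; have [f [hf h1 h2]] := taylor_element hR hs xn xR hu.
  have kf : kills i.+1 f by move=> e k; exact: (h2 e _ (dalg_monom s0 k)).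
  by exists f; split => // e; rewrite (kills_beta e hf kf); exact: h1.
elim: j t => [|j IH] t ht.
  have [f [hf kf bf]] := el 0%N (fun e => t e 0%N) (fun=> ht).
  by exists f; split => // e i; rewrite leqn0 => /eqP ->; exact: bf.
have [g [hg kg bg]] := el j.+1 (fun e => t e j.+1) (fun h => match notF (introT eqP h) with end).
have g0 : B w true g 0%N = B w false g 0%N.
  apply: beta_eq; have cf : nrm w false g 0 @ \oo --> B w false g 0 :=
    betaP hR hs hr hbx hlam (bp false hg).
  have E : nrm w true g 0 = nrm w false g 0.
    by apply/funext => n; exact: (congr1 (fun y => y / _) (pair_one hR hs hg)).
  by rewrite E.
have [f [hf kf bf]] := IH (fun e i => t e i - B w e g i) (congr2 (fun a b => a - b) ht g0).
exists (1 *: f + g); split; first exact: (hardy_lin hR 1 hf hg).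
  exact: (kills_scale_add 1 hf hg (killsS hf kf) kg).
move=> e i; rewrite leq_eqVlt => /orP[/eqP->|ij]; rewrite (beta_scale_add e 1 _ hf hg) mul1r.
  rewrite bg (kills_beta e hf (killsS hf kf)).
  have := kills_dalg e hf kf (dalg_cst s 1).
  by under eq_fun do rewrite mulr1; move=> ->; rewrite add0r.
by rewrite (bf e i ij) subrK.
Qed.

(** The pairings of the n-th iterate with z^k are those of [f] with the k-th power of the orbit map,
    to which [orb_power_rate] applies on both circles. *)
Lemma norm_rate j f : hardy R f -> (forall e i, (i < j)%N -> B w e f i = 0) ->
  rate_le (fun n => N (it n w f)) (j%:R * Lam).
Proof.
move=> hf b0.
have [Et [Et0 rEt hEt]] := orb_power_rate hR hs hr htau hbx Lam0 hlam (bp true hf) (b0 true).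
have [Ef [Ef0 rEf hEf]] := orb_power_rate hR hs hr htau hbx Lam0 hlam (bp false hf) (b0 false).
apply: (rate_near (v := fun n => C1 * (Et n + Ef n))); last first.
  by apply: rate_scale (rate_add rEt rEf) => [|n]; [exact: ltW|exact: addr_ge0].
apply: filterS2 hEt hEf => n h1 h2; apply: norm_le.
- exact: (it_hardy okS pf_step n ow hf).
- exact: addr_ge0.
have rho0 k : 0 <= rho ^+ k.
  case/andP: hr => h3 _; case/andP: htau => h4 _; apply: exprn_ge0; apply: addr_ge0; first exact: ltW.
  by rewrite divr_ge0 ?subr_ge0 // ltW.
move=> e k; rewrite (it_pair n e hf (dalg_monom s0 k)).
case: e; [apply: le_trans (h1 k) _|apply: le_trans (h2 k) _]; apply: ler_wpM2r => //; rewrite ?lerDl ?lerDr //.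
Qed.

(** The iterate is tested against the j-th power of the hyperbolic coordinate at its own fixed
    point, which is bounded by 1; the pairing is lam_n^j times a quantity tending to beta_j. *)
Lemma norm_lower j f e : hardy R f -> B w e f j != 0 -> exists2 c, 0 < c &
  \forall n \near \oo, c * L w n ^+ j <= N (it n w f).
Proof.
move=> hf bj; set l := modulus (B w e f j); have lp : 0 < l by rewrite modulus_gt0.
have l2 : 0 < l / 2 by rewrite divr_gt0.
have cf : nrm w e f j @ \oo --> B w e f j :=
  betaP hR hs hr hbx hlam (bp e hf).
exists (l / 2 / C2); first by rewrite divr_gt0.
have /cvg_modulus/(_ _ l2) := cf; apply: filterS => n h1.
have h2 : l / 2 <= modulus (nrm w e f j n).
  have := modulus_triangle (nrm w e f j n) (B w e f j) 0.
  rewrite !subr0 (modulusB (B w e f j)) -/l; move: h1; move: (modulus _) (modulus _) => a c.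
  exact: half_le.
have hn := it_hardy okS pf_step n ow hf.
have xn := x_bound hs hr hbx n.
have dm : dalg s (fun z => hmap (points w n) z ^+ j) by exact: (dalgX s0 j (dalg_hmap hR hs xn)).
have h3 : modulus (pair s e (it n w f) (fun z => hmap (points w n) z ^+ j)) <= C2 * N (it n w f) * 1.
  apply: pair_le => // z zs; rewrite modulusX exprn_ile1 ?modulus_ge0 //.
  apply: le_trans (hmap_le xn (le_lt_trans zs s1)) _.
  have := @gain_lt1 K (modulus z) (points w n); rewrite modulus_ge0 (le_lt_trans zs s1) => /(_ isT xn)/andP[_ h4].
  exact: ltW.
rewrite (it_pair n e hf dm) mulr1 in h3.
rewrite mulrAC ler_pdivrMr // (mulrC (N _)); apply: le_trans h3.
move: h2; rewrite /normalized (modulusM (pair _ _ _ _)) modulusV modulusX modulus_of_real ger0_norm ?(ltW (l0 n)) //.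
by rewrite ler_pdivlMr // exprn_gt0.
Qed.

End AtPoint.

(** Elements supported on jets of order at most j at the fixed point whose lower limits vanish. The
    limits beta_j on the two circles are coordinates on this space; they coincide for j = 0. *)
Definition slow_space w j : set (cplx K -> cplx K) :=
  [set f | [/\ hardy R f, kills w j.+1 f & forall e i, (i < j)%N -> B w e f i = 0]].

Definition fast_complement w j : set (cplx K -> cplx K) :=
  [set f | hardy R f /\ forall e i, (i <= j)%N -> B w e f i = 0].

(** * The Oseledets splitting at a point *)

Section Splitting.
Variable w : Omega.
Hypothesis gw : good w.
Let ow : ok_symbols r s w. Proof. by case: gw. Qed.
Let hlam : growth Lam (L w). Proof. by case: gw. Qed.
Local Notation V := (slow_space w).
Local Notation F := (fast_complement w).

Lemma beta_compat f : hardy R f -> B w true f 0%N = B w false f 0%N.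
Proof.
move=> hf; have [_ hbx _] := gw; apply: beta_eq.
have cf : nrm w false f 0 @ \oo --> B w false f 0 :=
  betaP hR hs hr hbx hlam (pair_bfunc hR false (hardy_analytic hf) hs).
have E : nrm w true f 0 = nrm w false f 0.
  by apply/funext => n; exact: (congr1 (fun y => y / _) (pair_one hR hs hf)).
by rewrite E.
Qed.

Lemma slow_lin j (a : K[i]) f g : V j f -> V j g -> V j (a *: f + g).
Proof.
move=> [hf kf bf] [hg kg bg]; split; first exact: (hardy_lin hR a hf hg).
  exact: (kills_scale_add gw a hf hg kf kg).
by move=> e i ij; rewrite (beta_scale_add gw e a i hf hg) (bf e i ij) (bg e i ij) mulr0 addr0.
Qed.

Lemma slow0 j : V j 0.
Proof.
split; [exact: hardy0| |by move=> e i _; exact: beta0 gw e i].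
by move=> e k; apply: (pair_zero hR hs e); case: gw => _ hbx _;
  exact: (dalgM s0 (dalgX s0 j.+1 (dalg_coord hR hs hr hbx 0)) (dalg_monom s0 k)).
Qed.

Lemma slow_eq0 j f : V j f -> (forall e, B w e f j = 0) -> f = 0.
Proof.
move=> [hf kf bf] bj; apply: (kills_zero gw hf kf) => e i.
by rewrite ltnS leq_eqVlt => /orP[/eqP->|]; [exact: bj|exact: bf].
Qed.

Lemma slow_unique j f g : V j f -> V j g -> (forall e, B w e f j = B w e g j) -> f = g.
Proof.
move=> Vf Vg bfg; have [hf _ _] := Vf; have [hg _ _] := Vg.
have Vd : V j (-1 *: g + f) by exact: slow_lin.
have d0 : -1 *: g + f = 0.
  apply: (slow_eq0 Vd) => e; rewrite (beta_scale_add gw e (-1) j hg hf) bfg.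
  by rewrite mulN1r addNr.
by apply/eqP; rewrite -subr_eq0 -d0 scaleN1r addrC.
Qed.

Lemma slow_element j (t : bool -> cplx K) : (j = 0%N -> t true = t false) ->
  exists2 f, V j f & forall e, B w e f j = t e.
Proof.
move=> ht; have [|f [hf kf bf]] := interpolate gw j (t := fun e i => if i == j then t e else 0).
  by case: eqP => // /esym.
exists f => [|e]; last by rewrite (bf e j (leqnn j)) eqxx.
by split => // e i ij; rewrite (bf e i (ltnW ij)) ltn_eqF.
Qed.

Lemma split_top j g : hardy R g -> (forall e i, (i < j)%N -> B w e g i = 0) ->
  exists2 v, V j v & F j (g - v).
Proof.
move=> hg bg; have [|v Vv bv] := @slow_element j (fun e => B w e g j).
  by move=> ->; exact: beta_compat.
have [hv kv b0] := Vv; exists v => //; split; first exact: (hardyB hR hg hv).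
move=> e i; rewrite (beta_sub gw e i hg hv) leq_eqVlt => /orP[/eqP->|ij]; first by rewrite bv subrr.
by rewrite (bg e i ij) (b0 e i ij) subrr.
Qed.

Lemma splitting j f : hardy R f -> exists (v : nat -> cplx K -> cplx K) g,
  [/\ forall i, (i <= j)%N -> V i (v i), F j g & f = \sum_(i < j.+1) v i + g].
Proof.
move=> hf; elim: j => [|j [v [g [Vv [hg bg] fE]]]].
  have [v Vv Fv] := @split_top 0 f hf (fun e i h => match notF h with end).
  exists (fun=> v), (f - v); split => // [i|]; first by rewrite leqn0 => /eqP->.
  by rewrite big_ord1 addrC subrK.
have [u Vu Fu] := @split_top j.+1 g hg bg.
exists (fun i => if i == j.+1 then u else v i), (g - u); split => // [i|].
  by rewrite leq_eqVlt; case: eqP => [->|_] // /= ij; exact: Vv.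
rewrite fE [in RHS]big_ord_recr /= eqxx -addrA; congr (_ + _).
  by apply: eq_bigr => i _; rewrite ltn_eqF.
by rewrite addrC subrK.
Qed.

Lemma beta_sum n (G : 'I_n -> cplx K -> cplx K) e k : (forall i, hardy R (G i)) ->
  B w e (\sum_(i < n) G i) k = \sum_(i < n) B w e (G i) k.
Proof.
elim: n G => [|n IH] G hG; first by rewrite !big_ord0; exact: beta0 gw e k.
rewrite !big_ord_recr /= -(IH (fun i => G (widen_ord (leqnSn n) i)) (fun i => hG _)).
exact: (beta_add gw e k (hardy_sum hR (fun i => hG (widen_ord (leqnSn n) i))) (hG _)).
Qed.

(** Induction on the order: once the lower components vanish, beta_i of the sum is beta_i of the
    i-th component alone, because higher components and the complement do not contribute. *)
Lemma splitting_unique j (v : 'I_j.+1 -> cplx K -> cplx K) g : (forall i : 'I_j.+1, V i (v i)) -> F j g ->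
  \sum_(i < j.+1) v i + g = 0 -> (forall i, v i = 0) /\ g = 0.
Proof.
move=> Vv [hg bg] sum0.
have hv i : hardy R (v i) by case: (Vv i).
have hS := hardy_sum hR hv.
suff v0 : forall k (i : 'I_j.+1), (i < k)%N -> v i = 0.
  have vi i : v i = 0 by exact: (v0 i.+1 i (ltnSn i)).
  by split => //; move: sum0; rewrite big1 ?add0r.
elim=> [//|k IH] i; rewrite ltnS leq_eqVlt => /orP[/eqP ik|]; last exact: IH.
apply: (slow_eq0 (Vv i)) => e.
have := beta0 gw e i; rewrite -sum0 (beta_add gw e i hS hg) (bg e i) ?addr0; last by rewrite -ltnS ltn_ord.
rewrite (beta_sum e i hv) (bigD1 i) //= big1 ?addr0 // => l li.
have [lk|kl] := ltnP l k; first by rewrite (IH l lk); exact: beta0 gw e i.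
have [_ _ bl] := Vv l; apply: bl; rewrite ik ltn_neqAle kl andbT -ik eq_sym.
by apply: contra_neq li => /val_inj.
Qed.

(** The basis is dual to the two limits beta_j; in order 0 these are equal and a single vector
    remains. *)
Lemma slow_dimension j : has_dimension (V j) (if j is 0%N then 1%N else 2%N).
Proof.
case: j => [|j].
  have [v Vv bv] := @slow_element 0 (fun=> 1) (fun=> erefl); have [hv _ _] := Vv.
  exists (fun=> v); split.
    apply/seteqP; split => f.
      move=> Vf; have [hf _ _] := Vf; exists (fun=> B w true f 0%N); rewrite big_ord1.
      have V0 := slow_lin (B w true f 0%N) Vv (slow0 0); rewrite addr0 in V0.
      apply: (slow_unique Vf V0) => e; rewrite (beta_scale gw e _ 0 hv) bv mulr1.
      by case: e; [exact: erefl|exact: (esym (beta_compat hf))].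
    by move=> [c ->]; rewrite big_ord1 -[_ *: v]addr0; exact: slow_lin (slow0 0).
  move=> c; rewrite big_ord1 => h i; rewrite ord1.
  have := beta_scale gw true (c ord0) 0 hv; rewrite h bv mulr1 => <-; exact: beta0 gw true 0.
have [vt Vt bt] := @slow_element j.+1 (fun e => e%:R) (fun h => match notF (introT eqP h) with end).
have [vf Vf bf] := @slow_element j.+1 (fun e => (~~ e)%:R) (fun h => match notF (introT eqP h) with end).
have [ht _ _] := Vt; have [hf _ _] := Vf.
pose v (i : 'I_2) := if i == ord0 then vt else vf.
have sE (c : 'I_2 -> K[i]) : \sum_(i < 2) c i *: v i = c ord0 *: vt + (c ord_max *: vf + 0).
  by rewrite big_ord_recl big_ord1 addr0 /v eqxx; congr (_ + c _ *: _); exact: val_inj.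
have Vc (a c : K[i]) : V j.+1 (a *: vt + (c *: vf + 0)).
  exact: slow_lin Vt (slow_lin c Vf (slow0 _)).
have bc (a c : K[i]) e : B w e (a *: vt + (c *: vf + 0)) j.+1 = a * e%:R + c * (~~ e)%:R.
  have h1 : hardy R (c *: vf + 0) by exact: (hardy_lin hR c hf (hardy0 R)).
  rewrite (beta_scale_add gw e a j.+1 ht h1) bt (beta_scale_add gw e c j.+1 hf (hardy0 R)) bf.
  by rewrite (beta0 gw e j.+1) addr0.
exists v; split.
  apply/seteqP; split => f.
    move=> Vg; exists (fun i => B w (i == ord0) f j.+1); rewrite sE.
    have e1 : (ord0 == ord0 :> 'I_2) = true by [].
    have e2 : (ord_max == ord0 :> 'I_2) = false by [].
    apply: (slow_unique Vg (Vc _ _)) => e; rewrite bc e1 e2.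
    case: e; move: (B w true f j.+1) (B w false f j.+1) => a c /=.
      by rewrite mulr1 mulr0 addr0.
    by rewrite mulr0 mulr1 add0r.
  by move=> [c ->]; rewrite sE; exact: Vc.
move=> c; rewrite sE => h i.
have bi e := bc (c ord0) (c ord_max) e; rewrite h in bi.
have b1 := bi true; have b2 := bi false.
rewrite (beta0 gw true j.+1) mulr1 mulr0 addr0 in b1.
rewrite (beta0 gw false j.+1) mulr0 mulr1 add0r in b2.
case: (unliftP ord0 i) => [l ->|->]; last by rewrite -b1.
by rewrite (ord1 l) [RHS]b2; congr c; exact: val_inj.
Qed.

Lemma slow_rate j f : V j f -> f <> 0 ->
  log_rate (N (it n w f))%:E n @[n --> \oo] --> (j%:R * Lam)%:E.
Proof.
move=> Vf f0; have [hf _ bf] := Vf.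
have [e be] : exists e, B w e f j != 0.
  apply: contrapT => h; apply: f0; apply: (slow_eq0 Vf) => e.
  by apply: contrapT => /eqP be; apply: h; exists e.
have [c c0 hc] := norm_lower gw hf be.
apply: (cvg_log_rate (x := fun n => (N (it n w f))%:E)) => [n|d d0|d d0].
- by rewrite lee_fin hardy_norm_ge0.
- by have [C C0 hC] := norm_rate gw hf bf d0; exists C.
(* The lower bound for lam is raised to the power j, which multiplies the error; dividing by j + 1
   also covers j = 0. *)
have d1 : 0 < d / j.+1%:R by rewrite divr_gt0 // ltr0n.
have [C C0 hC] := hlam d1; exists (c * C^-1 ^+ j) => [|]; first by rewrite mulr_gt0 // exprn_gt0 // invr_gt0.
apply: filterS hc => n h1; rewrite lee_fin; apply: le_trans h1; rewrite -mulrA (ler_pM2l c0).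
have /andP[h2 _] := hC n.
apply: le_trans (_ : _ <= (C^-1 * expR (n%:R * (Lam - d / j.+1%:R))) ^+ j) _; last first.
  have p0 : 0 <= C^-1 * expR (n%:R * (Lam - d / j.+1%:R)) by rewrite mulr_ge0 ?expR_ge0 // invr_ge0 ltW.
  by rewrite lerXn2r ?nnegrE // (le_trans p0).
rewrite exprMn; apply: ler_wpM2l; first by rewrite exprn_ge0 // invr_ge0 ltW.
rewrite -expRM_natl ler_expR mulrCA; apply: ler_wpM2l => //.
rewrite mulrBr lerD2l lerN2 mulrCA ler_piMr ?(ltW d0) // ler_pdivrMr ?ltr0n // mul1r ler_nat.
exact: leqnSn.
Qed.

Lemma fast_rate j f : F j f ->
  (limn_esup (fun n => log_rate (N (it n w f))%:E n) <= (j.+1%:R * Lam)%:E)%E.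
Proof.
move=> [hf bf]; apply: (@limn_esup_rate _ (fun n => (N (it n w f))%:E)) => [n|d d0].
  by rewrite lee_fin hardy_norm_ge0.
by have [C C0 hC] := norm_rate gw hf (j := j.+1) bf d0; exists C.
Qed.

Lemma fast_closed j : norm_closed (hardy R) N (F j).
Proof.
move=> u f Fu hf uf; split => // e i ij; apply: modulus_le_small => d d0.
have [C C0 hC] := beta_bound gw i.
have dC : 0 < d / C by rewrite divr_gt0.
have /cvgr0Pnorm_lt/(_ _ dC) [n _ /(_ n (leqnn n))] := uf.
have [hu bu] := Fu n.
have := hC e _ (hardyB hR hu hf); rewrite (beta_sub gw e i hu hf) (bu e i ij) sub0r modulusN => h1 h2.
apply: le_trans h1 _; rewrite mulrC -ler_pdivlMr //; apply: le_trans (ltW h2); exact: ler_norm.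
Qed.

End Splitting.

(** * Equivariance of the splitting *)

Section Equivariance.
Variable w : Omega.
Hypothesis gw : good w.
Hypothesis gw' : good (fwd w).
Let ow : ok_symbols r s w. Proof. by case: gw. Qed.
Let m := mult (symbols w) (points w) 0.

Lemma m_neq0 : of_real m != 0 :> cplx K.
Proof.
have [_ hbx _] := gw; have m0 := mult_gt0 hs hr hbx 0.
by rewrite -modulus_gt0 modulus_of_real normr_gt0 gt_eqF.
Qed.

Lemma step_hardy f : hardy R f -> hardy R (A w f).
Proof. by move=> hf; have [p1 _ _ _ _] := pf_step ow; exact: p1. Qed.

Lemma step_power n i f e : hardy R f ->
  pair s e (A w f) (fun z => H (fwd w) n z ^+ i) = pair s e f (fun z => H w n.+1 z ^+ i).
Proof.
move=> hf; have [_ _ p3 _ _] := pf_step ow; have [_ hbx' _] := gw'.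
apply: etrans (p3 _ _ e hf (dalgX s0 i (dalg_coord hR hs hr hbx' n))) _.
by congr pair; apply/funext => z; rewrite /pullback_disc coord_shift.
Qed.

(** Duality turns the coordinate at time n for the shifted sequence into that at time n + 1, while
    the product lam loses its first factor m. *)
Lemma step_beta f e i : hardy R f -> B (fwd w) e (A w f) i = of_real m ^+ i * B w e f i.
Proof.
move=> hf; have [_ hbx hlam] := gw; apply: beta_eq.
have cf : nrm w e f i @ \oo --> B w e f i :=
  betaP hR hs hr hbx hlam (pair_bfunc hR e (hardy_analytic hf) hs).
have E n : normalized (symbols (fwd w)) (points (fwd w)) (pair s e (A w f)) i n =
    of_real m ^+ i * nrm w e f i n.+1.
  rewrite /normalized (step_power n i e hf) lam_shift -/m of_realM exprMn.
  have := expf_neq0 i m_neq0; move: (pair _ _ _ _) (of_real _ ^+ i) (of_real m ^+ i) => a y u u0.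
  by rewrite invfM mulrCA (mulrA u) mulfV // mul1r.
rewrite (funext E : _ = fun n => _).
exact: (@cvg_scale_shift K (of_real m ^+ i) _ _ cf).
Qed.

Lemma step_kills f i : hardy R f -> kills w i f -> kills (fwd w) i (A w f).
Proof.
move=> hf kf e k; have [_ p2 p3 _ _] := pf_step ow; have [_ hbx hlam] := gw; have [_ hbx' _] := gw'.
have dk := dalg_monom s0 k.
have dh := dalg_coord hR hs hr hbx 0.
have dHk := dalgM s0 (dalgX s0 i (dalg_coord hR hs hr hbx' 0)) dk.
apply: etrans (p3 _ _ e hf dHk) _.
have [v dv vE] := coord_expand gw 1.
have [dT _] := p2 _ dk.
have dv' := dalgD (dalg_cst s (of_real (L w 1))) (dalgM s0 dh dv).
have dg := dalgM s0 (dalgX s0 i dv') dT.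
apply: etrans _ (kills_dalg gw e hf kf dg).
apply: (bfunc_ext s0 (pair_bfunc hR e (hardy_analytic hf) hs)); first by have [] := p2 _ dHk.
move=> z zs; rewrite /pullback_disc coord_shift (vE z zs) exprMn.
by rewrite mulrA.
Qed.

Lemma step_slow j f : slow_space w j f -> slow_space (fwd w) j (A w f).
Proof.
move=> [hf kf bf]; split; [exact: step_hardy|exact: step_kills|].
by move=> e i ij; rewrite step_beta // (bf e i ij) mulr0.
Qed.

(** The multiplier is nonzero because the fixed point is positive, so the preimage is obtained by
    prescribing beta_j divided by m^j; beta_j determines elements of the slow space. *)
Lemma step_slow_onto j : A w @` slow_space w j = slow_space (fwd w) j.
Proof.
apply/seteqP; split => g; first by move=> [f Vf <-]; exact: step_slow.
move=> Vg; have [hg _ _] := Vg.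
have [|f Vf bf] := slow_element gw (j := j) (t := fun e => of_real m ^- j * B (fwd w) e g j).
  by move=> ->; rewrite (beta_compat gw' hg).
exists f => //; apply: (slow_unique gw' (step_slow Vf) Vg) => e.
have [hf _ _] := Vf.
by rewrite step_beta // bf mulrA mulfV ?mul1r // expf_neq0 // m_neq0.
Qed.

Lemma step_fast j : A w @` fast_complement w j `<=` fast_complement (fwd w) j.
Proof.
move=> _ [f [hf bf] <-]; split; first exact: step_hardy.
by move=> e i ij; rewrite step_beta // (bf e i ij) mulr0.
Qed.

Theorem complete_oseledets : oseledets_at (hardy R) N bernoulli_shift A
  (fun j => (j%:R * Lam)%:E) (fun j => if j is 0%N then 1%N else 2%N) slow_space fast_complement w.
Proof.
split.
  rewrite mul0r.
  have rR : 0 < r < R := hr.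
  (* Since r is at most rho, bounds at rate r are covered by the constant for rho; the general facts
     on dual cocycles are stated at rate r. *)
  have norm_r f (a : K) : hardy R f -> 0 <= a -> (forall e k, modulus (pair s e f (monom k)) <= a * r ^+ k) ->
      hardy_norm R f <= C1 * a.
    move=> hf a0 h; apply: norm_le => // e k; apply: le_trans (h e k) _; rewrite ler_wpM2l //.
    case/andP: hr => r0 _; have t0 : 0 <= tau / (1 - tau).
      by case/andP: htau => /ltW t0 _; rewrite divr_ge0 // subr_ge0 ltW.
    by rewrite lerXn2r ?nnegrE ?addr_ge0 ?(ltW r0) // lerDl.
  exact: (operator_norm_rate hR hs hr C10 C20 norm_r pair_le (@ok_symbols_shift K r s) pf_step ow).
move=> j _; split; split.
- split; [by move=> f []|exact: slow0|by move=> a u v; exact: slow_lin].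
- exact: slow_dimension.
- exact: step_slow_onto.
- by move=> f; exact: slow_rate.
- split; last exact: fast_closed.
  split=> [f [] //||a f g [hf bf] [hg bg]].
    by split; [exact: hardy0|by move=> e i _; exact: beta0].
  split; first exact: (hardy_lin hR a hf hg).
  by move=> e i ij; rewrite (beta_scale_add gw e a i hf hg) (bf e i ij) (bg e i ij) mulr0 addr0.
- split=> [f hf|v g]; last exact: splitting_unique.
  have [v [g [Vv Fg fE]]] := splitting gw j hf; exists (fun i : 'I_j.+1 => v i), g.
  by split => // i; apply: Vv; rewrite -ltnS.
- exact: step_fast.
- by move=> f; exact: fast_rate.
Qed.

End Equivariance.

End CompleteSpectrum.

(** * The random fixed point *)

Section FixedPoint.
Variables (K : realType) (p : K) (P : probability Omega K).
Hypothesis hp : 0 <= p <= 1.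
Hypothesis hP : bernoulli_measure p P.
Implicit Types (w : Omega) (n : nat) (x y : K).

Lemma ae_shift (c : int) (Q : Omega -> Prop) : {ae P, forall w, Q w} -> {ae P, forall w, Q (shift_by c w)}.
Proof.
move=> [A [mA A0 QA]]; exists (shift_by c @^-1` A); split.
- exact: measurable_preshift.
- by rewrite (shift_preserving hP).
by move=> w Qw; exact: QA.
Qed.

Lemma ae_orbit (Q : Omega -> Prop) : {ae P, forall w, Q w} -> {ae P, forall w, forall n, Q (iter n fwd w)}.
Proof.
move=> h; apply: ae_foralln => n.
by have := ae_shift (1 *+ n) h; rewrite -iter_shift.
Qed.

Lemma real_blaschke_ge0 b x : 0 <= real_blaschke b x.
Proof. by rewrite -branch_sqr sqr_ge0. Qed.

Lemma real_blaschke_le1 b x : 0 <= x <= 1 -> real_blaschke b x <= 1.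
Proof.
move=> /andP[x0 x1]; rewrite -branch_sqr exprn_ile1 ?branch_ge0 //.
by case: b => //=; rewrite ler_pdivrMr ?mul1r; move: x0 x1; lra.
Qed.

(* The random fixed point in the disc is the limit of the images of 0 that start
   further and further in the past. *)
Fixpoint approx n w : K := if n is m.+1 then real_blaschke (w (-1)) (approx m (bwd w)) else 0.

Lemma approx_bound n w : 0 <= approx n w <= 1.
Proof.
elim: n w => [|n IH] w /=; first by rewrite lexx ler01.
by rewrite real_blaschke_ge0 real_blaschke_le1.
Qed.

Lemma approx_incr w : nondecreasing_seq (approx^~ w).
Proof.
apply/nondecreasing_seqP => n; elim: n w => [|n IH] w; first exact: real_blaschke_ge0.
by apply: real_blaschke_mono; rewrite IH andbT; case/andP: (approx_bound n (bwd w)).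
Qed.

Definition fixpt w : K := limn (approx^~ w).

Lemma approx_cvg w : approx^~ w @ \oo --> fixpt w.
Proof.
apply: nondecreasing_is_cvgn; first exact: approx_incr.
by exists 1 => _ [n _ <-]; case/andP: (approx_bound n w).
Qed.

Lemma approx_le_fixpt n w : approx n w <= fixpt w.
Proof. by apply: nondecreasing_cvgn_le; [exact: approx_incr|exact: approx_cvg]. Qed.

Lemma fixpt_le w c : (forall n, approx n w <= c) -> fixpt w <= c.
Proof. by move=> h; apply: limr_le; [exact: approx_cvg|exact: nearW]. Qed.

Lemma fixpt_bound w : 0 <= fixpt w <= 1.
Proof.
rewrite (le_trans _ (approx_le_fixpt 0 w)) //=; apply: fixpt_le => n.
by case/andP: (approx_bound n w).
Qed.

Lemma fixpt_step w : fixpt (fwd w) = real_blaschke (w 0) (fixpt w).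
Proof.
have [x0 _] := andP (fixpt_bound w).
apply/cvg_lim => //; rewrite -cvg_shiftS.
have -> : (fun n => approx n.+1 (fwd w)) = (fun n => real_blaschke (w 0) (approx n w)).
  by apply/funext => n /=; rewrite bwd_fwd; congr (real_blaschke (w _) _).
have cx := @approx_cvg w; rewrite /real_blaschke.
case: (w 0); last by under eq_fun do rewrite expr2; rewrite expr2; exact: cvgM.
suff H : ((approx n w + 4^-1) / (1 + approx n w / 4)) @[n --> \oo] --> (fixpt w + 4^-1) / (1 + fixpt w / 4).
  by under eq_fun do rewrite expr2; rewrite expr2; exact: cvgM.
apply: cvgM; first by apply: cvgD cx _; exact: cvg_cst.
apply: cvgV; first by rewrite gt_eqF // ltr_wpDr // divr_ge0.
by apply: cvgD; [exact: cvg_cst|apply: cvgM cx _; exact: cvg_cst].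
Qed.

Lemma fixpt_stepV w : fixpt w = real_blaschke (w (-1)) (fixpt (bwd w)).
Proof. by rewrite -{1}(fwd_bwd w) fixpt_step. Qed.

Lemma measurable_inv_pos (g : Omega -> K) : measurable_fun setT g -> (forall w, 0 < g w) ->
  measurable_fun setT (fun w => (g w)^-1).
Proof.
move=> mg g0; have -> : (fun w => (g w)^-1) = (fun w => expR (- ln (g w))).
  by apply/funext => w; rewrite expRN lnK // posrE.
apply: measurableT_comp; first exact: measurable_expR.
by apply: measurable_funN; apply: measurableT_comp mg; exact: measurable_ln.
Qed.

Lemma measurable_symbol (i : int) : measurable_fun setT (fun w : Omega => w i).
Proof.
move=> _ B _; rewrite setTI.
have E b : measurable [set w : Omega | w i = b] := measurable_coordinate i b.
have -> : (fun w : Omega => w i) @^-1` B =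
    ([set w : Omega | w i = true] `&` [set _ | B true]) `|` ([set w : Omega | w i = false] `&` [set _ | B false]).
  by apply/seteqP; split => w /=; [case wi: (w i) => h; [left|right]|case=> [[-> //]|[-> //]]].
have C (Q : Prop) : measurable ([set _ | Q] : set Omega).
  by case: (pselect Q) => q; [rewrite (_ : mkset _ = setT)|rewrite (_ : mkset _ = set0)] => //;
    apply/seteqP; split.
by apply: measurableU; apply: measurableI.
Qed.

Lemma measurable_branch (g : Omega -> K) (i : int) : measurable_fun setT g -> (forall w, 0 <= g w) ->
  measurable_fun setT (fun w => branch (w i) (g w)).
Proof.
move=> mg g0; rewrite /branch; apply: measurable_fun_ifT => //; first exact: measurable_symbol.
apply: measurable_funM; first by apply: measurable_funD => //; exact: measurable_cst.
apply: measurable_inv_pos => [|w]; last by rewrite ltr_wpDr // divr_ge0.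
by apply: measurable_funD; [exact: measurable_cst|apply: measurable_funM => //; exact: measurable_cst].
Qed.

Lemma measurable_approx n : measurable_fun setT (approx n).
Proof.
elim: n => [|n IH]; first exact: measurable_cst.
have mb : measurable_fun setT (approx n \o bwd) by apply: measurableT_comp IH _; exact: measurable_shift.
have := measurable_branch (-1) mb (fun w => proj1 (andP (approx_bound n (bwd w)))).
move=> /(measurable_funX 2); apply: eq_measurable_fun => w _ /=.
by rewrite branch_sqr.
Qed.

Lemma measurable_fixpt : measurable_fun setT fixpt.
Proof. by apply: (measurable_fun_cvg measurable_approx) => w _; exact: approx_cvg. Qed.

Definition log_multiplier w : K := ln (multiplier (w 0) (fixpt w)).

Lemma measurable_log_multiplier : measurable_fun setT log_multiplier.
Proof.
apply: measurableT_comp; first exact: measurable_ln.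
have f0 w : 0 <= fixpt w by case/andP: (fixpt_bound w).
have mb := measurable_branch 0 measurable_fixpt f0.
rewrite /multiplier /gain; apply: measurable_funM; first exact: measurable_funD.
apply: measurable_inv_pos => [|w]; last by rewrite ltr_wpDr // mulr_ge0 // branch_ge0.
by apply: measurable_funD; [exact: measurable_cst|exact: measurable_funM].
Qed.

(** T_1 maps 0 to 1/16, and it increases on the positive axis: after a symbol 1 the fixed point is
    at least 1/16. *)
Local Notation c16 := (ln (16 : K)).

Lemma c16_gt0 : 0 < c16. Proof. by apply: ln_gt0; lra. Qed.

(** Each zero squares the fixed point, that is, doubles its logarithm. After l zeros preceded by a 1
    it is at least 16 to the power - 2^l, and 2^l is 1 plus the run sum of base 2. *)
Lemma fixpt_lower M w : ~ zero_run M (bwd w) -> expR (- (c16 * (1 + run_sum 2 M (bwd w)))) <= fixpt w.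
Proof.
have one v : v (-1) = true -> forall N, expR (- (c16 * (1 + run_sum 2 N (bwd v)))) <= fixpt v.
  move=> v1 N; have [x0 x1] := andP (fixpt_bound (bwd v)); rewrite fixpt_stepV v1.
  apply: le_trans (_ : _ <= expR (- c16)) _.
    rewrite ler_expR lerN2 ler_peMr ?(ltW c16_gt0) // lerDl; exact: run_sum_ge0.
  have -> : expR (- c16) = 4^-1 ^+ 2 :> K.
    by rewrite expRN lnK ?posrE //; field.
  rewrite /real_blaschke lerXn2r ?nnegrE ?divr_ge0 ?addr_ge0 ?divr_ge0 //.
  by rewrite ler_pdivlMr; move: x0 x1; lra.
elim: M w => [|M IH] w nz.
  apply: one; case w1: (w (-1)) => //; exfalso; apply: nz; apply/zero_run0.
  by rewrite /bwd /shift_by add0r.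
case w1: (w (-1)); first exact: one.
have b0 : bwd w 0 = false by rewrite /bwd /shift_by add0r.
have /IH h : ~ zero_run M (bwd (bwd w)) by move=> h; apply: nz; apply/(zero_runS hp).
rewrite fixpt_stepV w1 (run_sumS hp) b0 /=.
have -> : - (c16 * (1 + (1 + 2 * run_sum 2 M (shift_by (-1) (bwd w))))) =
   2%:R * - (c16 * (1 + run_sum 2 M (bwd (bwd w)))) by rewrite /bwd; ring.
by rewrite expRM_natl lerXn2r ?nnegrE ?expR_ge0 //; case/andP: (fixpt_bound (bwd w)).
Qed.

Definition run_total w : \bar K := (\sum_(0 <= j <oo) (2 ^+ j * \1_(zero_run j) (bwd w))%:E)%E.

Lemma run_sum_le_total M w : ((run_sum 2 M (bwd w))%:E <= run_total w)%E.
Proof.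
rewrite /run_sum -sumEFin; apply: nneseries_lim_ge => j _ _.
by rewrite lee_fin mulr_ge0 // exprn_ge0.
Qed.

Lemma run_total_ge0 w : (0 <= run_total w)%E.
Proof. by apply: nneseries_ge0 => j _ _; rewrite lee_fin mulr_ge0 // exprn_ge0. Qed.

Lemma measurable_run_term j : measurable_fun setT (fun w => (2 ^+ j * \1_(zero_run j) (bwd w) : K)%:E).
Proof.
apply/measurable_EFinP; apply: measurable_funM; first exact: measurable_cst.
apply: measurableT_comp; last exact: measurable_shift.
by apply: measurable_indic; exact: measurable_zero_run.
Qed.

Lemma measurable_run_total : measurable_fun setT run_total.
Proof.
apply: ge0_emeasurable_sum => [j w _ _|j _]; last exact: measurable_run_term.
by rewrite lee_fin mulr_ge0 // exprn_ge0.
Qed.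

Hypothesis hp2 : p < 2^-1.

(** The mean is the geometric series with terms p (2 p)^j; here p < 1/2 enters. *)
Lemma run_total_integral : (\int[P]_w run_total w < +oo)%E.
Proof.
have t0 (j : nat) (w : Omega) : setT w -> (0 <= (2 ^+ j * \1_(zero_run j) (bwd w) : K)%:E)%E.
  by move=> _; rewrite lee_fin mulr_ge0 // exprn_ge0.
rewrite (integral_nneseries P measurableT measurable_run_term t0).
have [p0 _] := andP hp.
have E j : (\int[P]_w (2 ^+ j * \1_(zero_run j) (bwd w))%:E)%E = (p * (2 * p) ^+ j)%:E.
  have mA : measurable (bwd @^-1` zero_run j) by apply: measurable_preshift; exact: measurable_zero_run.
  have i1 : P.-integrable setT (EFin \o \1_(bwd @^-1` zero_run j)) by exact: integrable_indic.
  have -> : (\int[P]_w (2 ^+ j * \1_(zero_run j) (bwd w))%:E = (2 ^+ j)%:E * \int[P]_w (\1_(bwd @^-1` zero_run j) w)%:E)%E.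
    by rewrite -(integralZl measurableT i1); apply: eq_integral => w _; rewrite EFinM.
  have e : P (bwd @^-1` zero_run j) = P (zero_run j) := shift_preserving hP (-1) (measurable_zero_run j).
  have -> : (\int[P]_w (\1_(bwd @^-1` zero_run j) w)%:E = (p ^+ j.+1)%:E)%E.
    rewrite integral_indic // setIT; apply: etrans e _.
    by apply: etrans (prE P (measurable_zero_run j)) _; rewrite (zero_run_prob hP).
  rewrite -EFinM; congr EFin.
  by rewrite exprS exprMn; ring.
rewrite (eq_eseriesr (fun j _ => E j)).
apply: le_lt_trans (_ : _ <= (p / (1 - 2 * p))%:E)%E _; last exact: ltry.
apply: lime_le => [|].
  by apply: is_cvg_nneseries => j _ _; rewrite lee_fin mulr_ge0 // exprn_ge0 // mulr_ge0.
apply: nearW => n; rewrite sumEFin lee_fin.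
have := @geometric_partial K p (2 * p) 0 n; rewrite expr0 mulr1; apply => //.
by rewrite mulr_ge0 //=; move: hp2; lra.
Qed.

Lemma zero_run_total w : (forall M, zero_run M (bwd w)) -> run_total w = +oo%E.
Proof.
move=> h; apply/eqyP => A A0.
have [n hn] : exists n : nat, A <= n%:R.
  by exists (Num.truncn A).+1; rewrite ltW // truncnS_gt.
apply: le_trans (run_sum_le_total n w); rewrite lee_fin; apply: le_trans hn _.
elim: n => [|n IH]; first exact: run_sum_ge0.
rewrite run_sum_recr run_sum_indic asboolT // mulr1 -(natr1 n); apply: lerD IH _.
by rewrite exprn_ege1 // ler1n.
Qed.

(** An integrable function is finite almost everywhere, which excludes an infinite run of zeros in
    the past. *)
Lemma fixpt_pos_ae : {ae P, forall w, 0 < fixpt w}.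
Proof.
have it : P.-integrable setT run_total.
  apply/integrableP; split; first exact: measurable_run_total.
  by under eq_integral do rewrite gee0_abs ?run_total_ge0 //; exact: run_total_integral.
have := integrable_ae measurableT it; apply: filterS => w /(_ I) fin.
have [M nz] : exists M, ~ zero_run M (bwd w).
  by apply: contrapT => h; move: fin; rewrite zero_run_total // => M; apply: contrapT => nz; apply: h; exists M.
by apply: lt_le_trans (fixpt_lower nz); exact: expR_gt0.
Qed.

Lemma branch_le1 w : branch (w 0) (fixpt w) <= 1.
Proof.
have [x0 x1] := andP (fixpt_bound w).
have := real_blaschke_le1 (w 0) (fixpt_bound w); rewrite -branch_sqr expr_le1 //; exact: branch_ge0.
Qed.

Lemma multiplier_le1 w : 0 <= multiplier (w 0) (fixpt w) <= 1.
Proof.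
have [x0 x1] := andP (fixpt_bound w).
have u0 : 0 <= branch (w 0) (fixpt w) by exact: branch_ge0.
have u1 := branch_le1 w; rewrite /multiplier /gain; move: (branch _ _) u0 u1 => u u0 u1.
have d : 0 < 1 + u * u by rewrite ltr_wpDr // mulr_ge0.
apply/andP; split; first exact: divr_ge0 (addr_ge0 u0 u0) (ltW d).
by rewrite ler_pdivrMr // mul1r; nra.
Qed.

Lemma log_multiplier_le0 w : log_multiplier w <= 0.
Proof. by rewrite ln_le0 //; case/andP: (multiplier_le1 w). Qed.

(** The multiplier lies between the branch u and 1, so |log m| <= - log u. The branch is at least
    1/4 for the symbol 1, and the fixed point itself for the symbol 0, where [fixpt_lower]
    applies. *)
Lemma log_multiplier_bound w : (`|log_multiplier w|%:E <= c16%:E * (1 + run_total w))%E.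
Proof.
have [x0 x1] := andP (fixpt_bound w); have c0 := c16_gt0; have t0 := run_total_ge0 w.
pose u := branch (w 0) (fixpt w).
have u0 : 0 <= u by exact: branch_ge0.
have u1 : u <= 1 by exact: branch_le1.
(* For u = 0 the multiplier is 0 and [ln] takes its default value 0, so the bound holds
   trivially. *)
have [z|unz] := eqVneq u 0.
  rewrite /log_multiplier /multiplier -/u z /gain addr0 mul0r ln0 // normr0.
  by rewrite mule_ge0 ?lee_fin ?(ltW c0) // adde_ge0.
have up : 0 < u by rewrite lt_def unz.
have m1 : u <= multiplier (w 0) (fixpt w).
  rewrite /multiplier -/u /gain; have d : 0 < 1 + u * u by rewrite ltr_wpDr // mulr_ge0.
  by rewrite ler_pdivlMr //; move: u0 u1 => ? ?; nra.
have mp := lt_le_trans up m1.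
have -> : `|log_multiplier w| = - log_multiplier w by rewrite ler0_norm // log_multiplier_le0.
apply: le_trans (_ : _ <= (- ln u)%:E)%E _; first by rewrite lee_fin lerN2 ler_ln ?posrE.
have [M [hM]] : exists M, expR (- (c16 * (1 + run_sum 2 M (bwd w)))) <= u.
  move: u0 up; rewrite /u {u unz u1 m1 mp}; case: (w 0) => u0 up /=.
    exists 0%N; apply: le_trans (_ : _ <= expR (- c16)) _.
      rewrite ler_expR lerN2 ler_peMr ?(ltW c0) // lerDl; exact: run_sum_ge0.
    rewrite expRN lnK ?posrE // ler_pdivlMr; last by move: x0; lra.
    by move: x0 x1; lra.
  (* With only zeros in the past all approximants would be 0, contradicting u > 0. *)
  have [M nz] : exists M, ~ zero_run M (bwd w).
    apply: contrapT => h; have := up; rewrite /= ltNge => /negP; apply; apply: fixpt_le => n.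
    have hz v : (forall M, zero_run M (bwd v)) -> approx n v <= 0.
      elim: n v => // n IH v hv /=.
      have v1 : v (-1) = false by have /zero_run0 := hv 0%N; rewrite /bwd /shift_by add0r.
      rewrite v1 /real_blaschke; have hb : approx n (bwd v) <= 0.
        by apply: IH => M; have /(zero_runS hp)[_ hM] := hv M.+1; exact: hM.
      have a0 : approx n (bwd v) = 0 by apply/eqP; rewrite eq_le hb; case/andP: (approx_bound n (bwd v)).
      by rewrite a0 expr0n.
    by apply: hz => M; apply: contrapT => nz; apply: h; exists M.
  by exists M; exact: fixpt_lower.
have hl : - ln u <= c16 * (1 + run_sum 2 M (bwd w)).
  by rewrite lerNl -[leLHS](expRK) ler_ln ?posrE // expR_gt0.
apply: le_trans (_ : _ <= (c16 * (1 + run_sum 2 M (bwd w)))%:E)%E _; first by rewrite lee_fin.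
by rewrite EFinM lee_pmul2l // EFinD leeD2l // run_sum_le_total.
Qed.

Lemma log_multiplier_integrable : P.-integrable setT (EFin \o log_multiplier).
Proof.
apply: (le_integrable measurableT (f := EFin \o log_multiplier) (g := fun w => (c16%:E * (1 + run_total w))%E)).
- by apply/measurable_EFinP; exact: measurable_log_multiplier.
- move=> w _; rewrite /= gee0_abs; first exact: log_multiplier_bound.
  by rewrite mule_ge0 ?lee_fin ?(ltW c16_gt0) // adde_ge0 // run_total_ge0.
apply: integrableZl => //; apply: integrableD => //.
  exact: (finite_measure_integrable_cst P 1).
apply/integrableP; split; first exact: measurable_run_total.
by under eq_integral do rewrite gee0_abs ?run_total_ge0 //; exact: run_total_integral.
Qed.

Variables (R r s : K).
Hypothesis hs : R < s < 1.
Hypothesis hr : 0 < r < R.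
Hypothesis ok_ae : {ae P, forall w, ok_symbols r s w}.

Lemma approx_le_r w n : ok_symbols r s w -> approx n w <= r.
Proof.
have [r0 rR] := andP hr; have [Rs _] := andP hs.
elim: n w => [|n IH] w ow /=; first exact: ltW.
have h := IH (bwd w) (ok_symbols_shift (-1) ow); have [a0 _] := andP (approx_bound n (bwd w)).
have := ow (-1) (of_real (approx n (bwd w))); rewrite modulus_of_real ger0_norm // -of_real_blaschke modulus_of_real.
rewrite ger0_norm ?real_blaschke_ge0 //; apply.
by apply: le_trans h (ltW (lt_trans rR Rs)).
Qed.

Lemma fixed_orbit_ae : {ae P, forall w, fixed_orbit r s (symbols w) (points fixpt w)}.
Proof.
apply: filterS2 (ae_orbit ok_ae) (ae_orbit fixpt_pos_ae) => w ow fp n; split.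
- exact: (ow n 0).
- rewrite fp /=; apply: fixpt_le => k; apply: approx_le_r; exact: ow.
by rewrite /points -fixpt_step.
Qed.

Lemma log_multiplier_mean : exists2 Lam : K, Lam < 0 & (\int[P]_w (log_multiplier w)%:E)%E = Lam%:E.
Proof.
have it := log_multiplier_integrable; have fin := integrable_fin_num measurableT it.
exists (fine (\int[P]_w (log_multiplier w)%:E)); last by rewrite fineK.
have /andP[b0 b1] := mult_bound_lt1 hs hr.
(* A uniform bound below 1 on the multiplier makes the mean negative. Averaging [mult_bound] with 1
   keeps the argument of the logarithm positive. *)
pose l := ln ((mult_bound r + 1) / 2); have mb : 0 < (mult_bound r + 1) / 2 < 1.
  by apply/andP; split; move: b0 b1; lra.
have l0 : l < 0 by exact: ln_lt0.
have E : (\int[P]_w (- log_multiplier w)%:E = - \int[P]_w (log_multiplier w)%:E)%E.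
  rewrite -mulN1e -(integralZl measurableT it); apply: eq_integral => w _.
  by rewrite /= -EFinM mulN1r.
have cl : ((- l)%:E <= \int[P]_w (- log_multiplier w)%:E)%E.
  have -> : (- l)%:E = (\int[P]_w (- l)%:E)%E.
    have := @integral_cst _ _ _ P setT measurableT (- l)%:E.
    move=> e; apply/esym; apply: etrans e _.
    by rewrite -[RHS]mule1; congr (_ * _)%E; exact: probability_setT.
  apply: ae_ge0_le_integral => //.
  - by move=> w _; rewrite lee_fin oppr_ge0 ltW.
  - by move=> w _; rewrite lee_fin oppr_ge0 log_multiplier_le0.
  - by apply/measurable_EFinP; apply: measurable_funN; exact: measurable_log_multiplier.
  apply: filterS fixed_orbit_ae => w fo _; rewrite lee_fin lerN2.
  have m0 := mult_gt0 hs hr fo 0; have m1 := mult_le hs hr fo 0.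
  rewrite /log_multiplier ler_ln ?posrE //; last by case/andP: mb.
  by apply: le_trans m1 _; move: b1; lra.
by move: cl; rewrite E -(fineK fin) -EFinN lee_fin lerN2 => cl; exact: le_lt_trans cl l0.
Qed.

Lemma growth_ae Lam : (\int[P]_w (log_multiplier w)%:E)%E = Lam%:E ->
  {ae P, forall w, growth Lam (lam (symbols w) (points fixpt w))}.
Proof.
move=> mean.
have B : {ae P, forall w, forall e : K, 0 < e -> exists C : K, forall n,
    `|bsum fwd log_multiplier n w - n%:R * Lam| <= n%:R * e + C}.
  apply: (birkhoff _ _ _ log_multiplier_integrable mean).
  - exact: (measurable_shift 1).
  - by move=> A mA; exact: (shift_preserving hP).
  - by move=> A mA; exact: (shift_ergodic hP hp (c := 1) (oner_neq0 _) mA).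
apply: filterS2 B fixed_orbit_ae => w hw fo e e0; have [C hC] := hw e e0.
exists (expR C) => [|n]; first exact: expR_gt0.
have m0 i := mult_gt0 hs hr fo i.
have -> : lam (symbols w) (points fixpt w) n = expR (bsum fwd log_multiplier n w).
  rewrite /lam /bsum big_mkord expR_sum; apply: eq_bigr => i _.
  by rewrite /log_multiplier lnK ?posrE //; exact: m0.
rewrite -expRN -!expRD !ler_expR; have := hC n; rewrite ler_distl.
move: (bsum _ _ _ _) (n%:R) => u v /andP[h1 h2]; apply/andP; split.
  by apply: le_trans h1; rewrite mulrBr; lra.
by apply: le_trans h2 _; rewrite mulrDr; lra.
Qed.

End FixedPoint.

(** * Conclusion *)

Section Radii.
Variable K : realType.
Implicit Types (x y c : K) (b : bool).

Lemma gain_lipschitz x y c : 0 <= x <= y -> 0 <= c <= 1 -> gain y c - gain x c <= y - x.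
Proof.
move=> /andP[x0 xy] /andP[c0 c1]; have y0 := le_trans x0 xy.
have dx : 1 <= 1 + x * c by rewrite lerDl mulr_ge0.
have dy : 1 <= 1 + y * c by rewrite lerDl mulr_ge0.
have dx0 := lt_le_trans ltr01 dx; have dy0 := lt_le_trans ltr01 dy.
have -> : gain y c - gain x c = (y - x) * ((1 - c ^+ 2) / ((1 + y * c) * (1 + x * c))).
  by rewrite /gain; field; rewrite !gt_eqF.
rewrite ler_piMr ?subr_ge0 // ler_pdivrMr ?mulr_gt0 // mul1r.
apply: le_trans (_ : _ <= 1) _; first by rewrite lerBlDr lerDl sqr_ge0.
by rewrite -[leLHS]mulr1; apply: ler_pM.
Qed.

Lemma real_blaschke_lipschitz b x y : 0 <= x <= y -> y <= 1 ->
  real_blaschke b y - real_blaschke b x <= 2 * (y - x).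
Proof.
move=> xy y1; have /andP[x0 xy'] := xy; have y0 := le_trans x0 xy'.
have br z : 0 <= z <= 1 -> 0 <= branch b z <= 1.
  move=> /andP[z0 z1]; rewrite branch_ge0 //; case: b => //=.
  by rewrite ler_pdivrMr; move: z0 z1; lra.
have /andP[u0 u1] : 0 <= branch b x <= 1 by apply: br; rewrite x0 (le_trans xy').
have /andP[v0 v1] : 0 <= branch b y <= 1 by apply: br; rewrite y0.
have d : branch b y - branch b x <= y - x.
  case: b {br u0 u1 v0 v1} => //=; apply: gain_lipschitz => //.
  by apply/andP; split; lra.
rewrite -!branch_sqr; move: (branch b x) (branch b y) u0 u1 v0 v1 d => u v u0 u1 v0 v1 d.
by rewrite subr_sqr; nra.
Qed.

Lemma blaschke_modulus b (z : cplx K) : modulus z < 1 -> modulus (@blaschke K b z) <= real_blaschke b (modulus z).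
Proof.
move=> z1; case: b; last by rewrite blaschke0E modulusX.
rewrite blaschke1E modulusX lerXn2r ?nnegrE ?modulus_ge0 //.
  by rewrite divr_ge0 ?addr_ge0 ?divr_ge0 ?modulus_ge0.
have q : 0 <= (4^-1 : K) < 1 by apply/andP; split; lra.
have := hmap_le q (z := - z); rewrite modulusN => /(_ z1); congr (_ <= _).
have e4 : of_real 4^-1 = 4^-1 :> cplx K by rewrite of_realV of_real_nat.
by rewrite /hmap /mobius e4 mulrN opprK -opprD mulNr modulusN (mulrC 4^-1).
Qed.

Variable R : K.
Hypothesis hR : 0 < R < 1.

Lemma real_blaschke_le_max b : real_blaschke b R <= max_modulus (@blaschke K b) R.
Proof.
have /andP[R0 R1] := hR; apply: ub_le_sup.
  exists (real_blaschke b R) => _ [z zR <-].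
  by have := @blaschke_modulus b z; rewrite zR; exact.
exists (of_real R); first by rewrite /circle /= modulus_of_real gtr0_norm.
by rewrite -of_real_blaschke modulus_of_real -branch_sqr ger0_norm ?sqr_ge0.
Qed.

(** A Lipschitz constant 2 on the positive axis controls the image when the radius increases from R
    to s. *)
Lemma radii (Q : bool -> Prop) : (forall b, Q b -> real_blaschke b R < R) ->
  exists r s, [/\ R < s < 1, 0 < r < R & forall b, Q b -> contracting r s b].
Proof.
move=> hQ; have /andP[R0 R1] := hR.
(* The room left below R. Symbols outside [Q] receive R, so that the minimum is positive and at most
   R. *)
pose slack b := if asbool (Q b) then R - real_blaschke b R else R.
have sl b : 0 < slack b <= R.
  rewrite /slack; case: asboolP => [/hQ h|_]; last by rewrite R0 lexx.
  by rewrite subr_gt0 h gerBl -branch_sqr sqr_ge0.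
pose d := Num.min (slack false) (slack true).
have d0 : 0 < d by rewrite lt_min; case/andP: (sl false) => ->; case/andP: (sl true) => ->.
have dR : d <= R by rewrite ge_min; case/andP: (sl false) => _ ->.
have db b : d <= slack b by rewrite ge_min; case: b; rewrite lexx ?orbT.
(* Enlarging the radius by t <= d / 4 raises the image by at most d / 2, to R - d / 2 at most; t <=
   (1 - R) / 4 keeps s below 1. *)
pose t := Num.min d (1 - R) / 4.
have R1' : 0 < 1 - R by rewrite subr_gt0.
have t0 : 0 < t by rewrite divr_gt0 // lt_min d0.
have td : t <= d / 4 by rewrite ler_pM2r ?invr_gt0 // ge_min lexx.
have tR : t <= (1 - R) / 4 by rewrite ler_pM2r ?invr_gt0 // ge_min lexx orbT.
exists (R - d / 2), (R + t); split.
- by apply/andP; split; move: t0 tR R1; lra.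
- by apply/andP; split; move: d0 dR R0; lra.
move=> b Qb z zs.
have s1 : R + t < 1 by move: tR R1; lra.
apply: le_trans (blaschke_modulus b (le_lt_trans zs s1)) _.
apply: le_trans (real_blaschke_mono b (x' := R + t) _) _; first by rewrite modulus_ge0.
have RR : 0 <= R <= R + t by rewrite (ltW R0) lerDl ltW.
have := real_blaschke_lipschitz b RR (ltW s1); have := db b; rewrite /slack asboolT //.
by move: (real_blaschke b R) (real_blaschke b (R + t)) td => u v; lra.
Qed.

(** The essential supremum only concerns the symbol at position 0; stationarity and countability
    extend the bound to all positions. *)
Lemma contracting_ae (p : K) (P : probability Omega K) : 0 <= p <= 1 -> bernoulli_measure p P ->
  (ess_max_modulus P R < R%:E)%E ->
  exists r s, [/\ R < s < 1, 0 < r < R & {ae P, forall w, ok_symbols r s w}].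
Proof.
move=> hp hP hess; pose Q b := max_modulus (@blaschke K b) R < R.
have [b Qb|r [s [hs hr hQ]]] := @radii Q; first exact: le_lt_trans (real_blaschke_le_max b) Qb.
exists r, s; split => //.
have Q0 : {ae P, forall w : Omega, Q (w 0)}.
  have := ess_sup_ge P (fun w : Omega => (max_modulus (@blaschke K (w 0)) R)%:E).
  by apply: filterS => w h; rewrite /Q -lte_fin; exact: le_lt_trans h hess.
have Qi (c : int) : {ae P, forall w : Omega, Q (w c)}.
  by have := ae_shift hP c Q0; apply: filterS => w; rewrite /shift_by add0r.
have Qn : {ae P, forall w : Omega, forall n : nat, Q (w n%:Z)} by apply: ae_foralln => n; exact: Qi.
have QN : {ae P, forall w : Omega, forall n : nat, Q (w (- n%:Z))} by apply: ae_foralln => n; exact: Qi.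
apply: filterS2 Qn QN => w h1 h2 [n|n]; apply: hQ; first exact: h1.
by rewrite NegzE; exact: h2.
Qed.

End Radii.

Section Spectra.
Variables (K : realType) (p R : K) (P : probability Omega K).
Hypothesis hp : 0 <= p <= 1.
Hypothesis hP : bernoulli_measure p P.
Hypothesis hR : 0 < R < 1.
Hypothesis hess : (ess_max_modulus P R < R%:E)%E.

Let s0 (s : K) : R < s < 1 -> 0 < s. Proof. by move=> /andP[? _]; case/andP: hR => ? _; lra. Qed.

Lemma positive_constants (rho s : K) : 0 < rho < R -> R < s < 1 -> exists C1 C2 : K, [/\ 0 < C1, 0 < C2,
  forall f A, hardy R f -> 0 <= A ->
    (forall e k, modulus (pair s e f (monom k)) <= A * rho ^+ k) -> hardy_norm R f <= C1 * A &
  forall f e g (x : K), hardy R f -> dalg s g -> (forall z, modulus z <= s -> modulus (g z) <= x) ->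
    modulus (pair s e f g) <= C2 * hardy_norm R f * x].
Proof.
move=> hrho hs; have [C C0 hC] := hardy_norm_le hR hrho; have [D D0 hD] := pair_bound hR hs.
exists (C + 1), (D + 1); split => [||f A hf A0 fA|f e g x hf dg gx]; [exact: ltr_wpDl|exact: ltr_wpDl| |].
  apply: le_trans (hC f s A hf hs A0 fA) _; by rewrite ler_wpM2r // lerDl.
have x0 : 0 <= x by apply: le_trans (gx 0 _); rewrite ?modulus_ge0 // modulus0 ltW // s0.
apply: le_trans (hD f e g x hf dg gx) _; rewrite ler_wpM2r // ler_wpM2r ?hardy_norm_ge0 // lerDl //.
Qed.

Lemma noisy_collapse (eps : K) : 4^-1 <= p -> 0 < eps ->
  collapsed_spectrum (hardy R) (hardy_norm R) P bernoulli_shift (noisy_pf_cocycle R eps).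
Proof.
move=> hp4 e0; have [r [s [hs hr ok]]] := contracting_ae hR hp hP hess.
have [C1 [C2 [C10 C20 norm_le pair_le]]] := positive_constants hr hs.
exists (fun j => if j is 0%N then 0%E else -oo%E), (fun=> 1%N); split; [|by []|by []|by case].
split.
  split=> [|[|j]]; first exact: ltNyr.
    by split => [|_|//]; [exact: ltry|split; [exact: ltNyr|]].
  by split => [|h|]; [exact: lt_trans (ltNyr 0) (ltry 0)|rewrite ltxx in h|].
exists (fast_space R s eps), (fun _ _ => centred R s).
have hv := heavy_runs_ae hp hP hp4; have hv' := ae_shift hP (-1) hv.
apply: filterS3 ok hv hv' => w ow h1 h2.
exact: (collapse_oseledets hR hs hr e0 C10 C20 norm_le pair_le ow h1 h2).
Qed.

Lemma unperturbed_complete : p < 2^-1 ->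
  complete_spectrum (hardy R) (hardy_norm R) P bernoulli_shift (pf_cocycle R).
Proof.
move=> hp2; have [r [s [hs hr ok]]] := contracting_ae hR hp hP hess.
have /andP[r0 rR] := hr; have /andP[Rs _] := hs; have /andP[R0 R1] := hR.
(* Then tau < 1/4, so tau / (1 - tau) is less than R - r and the jet norm stays below R. *)
pose tau := (R - r) / 4.
have htau : 0 < tau <= s by rewrite /tau; apply/andP; split; move: r0 rR Rs; lra.
have t1 : 0 < 1 - tau by rewrite /tau; move: r0 R1; lra.
have hrho : 0 < r + tau / (1 - tau) < R.
  have /andP[t0 _] := htau; apply/andP; split; first by rewrite addr_gt0 // divr_gt0.
  rewrite addrC -ltrBrDr ltr_pdivrMr //; by rewrite /tau; move: r0 rR R1 => ? ? ?; nra.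
have [C1 [C2 [C10 C20 norm_le pair_le]]] := positive_constants hrho hs.
have [Lam L0 mean] := log_multiplier_mean hp hP hp2 hs hr ok.
exists (fun j => (j%:R * Lam)%:E), (fun j => if j is 0%N then 1%N else 2%N).
split; last by move=> j; rewrite ltNyr.
split.
  split=> [|j]; first by rewrite ltNyr.
  split => [|_|//]; first by rewrite ltry.
  by split; [rewrite lte_fin -(natr1 j) mulrDl mul1r gtrDl|case: j].
exists (slow_space R s (fixpt K)), (fast_complement R s (fixpt K)).
have g : {ae P, forall w, good r s (fixpt K) Lam w}.
  by apply: filterS3 ok (fixed_orbit_ae hp hP hp2 hs hr ok) (growth_ae hp hP hp2 hs hr ok mean).
apply: filterS2 g (ae_shift hP 1 g) => w g1 g2.
exact: (complete_oseledets hR hs hr htau C10 C20 norm_le pair_le L0 g1 g2).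
Qed.

End Spectra.

Theorem corollary3 (K : realType) (p R : K) (P : probability Omega K)
    (hp : 0 <= p <= 1) (hP : bernoulli_measure p P)
    (hR : 0 < R < 1) (hrR : (ess_max_modulus P R < R%:E)%E) :
  (4^-1 <= p -> forall eps : K, 0 < eps ->
     collapsed_spectrum (hardy R) (hardy_norm R) P bernoulli_shift
       (noisy_pf_cocycle R eps)) /\
  (4^-1 <= p < 2^-1 ->
     complete_spectrum (hardy R) (hardy_norm R) P bernoulli_shift (pf_cocycle R) /\
     forall eps : K, 0 < eps ->
       collapsed_spectrum (hardy R) (hardy_norm R) P bernoulli_shift
         (noisy_pf_cocycle R eps)).
Proof.
split=> [h eps e0|/andP[h1 h2]]; first exact: (noisy_collapse hp hP hR hrR h e0).
split; first exact: (unperturbed_complete hp hP hR hrR h2).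
by move=> eps e0; exact: (noisy_collapse hp hP hR hrR h1 e0).
Qed.
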